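(* (1) There is a dense $G_\delta$ subset $\mathcal R_\infty\subset{\rm Aut}(X,\mathcal B,\mu)$ such that every $T\in\mathcal R_\infty$ has $T^n$ of rank one for every $n\in\mathbb Z\setminus\{0\}$. Consequently every such $T$ has $T^n$ with simple spectrum for all $n\ge1$, $J^\infty(T)=J_2(T)$, the set of periodic points of $\widetilde T$ is closed and nowhere dense in $C_2(\mu)$, and $(C_2(\mu),\widetilde T)$ is not a $P$-system. (2) If $T$ is a Gaussian system with simple spectrum, then $T^n$ has simple spectrum for every $n\ge1$; in particular $J^\infty(T)=J_2(T)$ and $(C_2(\mu),\widetilde T)$ is not a $P$-system.
   Context: $(X,\mathcal B,\mu)$ is a standard non-atomic probability space; ${\rm Aut}(X,\mathcal B,\mu)$ carries the weak (Polish) topology. $C_2(\mu)$: probability measures on $X\times X$ with both marginals $\mu$, with the compact topology $\rho_n\to\rho$ iff $\rho_n(A\times B)\to\rho(A\times B)$ for all measurable $A,B$; lens $\widetilde T(\rho)(A\times B)=\rho(T^{-1}A\times T^{-1}B)$. $J_2(T)$ is the set of $T\times T$-invariant couplings and $J^\infty(T)=\bigcup_{n\ge1}J_2(T^n)$ is the set of periodic points of $\widetilde T$. A $P$-system is a topologically transitive system with dense periodic points. $T$ has simple spectrum if the Koopman operator $U_Tf=f\circ T$ on $L^2(\mu)$ (or on $L^2_0$) has a cyclic vector. *)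

(* Defs.v *)
From HB Require Import structures.
From mathcomp Require Import all_boot all_order all_algebra.
From mathcomp Require Import all_classical all_reals all_analysis.
Set Implicit Arguments.
Unset Strict Implicit.
Unset Printing Implicit Defensive.
Import Order.TTheory GRing.Theory Num.Theory.
Local Open Scope classical_set_scope.
Local Open Scope ring_scope.

Section ergodic_defs.
Context {R : realType}.

Definition ae_prop {d} {T : measurableType d} (m : set T -> \bar R) (P : T -> Prop) :=
  exists N : set T, measurable N /\ m N = 0%E /\ forall x, ~ N x -> P x.

Definition symdiff {T : Type} (A B : set T) : set T := (A `\` B) `|` (B `\` A).

Definition standard_nonatomic {d} {X : measurableType d} (mu : probability X R) :=
  exists (phi : X -> R) (psi : R -> X),
    measurable_fun setT phi /\ measurable_fun setT psi /\
    ae_prop mu (fun x => `[0%R, 1%R]%classic (phi x) /\ psi (phi x) = x) /\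
    ae_prop (@lebesgue_measure R)
      (fun y => `[0%R, 1%R]%classic y -> phi (psi y) = y) /\
    (forall B : set R, measurable B ->
       mu (phi @^-1` B) = lebesgue_measure (B `&` `[0%R, 1%R]%classic)).

Context {d : measure_display} {X : measurableType d}.
Variable mu : probability X R.

Definition mpreserving (f : X -> X) :=
  measurable_fun setT f /\ forall A, measurable A -> mu (f @^-1` A) = mu A.

(* An element of Aut(X,B,mu) is represented by a pair (T, T^{-1}) of
   measure-preserving maps that are inverse to each other mu-a.e. *)
Definition aut := ((X -> X) * (X -> X))%type.

Definition is_aut (T : aut) :=
  mpreserving T.1 /\ mpreserving T.2 /\
  ae_prop mu (fun x => T.2 (T.1 x) = x) /\ ae_prop mu (fun x => T.1 (T.2 x) = x).

Definition zpow (T : aut) (n : int) : X -> X :=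
  match n with Posz k => iter k T.1 | Negz k => iter k.+1 T.2 end.

Definition aut_pow (T : aut) (n : nat) : aut := (iter n T.1, iter n T.2).

(* ---- weak topology on Aut: U_T -> U_S strongly, i.e. generated by the
   basic neighbourhoods { S | mu(S^{-1}A_i symdiff T^{-1}A_i) < e, i < k } *)
Definition aut_nbhd (T : aut) (k : nat) (As : nat -> set X) (e : R) : set aut :=
  [set S | is_aut S /\ forall i, (i < k)%N ->
     (mu (symdiff (T.1 @^-1` As i) (S.1 @^-1` As i)) < e%:E)%E].

Definition aut_open (U : set aut) :=
  U `<=` is_aut /\
  forall T, U T -> exists k (As : nat -> set X) (e : R),
    0 < e /\ (forall i, (i < k)%N -> measurable (As i)) /\ aut_nbhd T k As e `<=` U.

Definition aut_dense (D : set aut) :=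
  forall T, is_aut T -> forall k (As : nat -> set X) (e : R),
    0 < e -> (forall i, (i < k)%N -> measurable (As i)) ->
    D `&` aut_nbhd T k As e !=set0.

Definition aut_Gdelta (D : set aut) :=
  exists U : nat -> set aut, (forall n, aut_open (U n)) /\ D = \bigcap_n U n.

Definition rank_one (f : X -> X) :=
  forall k (As : nat -> set X) (e : R),
    (forall i, (i < k)%N -> measurable (As i)) -> 0 < e ->
    exists (B : set X) (h : nat),
      measurable B /\ (0 < h)%N /\
      (forall i j, (i < h)%N -> (j < h)%N -> i <> j ->
         mu ((iter i f @^-1` B) `&` (iter j f @^-1` B)) = 0%E) /\
      ((1 - e)%:E < mu (\bigcup_(i in `I_h) (iter i f @^-1` B)))%E /\
      forall i, (i < k)%N -> exists J : set nat, J `<=` `I_h /\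
        (mu (symdiff (As i) (\bigcup_(j in J) (iter j f @^-1` B))) < e%:E)%E.

(* ---- simple spectrum: the Koopman operator U_T f = f o T on the complex
   Hilbert space L^2(mu) has a cyclic vector.  A complex function is
   represented by its real and imaginary parts. *)
Definition sq_int (g : X -> R) :=
  measurable_fun setT g /\ (\int[mu]_x ((g x) ^+ 2)%:E < +oo)%E.

Definition cdist2 (u1 v1 u2 v2 : X -> R) : \bar R :=
  (\int[mu]_x (((u1 x - u2 x) ^+ 2 + (v1 x - v2 x) ^+ 2)%:E))%E.

Definition simple_spectrum (T : aut) :=
  exists u v : X -> R, sq_int u /\ sq_int v /\
    forall g1 g2 : X -> R, sq_int g1 -> sq_int g2 -> forall e : R, 0 < e ->
      exists (N : nat) (a b : nat -> R),
        (* sum_{k=-N}^{N} (a_k + i b_k) U_T^k (u + i v) *)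
        (cdist2 g1 g2
          (fun x => (\sum_(0 <= k < (2 * N).+1)
             (a k * u (zpow T (k%:Z - N%:Z) x) - b k * v (zpow T (k%:Z - N%:Z) x)))%R)
          (fun x => (\sum_(0 <= k < (2 * N).+1)
             (a k * v (zpow T (k%:Z - N%:Z) x) + b k * u (zpow T (k%:Z - N%:Z) x)))%R)
         < e%:E)%E.

Definition coupling (rho : probability (X * X)%type R) :=
  forall A : set X, measurable A ->
    rho (A `*` setT) = mu A /\ rho (setT `*` A) = mu A.

Definition C2 : set (probability (X * X)%type R) := [set rho | coupling rho].

Definition pmap (f : X -> X) : X * X -> X * X := fun p => (f p.1, f p.2).

Definition J2 (f : X -> X) : set (probability (X * X)%type R) :=
  [set rho | coupling rho /\
     forall E : set (X * X), measurable E -> rho (pmap f @^-1` E) = rho E].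

Definition Jinf (T : aut) : set (probability (X * X)%type R) :=
  [set rho | exists n : nat, (0 < n)%N /\ J2 (iter n T.1) rho].

Definition lens_pow (T : aut) (n : nat) (rho rho' : probability (X * X)%type R) :=
  forall E : set (X * X), measurable E -> rho' E = rho (pmap (iter n T.1) @^-1` E).

Definition c2_nbhd (rho : probability (X * X)%type R) (k : nat)
    (As Bs : nat -> set X) (e : R) : set (probability (X * X)%type R) :=
  [set rho' | coupling rho' /\ forall i, (i < k)%N ->
     `| fine (rho' (As i `*` Bs i)) - fine (rho (As i `*` Bs i)) | < e].

Definition c2_basic_ok (k : nat) (As Bs : nat -> set X) (e : R) :=
  0 < e /\ forall i, (i < k)%N -> measurable (As i) /\ measurable (Bs i).

Definition c2_open (U : set (probability (X * X)%type R)) :=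
  U `<=` C2 /\
  forall rho, U rho -> exists k (As Bs : nat -> set X) (e : R),
    c2_basic_ok k As Bs e /\ c2_nbhd rho k As Bs e `<=` U.

Definition c2_closed (F : set (probability (X * X)%type R)) :=
  F `<=` C2 /\ c2_open (C2 `\` F).

Definition c2_closure (F : set (probability (X * X)%type R)) :=
  [set rho | coupling rho /\ forall k As Bs e, c2_basic_ok k As Bs e ->
     F `&` c2_nbhd rho k As Bs e !=set0].

Definition c2_nowhere_dense (F : set (probability (X * X)%type R)) :=
  forall U, c2_open U -> U `<=` c2_closure F -> U = set0.

Definition c2_transitive (T : aut) :=
  forall U V, c2_open U -> c2_open V -> U !=set0 -> V !=set0 ->
    exists (n : nat) rho rho', U rho /\ V rho' /\ lens_pow T n rho rho'.

(* P-system: topologically transitive with a dense set of periodic points *)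
Definition P_system (T : aut) :=
  c2_transitive T /\
  forall U, c2_open U -> U !=set0 -> U `&` Jinf T !=set0.

Definition gaussian_rv (g : X -> R) :=
  (exists c : R, ae_prop mu (fun x => g x = c)) \/
  exists m s : R, 0 < s /\
    forall B : set R, measurable B -> mu (g @^-1` B) = normal_prob m s B.

Definition gaussian_system (T : aut) :=
  exists f : X -> R, measurable_fun setT f /\
    (forall (N : nat) (a : nat -> R),
       gaussian_rv (fun x => \sum_(0 <= k < (2 * N).+1)
                               a k * f (zpow T (k%:Z - N%:Z) x))) /\
    forall A : set X, measurable A -> exists A' : set X,
      <<s [set E | exists (n : int) (B : set R), measurable B /\
                     E = (fun x => f (zpow T n x)) @^-1` B] >> A' /\
      mu (symdiff A A') = 0%E.

End ergodic_defs.

(* Main.v *)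
From HB Require Import structures.
From mathcomp Require Import all_boot all_order all_algebra all_fingroup.
From mathcomp Require Import cyclic separable cyclotomic complex ring lra zify.
From mathcomp Require Import all_classical all_reals all_analysis.
From mathcomp Require Import measurable_realfun.
(* Imported last: [fingroup] also defines [aut]. *)
Require Import Defs.
Set Implicit Arguments.
Unset Strict Implicit.
Unset Printing Implicit Defensive.
Import Order.TTheory GRing.Theory Num.Theory numFieldNormedType.Exports.
Local Open Scope classical_set_scope.
Local Open Scope ring_scope.
Local Open Scope complex_scope.
Local Notation Re := complex.Re.
Local Notation Im := complex.Im.
Local Notation normc := Normc.normc.
Local Notation "x ^*" := (conjc x) : ring_scope.
Local Notation "''i'" := (Complex 0 1) : ring_scope.

(** Rank one is witnessed by towers, and "the power [T^n] has a tower approximating [L] equal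
    intervals" is an open condition on [T], so the maps all of whose powers are rank one contain
    a G_delta.  It is dense: every automorphism is close to a cyclic permutation of [q] equal
    intervals, [q] prime, and such a cycle is conjugate, by a permutation of the intervals, to the
    rotation by [p / q], hence close to a conjugate of the rotation by a Liouville number, whose
    powers are all rank one.  Rank one gives cyclic vectors by approximation: [p(V) b] generates
    [b] as soon as the roots of [p] are moved off the unit circle.

    A coupling invariant under [T^n] is a bounded form invariant under [U^n], where [U] is the
    Koopman operator.  If [U^n] has a cyclic vector, such a form is invariant under every isometry
    commuting with [U^n], in particular under [U]; this gives [Jinf = J2].  The same principle
    gives ergodicity, so the relative product over [{A, A^c}] is a coupling which is not invariant,
    and J2 is closed and nowhere dense.

    For a Gaussian system, L^2 is the Fock space over the closed real span [H] of the centred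
    process: [e(h) = exp (|h|^2 / 2 + i h)] satisfies [<e h, e g> = exp <h, g>].  [U] has no
    eigenvector on [H], so [H] splits into many small orthogonal invariant pieces.  Projecting on
    the span of the [U^(n k) u] and averaging over the [n]-th roots of unity reduces the cyclicity
    of [u] under [U^n] to [W = 0] for a bounded [W] with [U W = z W U], [z <> 1].  The commutant
    principle applied to the kernel of [W] shows that for every invariant splitting [H = H1 + H2]
    the operator [W] vanishes on the Fock space of [H1] or of [H2]; a truncation argument over
    small pieces then gives [W = 0]. *)

(** * Real Hilbert spaces *)

(** No spectral measure is constructed: spectral projectors of the self-adjoint V + V^-1 come from
    an operator square root computed by iteration, and cyclicity is always approximation by Laurent
    polynomials in U.

    Why W vanishes on one side of an invariant splitting: for a projector Q commuting with U and Q'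
    = 1 - Q, the kernel k(h, g) = <W e(Q h), e(Q g)> conj <W e(Q' g), e(Q' h)> is U-invariant,
    because the factors conj z and z cancel. The isometry induced by U on the range of Q and by the
    identity on that of Q' commutes with U, but multiplies k by conj z alone. Hence k = 0, and k is
    a product of two factors in independent variables.

    Terms of low degree over a fine splitting involve few pieces, whose total weight can be made
    negligible; this is where the absence of eigenvectors enters. That absence is itself
    probabilistic: a relation h(T) + h(T^-1) = t h yields an invariant quadratic expression in h and
    h(T^-1), constant by ergodicity, which would bound a Gaussian variable. *)

Section RealHilbert.
Variable R : realType.

(** The inner product is a bare function and the axioms a proposition about it, so that one carrier
    can serve both as a complex space and, through [realify], as a real one. *)
Record real_hilbert (E : lmodType R) (ip : E -> E -> R) : Prop := RealHilbert {
  rh_lin : forall a x y z, ip (a *: x + y) z = a * ip x z + ip y z;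
  rh_sym : forall x y, ip x y = ip y x;
  rh_ge0 : forall x, 0 <= ip x x;
  rh_def : forall x, ip x x = 0 -> x = 0;
  rh_cpl : forall u : nat -> E,
    (forall e, 0 < e -> exists N, forall m n, (N <= m)%N -> (N <= n)%N ->
       ip (u m - u n) (u m - u n) < e) ->
    exists l, forall e, 0 < e -> exists N, forall n, (N <= n)%N ->
       ip (u n - l) (u n - l) < e }.

Variables (E : lmodType R) (ip : E -> E -> R).
Hypothesis H : real_hilbert ip.

Lemma ipDl x y z : ip (x + y) z = ip x z + ip y z.
Proof. by rewrite -[x in LHS]scale1r (rh_lin H) mul1r. Qed.

Lemma ip0l z : ip 0 z = 0.
Proof. by have := ipDl 0 0 z; rewrite addr0; lra. Qed.

Lemma ipZl a x z : ip (a *: x) z = a * ip x z.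
Proof. by rewrite -[a *: x]addr0 (rh_lin H) ip0l addr0. Qed.

Lemma ipNl x z : ip (- x) z = - ip x z.
Proof. by rewrite -scaleN1r ipZl mulN1r. Qed.

Lemma ipBl x y z : ip (x - y) z = ip x z - ip y z.
Proof. by rewrite ipDl ipNl. Qed.

Lemma ipDr x y z : ip z (x + y) = ip z x + ip z y.
Proof. by rewrite (rh_sym H) ipDl !(rh_sym H z). Qed.

Lemma ip0r z : ip z 0 = 0.
Proof. by rewrite (rh_sym H) ip0l. Qed.

Lemma ipZr a x z : ip z (a *: x) = a * ip z x.
Proof. by rewrite (rh_sym H) ipZl (rh_sym H). Qed.

Lemma ipNr x z : ip z (- x) = - ip z x.
Proof. by rewrite -scaleN1r ipZr mulN1r. Qed.

Lemma ipBr x y z : ip z (x - y) = ip z x - ip z y.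
Proof. by rewrite ipDr ipNr. Qed.

Definition ipE := (ipBl, ipBr, ipDl, ipDr, ipNl, ipNr, ipZl, ipZr, ip0l, ip0r).

Lemma ip_CS2 x y : ip x y ^+ 2 <= ip x x * ip y y.
Proof.
have [y0|y0] := eqVneq (ip y y) 0.
  by rewrite (rh_def H y0) !ipE expr0n mulr0.
have yy : 0 < ip y y by rewrite lt_neqAle eq_sym y0 (rh_ge0 H).
have := rh_ge0 H (ip y y *: x - ip x y *: y).
rewrite !ipE (rh_sym H y x).
rewrite (_ : _ - _ = ip y y * (ip x x * ip y y - ip x y ^+ 2)); last by ring.
by rewrite pmulr_rge0// subr_ge0.
Qed.

Definition nrm x := Num.sqrt (ip x x).

Lemma nrm_ge0 x : 0 <= nrm x. Proof. exact: sqrtr_ge0. Qed.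

Lemma sqr_nrm x : nrm x ^+ 2 = ip x x.
Proof. by rewrite sqr_sqrtr// (rh_ge0 H). Qed.

Lemma nrm0 : nrm 0 = 0.
Proof. by rewrite /nrm ip0l sqrtr0. Qed.

Lemma nrm_eq0 x : nrm x = 0 -> x = 0.
Proof. by move=> h; apply: (rh_def H); rewrite -sqr_nrm h expr0n. Qed.

Lemma ip_CS x y : `|ip x y| <= nrm x * nrm y.
Proof.
rewrite -(@ler_pXn2r _ 2)// ?nnegrE ?mulr_ge0 ?nrm_ge0//.
by rewrite exprMn !sqr_nrm real_normK ?num_real// ip_CS2.
Qed.

Lemma nrmZ a x : nrm (a *: x) = `|a| * nrm x.
Proof. by rewrite /nrm !ipE mulrA -expr2 sqrtrM ?sqr_ge0// sqrtr_sqr. Qed.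

Lemma nrmN x : nrm (- x) = nrm x.
Proof. by rewrite -scaleN1r nrmZ normrN1 mul1r. Qed.

Lemma nrmBC x y : nrm (x - y) = nrm (y - x).
Proof. by rewrite -nrmN opprB. Qed.

Lemma nrmD x y : nrm (x + y) <= nrm x + nrm y.
Proof.
rewrite -(@ler_pXn2r _ 2)// ?nnegrE ?addr_ge0 ?nrm_ge0//.
rewrite sqr_nrm !ipE (rh_sym H y x) -!sqr_nrm.
by have := ler_norm (ip x y); have := ip_CS x y; nra.
Qed.

Lemma nrmB x y : nrm (x - y) <= nrm x + nrm y.
Proof. by rewrite -(nrmN y) nrmD. Qed.

Lemma nrm_tri z x y : nrm (x - y) <= nrm (x - z) + nrm (z - y).
Proof. by rewrite -[x - y](subrKA z) nrmD. Qed.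

Lemma nrm_lt x e : 0 < e -> (nrm x < e) = (ip x x < e ^+ 2).
Proof.
by move=> e0; rewrite -(@ltr_pXn2r _ 2)// ?nnegrE ?nrm_ge0 ?ltW// sqr_nrm.
Qed.

Lemma nrm_le x e : 0 <= e -> (nrm x <= e) = (ip x x <= e ^+ 2).
Proof.
by move=> e0; rewrite -(@ler_pXn2r _ 2)// ?nnegrE ?nrm_ge0// sqr_nrm.
Qed.

Lemma small_eq0 x : (forall e, 0 < e -> nrm x <= e) -> x = 0.
Proof.
move=> h; apply: nrm_eq0; apply/eqP; rewrite eq_le nrm_ge0 andbT.
by apply/ler_addgt0Pr => e e0; rewrite add0r; apply: h.
Qed.

Definition tends (u : nat -> E) l :=
  forall e, 0 < e -> exists N, forall n, (N <= n)%N -> nrm (u n - l) < e.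

Lemma hcomplete (u : nat -> E) :
  (forall e, 0 < e -> exists N, forall m n, (N <= m)%N -> (m <= n)%N ->
     nrm (u m - u n) < e) -> exists l, tends u l.
Proof.
move=> cu; have [|l ul] := @rh_cpl _ _ H u.
  move=> e e0; have se0 : 0 < Num.sqrt e by rewrite sqrtr_gt0.
  have [N uN] := cu _ se0; exists N => m n Nm Nn.
  rewrite -[e]sqr_sqrtr ?ltW// -nrm_lt//.
  by case: (leqP m n) => [|/ltnW] mn; [|rewrite nrmBC]; apply: uN.
exists l => e e0; have [N uN] := ul _ (exprn_gt0 2 e0).
by exists N => n Nn; rewrite nrm_lt// uN.
Qed.

Lemma tends_uniq u l l' : tends u l -> tends u l' -> l = l'.
Proof.
move=> ul ul'; apply/subr0_eq/small_eq0 => e e0.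
have e2 : 0 < e / 2 by lra.
have [N uN] := ul _ e2; have [M uM] := ul' _ e2.
have := uN _ (leq_maxl N M); have := uM _ (leq_maxr N M).
have := nrm_tri (u (maxn N M)) l l'; rewrite (nrmBC l (u _)).
by lra.
Qed.

Lemma tendsD u v l m : tends u l -> tends v m -> tends (fun n => u n + v n) (l + m).
Proof.
move=> ul vm e e0.
have e2 : 0 < e / 2 by lra.
have [N uN] := ul _ e2; have [M uM] := vm _ e2.
exists (maxn N M) => n; rewrite geq_max => /andP[/uN a /uM b].
rewrite opprD addrACA; apply: le_lt_trans (nrmD _ _) _; lra.
Qed.

Lemma tendsZ a u l : tends u l -> tends (fun n => a *: u n) (a *: l).
Proof.
move=> ul e e0.
have a0 : 0 < `|a| + 1 by have := normr_ge0 a; lra.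
have [N uN] := ul _ (divr_gt0 e0 a0).
exists N => n /uN; rewrite -scalerBr nrmZ ltr_pdivlMr//.
have := nrm_ge0 (u n - l); nra.
Qed.

Lemma tends_ip u v l m : tends u l -> tends v m -> forall e, 0 < e -> exists N,
  forall n, (N <= n)%N -> `|ip (u n) (v n) - ip l m| < e.
Proof.
move=> ul vm e e0; set c := nrm l + nrm m + 1.
have c0 : 0 < c by rewrite /c; have := nrm_ge0 l; have := nrm_ge0 m; lra.
have d0 : 0 < Num.min 1 (e / (2 * c)) by rewrite lt_min ltr01 divr_gt0// mulr_gt0.
have [N uN] := ul _ d0; have [M uM] := vm _ d0.
exists (maxn N M) => n; rewrite geq_max => /andP[/uN a /uM b].
rewrite (_ : _ - _ = ip (u n - l) (v n) + ip l (v n - m)); last by rewrite !ipE; ring.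
apply: le_lt_trans (ler_normD _ _) _.
have := ip_CS (u n - l) (v n); have := ip_CS l (v n - m).
have vn : nrm (v n) <= nrm m + 1.
  rewrite -(subrK m (v n)) addrC; apply: le_trans (nrmD _ _) _.
  by rewrite lerD2l; move: b; rewrite lt_min => /andP[/ltW].
move: a b; rewrite !lt_min => /andP[_ a] /andP[_ b].
rewrite ltr_pdivlMr ?mulr_gt0// in a; rewrite ltr_pdivlMr ?mulr_gt0// in b.
have p0 := nrm_ge0 (u n - l); have q0 := nrm_ge0 (v n - m).
have l0 := nrm_ge0 l; have m0 := nrm_ge0 m.
have h1 : nrm (u n - l) * nrm (v n) <= nrm (u n - l) * c.
  by apply: ler_wpM2l => //; apply: le_trans vn _; rewrite /c; lra.
have h2 : nrm l * nrm (v n - m) <= nrm (v n - m) * c.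
  by rewrite mulrC; apply: ler_wpM2l => //; rewrite /c; lra.
lra.
Qed.

Lemma tends_ip_eq2 u v u' v' l m l' m' :
  tends u l -> tends v m -> tends u' l' -> tends v' m' ->
  (forall n, ip (u n) (v n) = ip (u' n) (v' n)) -> ip l m = ip l' m'.
Proof.
move=> ul vm ul' vm' h; apply/eqP; rewrite -subr_eq0 -normr_eq0 eq_le normr_ge0 andbT.
apply/ler_addgt0Pr => e e0; rewrite add0r; have e2 : 0 < e / 2 by lra.
have [N uN] := tends_ip ul vm e2; have [M uM] := tends_ip ul' vm' e2.
have := uN _ (leq_maxl N M); have := uM _ (leq_maxr N M).
by rewrite h !ltr_norml ler_norml => /andP[? ?] /andP[? ?]; lra.
Qed.

Lemma tends_ip_ge u v l m (f : R) : tends u l -> tends v m ->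
  (forall n, f <= ip (u n) (v n)) -> f <= ip l m.
Proof.
move=> ul vm h; apply/ler_addgt0Pr => e e0.
have [N /(_ N (leqnn _))] := tends_ip ul vm e0.
by have := h N; move=> a; rewrite ltr_norml => /andP[? ?]; lra.
Qed.

Lemma tends_cst l : tends (fun=> l) l.
Proof. by move=> e e0; exists 0 => n _; rewrite subrr nrm0. Qed.

Definition subspace (M : set E) := M 0 /\ forall a x y, M x -> M y -> M (a *: x + y).

Definition hclosure (M : set E) : set E :=
  [set x | forall e, 0 < e -> exists2 m, M m & nrm (x - m) < e].

Lemma subspaceZ M a x : subspace M -> M x -> M (a *: x).
Proof. by move=> [M0 ML] Mx; have := ML a x 0 Mx M0; rewrite addr0. Qed.

Lemma subspaceD M x y : subspace M -> M x -> M y -> M (x + y).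
Proof. by move=> [M0 ML] Mx My; have := ML 1 x y Mx My; rewrite scale1r. Qed.

Lemma subspaceB M x y : subspace M -> M x -> M y -> M (x - y).
Proof.
by move=> sM Mx My; rewrite -scaleN1r; apply: (subspaceD sM Mx); apply: (subspaceZ _ sM).
Qed.

Lemma sub_hclosure M : M `<=` hclosure M.
Proof. by move=> x Mx e e0; exists x; rewrite ?subrr ?nrm0. Qed.

Lemma hclosure_subspace M : subspace M -> subspace (hclosure M).
Proof.
move=> sM; split; first by apply: sub_hclosure; case: sM.
move=> a x y cx cy e e0.
have a0 : 0 < `|a| + 1 by have := normr_ge0 a; lra.
have e2 : 0 < e / 2 by lra.
have [m Mm xm] := cx _ (divr_gt0 e2 a0).
have [k Mk yk] := cy _ e2.
exists (a *: m + k); first by case: sM => _; apply.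
rewrite opprD addrACA -scalerBr; apply: le_lt_trans (nrmD _ _) _; rewrite nrmZ.
rewrite ltr_pdivlMr// in xm; have := nrm_ge0 (x - m); nra.
Qed.

Lemma tends_hclosure M u l : (forall n, hclosure M (u n)) -> tends u l -> hclosure M l.
Proof.
move=> uM ul e e0; have e2 : 0 < e / 2 by lra.
have [N /(_ N (leqnn _)) uN] := ul _ e2; have [m Mm um] := uM N _ e2.
exists m => //; apply: le_lt_trans (nrm_tri (u N) _ _) _.
by rewrite nrmBC; lra.
Qed.

(** For a subspace that may fail to be closed, the foot [p] lies in the closure: a minimising
    sequence is Cauchy by the parallelogram law, and minimality along the lines [p + t m] gives
    orthogonality. *)
Lemma hprojection M x : subspace M ->
  exists2 p, hclosure M p & forall m, M m -> ip (x - p) m = 0.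
Proof.
move=> sM; pose S := [set ip (x - m) (x - m) | m in M].
have Slb : has_lbound S by exists 0 => _ [m _ <-]; apply: rh_ge0.
have Sinf : has_inf S by split=> //; exists (ip (x - 0) (x - 0)), 0 => //; case: sM.
set d := inf S; have dS m : M m -> d <= ip (x - m) (x - m).
  by move=> Mm; apply: ge_inf => //; exists m.
have [u uP] : exists u : nat -> E, forall k, M (u k) /\
    ip (x - u k) (x - u k) < d + k.+1%:R^-1.
  suff /choice[u uP] : forall k, exists m, M m /\ ip (x - m) (x - m) < d + k.+1%:R^-1.
    by exists u.
  move=> k.
  have [] := @inf_adherent _ S k.+1%:R^-1 _ Sinf; first by rewrite invr_gt0.
  by move=> _ [m Mm <-] ?; exists m.
(* Parallelogram law: the midpoint of [u m] and [u n] belongs to [M], so its squared distance to [x]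
   is at least [d]. *)
have ucauchy m n : ip (u m - u n) (u m - u n) <= 2 * (m.+1%:R^-1 + n.+1%:R^-1).
  have [Mm um] := uP m; have [Mn un] := uP n.
  have /dS : M (2^-1 *: (u m + u n)) by apply: (subspaceZ _ sM); apply: (subspaceD sM).
  move: um un; rewrite !ipE (rh_sym H (u m) x) (rh_sym H (u n) x) (rh_sym H (u n) (u m)).
  by move: m.+1%:R^-1 n.+1%:R^-1 => a b; lra.
have [e e0|p up] := @hcomplete u.
  have e8 : 0 < e ^+ 2 / 4 by rewrite divr_gt0// exprn_gt0.
  exists (`|Num.truncn (e ^+ 2 / 4)^-1|)%N => m n Nm mn.
  rewrite nrm_lt//; apply: le_lt_trans (ucauchy m n) _.
  have inv k : (`|Num.truncn (e ^+ 2 / 4)^-1| <= k)%N -> k.+1%:R^-1 < e ^+ 2 / 4.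
    move=> Nk; rewrite -[ltRHS]invrK ltf_pV2 ?posrE ?invr_gt0//.
    apply: lt_le_trans (truncnS_gt _) _; rewrite ler_nat ltnS.
    by apply: leq_trans Nk; rewrite absz_nat.
  by move: (inv m Nm) (inv n (leq_trans Nm mn)); move: m.+1%:R^-1 n.+1%:R^-1 => a b; lra.
have Mp : hclosure M p by apply: tends_hclosure up => k; apply: sub_hclosure; case: (uP k).
exists p => // m Mm.
have xu : tends (fun n => x - u n) (x - p).
  rewrite -[_ - _]addrC -scaleN1r; under eq_fun do rewrite addrC -scaleN1r.
  by apply: tendsD; [apply: tendsZ | apply: tends_cst].
have dp t : d <= ip (x - p - t *: m) (x - p - t *: m).
  have ut : tends (fun n => x - u n - t *: m) (x - p - t *: m).
    by apply: (tendsD xu); apply: tends_cst.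
  apply: (tends_ip_ge ut ut) => n; rewrite -addrA -opprD; apply: dS.
  by apply: (subspaceD sM); [case: (uP n) | apply: (subspaceZ _ sM)].
have pd : ip (x - p) (x - p) <= d.
  apply/ler_addgt0Pr => e e0; have e2 : 0 < e / 2 by lra.
  have [N xN] := tends_ip xu xu e2.
  have [k kN ke] : exists2 k, (N <= k)%N & k.+1%:R^-1 < e / 2.
    exists (N + `|Num.truncn (e / 2)^-1|)%N; first by rewrite leq_addr.
    rewrite -[ltRHS]invrK ltf_pV2 ?posrE ?invr_gt0//.
    apply: lt_le_trans (truncnS_gt _) _; rewrite ler_nat ltnS absz_nat leq_addl//.
  have := xN _ kN; have [_ ] := uP k; move: k.+1%:R^-1 ke => a ke.
  by rewrite ltr_norml => ? /andP[? ?]; lra.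
have q t : 0 <= t ^+ 2 * ip m m - 2 * t * ip (x - p) m.
  have := le_trans pd (dp t); move: (x - p) => y.
  by rewrite !ipE (rh_sym H m y); lra.
set c := ip (x - p) m in q *; have mm := rh_ge0 H m.
have m1 : 0 < ip m m + 1 by lra.
(* The optimal [t] is [c / ip m m]; adding 1 to the denominator also covers [m = 0] and still leaves
   a nonpositive multiple of [c ^+ 2]. *)
have := q (c / (ip m m + 1)).
rewrite (_ : _ - _ = c ^+ 2 * (- ip m m - 2) / (ip m m + 1) ^+ 2); last first.
  by field; rewrite lt0r_neq0.
have i0 : 0 < (ip m m + 1) ^- 2 by rewrite invr_gt0 exprn_gt0.
rewrite pmulr_lge0// => h; apply/eqP; rewrite -sqrf_eq0 eq_le sqr_ge0 andbT.
have := sqr_ge0 c; nra.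
Qed.

End RealHilbert.

(** * Spectral splitting *)

Section Operators.
Variables (R : realType) (E : lmodType R) (ip : E -> E -> R).
Hypothesis H : real_hilbert ip.
Local Notation nrm := (nrm ip).
Local Notation tends := (tends ip).
Let ipS := rh_sym H.

Definition oplin (A : E -> E) := forall a x y, A (a *: x + y) = a *: A x + A y.
Definition opbdd (A : E -> E) (c : R) := forall x, nrm (A x) <= c * nrm x.
Definition opcomm (A B : E -> E) := forall x, A (B x) = B (A x).
Definition opadj (A B : E -> E) := forall x y, ip (A x) y = ip x (B y).

Lemma oplin0 A : oplin A -> A 0 = 0.
Proof. by move=> lA; have := lA (-1) 0 0; rewrite scaler0 addr0 scaleN1r addNr. Qed.

Lemma oplinD A x y : oplin A -> A (x + y) = A x + A y.
Proof. by move=> lA; have := lA 1 x y; rewrite !scale1r. Qed.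

Lemma oplinZ A a x : oplin A -> A (a *: x) = a *: A x.
Proof. by move=> lA; have := lA a x 0; rewrite (oplin0 lA) !addr0. Qed.

Lemma oplinN A x : oplin A -> A (- x) = - A x.
Proof. by move=> lA; rewrite -scaleN1r (oplinZ _ _ lA) scaleN1r. Qed.

Lemma oplinB A x y : oplin A -> A (x - y) = A x - A y.
Proof. by move=> lA; rewrite (oplinD _ _ lA) (oplinN _ lA). Qed.

Lemma oplin_sum A (I : Type) (r : seq I) (P : pred I) (F : I -> E) : oplin A ->
  A (\sum_(i <- r | P i) F i) = \sum_(i <- r | P i) A (F i).
Proof.
move=> lA; apply: (big_morph A); last exact: oplin0.
by move=> x y; apply: oplinD.
Qed.

Lemma opadj_oplin A B : opadj A B -> oplin A.
Proof.
move=> AB a x y; apply/subr0_eq/(rh_def H); set z := _ - _.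
by rewrite {1}/z !(ipE H) !AB -!(ipE H) !(ipE H); ring.
Qed.

Lemma opadj_sym A B : opadj A B -> opadj B A.
Proof. by move=> AB x y; rewrite ipS -AB ipS. Qed.

Lemma tends_bdd A c u l : oplin A -> opbdd A c -> tends u l ->
  tends (fun n => A (u n)) (A l).
Proof.
move=> lA bA ul e e0; have c0 : 0 < `|c| + 1 by have := normr_ge0 c; lra.
have [N uN] := ul _ (divr_gt0 e0 c0); exists N => n /uN.
rewrite -(oplinB _ _ lA) ltr_pdivlMr// => h; apply: le_lt_trans (bA _) _.
have := ler_norm c; have := nrm_ge0 ip (u n - l); nra.
Qed.

(* The Newton-like iteration [Y := (D + Y^2) / 2] for [1 - sqrt (1 - D)];
   [ynum] is its scalar majorant, the same iteration at [D = 1]. *)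
Fixpoint ynum (n : nat) : R := if n is m.+1 then (1 + ynum m ^+ 2) / 2 else 0.
Fixpoint yop (D : E -> E) (n : nat) (x : E) : E :=
  if n is m.+1 then 2^-1 *: (D x + yop D m (yop D m x)) else 0.

Lemma ynum_ge0 n : 0 <= ynum n.
Proof. by case: n => //= n; rewrite divr_ge0// addr_ge0// sqr_ge0. Qed.

Lemma ynum_le1 n : ynum n <= 1.
Proof. by elim: n => //= n IH; have := ynum_ge0 n; nra. Qed.

Lemma ynum_mono n : ynum n <= ynum n.+1.
Proof. by rewrite /=; have := sqr_ge0 (1 - ynum n); nra. Qed.

(** One step adds [(1 - y) ^+ 2 / 2], so a sequence staying below [1 - e] would grow linearly and
    exceed 1. *)
Lemma ynum_cauchy e : 0 < e -> exists N, forall n, (N <= n)%N -> 1 - e < ynum n.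
Proof.
move=> e0; apply/not_existsP => h.
have h2 n : ynum n <= 1 - e.
  have /existsNP[m /not_implyP[nm /negP]] := h n; rewrite -leNgt; apply: le_trans.
  rewrite -(subnKC nm); elim: (m - n)%N => [|k IH]; first by rewrite addn0.
  by apply: le_trans IH _; rewrite addnS ynum_mono.
have step n : ynum n + e ^+ 2 / 2 <= ynum n.+1.
  by rewrite /=; have := h2 n; have := ynum_ge0 n; nra.
have big n : n%:R * (e ^+ 2 / 2) <= ynum n.
  elim: n => [|n IH]; first by rewrite mul0r.
  by rewrite -natr1 mulrDl mul1r; have := step n; lra.
have f0 : 0 < e ^+ 2 / 2 by rewrite divr_gt0// exprn_gt0.
have := big (Num.truncn (e ^+ 2 / 2)^-1).+1.
have := truncnS_gt (e ^+ 2 / 2)^-1; rewrite -[_^-1]mul1r ltr_pdivrMr// => a b.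
have := le_trans b (ynum_le1 _); lra.
Qed.

(** The relation for [Y] says [(1 - Y)^2 = 1 - D]. The increments of [yop] are dominated by those of
    [ynum], so the iteration converges at every vector; each iterate is a polynomial in [D] and
    commutes with whatever commutes with [D]. *)
Lemma sqrt_op D : opadj D D -> opbdd D 1 -> exists Y, [/\ opadj Y Y, opbdd Y 1,
  forall x, 2 *: Y x = D x + Y (Y x) &
  forall Q Q', opadj Q Q' -> (exists c, opbdd Q c) -> opcomm Q D -> opcomm Q Y].
Proof.
move=> sD bD; have lD := opadj_oplin sD.
pose y := yop D.
have sy n : opadj (y n) (y n).
  elim: n => [|n IH] x z; rewrite /y/=; first by rewrite (ip0l H) (ip0r H).
  by rewrite !(ipE H) sD !IH.
have ly n := opadj_oplin (sy n).
have by_ n : opbdd (y n) (ynum n).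
  elim: n => [|n IH] x; rewrite /y/=; first by rewrite (nrm0 H) mul0r.
  rewrite (nrmZ H) ger0_norm// mulrC -mulrAC ler_pM2r// mulrDl mul1r.
  apply: le_trans (nrmD H _ _) _; apply: lerD; first by rewrite -[leRHS]mul1r bD.
  apply: le_trans (IH _) _; rewrite expr2 -mulrA.
  by apply: ler_wpM2l (IH _); apply: ynum_ge0.
have cy Q Q' : opadj Q Q' -> opcomm Q D -> forall n, opcomm Q (y n).
  move=> /opadj_oplin lQ QD; elim=> [|n IH] x; rewrite /y/=; first by rewrite oplin0.
  by rewrite (oplinZ _ _ lQ) (oplinD _ _ lQ) QD !IH.
have cyy n m : opcomm (y n) (y m) by apply: (cy _ _ (sy n)) => x; rewrite (cy _ _ sD).
have dy n x : nrm (y n.+1 x - y n x) <= (ynum n.+1 - ynum n) * nrm x.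
  elim: n x => [|n IH] x.
    rewrite /y/= !subr0 addr0 (nrmZ H) ger0_norm//.
    by have := bD x; have := nrm_ge0 ip x; nra.
  (* A difference of squares, [y n] and [y n.+1] being commuting polynomials in [D]; the scalars
     [ynum] obey the same identity. *)
  have -> : y n.+2 x - y n.+1 x =
      2^-1 *: (y n.+1 (y n.+1 x - y n x) + y n (y n.+1 x - y n x)).
    rewrite !(oplinB _ _ (ly _)) (cyy n n.+1) subrKA.
    transitivity (2^-1 *: (D x + y n.+1 (y n.+1 x)) - 2^-1 *: (D x + y n (y n x))) => //.
    by rewrite -scalerBr opprD addrACA subrr add0r.
  rewrite (nrmZ H) ger0_norm//.
  apply: le_trans (_ : 2^-1 * ((ynum n.+1 + ynum n) * ((ynum n.+1 - ynum n) * nrm x)) <= _).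
    rewrite ler_pM2l//; apply: le_trans (nrmD H _ _) _; rewrite mulrDl.
    have := by_ n.+1 (y n.+1 x - y n x); have := by_ n (y n.+1 x - y n x).
    by have := IH x; have := ynum_ge0 n; have := ynum_ge0 n.+1; nra.
  by rewrite [ynum n.+2]/= -/(ynum n.+1) [ynum n.+1 in X in _ <= (_ - X) * _]/=; lra.
have dym n m x : (n <= m)%N -> nrm (y m x - y n x) <= (ynum m - ynum n) * nrm x.
  move=> nm; rewrite -(subnKC nm); elim: (m - n)%N => [|k IH].
    by rewrite addn0 !subrr (nrm0 H) mul0r.
  rewrite addnS; apply: le_trans (nrm_tri H (y (n + k)%N x) _ _) _.
  by have := dy (n + k)%N x; lra.
have /choice[Y yY] x : exists l, tends (fun n => y n x) l.
  apply: (hcomplete H) => e e0; have n1 : 0 < nrm x + 1 by have := nrm_ge0 ip x; lra.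
  have [N yN] := ynum_cauchy (divr_gt0 e0 n1).
  exists N => m n Nm mn; rewrite (nrmBC H); apply: le_lt_trans (dym _ _ _ mn) _.
  have := yN m Nm; rewrite ltrBlDr -ltrBlDl ltr_pdivlMr// => h.
  by have := ynum_le1 n; have := nrm_ge0 ip x; have := ynum_le1 m; nra.
have sY : opadj Y Y.
  move=> x z; apply: (tends_ip_eq2 H (yY x) (tends_cst H z) (tends_cst H x) (yY z)) => n.
  exact: sy.
have lY := opadj_oplin sY.
have yY1 x : tends (fun n => y n.+1 x) (Y x).
  by move=> e /(yY x)[N yN]; exists N => n Nn; apply: yN; apply: leqW.
exists Y; split=> //.
- move=> x; rewrite mul1r (nrm_le H) ?nrm_ge0//.
  rewrite -[ip _ _]opprK lerNl -(ipNr H) -scaleN1r.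
  apply: (tends_ip_ge H (yY x) (tendsZ H (-1) (yY x))) => n.
  rewrite (ipZr H) mulN1r lerN2 -(nrm_le H) ?nrm_ge0//.
  by have := by_ n x; have := ynum_le1 n; have := nrm_ge0 ip x; nra.
- move=> x; apply: (tends_uniq H (tendsZ H 2 (yY1 x))).
  have -> : (fun n => 2 *: y n.+1 x) = (fun n => D x + y n (y n x)).
    by apply/funext => n; rewrite /y/= scalerA divff// scale1r.
  apply: (tendsD H (tends_cst H _)) => e e0; have e2 : 0 < e / 2 by lra.
  have [N yN] := yY x _ e2; have [M yM] := yY (Y x) _ e2.
  exists (maxn N M) => n; rewrite geq_max => /andP[/yN a /yM b].
  apply: le_lt_trans (nrm_tri H (y n (Y x)) _ _) _; rewrite -(oplinB _ _ (ly n)).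
  have := by_ n (y n x - Y x); have := ynum_le1 n; have := nrm_ge0 ip (y n x - Y x); nra.
- move=> Q Q' aQ [c bQ] QD x; have lQ := opadj_oplin aQ.
  apply: (tends_uniq H (tends_bdd lQ bQ (yY x))).
  by under eq_fun do rewrite (cy _ _ aQ QD); apply: yY.
Qed.

(** With [D = 1 - Z^2 / c^2], the operator [N = c (1 - Y)] has square [Z^2], and it is positive as
    [Y] is a contraction: it is the absolute value of [Z]. *)
Lemma abs_op Z c : 0 < c -> opadj Z Z -> opbdd Z c -> exists N, [/\ opadj N N,
  exists b, opbdd N b, forall x, 0 <= ip (N x) x, forall x, N (N x) = Z (Z x) &
  forall Q Q', opadj Q Q' -> (exists b, opbdd Q b) -> opcomm Q Z -> opcomm Q N].
Proof.
move=> c0 sZ bZ; have lZ := opadj_oplin sZ.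
pose D x := x - c ^- 2 *: Z (Z x).
have sD : opadj D D by move=> x y; rewrite /D !(ipE H) !sZ.
have cc : c ^- 2 * c ^+ 2 = 1 by rewrite mulVf// expf_neq0// lt0r_neq0.
have c2 : 0 < c ^- 2 by rewrite invr_gt0 exprn_gt0.
have bD : opbdd D 1.
  move=> x; rewrite mul1r (nrm_le H) ?nrm_ge0// (sqr_nrm H) /D !(ipE H) (ipS x).
  rewrite sZ -(sqr_nrm H (Z x)) -(sqr_nrm H (Z (Z x))).
  suff : c ^- 2 * nrm (Z (Z x)) ^+ 2 <= nrm (Z x) ^+ 2.
    move=> h; have : c ^- 2 * (c ^- 2 * nrm (Z (Z x)) ^+ 2) <= c ^- 2 * nrm (Z x) ^+ 2.
      by rewrite ler_pM2l.
    have h2 : 0 <= c ^- 2 * nrm (Z x) ^+ 2 by rewrite mulr_ge0 ?sqr_ge0// ltW.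
    lra.
  apply: le_trans (_ : c ^- 2 * (c * nrm (Z x)) ^+ 2 <= _).
    by rewrite ler_pM2l// ler_pXn2r ?nnegrE ?mulr_ge0 ?nrm_ge0 ?(ltW c0)//; apply: bZ.
  by rewrite exprMn mulrA cc mul1r.
have [Y [sY bY eY cY]] := sqrt_op sD bD; have lY := opadj_oplin sY.
exists (fun x => c *: (x - Y x)); split.
- by move=> x y; rewrite !(ipE H) sY.
- exists (c * 2) => x; rewrite (nrmZ H) gtr0_norm// -mulrA ler_pM2l//.
  by apply: le_trans (nrmB H _ _) _; have := bY x; lra.
- move=> x; rewrite !(ipE H); apply: mulr_ge0; first exact: ltW.
  rewrite subr_ge0.
  apply: le_trans (ler_norm _) _; apply: le_trans (ip_CS H _ _) _.
  by rewrite -(sqr_nrm H) expr2; have := bY x; have := nrm_ge0 ip x; nra.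
- move=> x; rewrite (oplinZ _ _ lY) (oplinB _ _ lY) -scalerBr scalerA -expr2.
  have -> : x - Y x - (Y x - Y (Y x)) = c ^- 2 *: Z (Z x).
    have /eqP := eY x; rewrite /D scaler_nat mulr2n eq_sym -subr_eq0 => /eqP h.
    apply/subr0_eq; rewrite -[RHS]h opprB opprD; move: (Y x) (Y (Y x)) (_ *: _) => p q r.
    by rewrite [LHS](AC (2*2*1) ((1*5*3)*(2*4))).
  by rewrite scalerA mulrC cc scale1r.
- move=> Q Q' aQ bQ QZ x; have lQ := opadj_oplin aQ.
  rewrite (oplinZ _ _ lQ) (oplinB _ _ lQ) (cY _ _ aQ bQ)// => z.
  by rewrite /D (oplinB _ _ lQ) (oplinZ _ _ lQ) !QZ.
Qed.

Lemma proj_bdd P : opadj P P -> (forall x, P (P x) = P x) -> opbdd P 1.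
Proof.
move=> sP PP x; rewrite mul1r (nrm_le H) ?nrm_ge0// (sqr_nrm H).
have h : ip (P x) (P x) = ip x (P x) by rewrite sP PP.
have := rh_ge0 H (x - P x); rewrite !(ipE H) (ipS (P x) x); lra.
Qed.

Lemma proj_op M : subspace M -> hclosure ip M `<=` M -> exists P, [/\ opadj P P, forall x, M (P x), forall x, M x -> P x = x,
  forall x m, M m -> ip (x - P x) m = 0 &
  forall Q Q', opadj Q Q' -> (forall m, M m -> M (Q m)) ->
    (forall m, M m -> M (Q' m)) -> opcomm Q P].
Proof.
move=> sM M_closed.
have /choice[P PP] x : exists p, M p /\ forall m, M m -> ip (x - p) m = 0.
  by have [p /M_closed Mp h] := hprojection H x sM; exists p.
have PM x : M (P x) by case: (PP x).
have Po x m : M m -> ip (x - P x) m = 0 by case: (PP x) => _; apply.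
have Pu x p : M p -> (forall m, M m -> ip (x - p) m = 0) -> P x = p.
  move=> Mp hp; apply/subr0_eq/(rh_def H); set z := P x - p.
  have Mz : M z by apply: (subspaceB sM).
  by rewrite {1}/z -[P x - p](subrKA x) (addrC _ (x - p)) -(opprB x) (ipBl H) Po// hp// subrr.
have Pid x : M x -> P x = x by move=> Mx; apply: Pu => // m _; rewrite subrr (ip0l H).
exists P; split=> //; last first.
- move=> Q Q' aQ MQ MQ' x; have lQ := opadj_oplin aQ.
  apply/esym/Pu; first exact: MQ.
  by move=> m Mm; rewrite -(oplinB _ _ lQ) aQ Po//; apply: MQ'.
- move=> x y; transitivity (ip (P x) (P y)).
    by apply/eqP; rewrite -subr_eq0 -(ipBr H) ipS Po.
  by apply/eqP; rewrite eq_sym -subr_eq0 -(ipBl H) Po.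
Qed.

Lemma spec_proj Z c : 0 < c -> opadj Z Z -> opbdd Z c -> exists P, [/\
  opadj P P, forall x, P (P x) = P x, forall x, ip (Z (P x)) (P x) <= 0,
  forall x, 0 <= ip (Z (x - P x)) (x - P x) &
  forall Q Q', opadj Q Q' -> (exists b, opbdd Q b) -> (exists b, opbdd Q' b) ->
    opcomm Q Z -> opcomm Q' Z -> opcomm Q P].
Proof.
move=> c0 sZ bZ; have lZ := opadj_oplin sZ.
have [N [sN [b bN] N0 NN cN]] := abs_op c0 sZ bZ; have lN := opadj_oplin sN.
have ZN : opcomm Z N by apply: (cN _ _ sZ) => //; exists c.
pose M := [set x | N x + Z x = 0].
have sM : subspace M.
  split=> [|a x y /= Mx My]; first by rewrite /M/= (oplin0 lN) (oplin0 lZ) addr0.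
  by rewrite /M/= lN lZ addrACA -scalerDr Mx My scaler0 addr0.
have M_closed : hclosure ip M `<=` M.
  move=> x cx; apply: (small_eq0 H) => e e0.
  have bc : 0 < `|b| + c by have := normr_ge0 b; lra.
  have [m Mm xm] := cx _ (divr_gt0 e0 bc).
  rewrite -[_ + _]subr0 -Mm opprD addrACA -(oplinB _ _ lN) -(oplinB _ _ lZ).
  apply: le_trans (nrmD H _ _) _; rewrite ltr_pdivlMr// in xm.
  have := bN (x - m); have := bZ (x - m); have := ler_norm b; have := nrm_ge0 ip (x - m).
  nra.
have [P [sP PM Pid Po Pc]] := proj_op sM M_closed.
have PP x : P (P x) = P x by apply/Pid/PM.
exists P; split=> //.
- move=> x; have /(congr1 (ip^~ (P x))) := PM x; rewrite (ipDl H) (ip0l H).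
  by have := N0 (P x); lra.
- move=> x; set y := x - P x.
  have yM m : M m -> ip y m = 0 by apply: Po.
  pose k := N y - Z y.
  have kM z : M (N z - Z z).
    by rewrite /M/= (oplinB _ _ lN) (oplinB _ _ lZ) NN ZN addrC subrKA subrr.
  have k0 : k = 0.
    apply: (rh_def H); rewrite {1}/k (ipBl H) sN sZ -(ipBr H).
    exact/yM/kM.
  by move/subr0_eq: k0 => <-; apply: N0.
- move=> Q Q' aQ bQ bQ' QZ QZ' x; have lQ := opadj_oplin aQ.
  have QN := cN _ _ aQ bQ QZ; have QN' := cN _ _ (opadj_sym aQ) bQ' QZ'.
  have MQ m : M m -> M (Q m).
    by rewrite /M/= -QN -QZ -(oplinD _ _ lQ) => ->; apply: oplin0.
  have MQ' m : M m -> M (Q' m).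
    have lQ' := opadj_oplin (opadj_sym aQ).
    by rewrite /M/= -QN' -QZ' -(oplinD _ _ lQ') => ->; apply: oplin0.
  exact: (Pc _ _ aQ MQ MQ').
Qed.

Section Splitting.
Variables (V V' : E -> E) (F : set E).
Hypotheses (aV : opadj V V') (VV' : forall x, V (V' x) = x) (V'V : forall x, V' (V x) = x).
Hypotheses (sF : subspace F) (cF : hclosure ip F `<=` F).
Hypotheses (FV : forall x, F x -> F (V x)) (FV' : forall x, F x -> F (V' x)).
Hypothesis noeig : forall t x, F x -> V x + V' x = t *: x -> x = 0.

Let lV := opadj_oplin aV.
Let lV' := opadj_oplin (opadj_sym aV).
Let Z s x := V x + V' x - s *: x.

Let nrmV x : nrm (V x) = nrm x.
Proof. by rewrite /nrm aV V'V. Qed.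

Let nrmV' x : nrm (V' x) = nrm x.
Proof. by rewrite -nrmV VV'. Qed.

Let sZ s : opadj (Z s) (Z s).
Proof. by move=> x y; rewrite /Z !(ipE H) aV (opadj_sym aV); ring. Qed.

Let VZ s : opcomm V (Z s).
Proof. by move=> x; rewrite /Z (oplinB _ _ lV) (oplinD _ _ lV) (oplinZ _ _ lV) VV' V'V. Qed.

Let VZ' s : opcomm V' (Z s).
Proof. by move=> x; rewrite /Z (oplinB _ _ lV') (oplinD _ _ lV') (oplinZ _ _ lV') VV' V'V. Qed.

(** [Pi s] plays the role of the spectral projector of [V + V'] for the half-line up to [s]. *)
Let spec_family : exists Pi : R -> E -> E, [/\ forall s, opadj (Pi s) (Pi s),
  forall s x, Pi s (Pi s x) = Pi s x, forall s x, ip (Z s (Pi s x)) (Pi s x) <= 0,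
  forall s x, 0 <= ip (Z s (x - Pi s x)) (x - Pi s x) &
  [/\ forall s, opcomm V (Pi s), forall s, opcomm V' (Pi s),
   forall s t, opcomm (Pi s) (Pi t) & forall s x, F x -> F (Pi s x)]].
Proof.
have /choice[Pi PiP] s : exists P, [/\ opadj P P, forall x, P (P x) = P x,
    forall x, ip (Z s (P x)) (P x) <= 0, forall x, 0 <= ip (Z s (x - P x)) (x - P x) &
    forall Q Q', opadj Q Q' -> (exists b, opbdd Q b) -> (exists b, opbdd Q' b) ->
    opcomm Q (Z s) -> opcomm Q' (Z s) -> opcomm Q P].
  apply: (@spec_proj _ (3 + `|s|)); [by have := normr_ge0 s; lra|exact: sZ|move=> x].
  apply: le_trans (nrmB H _ _) _; rewrite (nrmZ H) mulrDl lerD2r.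
  apply: le_trans (nrmD H _ _) _; rewrite nrmV nrmV'; have := nrm_ge0 ip x; lra.
have bV : exists b, opbdd V b by exists 1 => x; rewrite nrmV mul1r.
have bV' : exists b, opbdd V' b by exists 1 => x; rewrite nrmV' mul1r.
have cV s : opcomm V (Pi s).
  by case: (PiP s) => _ _ _ _; apply; [exact: aV|..].
have cV' s : opcomm V' (Pi s).
  by case: (PiP s) => _ _ _ _; apply; [exact: opadj_sym aV|..].
have sPi s : opadj (Pi s) (Pi s) by case: (PiP s).
have PPi s x : Pi s (Pi s x) = Pi s x by case: (PiP s).
have cZ s t : opcomm (Pi s) (Z t).
  have l := opadj_oplin (sPi s).
  by move=> x; rewrite /Z (oplinB _ _ l) (oplinD _ _ l) (oplinZ _ _ l) -cV -cV'.
have bP s : exists b, opbdd (Pi s) b by exists 1; apply: proj_bdd.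
exists Pi; split=> //; [by move=> s x; case: (PiP s)|by move=> s x; case: (PiP s)|].
split=> //; first by move=> s t; case: (PiP t) => _ _ _ _; apply.
move=> s x Fx; have [P [sP PF Pid _ Pc]] := proj_op sF cF.
have PP y : P (P y) = P y by apply/Pid/PF.
have PV := Pc _ _ aV FV FV'; have PV' := Pc _ _ (opadj_sym aV) FV' FV.
have l := opadj_oplin sP.
have PZ : opcomm P (Z s).
  by move=> y; rewrite /Z (oplinB _ _ l) (oplinD _ _ l) (oplinZ _ _ l) -PV -PV'.
have PPs : opcomm P (Pi s).
  by case: (PiP s) => _ _ _ _; apply=> //; exists 1; apply: proj_bdd.
by rewrite -(Pid x Fx) -PPs.
Qed.

(** Without eigenvectors the functions [s |-> <Pi s x, x>] are continuous, so [[-3, 3]], which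
    contains the spectrum of [V + V'], can be cut into finitely many intervals on each of which [h]
    and [g] have little mass. The [Q i] are differences of consecutive [Pi]. *)
Lemma hilbert_splitting h g (e : R) : F h -> F g -> 0 < e ->
  exists (N : nat) (Q : nat -> E -> E), [/\ forall i, opadj (Q i) (Q i),
    forall i j x, (i < N)%N -> (j < N)%N -> Q i (Q j x) = if i == j then Q i x else 0,
    forall x, \sum_(i < N) Q i x = x,
    forall i, opcomm V (Q i) /\ forall x, F x -> F (Q i x) &
    forall i, (i < N)%N -> ip (Q i h) (Q i h) < e /\ ip (Q i g) (Q i g) < e].
Proof.
move=> Fh Fg e0; have [Pi [sP PP Pn Pp [cV cV' cP FP]]] := spec_family.
have lP s := opadj_oplin (sP s).
have ZE s t x : Z s x = Z t x + (t - s) *: x.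
  by rewrite /Z scalerBl addrA subrK.
have mono s t x : s <= t -> Pi t (Pi s x) = Pi s x.
  rewrite le_eqVlt => /orP[/eqP->//|st].
  (* [y] lies where [Z t] is nonnegative and [Z s] nonpositive, although [Z s = Z t + (t - s)] with
     [s < t]. *)
  apply/esym/subr0_eq/(rh_def H); set y := _ - _.
  have yt : 0 <= ip (Z t y) y := Pp t (Pi s x).
  have ys : Pi s y = y by rewrite /y (oplinB _ _ (lP s)) PP cP PP.
  have := Pn s y; rewrite ys (ZE s t) (ipDl H) (ipZl H); have := rh_ge0 H y; nra.
have mono' s t x : s <= t -> Pi s (Pi t x) = Pi s x by move=> st; rewrite cP mono.
have nB s t x : s <= t ->
    ip (Pi t x - Pi s x) (Pi t x - Pi s x) = ip (Pi t x) x - ip (Pi s x) x.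
  move=> st; rewrite !(ipE H) -!(sP t _ x) -!(sP s _ x) !PP (mono _ _ _ st) (mono' _ _ _ st); ring.
have fmono s t x : s <= t -> ip (Pi s x) x <= ip (Pi t x) x.
  by move=> st; rewrite -subr_ge0 -nB// (rh_ge0 H).
(* Continuity at [t]: otherwise the projectors onto shrinking intervals around [t] keep mass at
   least [e] on [x], and the limit [l] of their values at [x] is a nonzero eigenvector. *)
have loc x t : F x -> exists2 d, 0 < d & forall a b, t - d < a -> a <= b -> b < t + d ->
    ip (Pi b x - Pi a x) (Pi b x - Pi a x) < e.
  move=> Fx; apply: contrapT => hN.
  pose G d := ip (Pi (t + d) x) x - ip (Pi (t - d) x) x.
  have Ge d : 0 < d -> e <= G d.
    move=> d0; rewrite leNgt; apply/negP => Gd; apply: hN; exists d => // a b ha ab hb.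
    rewrite nB//; apply: le_lt_trans Gd; apply: lerB; apply: fmono; lra.
  pose d (k : nat) : R := (k.+1%:R : R)^-1; have d0 k : 0 < d k by rewrite invr_gt0.
  have dd m n : (m <= n)%N -> d n <= d m.
    by move=> mn; rewrite lef_pV2 ?posrE// ler_nat ltnS.
  pose Q k y := Pi (t + d k) y - Pi (t - d k) y.
  have QE k y : Q k y = Pi (t + d k) y - Pi (t - d k) y by [].
  clearbody Q.
  have sQ k : opadj (Q k) (Q k) by move=> y z; rewrite !QE !(ipE H) !sP.
  have QQ m n y : (m <= n)%N -> Q m (Q n y) = Q n y.
    move=> /dd mn; have dm0 := d0 m; have dn0 := d0 n.
    rewrite !QE !(oplinB _ _ (lP _)) (mono (t + d n) (t + d m)) ?(mono (t - d n) (t + d m));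
      rewrite ?(mono' (t - d m) (t + d n)) ?(mono' (t - d m) (t - d n)) ?subrr ?subr0//; lra.
  have [l Ql] : exists l, tends (Q^~ x) l.
    pose S := [set G (d k) | k in [set: nat]].
    have Sinf : has_inf S.
      by split; [exists (G (d 0%N)), 0%N | exists e => _ [k _ <-]; apply: Ge].
    have Gm m n : (m <= n)%N -> G (d n) <= G (d m).
      by move=> /dd mn; apply: lerB; apply: fmono; lra.
    apply: (hcomplete H) => f f0.
    have [_ [N _ <-] GN] := @inf_adherent _ S _ (exprn_gt0 2 f0) Sinf.
    exists N => m n Nm mn; rewrite (nrm_lt H)//.
    suff -> : ip (Q m x - Q n x) (Q m x - Q n x) = G (d m) - G (d n).
      have : inf S <= G (d n) by apply: ge_inf; [case: Sinf | exists n].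
      by have := Gm _ _ Nm; move: GN; move: (f ^+ 2) => ?; lra.
    rewrite !(ipE H) (ipS (Q m x) (Q n x)) -!(sQ n _ x) -!(sQ m _ x).
    rewrite !(QQ _ _ _ mn) !(QQ _ _ _ (leqnn _)) !QE !(ipBl H) /G; ring.
  have le : e <= ip l l.
    apply: (tends_ip_ge H Ql Ql) => n; rewrite -sQ QQ//.
    by apply: le_trans (Ge _ (d0 n)) _; rewrite /G QE (ipBl H).
  have Fl : F l.
    apply: cF; apply: (tends_hclosure H _ Ql) => n; apply: (sub_hclosure H).
    by rewrite QE; apply: (subspaceB sF); apply: FP.
  have Qfix k : Q k l = l.
    have lQ := opadj_oplin (sQ k); have bQ : opbdd (Q k) 1.
      by apply: proj_bdd => // y; apply: QQ.
    apply: (tends_uniq H (tends_bdd lQ bQ Ql)) => f f0.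
    have [N QN] := Ql _ f0; exists (maxn k N) => n; rewrite geq_max => /andP[kn Nn].
    by rewrite QQ//; apply: QN.
  have QZ k : opcomm (Q k) (Z t).
    have lQ := opadj_oplin (sQ k).
    move=> y; rewrite /Z (oplinB _ _ lQ) (oplinD _ _ lQ) (oplinZ _ _ lQ).
    by rewrite !QE !(oplinB _ _ lV) !(oplinB _ _ lV') !cV !cV'.
  (* On a vector fixed by [Q k], the form of [Z t] lies between [- d k] and [d k] times the squared
     norm. *)
  have qf y : (forall k, Q k y = y) -> ip (Z t y) y = 0.
    move=> Qy; apply/eqP; rewrite -normr_eq0 eq_le normr_ge0 andbT.
    apply/ler_addgt0Pr => f f0; rewrite add0r.
    have yy1 : 0 < ip y y + 1 by have := rh_ge0 H y; lra.
    have [k dk] : exists k, d k < f / (ip y y + 1).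
      exists (Num.truncn (f / (ip y y + 1))^-1); rewrite /d -[ltRHS]invrK.
      by rewrite ltf_pV2 ?posrE ?invr_gt0 ?divr_gt0// truncnS_gt.
    have kd := d0 k; have t1 : Pi (t + d k) y = y.
      by rewrite -(Qy k) QE (oplinB _ _ (lP _)) PP mono//; lra.
    have t2 : Pi (t - d k) y = 0.
      by rewrite -(Qy k) QE (oplinB _ _ (lP _)) PP mono' ?subrr//; lra.
    have := Pn (t + d k) y; rewrite t1 (ZE _ t) (ipDl H) (ipZl H).
    have := Pp (t - d k) y; rewrite t2 subr0 (ZE _ t) (ipDl H) (ipZl H).
    rewrite ltr_pdivlMr// in dk; move=> a b; have := rh_ge0 H y.
    by move: dk a b; rewrite ler_norml; move: (ip y y) => z *; apply/andP; split; nra.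
  (* The form of [Z t] vanishes at [l], at [z = Z t l] and at [l + z]; polarising, [<z, z> = 0], so
     [l] is an eigenvector. *)
  have QZl k : Q k (Z t l) = Z t l by rewrite QZ Qfix.
  have [z zE] : exists z, Z t l = z by exists (Z t l).
  have [z2 z2E] : exists z2, Z t z = z2 by exists (Z t z).
  have h1 : ip z l = 0 by rewrite -zE; apply: qf.
  have h2 : ip z2 z = 0 by rewrite -z2E; apply: qf => k; rewrite -zE.
  have h3 : ip z2 l = ip z z by rewrite -{1}z2E sZ zE.
  have h4 : ip (z + z2) (l + z) = 0.
    have := qf (l + z); rewrite (oplinD _ _ (opadj_oplin (sZ t))) zE z2E; apply=> k.
    by rewrite (oplinD _ _ (opadj_oplin (sQ k))) Qfix -zE QZl.
  have z0 : z = 0.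
    by apply: (rh_def H); move: h4; rewrite !(ipE H) h1 h2 h3; lra.
  have l0 : l = 0 by apply: (noeig (t := t) Fl); apply/subr0_eq; rewrite -[LHS]/(Z t l) zE.
  by move: le; rewrite l0 (ip0l H); lra.
pose small a b := ip (Pi b h - Pi a h) (Pi b h - Pi a h) < e /\
  ip (Pi b g - Pi a g) (Pi b g - Pi a g) < e.
(* Compactness of [[-3, 3]] by a supremum: local continuity at the supremum of the reachable [t]
   extends a partition beyond it. *)
pose ok t := exists N (s : nat -> R), [/\ s 0%N = -3, s N = t &
  forall i, (i < N)%N -> s i <= s i.+1 /\ small (s i) (s i.+1)].
have ok_step t t' : ok t -> t <= t' -> small t t' -> ok t'.
  move=> [N [s [s0 sN ss]]] tt' stt'.
  exists N.+1, (fun i => if (i <= N)%N then s i else t'); split=> //=; first by rewrite ltnn.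
  move=> i; rewrite ltnS => iN; rewrite iN; case: ltnP => [/ss//|Ni].
  by have -> : i = N by [apply/eqP; rewrite eqn_leq iN]; rewrite sN.
have ok3 : ok 3.
  pose S := [set t | ok t /\ t <= 3].
  have okm3 : ok (-3) by exists 0%N, (fun=> -3).
  have Ssup : has_sup S.
    by split; [exists (-3); split=> //; lra | exists 3 => t []].
  have S3 : sup S <= 3 by apply: ge_sup; [case: Ssup|move=> t []].
  have [d1 d10 h1] := loc h (sup S) Fh; have [d2 d20 h2] := loc g (sup S) Fg.
  pose dl := Num.min d1 d2; have dl0 : 0 < dl by rewrite lt_min d10.
  have dl1 : dl <= d1 by rewrite ge_min lexx.
  have dl2 : dl <= d2 by rewrite ge_min lexx orbT.
  clearbody dl.
  have [t [okt t3] tS] := sup_adherent dl0 Ssup.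
  have tS' : t <= sup S by apply: ub_le_sup; [case: Ssup|split].
  pose t' := Num.min 3 (sup S + dl / 2).
  have t't : t <= t' by rewrite le_min t3/=; lra.
  have t'1 : t' <= sup S + dl / 2 by rewrite ge_min lexx orbT.
  have t'3 : t' <= 3 by rewrite ge_min lexx.
  have t'2 : t' = 3 \/ t' = sup S + dl / 2.
    by rewrite /t'; case: (leP 3 (sup S + dl / 2)) => _; [left|right].
  clearbody t'.
  have okt' : ok t'.
    by apply: ok_step okt t't _; split; [apply: h1|apply: h2] => //; lra.
  have : t' <= sup S by apply: ub_le_sup; [case: Ssup|split].
  by case: t'2 => t'E; [rewrite -t'E | lra].
have [N [s [s0 sN ss]]] := ok3.
have smono i j : (i <= j)%N -> (j <= N)%N -> s i <= s j.
  move=> ij; rewrite -(subnKC ij); elim: (j - i)%N => [|k IH]; first by rewrite addn0.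
  rewrite addnS => ikN; apply: le_trans (IH (ltnW ikN)) _; exact: (ss _ ikN).1.
exists N, (fun i x => Pi (s i.+1) x - Pi (s i) x); split.
- by move=> i x y; rewrite !(ipE H) !sP.
- move=> i j x iN jN; rewrite !(oplinB _ _ (lP _)); case: eqVneq => [<-|ij].
    by rewrite !PP (mono (s i)) ?(mono' (s i)) ?subrr ?subr0//; apply: smono.
  have [lij|lij|ijE] := ltngtP i j; last by rewrite ijE eqxx in ij.
    by rewrite !mono' ?subrr//; apply: smono => //; apply: ltnW => //; apply: ltnW.
  by rewrite !mono ?subrr//; apply: smono => //; apply: ltnW => //; apply: ltnW.
- move=> x; have -> : \sum_(i < N) (Pi (s i.+1) x - Pi (s i) x) = Pi (s N) x - Pi (s 0%N) x.
    by rewrite -(big_mkord xpredT (fun i => Pi (s i.+1) x - Pi (s i) x)) telescope_sumr.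
  (* [V] and [V'] are isometries, so [V + V'] has norm at most 2 and the projectors at -3 and 3 are
     0 and the identity. *)
  have nZ y : `|ip (Z 0 y) y| <= 2 * ip y y.
    apply: le_trans (ip_CS H _ _) _; rewrite -(sqr_nrm H) expr2 mulrA.
    apply: ler_wpM2r; rewrite ?nrm_ge0// /Z scale0r subr0.
    by apply: le_trans (nrmD H _ _) _; rewrite nrmV nrmV' mulr2n mulrDl mul1r.
  have Pm : Pi (-3) x = 0.
    apply: (rh_def H); have := Pn (-3) x; rewrite (ZE _ 0) (ipDl H) (ipZl H).
    have := nZ (Pi (-3) x); rewrite ler_norml => /andP[a b] c.
    by apply/eqP; rewrite eq_le (rh_ge0 H) andbT; lra.
  have P3 : Pi 3 x = x.
    apply/esym/subr0_eq/(rh_def H); have := Pp 3 x; rewrite (ZE _ 0) (ipDl H) (ipZl H).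
    have := nZ (x - Pi 3 x); rewrite ler_norml => /andP[a b] c.
    by apply/eqP; rewrite eq_le (rh_ge0 H) andbT; lra.
  by rewrite s0 sN Pm P3 subr0.
- move=> i; split=> x; first by rewrite (oplinB _ _ lV) !cV.
  by move=> Fx; apply: (subspaceB sF); apply: FP.
- by move=> i iN; apply: (ss i iN).2.
Qed.

End Splitting.
End Operators.

(** * Complex Hilbert spaces and cyclic representations *)

(** An alias, so that a complex module can carry a second, real module structure without a conflict
    of instances. *)
Definition realify (R : realType) (E : lmodType R[i]) : Type := E.
HB.instance Definition _ (R : realType) (E : lmodType R[i]) :=
  GRing.Zmodule.on (realify E).

Section Realify.
Variables (R : realType) (E : lmodType R[i]).
Let scal (a : R) (x : realify E) : realify E := (a%:C *: (x : E)).

Let scalA a b x : scal a (scal b x) = scal (a * b) x.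
Proof. by rewrite /scal scalerA -rmorphM. Qed.
Let scal1 x : scal 1 x = x.
Proof. by rewrite /scal scale1r. Qed.
Let scalDr a : {morph scal a : x y / x + y}.
Proof. by move=> x y; rewrite /scal scalerDr. Qed.
Let scalDl x : {morph scal^~ x : a b / a + b}.
Proof. by move=> a b; rewrite /scal rmorphD scalerDl. Qed.

HB.instance Definition _ :=
  GRing.Zmodule_isLmodule.Build R (realify E) scalA scal1 scalDr scalDl.
End Realify.

Section ComplexHilbert.
Variable R : realType.
Local Notation C := R[i].

(** Only the real part of the inner product is stored, a real inner product for which multiplication
    by ['i] is isometric; [cip] recovers the complex one, linear in its first argument. *)
Record cplx_hilbert (E : lmodType C) (rip : E -> E -> R) : Prop := CplxHilbert {
  ch_add : forall x y z, rip (x + y) z = rip x z + rip y z;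
  ch_scal : forall (a : R) x z, rip (a%:C *: x) z = a * rip x z;
  ch_i : forall x y, rip ('i *: x) ('i *: y) = rip x y;
  ch_sym : forall x y, rip x y = rip y x;
  ch_ge0 : forall x, 0 <= rip x x;
  ch_def : forall x, rip x x = 0 -> x = 0;
  ch_cpl : forall u : nat -> E,
    (forall e, 0 < e -> exists N, forall m n, (N <= m)%N -> (N <= n)%N ->
       rip (u m - u n) (u m - u n) < e) ->
    exists l, forall e, 0 < e -> exists N, forall n, (N <= n)%N ->
       rip (u n - l) (u n - l) < e }.

Variables (E : lmodType C) (rip : E -> E -> R).
Hypothesis H : cplx_hilbert rip.

Lemma realify_hilbert : @real_hilbert R (realify E) rip.
Proof.
split; [|exact: ch_sym|exact: ch_ge0|exact: ch_def|exact: ch_cpl].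
by move=> a x y z; rewrite (ch_add H) (ch_scal H).
Qed.
Let HR := realify_hilbert.

Definition cip (x y : E) : C := rip x y +i* rip x ('i *: y).
Definition cnrm (x : E) : R := nrm (rip : realify E -> realify E -> R) x.

Let ripDr x y z : rip z (x + y) = rip z x + rip z y.
Proof. by rewrite (ch_sym H) (ch_add H) !(ch_sym H z). Qed.

Let ripZr (a : R) x z : rip z (a%:C *: x) = a * rip z x.
Proof. by rewrite (ch_sym H) (ch_scal H) (ch_sym H). Qed.

Let complexD (c : C) (x : E) : c *: x = (Re c)%:C *: x + (Im c)%:C *: ('i *: x).
Proof. by rewrite scalerA -scalerDl {1}[c]complexE [_ * 'i]mulrC. Qed.

Let ii (x : E) : 'i *: ('i *: x) = - x :> E.
Proof. by rewrite scalerA -expr2 sqr_i scaleN1r. Qed.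

Let ripNr x z : rip z (- x) = - rip z x.
Proof. by apply/eqP; rewrite -addr_eq0 -ripDr addNr -[0 : E](scale0r (0 : E)) (ripZr 0) mul0r. Qed.

Let rip_il x y : rip ('i *: x) y = - rip x ('i *: y).
Proof. by rewrite -(ch_i H) ii (ch_sym H) ripNr (ch_sym H). Qed.

Lemma cipDl x y z : cip (x + y) z = cip x z + cip y z.
Proof. by rewrite /cip !(ch_add H). Qed.

Lemma cipDr x y z : cip z (x + y) = cip z x + cip z y.
Proof. by rewrite /cip !scalerDr !ripDr. Qed.

Lemma cipC x y : cip x y = (cip y x)^*.
Proof. by rewrite /cip /= (ch_sym H x y) (ch_sym H x) rip_il. Qed.

Lemma cipZl (c : C) x y : cip (c *: x) y = c * cip x y.
Proof.
rewrite complexD cipDl /cip !(ch_scal H) (ch_i H) (rip_il x y).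
by case: c => a b; apply/eqP; rewrite eq_complex; apply/andP; split; apply/eqP => /=; ring.
Qed.

Lemma cipZr (c : C) x y : cip y (c *: x) = c^* * cip y x.
Proof. by rewrite cipC cipZl rmorphM [cip y x]cipC. Qed.

Lemma cip0l x : cip 0 x = 0.
Proof. by rewrite -[0 : E](scale0r (0 : E)) cipZl mul0r. Qed.

Lemma cipNl x y : cip (- x) y = - cip x y.
Proof. by rewrite -scaleN1r cipZl mulN1r. Qed.

Lemma cipNr x y : cip x (- y) = - cip x y.
Proof. by rewrite -scaleN1r cipZr rmorphN1 mulN1r. Qed.

Lemma cipBl x y z : cip (x - y) z = cip x z - cip y z.
Proof. by rewrite cipDl cipNl. Qed.

Lemma cipBr x y z : cip z (x - y) = cip z x - cip z y.
Proof. by rewrite cipDr cipNr. Qed.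

Lemma Re_cip x y : Re (cip x y) = rip x y. Proof. by []. Qed.

Lemma cnrm_ge0 x : 0 <= cnrm x. Proof. exact: nrm_ge0. Qed.

Lemma cnrmE x : cnrm x = Num.sqrt (rip x x). Proof. by []. Qed.

Lemma sqr_cnrm x : cnrm x ^+ 2 = rip x x. Proof. exact: (sqr_nrm HR). Qed.

Lemma cipxx x : cip x x = (cnrm x ^+ 2)%:C.
Proof.
rewrite sqr_cnrm /cip; congr (_ +i* _).
by have := rip_il x x; rewrite (ch_sym H); lra.
Qed.

Lemma cnrm0 : cnrm 0 = 0. Proof. exact: (nrm0 HR). Qed.
Lemma cnrm_eq0 x : cnrm x = 0 -> x = 0. Proof. exact: (nrm_eq0 HR). Qed.
Lemma cnrmD x y : cnrm (x + y) <= cnrm x + cnrm y. Proof. exact: (nrmD HR). Qed.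
Lemma cnrmB x y : cnrm (x - y) <= cnrm x + cnrm y. Proof. exact: (nrmB HR). Qed.
Lemma cnrmBC x y : cnrm (x - y) = cnrm (y - x). Proof. exact: (nrmBC HR). Qed.
Lemma cnrm_tri z x y : cnrm (x - y) <= cnrm (x - z) + cnrm (z - y).
Proof. exact: (nrm_tri HR). Qed.
Lemma csmall_eq0 x : (forall e, 0 < e -> cnrm x <= e) -> x = 0.
Proof. exact: (small_eq0 HR). Qed.

Lemma sqr_normc (c : C) : normc c ^+ 2 = Re c ^+ 2 + Im c ^+ 2.
Proof. by case: c => a b /=; rewrite sqr_sqrtr// addr_ge0 ?sqr_ge0. Qed.

Lemma normc_ge0 (c : C) : 0 <= normc c.
Proof. by case: c => a b; apply: sqrtr_ge0. Qed.

Lemma normc_conj (c : C) : normc c^* = normc c.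
Proof. by case: c => a b /=; rewrite sqrrN. Qed.

Lemma conjM_normc (c : C) : c^* * c = (normc c ^+ 2)%:C.
Proof.
case: c => a b; rewrite sqr_normc/=; apply/eqP; rewrite eq_complex/=.
by apply/andP; split; apply/eqP; ring.
Qed.

Lemma normc_real (a : R) : normc a%:C = `|a|.
Proof. by rewrite /= expr0n addr0 sqrtr_sqr. Qed.

Lemma cnrmZ (c : C) x : cnrm (c *: x) = normc c * cnrm x.
Proof.
apply/eqP; rewrite -(@eqrXn2 _ 2)// ?mulr_ge0 ?normc_ge0 ?cnrm_ge0//; apply/eqP.
apply: complexI; rewrite -cipxx cipZl cipZr mulrA [c * _]mulrC conjM_normc.
by rewrite cipxx exprMn; apply/esym/(rmorphM (real_complex R)).
Qed.

Lemma cip_CS x y : normc (cip x y) <= cnrm x * cnrm y.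
Proof.
have [->|z0] := eqVneq (cip x y) 0.
  by rewrite Normc.normc0 mulr_ge0// cnrm_ge0.
set z := cip x y in z0 *.
have p0 : 0 < normc z.
  by rewrite lt_neqAle normc_ge0 andbT eq_sym; apply: contra_neq z0 => /Normc.eq0_normc.
rewrite -(ler_pM2l p0) -expr2 mulrA.
have -> : normc z ^+ 2 = rip (z^* *: x) y.
  by rewrite -Re_cip cipZl -/z conjM_normc.
apply: le_trans (ler_norm _) _; apply: le_trans (ip_CS HR _ _) _.
by rewrite -!/(cnrm _) cnrmZ normc_conj.
Qed.

Lemma cnrm_sqrB x y : cnrm (x - y) ^+ 2 = cnrm x ^+ 2 + cnrm y ^+ 2 - 2 * Re (cip x y).
Proof. by rewrite !sqr_cnrm Re_cip !(ipE HR) (ch_sym H y x); ring. Qed.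

Lemma ccomplete (u : nat -> E) :
  (forall e, 0 < e -> exists N, forall m n, (N <= m)%N -> (m <= n)%N ->
     cnrm (u m - u n) < e) ->
  exists l, forall e, 0 < e -> exists N, forall n, (N <= n)%N -> cnrm (u n - l) < e.
Proof. exact: (hcomplete HR). Qed.

Definition comb (I : Type) (e : I -> E) (s : seq (C * I)) : E :=
  \sum_(p <- s) p.1 *: e p.2.

Definition cscale (I : Type) (c : C) (s : seq (C * I)) := [seq (c * p.1, p.2) | p <- s].

Lemma comb_cat I (e : I -> E) s t : comb e (s ++ t) = comb e s + comb e t.
Proof. exact: big_cat. Qed.

Lemma comb_scale I (e : I -> E) c s : comb e (cscale c s) = c *: comb e s.
Proof. by rewrite /comb big_map scaler_sumr; apply: eq_bigr => p _; rewrite scalerA. Qed.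

Definition total (I : Type) (e : I -> E) :=
  forall x f, 0 < f -> exists s, cnrm (x - comb e s) < f.

Definition clin (E' : lmodType C) (A : E -> E') :=
  forall c x y, A (c *: x + y) = c *: A x + A y.

Definition sesq (a : E -> E -> C) :=
  (forall c x y z, a (c *: x + y) z = c * a x z + a y z) /\
  (forall c x y z, a z (c *: x + y) = c^* * a z x + a z y).

Definition fbdd (a : E -> E -> C) (K : R) :=
  forall x y, normc (a x y) <= K * (cnrm x * cnrm y).

Lemma clin0 (E' : lmodType C) (A : E -> E') : clin A -> A 0 = 0.
Proof. by move=> lA; have := lA (-1) 0 0; rewrite scaler0 addr0 scaleN1r addNr. Qed.

Lemma clinZ (E' : lmodType C) (A : E -> E') c x : clin A -> A (c *: x) = c *: A x.
Proof. by move=> lA; have := lA c x 0; rewrite (clin0 lA) !addr0. Qed.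

Lemma clinD (E' : lmodType C) (A : E -> E') x y : clin A -> A (x + y) = A x + A y.
Proof. by move=> lA; have := lA 1 x y; rewrite !scale1r. Qed.

Lemma clinB (E' : lmodType C) (A : E -> E') x y : clin A -> A (x - y) = A x - A y.
Proof. by move=> lA; rewrite (clinD _ _ lA) -[- y]scaleN1r (clinZ _ _ lA) scaleN1r. Qed.

Lemma clin_sum (E' : lmodType C) (A : E -> E') J (r : seq J) (F : J -> E) : clin A ->
  A (\sum_(i <- r) F i) = \sum_(i <- r) A (F i).
Proof.
by move=> lA; apply: (big_morph A); [move=> x y; exact: clinD|exact: clin0].
Qed.

Lemma sesq_suml a J (r : seq J) (F : J -> E) z : sesq a ->
  a (\sum_(i <- r) F i) z = \sum_(i <- r) a (F i) z.
Proof.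
move=> [al _]; apply: (big_morph (a^~ z)).
  by move=> x y; have := al 1 x y z; rewrite !scale1r !mul1r.
by have := al (-1) 0 0 z; rewrite scaler0 addr0 mulN1r addNr.
Qed.

Lemma sesq_sumr a J (r : seq J) (F : J -> E) z : sesq a ->
  a z (\sum_(i <- r) F i) = \sum_(i <- r) a z (F i).
Proof.
move=> [_ ar]; apply: (big_morph (a z)).
  by move=> x y; have := ar 1 x y z; rewrite !scale1r rmorph1 !mul1r.
by have := ar (-1) 0 0 z; rewrite scaler0 addr0 rmorphN1 mulN1r addNr.
Qed.

Lemma sesqZl a c x z : sesq a -> a (c *: x) z = c * a x z.
Proof.
move=> sa; have [al _] := sa; have := al c x 0 z; rewrite addr0 => ->.
by have := @sesq_suml a bool [::] (fun=> x) z sa; rewrite !big_nil => ->; rewrite addr0.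
Qed.

Lemma sesqZr a c x z : sesq a -> a z (c *: x) = c^* * a z x.
Proof.
move=> sa; have [_ ar] := sa; have := ar c x 0 z; rewrite addr0 => ->.
by have := @sesq_sumr a bool [::] (fun=> x) z sa; rewrite !big_nil => ->; rewrite addr0.
Qed.

Lemma sesqBl a x y z : sesq a -> a (x - y) z = a x z - a y z.
Proof.
by move=> sa; have [al _] := sa; rewrite addrC -scaleN1r al mulN1r addrC.
Qed.

Lemma sesqBr a x y z : sesq a -> a z (x - y) = a z x - a z y.
Proof.
by move=> sa; have [_ ar] := sa; rewrite addrC -scaleN1r ar rmorphN1 mulN1r addrC.
Qed.

Lemma sesq_cip : sesq cip.
Proof. by split=> c x y z; [rewrite cipDl cipZl | rewrite cipDr cipZr]. Qed.

Lemma sesq_comb a (I J : Type) (e : I -> E) (f : J -> E) s t : sesq a ->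
  a (comb e s) (comb f t) =
  \sum_(p <- s) \sum_(q <- t) p.1 * q.1^* * a (e p.2) (f q.2).
Proof.
move=> sa; rewrite sesq_suml//; apply: eq_bigr => p _; rewrite sesq_sumr//.
by apply: eq_bigr => q _; rewrite sesqZl// sesqZr// mulrA.
Qed.

Lemma normc_tri (a b c : C) :
  normc (a - c) <= normc (a - b) + normc (b - c).
Proof. by rewrite -[a - c](subrKA b); apply: le_normcD. Qed.

Lemma normc_small_eq (a b : C) (K : R) : 0 <= K ->
  (forall e, 0 < e -> normc (a - b) <= K * e) -> a = b.
Proof.
move=> K0 h; apply/subr0_eq/Normc.eq0_normc/eqP; rewrite eq_le normc_ge0 andbT.
apply/ler_addgt0Pr => e e0; rewrite add0r; have K1 : 0 < K + 1 by lra.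
apply: le_trans (h _ (divr_gt0 e0 K1)) _.
by rewrite mulrA ler_pdivrMr//; nra.
Qed.

Lemma fbdd_close a K x y x' y' : 0 <= K -> sesq a -> fbdd a K ->
  normc (a x y - a x' y') <=
  K * (cnrm (x - x') * cnrm y) + K * (cnrm x' * cnrm (y - y')).
Proof.
move=> K0 sa ba; apply: le_trans (normc_tri _ (a x' y) _) _.
by rewrite -sesqBl// -sesqBr//; apply: lerD; apply: ba.
Qed.

Lemma forms_eq I (e : I -> E) a b K L : total e -> 0 <= K -> 0 <= L ->
  sesq a -> sesq b -> fbdd a K -> fbdd b L ->
  (forall i j, a (e i) (e j) = b (e i) (e j)) -> forall x y, a x y = b x y.
Proof.
move=> te K0 L0 sa sb ba bb ab x y.
apply: (@normc_small_eq _ _ ((K + L) * (cnrm x + cnrm y + 1))).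
  by rewrite mulr_ge0 ?addr_ge0 ?cnrm_ge0.
move=> f f0; pose g := Num.min 1 f.
have g0 : 0 < g by rewrite lt_min ltr01.
have g1 : g <= 1 by rewrite ge_min lexx.
have gf : g <= f by rewrite ge_min lexx orbT.
clearbody g.
have [s xs] := te x _ g0; have [t yt] := te y _ g0.
have eqc : a (comb e s) (comb e t) = b (comb e s) (comb e t).
  by rewrite !sesq_comb//; apply: eq_bigr => p _; apply: eq_bigr => q _; rewrite ab.
apply: le_trans (normc_tri _ (a (comb e s) (comb e t)) _) _.
have h1 := fbdd_close x y (comb e s) (comb e t) K0 sa ba.
have := fbdd_close x y (comb e s) (comb e t) L0 sb bb.
rewrite {1}eqc -normcN opprB => h2.
have ns : cnrm (comb e s) <= cnrm x + g.
  rewrite -[comb e s](subKr x); apply: le_trans (cnrmB _ _) _.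
  by rewrite lerD2l ltW.
have k1 : cnrm (x - comb e s) * cnrm y + cnrm (comb e s) * cnrm (y - comb e t)
    <= (cnrm x + cnrm y + 1) * f.
  have p1 := cnrm_ge0 (x - comb e s); have p2 := cnrm_ge0 (y - comb e t).
  have p3 := cnrm_ge0 x; have p4 := cnrm_ge0 y; have p5 := cnrm_ge0 (comb e s).
  have q1 : cnrm (x - comb e s) * cnrm y <= f * cnrm y.
    by apply: ler_wpM2r => //; lra.
  have q2 : cnrm (comb e s) * cnrm (y - comb e t) <= (cnrm x + 1) * f.
    by apply: ler_pM => //; lra.
  by nra.
by move: k1; move: h1 h2; rewrite -eqc; nra.
Qed.

End ComplexHilbert.

Local Notation cnrm_of := cnrm.

(** * Unitary representations of the integers and cyclic vectors *)

Section UnitaryRep.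
Variables (R : realType) (E : lmodType R[i]) (rip : E -> E -> R).
Hypothesis H : cplx_hilbert rip.
Local Notation C := R[i].
Local Notation cip := (cip rip).
Local Notation cnrm := (cnrm rip).

Record unitary_rep (U : int -> E -> E) : Prop := UnitaryRep {
  ur_lin : forall k, clin (U k);
  ur_ip : forall k x y, cip (U k x) (U k y) = cip x y;
  ur_add : forall j k x, U j (U k x) = U (j + k) x;
  ur_id : forall x, U 0 x = x }.

Variable U : int -> E -> E.
Hypothesis HU : unitary_rep U.

Definition lc (s : seq (C * int)) (x : E) : E := comb (U^~ x) s.
Definition lcadj (s : seq (C * int)) := [seq (p.1^*, - p.2) | p <- s].
Definition lcsize (s : seq (C * int)) : R := \sum_(p <- s) normc p.1.

Lemma lcsize_ge0 s : 0 <= lcsize s.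
Proof. by apply: sumr_ge0 => p _; apply: normc_ge0. Qed.

Lemma lc_lin s : clin (lc s).
Proof.
move=> c x y; rewrite /lc /comb scaler_sumr -big_split/=; apply: eq_bigr => p _.
by rewrite (ur_lin HU) scalerDr !scalerA mulrC.
Qed.

Lemma cnrm_U k x : cnrm (U k x) = cnrm x.
Proof.
by rewrite !cnrmE -!Re_cip (ur_ip HU).
Qed.

Lemma lc_le s x : cnrm (lc s x) <= lcsize s * cnrm x.
Proof.
rewrite /lc /comb /lcsize; elim: s => [|p s IH]; first by rewrite !big_nil cnrm0 ?mul0r.
rewrite !big_cons mulrDl; apply: le_trans (cnrmD H _ _) _.
by apply: lerD => //; rewrite (cnrmZ H) cnrm_U.
Qed.

Lemma lc_comm (A : E -> E) s x : clin A -> (forall k y, A (U k y) = U k (A y)) ->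
  A (lc s x) = lc s (A x).
Proof.
move=> lA cA; rewrite /lc /comb (clin_sum _ _ lA); apply: eq_bigr => p _.
by rewrite (clinZ _ _ lA) cA.
Qed.

Lemma lc_U s k x : lc s (U k x) = U k (lc s x).
Proof.
by rewrite [RHS]lc_comm//; [exact: (ur_lin HU)|move=> j y; rewrite !(ur_add HU) addrC].
Qed.

Lemma lcC s t x : lc s (lc t x) = lc t (lc s x).
Proof. by rewrite lc_comm//; [exact: lc_lin|move=> k y; exact: lc_U]. Qed.

Lemma lc_cons p s x : lc (p :: s) x = p.1 *: U p.2 x + lc s x.
Proof. exact: big_cons. Qed.

Lemma lc_lc s t x : exists r, lc s (lc t x) = lc r x.
Proof.
elim: s => [|p s [r IH]]; first by exists [::]; rewrite /lc /comb !big_nil.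
exists ([seq (p.1 * q.1, p.2 + q.2) | q <- t] ++ r).
rewrite lc_cons IH /lc comb_cat; congr (_ + _).
rewrite /comb big_map (clin_sum _ _ (ur_lin HU _)) scaler_sumr; apply: eq_bigr => q _.
by rewrite (clinZ _ _ (ur_lin HU _)) (ur_add HU) scalerA.
Qed.

Lemma lc_adj a s x y : sesq a -> (forall k x y, a (U k x) (U k y) = a x y) ->
  a x (lc s y) = a (lc (lcadj s) x) y.
Proof.
move=> sa ia; rewrite /lc /comb sesq_sumr// sesq_suml// big_map.
apply: eq_bigr => p _; rewrite sesqZr// sesqZl// -[in RHS](ia p.2).
by rewrite (ur_add HU) subrr (ur_id HU).
Qed.

Definition cyclic_space (x y : E) := forall f, 0 < f -> exists s, cnrm (y - lc s x) < f.

(* For a Laurent polynomial [r] with [r u] close to [G u], the adjoint polynomial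
   satisfies [|r^* (G u) - u| = |G u - r u|], because [G] commutes with [r]. *)
Theorem commutant_invariance u a K G : total rip (U^~ u) -> 0 <= K -> sesq a ->
  fbdd rip a K -> (forall k x y, a (U k x) (U k y) = a x y) ->
  clin G -> (forall x y, cip (G x) (G y) = cip x y) ->
  (forall k x, G (U k x) = U k (G x)) -> forall x y, a (G x) (G y) = a x y.
Proof.
move=> tu K0 sa ba ia lG iG cG.
have nG x : cnrm (G x) = cnrm x by rewrite !cnrmE -!Re_cip iG.
apply: (forms_eq H tu K0 K0) => //.
- by split=> c x y z; rewrite lG; case: sa => h1 h2; [rewrite h1 | rewrite h2].
- by move=> x y; rewrite -(nG x) -(nG y).
move=> j k; rewrite !cG.
have red x y : a (U j x) (U k y) = a (U (j - k) x) y.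
  by rewrite -(ia k (U (j - k) x)) (ur_add HU) addrC subrK.
rewrite !red; apply: (@normc_small_eq _ _ _ (2 * K * cnrm u)).
  by rewrite !mulr_ge0 ?cnrm_ge0.
move=> e e0; have [s us] := tu (G u) _ e0; rewrite -/(lc s u) in us.
have adj x y : cip x (lc s y) = cip (lc (lcadj s) x) y.
  by apply: lc_adj; [exact: sesq_cip|exact: (ur_ip HU)].
have us' : cnrm (lc (lcadj s) (G u) - u) < e.
  rewrite -(@ltr_pXn2r _ 2) ?nnegrE ?cnrm_ge0 ?ltW// in us.
  rewrite -(@ltr_pXn2r _ 2) ?nnegrE ?cnrm_ge0 ?ltW//.
  suff -> : cnrm (lc (lcadj s) (G u) - u) ^+ 2 = cnrm (G u - lc s u) ^+ 2 by [].
  rewrite !(cnrm_sqrB H) nG -adj addrC [in RHS]addrC; congr (_ + _).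
  rewrite addrC; congr (_ + _); rewrite -lc_comm// nG.
  apply: complexI; rewrite -(cipxx H) -adj lcC (cipC H) -adj.
  by rewrite (cipxx H) conjc_real.
(* In the second argument [G u] is replaced by [r u]; the polynomial then moves to the first
   argument as its adjoint, where it turns [G u] back into [u]. Each replacement costs at most
   [K * cnrm u * e]. *)
apply: le_trans (normc_tri _ (a (U (j - k) (G u)) (lc s u)) _) _.
rewrite -(sesqBr _ _ _ sa) (lc_adj _ _ _ sa ia) lc_U -(sesqBl _ _ _ sa).
rewrite -(clinB _ _ (ur_lin HU _)).
have h1 := ba (U (j - k) (G u)) (G u - lc s u).
have h2 := ba (U (j - k) (lc (lcadj s) (G u) - u)) u.
rewrite !cnrm_U nG in h1 h2.
have n0 := cnrm_ge0 rip u.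
have k1 : cnrm u * cnrm (G u - lc s u) <= cnrm u * e by rewrite ler_wpM2l// ltW.
have k2 : cnrm (lc (lcadj s) (G u) - u) * cnrm u <= cnrm u * e.
  by rewrite mulrC ler_wpM2l// ltW.
apply: le_trans (lerD h1 h2) _; rewrite -mulrDr -!mulrA mulrCA ler_wpM2l//; lra.
Qed.

Lemma cyclic_trans x y z : cyclic_space x y -> cyclic_space y z -> cyclic_space x z.
Proof.
move=> xy yz f f0; have f2 : 0 < f / 2 by lra.
have [s zs] := yz _ f2; have s1 : 0 < lcsize s + 1 by have := lcsize_ge0 s; lra.
have [t yt] := xy _ (divr_gt0 f2 s1); have [r rE] := lc_lc s t x.
exists r; rewrite -rE; apply: le_lt_trans (cnrm_tri H (lc s y) _ _) _.
rewrite -(clinB _ _ (lc_lin s)); have := lc_le s (y - lc t x).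
rewrite ltr_pdivlMr// in yt; have := cnrm_ge0 rip (y - lc t x); have := lcsize_ge0 s; nra.
Qed.

Lemma cyclic_scaleU x (c : C) k : c != 0 -> cyclic_space (c *: U k x) x.
Proof.
move=> c0 f f0; exists [:: (c^-1, - k)]; rewrite /lc /comb big_seq1/=.
by rewrite (clinZ _ _ (ur_lin HU _)) (ur_add HU) addNr (ur_id HU) scalerA mulVf// scale1r subrr cnrm0.
Qed.

Lemma exp_small (r K f : R) : 0 <= r -> r < 1 -> 0 < f -> exists n, r ^+ n * K < f.
Proof.
move=> r0 r1 f0; have K1 : 0 < `|K| + 1 by have := normr_ge0 K; lra.
have nr : `|r| < 1 by rewrite ger0_norm.
have /cvgrPdist_lt/(_ _ (divr_gt0 f0 K1))[n _ /(_ n (leqnn _))] := cvg_expr nr.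
rewrite sub0r normrN ger0_norm ?exprn_ge0// ltr_pdivlMr// => h.
exists n; apply: le_lt_trans h; rewrite ler_wpM2l ?exprn_ge0//.
by have := ler_norm K; lra.
Qed.

(** [b] is the sum of the convergent geometric series of the [c^m U^(k m) (b - c U^k b)]. *)
Lemma cyclic_geom b (c : C) k : normc c < 1 -> cyclic_space (b - c *: U k b) b.
Proof.
move=> c1 f f0; have [n nf] := exp_small (cnrm b) (normc_ge0 c) c1 f0.
exists [seq (c ^+ m, k * m%:Z) | m <- iota 0 n]; set y := b - c *: U k b.
suff -> : lc [seq (c ^+ m, k * m%:Z) | m <- iota 0 n] y = b - c ^+ n *: U (k * n%:Z) b.
  rewrite subKr (cnrmZ H) cnrm_U.
  suff -> : normc (c ^+ n) = normc c ^+ n by [].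
  elim: (n) => [|m IH]; first by rewrite !expr0 Normc.normc1.
  by rewrite !exprS Normc.normcM IH.
rewrite /lc /comb big_map; elim: (n) => [|m IH].
  by rewrite big_nil mulr0 (ur_id HU) expr0 scale1r subrr.
rewrite -addn1 iotaD big_cat/= big_seq1 IH add0n /y.
rewrite (clinB _ _ (ur_lin HU _)) (clinZ _ _ (ur_lin HU _)) (ur_add HU).
rewrite scalerBr scalerA -exprSr addrA subrK addn1.
by rewrite (_ : k * m%:Z + k = k * m.+1%:Z)// -addn1 PoszD mulrDr mulr1.
Qed.

(** Off the unit circle [U - a] is inverted by a geometric series, in powers of [a U^-1] or of
    [a^-1 U] according to whether [a] has modulus below or above 1. *)
Lemma cyclic_root b (a : C) : normc a != 1 -> cyclic_space (U 1 b - a *: b) b.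
Proof.
move=> a1; have [al|ag|aE] := ltgtP (normc a) 1; last by rewrite aE eqxx in a1.
  apply: (@cyclic_trans _ (b - a *: U (-1) b)); last exact: cyclic_geom.
  have := @cyclic_scaleU (b - a *: U (-1) b) 1 1 (oner_neq0 _); congr cyclic_space.
  by rewrite scale1r (clinB _ _ (ur_lin HU _)) (clinZ _ _ (ur_lin HU _)) (ur_add HU) subrr (ur_id HU).
have a0 : a != 0 by apply: contraTneq ag => ->; rewrite Normc.normc0 -leNgt ler01.
apply: (@cyclic_trans _ (b - a^-1 *: U 1 b)); last first.
  by apply: cyclic_geom; rewrite Normc.normcV invf_lt1// (lt_trans _ ag).
have := @cyclic_scaleU (b - a^-1 *: U 1 b) (- a) 0; rewrite oppr_eq0 => /(_ a0).
by rewrite (ur_id HU) scaleNr scalerBr scalerA divff// scale1r opprB.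
Qed.

Definition pv (p : {poly C}) (b : E) : E := \sum_(i < size p) p`_i *: U i%:Z b.

Lemma pv_widen (p : {poly C}) b n : (size p <= n)%N -> pv p b = \sum_(i < n) p`_i *: U i%:Z b.
Proof.
move=> pn; rewrite /pv (big_ord_widen_cond n xpredT (fun i => p`_i *: U i%:Z b))//.
rewrite big_mkcond; apply: eq_bigr => i _; case: ltnP => //= h.
by rewrite nth_default// scale0r.
Qed.

Lemma pv_sub (p q : {poly C}) b : pv (p - q) b = pv p b - pv q b.
Proof.
set n := maxn (size p) (size q).
rewrite (@pv_widen _ _ n) ?(leq_trans (size_polyD _ _))// ?size_polyN//.
rewrite (@pv_widen p _ n) ?leq_maxl// (@pv_widen q _ n) ?leq_maxr//.
by rewrite -sumrB; apply: eq_bigr => i _; rewrite coefB scalerBl.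
Qed.

Lemma pv_scale c (p : {poly C}) b : pv (c *: p) b = c *: pv p b.
Proof.
rewrite (@pv_widen _ _ (size p)) ?size_scale_leq// scaler_sumr.
by apply: eq_bigr => i _; rewrite coefZ scalerA.
Qed.

Lemma pv_mulX (p : {poly C}) b : pv (p * 'X) b = U 1 (pv p b).
Proof.
rewrite (@pv_widen _ _ (size p).+1); last first.
  by apply: leq_trans (size_polyMleq _ _) _; rewrite size_polyX addn2.
rewrite big_ord_recl coefMX/= scale0r add0r (clin_sum _ _ (ur_lin HU _)).
apply: eq_bigr => i _; rewrite (clinZ _ _ (ur_lin HU _)) (ur_add HU) coefMX/=.
by congr (_ *: U _ _); rewrite /bump/=; lia.
Qed.

Lemma pv_root (p : {poly C}) a b : pv (p * ('X - a%:P)) b = U 1 (pv p b) - a *: pv p b.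
Proof. by rewrite mulrBr pv_sub pv_mulX mulrC mul_polyC pv_scale. Qed.

(** After factoring [p], the roots on the unit circle are moved slightly off it, and [cyclic_root]
    undoes the factors one by one. The zero polynomial is replaced by a small nonzero constant. *)
Lemma pv_perturb (p : {poly C}) b f : 0 < f -> exists2 y, cnrm (y - pv p b) < f & cyclic_space y b.
Proof.
move=> f0; have [->|p0] := eqVneq p 0.
  have b1 : 0 < cnrm b + 1 by have := cnrm_ge0 rip b; lra.
  exists ((f / (cnrm b + 1))%:C *: b).
    rewrite /pv size_poly0 big_ord0 subr0 (cnrmZ H) normc_real gtr0_norm ?divr_gt0//.
    by rewrite -mulrAC ltr_pdivrMr//; have := cnrm_ge0 rip b; nra.
  have := @cyclic_scaleU b (f / (cnrm b + 1))%:C 0; rewrite (ur_id HU); apply.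
  rewrite -[0 : C]/(0%:C); apply/eqP => /complexI/eqP.
  by rewrite mulf_eq0 invr_eq0 !gt_eqF.
have [r pE] := closed_field_poly_normal p.
have [y yp yb] : exists2 y, normc (lead_coef p) *
    cnrm (y - pv (\prod_(z <- r) ('X - z%:P)) b) < f & cyclic_space y b.
  set c := normc _; have c0 : 0 <= c by apply: normc_ge0.
  elim: r {pE} f f0 => [|z r IH] f f0.
    rewrite big_nil; exists b; last by move=> g g0; exists [:: (1, 0)];
      rewrite /lc /comb big_seq1 /= scale1r (ur_id HU) subrr cnrm0.
    by rewrite /pv size_poly1 big_ord1 coef1 scale1r (ur_id HU) subrr (cnrm0 H) mulr0.
  have z1 : 0 < 2 * (1 + normc z) by have := normc_ge0 z; lra.
  have [y yp yb] := IH _ (divr_gt0 f0 z1).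
  have cy1 : 0 < 2 * (c * cnrm y + 1).
    by have := mulr_ge0 c0 (cnrm_ge0 rip y); lra.
  (* Moving a root of modulus 1 by [h] costs at most [f / 2] after multiplication by the leading
     coefficient; the other half is left for the previous factors. *)
  pose h := f / (2 * (c * cnrm y + 1)).
  have h0 : 0 < h by rewrite divr_gt0.
  have [z' z'1 zz'] : exists2 z', normc z' != 1 & normc (z - z') <= h.
    have [zn|zn] := eqVneq (normc z) 1; last first.
      by exists z => //; rewrite subrr Normc.normc0 ltW.
    exists ((1 + h)%:C * z); first by rewrite Normc.normcM normc_real zn mulr1 gtr0_norm; lra.
    have -> : z - (1 + h)%:C * z = (- h)%:C * z.
      by rewrite -{1}[z]mul1r -mulrBl; congr (_ * _); apply/eqP; rewrite eq_complex/= subr0 eqxx andbT opprD addrA subrr add0r.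
    by rewrite Normc.normcM normc_real zn mulr1 normrN gtr0_norm.
  exists (U 1 y - z' *: y); last by apply: cyclic_trans yb; apply: cyclic_root.
  rewrite big_cons [X in pv X _]mulrC pv_root; set x := pv _ b in yp *.
  have -> : U 1 y - z' *: y - (U 1 x - z *: x) = U 1 (y - x) - z *: (y - x) + (z - z') *: y.
    rewrite (clinB _ _ (ur_lin HU _)) scalerBr scalerBl !opprB.
    by rewrite [RHS](AC (2*2*2) ((1*6)*(3*2)*(4*5)))/= addNr addr0.
  apply: le_lt_trans (ler_wpM2l c0 (cnrmD H _ _)) _; rewrite mulrDr.
  have d1 : c * cnrm (U 1 (y - x) - z *: (y - x)) < f / 2.
    apply: le_lt_trans (ler_wpM2l c0 (cnrmB H _ _)) _; rewrite (cnrmZ H) cnrm_U.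
    by rewrite ltr_pdivlMr// in yp; have := normc_ge0 z; nra.
  have d2 : c * cnrm ((z - z') *: y) <= f / 2.
    rewrite (cnrmZ H); have : normc (z - z') * (c * cnrm y) <= h * (c * cnrm y + 1).
      by apply: ler_pM; rewrite ?normc_ge0 ?mulr_ge0 ?cnrm_ge0//; lra.
    have -> : h * (c * cnrm y + 1) = f / 2.
      by rewrite /h; field; have := mulr_ge0 c0 (cnrm_ge0 rip y); lra.
    by rewrite mulrCA.
  lra.
exists (lead_coef p *: y).
  by rewrite {2}pE pv_scale -scalerBr (cnrmZ H).
apply: cyclic_trans yb; have := @cyclic_scaleU y (lead_coef p) 0.
by rewrite (ur_id HU); apply; rewrite lead_coef_eq0.
Qed.

(** A nested ball construction: every vector in the ball of stage [m] generates [g 0, ..., g m] up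
    to [1 / (m + 1)], so the common point of the balls generates the whole sequence. *)
Theorem cyclic_vector (g : nat -> E) :
  (forall (l : seq E) f, 0 < f -> exists b, forall x, x \in l ->
     exists p, cnrm (x - pv p b) < f) ->
  exists u, forall j, cyclic_space u (g j).
Proof.
move=> ap.
pose good m (u : E) r := forall v, cnrm (v - u) <= r -> forall j, (j <= m)%N ->
  exists s, cnrm (g j - lc s v) < m.+1%:R^-1.
have step m (w : E * R) : exists w' : E * R, 0 < w.2 ->
    [/\ 0 < w'.2, w'.2 <= m.+1%:R^-1, cnrm (w'.1 - w.1) + w'.2 <= w.2 & good m w'.1 w'.2].
  case: w => u r /=; have [r0|] := ltP 0 r; last by exists (0, 0).
  have m0 : 0 < m.+1%:R^-1 :> R by rewrite invr_gt0.
  set em : R := m.+1%:R^-1 in m0 *.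
  pose f := Num.min (r / 4) (em / 4).
  have f0 : 0 < f by rewrite lt_min !divr_gt0.
  have fr : f <= r / 4 by rewrite ge_min lexx.
  have fe : f <= em / 4 by rewrite ge_min lexx orbT.
  clearbody f.
  (* The centre [u] joins the targets, so that some [p(U) b] is close to it; the perturbation [y] of
     [p(U) b] becomes the new centre and still generates [b], hence approximates all targets. *)
  have [b bP] := ap (u :: [seq g j | j <- iota 0 m.+1]) _ f0.
  have [p up] := bP u (mem_head _ _).
  have [y yp yb] := pv_perturb p b f0.
  have /choice[t tP] j : exists t, (j <= m)%N -> cnrm (g j - lc t y) < em / 2.
    have [jm|] := leqP j m; last by exists [::].
    have [|q gq] := bP (g j).
      by rewrite inE map_f ?orbT// mem_iota.
    have [] := @cyclic_trans y b (pv q b) yb _ (em / 4); [|by lra|].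
      move=> h h0; exists [seq (q`_i, i%:Z) | i <- iota 0 (size q)].
      rewrite /lc /comb big_map /pv -(big_mkord xpredT (fun i => q`_i *: U i%:Z b)).
      by rewrite /index_iota subn0 subrr cnrm0.
    move=> t qt; exists t => _; apply: le_lt_trans (cnrm_tri H (pv q b) _ _) _; lra.
  pose L := \sum_(j < m.+1) lcsize (t j).
  have L0 : 0 <= L by apply: sumr_ge0 => j _; apply: lcsize_ge0.
  have tL j : (j <= m)%N -> lcsize (t j) <= L.
    move=> jm; rewrite /L (bigD1 (Ordinal (jm : (j < m.+1)%N)))//= lerDl.
    by apply: sumr_ge0 => i _; apply: lcsize_ge0.
  clearbody L.
  pose r' := Num.min f (em / (2 * (L + 1))).
  have r'0 : 0 < r' by rewrite lt_min f0 divr_gt0//; lra.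
  have r'f : r' <= f by rewrite ge_min lexx.
  have r'L : r' * (L + 1) <= em / 2.
    have : r' <= em / (2 * (L + 1)) by rewrite ge_min lexx orbT.
    rewrite ler_pdivlMr; lra.
  clearbody r'.
  exists (y, r') => _ /=; split=> //; first by lra.
    have := cnrm_tri H (pv p b) y u; rewrite (cnrmBC H (pv p b)); lra.
  move=> v vy j jm; exists (t j); apply: le_lt_trans (cnrm_tri H (lc (t j) y) _ _) _.
  rewrite -(clinB _ _ (lc_lin _)); have := lc_le (t j) (y - v); have := tP j jm.
  have := tL j jm; have := lcsize_ge0 (t j); have := cnrm_ge0 rip (y - v).
  rewrite (cnrmBC H v) in vy; move=> h1 h2 h3 h4 h5.
  have : lcsize (t j) * cnrm (y - v) <= L * r' by apply: ler_pM.
  by rewrite -/em; nra.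
have /choice[F FP] (mw : nat * (E * R)) := step mw.1 mw.2.
pose w := fix w m : E * R := if m is k.+1 then F (k, w k) else (0, 1).
have w0 m : 0 < (w m).2 by elim: m => //= m IH; have [] := FP (m, w m) IH.
have wP m := FP (m, w m) (w0 m); rewrite /= in wP.
have nest m n : (m <= n)%N -> cnrm ((w n).1 - (w m).1) + (w n).2 <= (w m).2.
  move=> mn; rewrite -(subnKC mn); elim: (n - m)%N => [|k IH].
    by rewrite addn0 subrr (cnrm0 H) add0r.
  rewrite addnS; have [_ _ + _] := wP (m + k)%N => /= h.
  have := cnrm_tri H (w (m + k)%N).1 (F ((m + k)%N, w (m + k)%N)).1 (w m).1; lra.
have rsmall f : 0 < f -> exists N, forall m, (N <= m)%N -> (w m).2 < f.
  move=> f0; exists (Num.truncn f^-1).+1 => -[//|m] Nm.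
  have [_ h _ _] := wP m; apply: le_lt_trans h _; rewrite -[f]invrK.
  rewrite ltf_pV2 ?posrE ?invr_gt0//; apply: lt_le_trans (truncnS_gt _) _.
  by rewrite ler_nat.
have [e e0|u uP] := @ccomplete _ _ _ H (fun m => (w m).1).
  have [N NP] := rsmall _ e0; exists N => m n Nm mn.
  rewrite (cnrmBC H); have := nest _ _ mn; have := NP _ Nm; have := w0 n; lra.
have uw m : cnrm (u - (w m).1) <= (w m).2.
  apply/ler_addgt0Pr => f f0; have [N NP] := uP _ f0.
  have := NP _ (leq_maxl N m); have := nest _ _ (leq_maxr N m); rewrite (cnrmBC H _ u).
  have := cnrm_tri H (w (maxn N m)).1 u (w m).1; have := w0 (maxn N m); lra.
exists u => j f f0; pose m := maxn j (Num.truncn f^-1).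
have [_ _ _ gm] := wP m; have [|s us] := gm u (uw m.+1) j; first exact: leq_maxl.
exists s; apply: lt_trans us _; rewrite -[f]invrK ltf_pV2 ?posrE ?invr_gt0//.
by apply: lt_le_trans (truncnS_gt _) _; rewrite ler_nat ltnS leq_maxr.
Qed.

End UnitaryRep.

(** * Fock spaces *)

Section Extension.
Variables (R : realType) (E E' : lmodType R[i]) (rip : E -> E -> R) (rip' : E' -> E' -> R).
Hypotheses (H : cplx_hilbert rip) (H' : cplx_hilbert rip').
Local Notation C := R[i].

(** The relation [G] is the closure of the graph of [comb e s |-> comb e' s]; the bound makes it
    single-valued and completeness of the target makes it total. *)
Lemma extend_bounded (I : Type) (e : I -> E) (e' : I -> E') (K : R) :
  total rip e -> 0 <= K ->
  (forall s, cnrm rip' (comb e' s) <= K * cnrm rip (comb e s)) ->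
  exists A : E -> E', [/\ clin A, forall i, A (e i) = e' i &
    forall x, cnrm rip' (A x) <= K * cnrm rip x].
Proof.
move=> te K0 be.
pose G x y := forall f, 0 < f -> exists s,
  cnrm rip (x - comb e s) < f /\ cnrm rip' (y - comb e' s) < f.
have Gbd x y : G x y -> cnrm rip' y <= K * cnrm rip x.
  move=> xy; apply/ler_addgt0Pr => f f0; have K1 : 0 < K + 1 by lra.
  have [s [xs ys]] := xy _ (divr_gt0 f0 K1).
  have := cnrmD H' (y - comb e' s) (comb e' s); rewrite subrK => h.
  have := cnrmB H x (x - comb e s); rewrite subKr => h2.
  have := be s; rewrite !ltr_pdivlMr// in xs ys.
  by have := cnrm_ge0 rip (x - comb e s); nra.
have Glin c x y x' y' : G x y -> G x' y' -> G (c *: x + x') (c *: y + y').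
  move=> xy xy' f f0; have c1 : 0 < 2 * (normc c + 1) by have := normc_ge0 c; lra.
  have f2 : 0 < f / 2 by lra.
  have [s [xs ys]] := xy _ (divr_gt0 f0 c1); have [t [xt yt]] := xy' _ f2.
  exists (cscale c s ++ t); rewrite !comb_cat !comb_scale !opprD.
  rewrite !ltr_pdivlMr// in xs ys; split.
    rewrite addrACA -scalerBr; apply: le_lt_trans (cnrmD H _ _) _; rewrite (cnrmZ H).
    by have := normc_ge0 c; have := cnrm_ge0 rip (x - comb e s); nra.
  rewrite addrACA -scalerBr; apply: le_lt_trans (cnrmD H' _ _) _; rewrite (cnrmZ H').
  by have := normc_ge0 c; have := cnrm_ge0 rip' (y - comb e' s); nra.
have Gun x y y' : G x y -> G x y' -> y = y'.
  move=> xy xy'; have := Glin (-1) _ _ _ _ xy' xy; rewrite !scaleN1r addNr => /Gbd.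
  rewrite (cnrm0 H) mulr0 => h; apply/subr0_eq/(cnrm_eq0 H')/eqP.
  by rewrite eq_le cnrm_ge0 andbT addrC.
have /choice[A AP] x : exists y, G x y.
  have /choice[s sP] (n : nat) : exists s, cnrm rip (x - comb e s) < n.+1%:R^-1.
    by apply: te; rewrite invr_gt0.
  have inv f : 0 < f -> exists N, forall n, (N <= n)%N -> n.+1%:R^-1 < f :> R.
    move=> f0; exists (Num.truncn f^-1) => n Nn; rewrite -[f]invrK ltf_pV2 ?posrE ?invr_gt0//.
    by apply: lt_le_trans (truncnS_gt _) _; rewrite ler_nat.
  have [f f0|y yP] := @ccomplete _ _ _ H' (fun n => comb e' (s n)).
    have K2 : 0 < 2 * (K + 1) by lra.
    have [N NP] := inv _ (divr_gt0 f0 K2); exists N => m n Nm mn.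
    have := be (s m ++ cscale (-1) (s n)); rewrite !comb_cat !comb_scale !scaleN1r => h.
    apply: le_lt_trans h _; have := cnrm_tri H x (comb e (s m)) (comb e (s n)).
    have := sP m; have := sP n; have := NP m Nm; have := NP n (leq_trans Nm mn).
    rewrite (cnrmBC H (comb e (s m)) x) !ltr_pdivlMr//.
    move: (m.+1%:R^-1) (n.+1%:R^-1) (cnrm_ge0 rip (x - comb e (s m))) (cnrm_ge0 rip (x - comb e (s n))) (cnrm_ge0 rip (comb e (s m) - comb e (s n))).
    by move: (cnrm rip _) (cnrm rip _) (cnrm rip _) => a b c p q *; nra.
  exists y => f f0; have [N NP] := inv _ f0; have [M MP] := yP _ f0.
  exists (s (maxn N M)); split; last by rewrite (cnrmBC H') MP// leq_maxr.
  by apply: lt_trans (sP _) _; apply: NP; rewrite leq_maxl.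
exists A; split=> [c x y|i|x]; last exact: Gbd.
  by apply: (Gun _ _ _ (AP _)); apply: Glin.
apply: (Gun _ _ _ (AP _)) => f f0; exists [:: (1, i)].
by rewrite /comb !big_seq1 !scale1r !subrr cnrm0 ?cnrm0.
Qed.

End Extension.

Section ScalarHilbert.
Variable R : realType.
Local Notation C := R[i].

Definition sip (z w : C^o) : R := Re z * Re w + Im z * Im w.

Lemma cauchy_real (u : nat -> R) :
  (forall e, 0 < e -> exists N, forall m n, (N <= m)%N -> (N <= n)%N -> `|u m - u n| < e) ->
  exists l, forall e, 0 < e -> exists N, forall n, (N <= n)%N -> `|u n - l| < e.
Proof.
move=> cu; have /cvg_ex[l ul] : cvgn u.
  apply: cauchy_cvg; apply/cauchyP => e e0; have [N uN] := cu _ e0.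
  exists (u N); exists N => // n /= Nn.
  by rewrite -ball_normE /ball_/=; apply: uN.
exists l => e e0; move/cvgrPdist_lt/(_ _ e0): ul => [N _ uN].
by exists N => n Nn; rewrite distrC; apply: uN.
Qed.

Lemma norm_lt_sqr (a e : R) : 0 < e -> (`|a| < e) = (a ^+ 2 < e ^+ 2).
Proof.
move=> e0; rewrite -[a ^+ 2]real_normK ?num_real//.
by rewrite ltr_pXn2r// nnegrE ?normr_ge0 ?ltW.
Qed.

(** The scalars as a one-dimensional Hilbert space, so that functionals are extended by the same
    lemma as operators. *)
Lemma scalar_hilbert : cplx_hilbert sip.
Proof.
split; rewrite /sip.
- by move=> [a b] [c d] [f g] /=; ring.
- by move=> r [c d] [f g] /=; ring.
- by move=> [c d] [f g] /=; ring.
- by move=> [c d] [f g] /=; ring.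
- by move=> [a b] /=; have := sqr_ge0 a; have := sqr_ge0 b; rewrite !expr2; lra.
- move=> [a b] /= h; have := sqr_ge0 a; have := sqr_ge0 b => p q.
  have a0 : a ^+ 2 = 0 by move: p q; rewrite !expr2; lra.
  have b0 : b ^+ 2 = 0 by move: p q; rewrite !expr2; lra.
  by apply/eqP; rewrite eq_complex/= -(sqrf_eq0 a) a0 -(sqrf_eq0 b) b0 eqxx.
- move=> u cu.
  have cu' (e : R) : 0 < e -> exists N, forall m n, (N <= m)%N -> (N <= n)%N ->
      `|Re (u m) - Re (u n)| < e /\ `|Im (u m) - Im (u n)| < e.
    move=> e0; have [N uN] := cu _ (exprn_gt0 2 e0); exists N => m n Nm Nn.
    have := uN _ _ Nm Nn; case: (u m) (u n) => [a b] [c d] /= h.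
    rewrite !norm_lt_sqr//; move: h; rewrite -!expr2 => h.
    by split; apply: le_lt_trans h; rewrite ?lerDl ?lerDr sqr_ge0.
  have [|l1 h1] := @cauchy_real (fun n => Re (u n)).
    by move=> e /cu'[N uN]; exists N => m n Nm Nn; have [] := uN m n Nm Nn.
  have [|l2 h2] := @cauchy_real (fun n => Im (u n)).
    by move=> e /cu'[N uN]; exists N => m n Nm Nn; have [] := uN m n Nm Nn.
  exists (l1 +i* l2) => e e0; pose f := Num.sqrt (e / 2).
  have f0 : 0 < f by rewrite sqrtr_gt0; lra.
  have f2 : f ^+ 2 = e / 2 by rewrite sqr_sqrtr//; lra.
  have [N NP] := h1 _ f0; have [M MP] := h2 _ f0.
  exists (maxn N M) => n; rewrite geq_max => /andP[/NP + /MP]; case: (u n) => a b /= p q.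
  rewrite norm_lt_sqr// in p; rewrite norm_lt_sqr// in q.
  by rewrite -!expr2; lra.
Qed.

Lemma cnrm_sip (z : C^o) : cnrm sip z = normc z.
Proof. by case: z => a b; rewrite cnrmE /sip/= -!expr2. Qed.

End ScalarHilbert.

(** * Bounded sesquilinear forms prescribed on a total family *)

Section ExtendForm.
Variables (R : realType) (E : lmodType R[i]) (rip : E -> E -> R).
Hypotheses (H : cplx_hilbert rip).
Local Notation C := R[i].
Local Notation cnrm := (cnrm rip).

Lemma maps_eq (E' : lmodType C) (rip' : E' -> E' -> R) (I : Type) (e : I -> E)
    (A B : E -> E') (K L : R) : cplx_hilbert rip' -> total rip e -> clin A -> clin B ->
  (forall x, cnrm_of rip' (A x) <= K * cnrm x) ->
  (forall x, cnrm_of rip' (B x) <= L * cnrm x) ->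
  (forall i, A (e i) = B (e i)) -> forall x, A x = B x.
Proof.
move=> H' te lA lB bA bB AB x; apply/subr0_eq/(csmall_eq0 H') => f f0.
have KL : 0 < `|K| + `|L| + 1 by have := normr_ge0 K; have := normr_ge0 L; lra.
have [s xs] := te x _ (divr_gt0 f0 KL).
have cE : A (comb e s) = B (comb e s).
  rewrite /comb !clin_sum//; apply: eq_bigr => p _.
  by rewrite (clinZ _ _ lA) (clinZ _ _ lB) AB.
have -> : A x - B x = A (x - comb e s) - B (x - comb e s).
  by rewrite (clinB _ _ lA) (clinB _ _ lB) cE opprB addrA subrK.
apply: le_trans (cnrmB H' _ _) _; rewrite ltr_pdivlMr// in xs.
have := bA (x - comb e s); have := bB (x - comb e s).
have := ler_norm K; have := ler_norm L; have := cnrm_ge0 rip (x - comb e s); nra.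
Qed.

(** The kernel is extended one variable at a time: [phi j] in the first, then, for each [x], [psi x]
    in the second. A conjugation turns the antilinear variable into a linear one. *)
Lemma extend_form (I : Type) (e : I -> E) (k : I -> I -> C) (K : R) :
  total rip e -> 0 <= K ->
  (forall s t, normc (\sum_(p <- s) \sum_(q <- t) p.1 * q.1^* * k p.2 q.2) <=
     K * (cnrm (comb e s) * cnrm (comb e t))) ->
  exists a, [/\ sesq a, fbdd rip a K & forall i j, a (e i) (e j) = k i j].
Proof.
move=> te K0 bk; have HC := scalar_hilbert R.
have /choice[phi phiP] j : exists f : E -> C^o, [/\ clin f, forall i, f (e i) = k i j &
    forall x, cnrm_of (@sip R) (f x) <= K * cnrm (e j) * cnrm x].
  apply: (extend_bounded H HC) => //; first by rewrite mulr_ge0 ?cnrm_ge0.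
  move=> s; rewrite cnrm_sip; have := bk s [:: (1, j)].
  rewrite /comb !big_seq1 scale1r mulrA mulrAC; apply: le_trans.
  rewrite le_eqVlt; apply/orP; left; apply/eqP; congr normc; apply: eq_bigr => p _.
  by rewrite big_seq1 rmorph1 mulr1.
have phis s t : \sum_(p <- s) \sum_(q <- t) p.1 * q.1^* * k p.2 q.2 =
    (\sum_(q <- t) q.1 * (phi q.2 (comb e s))^*)^*.
  rewrite exchange_big/= rmorph_sum; apply: eq_bigr => q _.
  rewrite rmorphM/= conjcK; have [l h _] := phiP q.2; rewrite /comb clin_sum// mulr_sumr.
  apply: eq_bigr => p _; rewrite (clinZ _ _ l) h mulrAC -mulrA.
  by rewrite [RHS]mulrC mulrA.
have /choice[psi psiP] x : exists f : E -> C^o, [/\ clin f,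
    forall j, f (e j) = (phi j x)^* &
    forall y, cnrm_of (@sip R) (f y) <= K * cnrm x * cnrm y].
  apply: (extend_bounded H HC) => //; first by rewrite mulr_ge0 ?cnrm_ge0.
  (* The bound is known when [x] is a combination of the [e i]; it passes to [x] up to [f] by
     continuity of the finitely many [phi] involved. *)
  move=> t; rewrite cnrm_sip; apply/ler_addgt0Pr => f f0.
  pose L := \sum_(q <- t) normc q.1 * (K * cnrm (e q.2)) + K * cnrm (comb e t) + 1.
  have L0 : 0 < L.
    apply: ltr_wpDl => //; apply: addr_ge0; last by rewrite mulr_ge0 ?cnrm_ge0.
    by apply: sumr_ge0 => q _; rewrite !mulr_ge0 ?normc_ge0 ?cnrm_ge0.
  have [s xs] := te x _ (divr_gt0 f0 L0).
  have h1 : normc (\sum_(q <- t) q.1 * (phi q.2 (comb e s))^*) <=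
      K * (cnrm (comb e s) * cnrm (comb e t)).
    by rewrite -normc_conj -phis; apply: bk.
  have h2 : normc (\sum_(q <- t) q.1 * (phi q.2 x)^* -
      \sum_(q <- t) q.1 * (phi q.2 (comb e s))^*) <=
      (\sum_(q <- t) normc q.1 * (K * cnrm (e q.2))) * cnrm (x - comb e s).
    rewrite -sumrB mulr_suml; elim: (t) => [|q r IH]; first by rewrite !big_nil Normc.normc0.
    rewrite !big_cons; apply: le_trans (le_normcD _ _) _; apply: lerD => //.
    have [l _ hb] := phiP q.2; rewrite -mulrBr -rmorphB/= Normc.normcM normc_conj.
    rewrite -mulrA ler_wpM2l ?normc_ge0//.
    by have := hb (x - comb e s); rewrite cnrm_sip (clinB _ _ l).
  have := le_normcD (\sum_(q <- t) q.1 * (phi q.2 x)^* -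
      \sum_(q <- t) q.1 * (phi q.2 (comb e s))^*) (\sum_(q <- t) q.1 * (phi q.2 (comb e s))^*).
  rewrite subrK => h3; apply: le_trans h3 _.
  have h4 : cnrm (comb e s) <= cnrm x + cnrm (x - comb e s).
    by have := cnrmB H x (x - comb e s); rewrite subKr.
  rewrite ltr_pdivlMr// in xs.
  have n0 := cnrm_ge0 rip (x - comb e s); have t0 := cnrm_ge0 rip (comb e t).
  have h5 : K * (cnrm (comb e s) * cnrm (comb e t)) <=
      K * ((cnrm x + cnrm (x - comb e s)) * cnrm (comb e t)).
    by rewrite ler_wpM2l// ler_wpM2r.
  move: xs h1 h2 h5; rewrite /L; set S := \sum_(q <- t) normc _ * _.
  by move: (normc _) (normc _) => A B *; nra.
exists (fun x y => (psi x y)^*); split.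
- split=> c x y z; last first.
    have [l _ _] := psiP z; rewrite (clinD _ _ l) (clinZ _ _ l) rmorphD.
    by rewrite rmorphM.
  rewrite -[c * _]/(c * _) -[c]conjcK -rmorphM -rmorphD; congr conjc.
  have [l1 h1 b1] := psiP (c^*^* *: x + y).
  have [l2 h2 b2] := psiP x; have [l3 h3 b3] := psiP y.
  pose B (z : E) : C^o := c^* * psi x z + psi y z.
  apply: (@maps_eq _ _ _ _ _ B (K * cnrm (c^*^* *: x + y))
    (normc c * (K * cnrm x) + K * cnrm y) HC te l1).
  + by move=> d p q; rewrite /B l2 l3 !mulrDr scalerDr addrACA -[_ *: (c^* * _)]mulrCA.
  + exact: b1.
  + move=> v; rewrite cnrm_sip /B; apply: le_trans (le_normcD _ _) _.
    rewrite Normc.normcM normc_conj mulrDl; have := b2 v; have := b3 v; rewrite !cnrm_sip => p q.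
    by apply: lerD => //; rewrite -mulrA ler_wpM2l ?normc_ge0.
  + move=> j; rewrite /B h1 h2 h3; have [l _ _] := phiP j.
    by rewrite (clinD _ _ l) (clinZ _ _ l) !conjcK rmorphD rmorphM.
- move=> x y; rewrite normc_conj; have [_ _ b] := psiP x.
  by have := b y; rewrite cnrm_sip mulrA.
- move=> i j; have [_ -> _] := psiP (e i); have [_ h _] := phiP j.
  by rewrite conjcK h.
Qed.

End ExtendForm.

(** * Positive kernels, Schur products and formal tensors *)

Section Schur.
Variables (R : realType) (E : lmodType R[i]) (rip : E -> E -> R).
Hypotheses (H : cplx_hilbert rip).
Local Notation C := R[i].
Local Notation cip := (cip rip).
Local Notation cnrm := (cnrm rip).

Definition psd (I : Type) (A : I -> I -> C) := forall s : seq (C * I),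
  0 <= Re (\sum_(p <- s) \sum_(q <- s) p.1 * q.1^* * A p.2 q.2).

(* Gram-Schmidt: splitting off the component along one vector exhibits the
   Hadamard product with a Gram matrix as a sum of positive kernels. *)
Lemma schur_product (I : eqType) (A : I -> I -> C) : psd A ->
  psd (fun p q : I * E => A p.1 q.1 * cip p.2 q.2).
Proof.
move=> pA s; pose nz (l : seq (C * (I * E))) := count (fun p => p.2.2 != 0) l.
move: {2}(nz s) (leqnn (nz s)) => n; elim: n s => [|n IH] s sn.
  rewrite big1_seq ?lexx//= => p ps; rewrite big1// => q _.
  have /eqP -> : p.2.2 == 0.
    apply: contraTT sn => pn; rewrite -ltnNge /nz -has_count.
    by apply/hasP; exists p.
  by rewrite (cip0l H) !mulr0.
have [/hasP[p0 p0s y0]|] := boolP (has (fun p => p.2.2 != 0) s); last first.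
  by rewrite has_count -leqNgt leqn0 => /eqP s0; apply: IH; rewrite /nz s0.
set y := p0.2.2 in y0; have c0 : cip y y != 0.
  rewrite (cipxx H) -[0]/(0%:C); apply/eqP => /complexI/eqP.
  by rewrite sqrf_eq0 => /eqP/(cnrm_eq0 H)/eqP; apply/negP.
pose al x : C := cip x y / cip y y.
pose pr x := x - al x *: y.
have prE x : x = pr x + al x *: y by rewrite subrK.
have pro x : cip (pr x) y = 0.
  by rewrite /pr (cipBl H) (cipZl H) /al divfK// subrr.
have pr0 : pr 0 = 0 by rewrite /pr /al (cip0l H) mul0r scale0r subr0.
have pry : pr y = 0 by rewrite /pr /al divff// scale1r subrr.
clearbody pr al.
have dec x z : cip x z = (cnrm y ^+ 2)%:C * (al x * (al z)^*) + cip (pr x) (pr z).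
  rewrite {1}[x]prE {1}[z]prE !(cipDl H, cipDr H) !(cipZl H) !(cipZr H) pro.
  rewrite [cip y (pr z)](cipC H) pro rmorph0 (cipxx H); ring.
pose s1 := [seq (p.1 * al p.2.2, p.2.1) | p <- s].
pose s2 := [seq (p.1, (p.2.1, pr p.2.2)) | p <- s].
have -> : \sum_(p <- s) \sum_(q <- s) p.1 * q.1^* * (A p.2.1 q.2.1 * cip p.2.2 q.2.2) =
    (cnrm y ^+ 2)%:C * (\sum_(p <- s1) \sum_(q <- s1) p.1 * q.1^* * A p.2 q.2) +
    \sum_(p <- s2) \sum_(q <- s2) p.1 * q.1^* * (A p.2.1 q.2.1 * cip p.2.2 q.2.2).
  rewrite !big_map mulr_sumr -big_split/=; apply: eq_bigr => p _.
  rewrite !big_map mulr_sumr -big_split/=; apply: eq_bigr => q _.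
  by rewrite {1}dec rmorphM/=; ring.
have -> (a b : C) : Re (a + b) = Re a + Re b by case: a b => [? ?] [].
apply: addr_ge0.
  have -> (a : R) (b : C) : Re (a%:C * b) = a * Re b by case: b => ? ? /=; ring.
  by rewrite mulr_ge0 ?sqr_ge0//; apply: pA.
apply: IH; rewrite /nz count_map; rewrite /nz in sn.
suff : (count (preim (fun p : C * (I * E) => (p.1, (p.2.1, pr p.2.2)))
    (fun p => p.2.2 != 0%R)) s < count (fun p => p.2.2 != 0%R) s)%N.
  by move=> h; rewrite -ltnS; apply: leq_trans h sn.
have sub : subpred (preim (fun p : C * (I * E) => (p.1, (p.2.1, pr p.2.2)))
    (fun p => p.2.2 != 0%R)) (fun p => p.2.2 != 0%R).
  move=> p /=; by apply: contra => /eqP->; rewrite pr0.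
have [s3 [s4 sE]] : exists s3 s4, s = s3 ++ p0 :: s4.
  by case/splitPr: p0s => s3 s4; exists s3, s4.
rewrite sE !count_cat /= -/y y0.
by rewrite pry eqxx add0n addnS ltnS leq_add// sub_count.
Qed.

(** Inner product of formal combinations of pure tensors; computing with lists avoids building a
    Hilbert tensor product. *)
Definition tip (s t : seq (C * (E * E))) : C :=
  \sum_(p <- s) \sum_(q <- t) p.1 * q.1^* * (cip p.2.1 q.2.1 * cip p.2.2 q.2.2).

Let tip_catl s s' t : tip (s ++ s') t = tip s t + tip s' t.
Proof. exact: big_cat. Qed.

Let tip_catr s t t' : tip s (t ++ t') = tip s t + tip s t'.
Proof.
by rewrite /tip -big_split/=; apply: eq_bigr => p _; rewrite big_cat.
Qed.

Let tip_zl c s t : tip (cscale c s) t = c * tip s t.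
Proof.
rewrite /tip big_map mulr_sumr; apply: eq_bigr => p _; rewrite mulr_sumr.
by apply: eq_bigr => q _; rewrite !mulrA.
Qed.

Let tip_sym s t : tip t s = (tip s t)^*.
Proof.
rewrite /tip exchange_big/= rmorph_sum/=; apply: eq_bigr => p _.
rewrite rmorph_sum/=; apply: eq_bigr => q _.
rewrite (cipC H q.2.1) (cipC H q.2.2) !rmorphM/= conjcK; ring.
Qed.

Lemma psd_gram (I : Type) (x : I -> E) : psd (fun i j => cip (x i) (x j)).
Proof.
move=> s; rewrite -(sesq_comb _ _ _ _ (sesq_cip H)) (cipxx H)/=; exact: sqr_ge0.
Qed.

Lemma tip_ge0 s : 0 <= Re (tip s s).
Proof. exact: (schur_product (psd_gram id)). Qed.

(** Positivity at [s - r T t] with [T = tip s t] and [r] real: [r = 1 / b] in general, and a large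
    [r] when [b = 0]. *)
Lemma tip_CS s t : normc (tip s t) ^+ 2 <= Re (tip s s) * Re (tip t t).
Proof.
set T := tip s t; set a := Re (tip s s); set b := Re (tip t t).
have key (r : R) : 0 <= a - 2 * r * normc T ^+ 2 + r ^+ 2 * normc T ^+ 2 * b.
  have := tip_ge0 (s ++ cscale (- r%:C * T) t).
  rewrite tip_catl !tip_catr !tip_zl (tip_sym (cscale _ _) s) tip_zl.
  rewrite (tip_sym (cscale _ _) t) tip_zl (tip_sym s t) -/T.
  have bE : (tip t t)^* = tip t t by rewrite -tip_sym.
  have bR : tip t t = b%:C.
    by move: bE; rewrite /b; case: (tip t t) => p q [h]; congr (_ +i* _); lra.
  rewrite bR sqr_normc /a; case: (tip s s) => p q /=; case: (T) => m n /=.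
  by set X := (X in _ -> 0 <= X); set Y := (X in 0 <= X -> _); have -> : X = Y by rewrite /X /Y; ring.
have a0 : 0 <= a := tip_ge0 s; have b0 : 0 <= b := tip_ge0 t.
move: key; set m := normc T ^+ 2; have m0 : 0 <= m by exact: sqr_ge0.
clearbody m => key; have [b1|b1] := eqVneq b 0.
  rewrite b1 mulr0 leNgt; apply/negP => mp; have := key ((a + 1) / (2 * m)).
  rewrite b1 mulr0 addr0; have -> : 2 * ((a + 1) / (2 * m)) * m = a + 1 by field; lra.
  lra.
have := key b^-1; have bp : 0 < b by rewrite lt_neqAle eq_sym b1.
have -> : a - 2 * b^-1 * m + b^-1 ^+ 2 * m * b = (a * b - m) / b by field.
by rewrite pmulr_lge0 ?invr_gt0// subr_ge0.
Qed.

(** The kernel [K^2 <x, y> - <W x, W y>] is positive, and its Schur product with a Gram kernel says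
    that [W] tensored with the identity still has norm at most [K]. *)
Lemma tip_op (W : E -> E) (K : R) s : 0 <= K -> clin W ->
  (forall x, cnrm (W x) <= K * cnrm x) ->
  Re (tip [seq (p.1, (W p.2.1, p.2.2)) | p <- s] [seq (p.1, (W p.2.1, p.2.2)) | p <- s])
  <= K ^+ 2 * Re (tip s s).
Proof.
move=> K0 lW bW.
pose A (x y : E) : C := (K ^+ 2)%:C * cip x y - cip (W x) (W y).
have pA : psd A.
  move=> t.
  have -> : \sum_(p <- t) \sum_(q <- t) p.1 * q.1^* * A p.2 q.2 =
      (K ^+ 2)%:C * cip (comb id t) (comb id t) - cip (W (comb id t)) (W (comb id t)).
    have -> : W (comb id t) = comb W t.
      rewrite /comb clin_sum//; apply: eq_bigr => p _; exact: clinZ.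
    rewrite !(sesq_comb _ _ _ _ (sesq_cip H)) mulr_sumr -sumrB; apply: eq_bigr => p _.
    rewrite mulr_sumr -sumrB; apply: eq_bigr => q _.
    by rewrite /A; ring.
  rewrite !(cipxx H) -rmorphM -rmorphB/= subr_ge0 -exprMn ler_pXn2r//.
  - by rewrite nnegrE cnrm_ge0.
  - by rewrite nnegrE mulr_ge0 ?cnrm_ge0.
have := schur_product pA s.
have -> : \sum_(p <- s) \sum_(q <- s) p.1 * q.1^* * (A p.2.1 q.2.1 * cip p.2.2 q.2.2) =
    (K ^+ 2)%:C * tip s s -
    tip [seq (p.1, (W p.2.1, p.2.2)) | p <- s] [seq (p.1, (W p.2.1, p.2.2)) | p <- s].
  rewrite /tip !big_map mulr_sumr -sumrB; apply: eq_bigr => p _.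
  rewrite !big_map mulr_sumr -sumrB; apply: eq_bigr => q _.
  by rewrite /A/=; ring.
move: (tip (map _ _) _) => z; case: (tip s s) => a b; case: z => c d /=; lra.
Qed.

Lemma tip_swap s t : tip [seq (p.1, (p.2.2, p.2.1)) | p <- s] [seq (p.1, (p.2.2, p.2.1)) | p <- t]
  = tip s t.
Proof.
rewrite /tip big_map; apply: eq_bigr => p _; rewrite big_map; apply: eq_bigr => q _ /=.
by rewrite [X in _ * X]mulrC.
Qed.

End Schur.

Section Truncation.
Variable C : pzRingType.

(* The expansion of [\prod_(i in l) (1 + (X_i - 1))] up to degree [< m]; a list [r]
   of indices stands for the monomial [\prod_(i in r) X_i]. *)
Fixpoint tau (l : seq nat) (m : nat) : seq (C * seq nat) :=
  match l, m with
  | _, 0 => [::]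
  | [::], _ => [:: (1, [::])]
  | a :: l', m'.+1 => tau l' m ++ [seq (p.1, a :: p.2) | p <- tau l' m'] ++
                      [seq (- p.1, p.2) | p <- tau l' m']
  end.

Lemma tau_sub l m p : p \in tau l m -> subseq p.2 l /\ (size p.2 < m)%N.
Proof.
elim: l m p => [|a l IH] [|m] p //=; first by rewrite inE => /eqP ->.
rewrite !mem_cat => /or3P[/IH[sp pm]|/mapP[q /IH[sq qm] ->]|/mapP[q /IH[sq qm] ->]] /=.
- by split=> //; apply: subseq_trans sp (subseq_cons _ _).
- by rewrite eqxx.
- by split; [apply: subseq_trans sq (subseq_cons _ _) | apply: leqW].
Qed.

End Truncation.

(** * The Fock space argument *)

Section Fock.
Variables (R : realType) (E : lmodType R[i]) (rip : E -> E -> R).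
Hypotheses (H : cplx_hilbert rip).
Local Notation C := R[i].
Local Notation cip := (cip rip).
Local Notation cnrm := (cnrm rip).
Local Notation RE := (realify E).
Variable U : int -> E -> E.
Hypothesis HU : unitary_rep rip U.
Variable u : E.
Hypothesis tu : total rip (U^~ u).
Variables (F : set E) (e : E -> E).
Hypotheses (sF : @subspace R RE F) (cF : @hclosure R RE rip F `<=` F).
Hypotheses (FU : forall x, F x -> F (U 1 x)) (FU' : forall x, F x -> F (U (-1) x)).
Hypothesis noeig : forall (t : R) x, F x -> U 1 x + U (-1) x = t%:C *: x -> x = 0.
Hypothesis eE : forall h g, F h -> F g -> cip (e h) (e g) = (expR (rip h g))%:C.
Hypothesis eU : forall h, F h -> U 1 (e h) = e (U 1 h).
Let I := {h : E | F h}.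
Let eI (i : I) := e (sval i).
Hypothesis te : total rip eI.
Let rh := realify_hilbert H.

Let ripE := (ipE rh).
Let ripC := ch_sym H.

Let U1V x : U 1 (U (-1) x) = x.
Proof. by rewrite (ur_add HU) (ur_id HU). Qed.
Let UV1 x : U (-1) (U 1 x) = x.
Proof. by rewrite (ur_add HU) (ur_id HU). Qed.

Let Ue k h : F h -> F (U k h) /\ U k (e h) = e (U k h).
Proof.
move=> Fh; elim/int_ind: k => [|n [FUn eUn]|n [FUn eUn]]; first by rewrite !(ur_id HU).
  by rewrite -add1n PoszD -!(ur_add HU) eUn eU//; split=> //; apply: FU.
rewrite -add1n PoszD opprD -!(ur_add HU) eUn; split; first exact: FU'.
by rewrite -{1}[U (- n%:Z) h]U1V -eU ?UV1//; apply: FU'.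
Qed.

Let cnrm_e h : F h -> cnrm (e h) ^+ 2 = expR (rip h h).
Proof. by move=> Fh; apply: complexI; rewrite -(cipxx H) eE. Qed.

Section Intertwiner.
Variables (W : E -> E) (K : R) (z : C).
Hypotheses (K0 : 0 <= K) (lW : clin W) (bW : forall x, cnrm (W x) <= K * cnrm x).
Hypotheses (zW : forall x, U 1 (W x) = z *: W (U 1 x)) (z1 : z != 1) (zz : z^* * z = 1).
Let w h g := cip (W (e h)) (e g).

Let wU h g : F h -> F g -> w (U 1 h) (U 1 g) = z^* * w h g.
Proof.
move=> Fh Fg; rewrite /w -!eU//.
have -> : W (U 1 (e h)) = z^* *: U 1 (W (e h)) by rewrite zW scalerA zz scale1r.
by rewrite (cipZl H) (ur_ip HU).
Qed.

Section Clean.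
Variable Q : E -> E.
Hypotheses (aQ : @opadj R RE rip Q Q) (QQ : forall x, Q (Q x) = Q x).
Hypotheses (QU : forall x, U 1 (Q x) = Q (U 1 x)) (FQ : forall x, F x -> F (Q x)).
Let Q' x := x - Q x.

Let QB x y : Q (x - y) = Q x - Q y.
Proof. exact: (oplinB _ _ (opadj_oplin rh aQ)). Qed.
Let QD x y : Q (x + y) = Q x + Q y.
Proof. exact: (oplinD _ _ (opadj_oplin rh aQ)). Qed.
Let ripQ x y : rip (Q x) y = rip x (Q y).
Proof. exact: aQ. Qed.
Let QQ' x : Q (Q' x) = 0.
Proof. by rewrite /Q' QB QQ subrr. Qed.
Let Q'Q x : Q' (Q x) = 0.
Proof. by rewrite /Q' QQ subrr. Qed.
Let FQ' x : F x -> F (Q' x).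
Proof. by move=> Fx; apply: (subspaceB sF) => //; apply: FQ. Qed.
Let QQ'K x : Q x + Q' x = x.
Proof. by rewrite addrC subrK. Qed.
Let ripQQ' x y : rip (Q x) (Q' y) = 0.
Proof. by rewrite ripQ QQ' ripE. Qed.
Let rip_split x y : rip x y = rip (Q x) (Q y) + rip (Q' x) (Q' y).
Proof.
rewrite -{1}(QQ'K x) -{1}(QQ'K y); move: (ripQQ' x y) (ripQQ' y x).
rewrite (ripC (Q y)); move: (Q x) (Q' x) (Q y) (Q' y) => a b c d h1 h2.
by rewrite !ripE h1 h2; ring.
Qed.
Let Q'U x : U 1 (Q' x) = Q' (U 1 x).
Proof. by rewrite /Q' (clinB _ _ (ur_lin HU _)) QU. Qed.
Let Qk k x : U k (Q x) = Q (U k x).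
Proof.
elim/int_ind: k => [|n IH|n IH]; first by rewrite !(ur_id HU).
  by rewrite -add1n PoszD -!(ur_add HU) IH QU.
rewrite -add1n PoszD opprD -!(ur_add HU) IH.
by rewrite -[in RHS](UV1 (Q _)) QU U1V.
Qed.

(** The two factors are entries of [W] on the two sides of the splitting, the second conjugated with
    swapped arguments: [U] multiplies the first by [conj z] and the second by [z]. *)
Let k (i j : I) : C := w (Q (sval i)) (Q (sval j)) * (w (Q' (sval j)) (Q' (sval i)))^*.

(** [e(h)] behaves as the tensor of [e(Q h)] and [e(Q' h)]: [<h, g>] is additive over the splitting
    and inner products of the [e] are exponentials. *)
Let gramQ (s : seq (C * I)) :
  tip rip [seq (p.1, (e (Q (sval p.2)), e (Q' (sval p.2)))) | p <- s]
          [seq (p.1, (e (Q (sval p.2)), e (Q' (sval p.2)))) | p <- s] =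
  (cnrm (comb eI s) ^+ 2)%:C.
Proof.
rewrite -(cipxx H) (sesq_comb _ _ _ _ (sesq_cip H)) /tip big_map.
apply: eq_bigr => p _; rewrite big_map; apply: eq_bigr => q _ /=; congr (_ * _).
have Fp := svalP p.2; have Fq := svalP q.2.
rewrite (eE (FQ Fp) (FQ Fq)) (eE (FQ' Fp) (FQ' Fq)) (eE Fp Fq).
by rewrite [in RHS]rip_split expRD; apply/esym/(rmorphM (real_complex R)).
Qed.

(** [k] pairs [W] acting on the first tensor factor with [W] acting on the second; each action is
    bounded by [K] through [tip_op], the second one after a swap. *)
Let k_bounded s t : normc (\sum_(p <- s) \sum_(q <- t) p.1 * q.1^* * k p.2 q.2) <=
  K ^+ 2 * (cnrm (comb eI s) * cnrm (comb eI t)).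
Proof.
pose s0 := [seq (p.1, (e (Q (sval p.2)), e (Q' (sval p.2)))) | p : C * I <- s].
pose t0 := [seq (p.1, (e (Q (sval p.2)), e (Q' (sval p.2)))) | p : C * I <- t].
pose s1 := [seq (p.1, (W p.2.1, p.2.2)) | p <- s0].
pose t0' := [seq (p.1, (p.2.2, p.2.1)) | p <- t0].
pose t1' := [seq (p.1, (W p.2.1, p.2.2)) | p <- t0'].
pose t1 := [seq (p.1, (p.2.2, p.2.1)) | p <- t1'].
have -> : \sum_(p <- s) \sum_(q <- t) p.1 * q.1^* * k p.2 q.2 = tip rip s1 t1.
  rewrite /tip /s1 /s0 /t1 /t1' /t0' /t0 !big_map; apply: eq_bigr => p _.
  rewrite !big_map; apply: eq_bigr => q _ /=.
  by rewrite /k /w -(cipC H).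
rewrite -(@ler_pXn2r _ 2)// ?nnegrE ?normc_ge0 ?mulr_ge0 ?sqr_ge0 ?cnrm_ge0//.
apply: le_trans (tip_CS H _ _) _; rewrite tip_swap.
have h1 := tip_op H s0 K0 lW bW; have h2 := tip_op H t0' K0 lW bW.
rewrite tip_swap in h2; rewrite gramQ/= in h1; rewrite gramQ/= in h2.
rewrite -/s1 in h1; rewrite -/t1' in h2.
set p := cnrm _; set q := cnrm _.
have -> : (K ^+ 2 * (p * q)) ^+ 2 = (K ^+ 2 * p ^+ 2) * (K ^+ 2 * q ^+ 2) by ring.
by apply: ler_pM => //; apply: tip_ge0.
Qed.

(** [U] on the range of [Q], the identity on its complement: the induced isometry commutes with [U],
    yet it changes only the first factor of [k]. *)
Let M (i : I) : E := U 1 (Q (sval i)) + Q' (sval i).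
Let FM i : F (M i).
Proof. by have Fi := svalP i; apply: (subspaceD sF); [apply/FU/FQ | apply: FQ']. Qed.
Let MI i : I := exist _ (M i) (FM i).

Let QM i : Q (M i) = U 1 (Q (sval i)).
Proof. by rewrite /M QD QQ' addr0 -QU QQ. Qed.
Let Q'M i : Q' (M i) = Q' (sval i).
Proof. by rewrite /Q' QM /M addrAC subrr add0r. Qed.

(** The commutant principle gives [k (M i) (M j) = k i j], whereas the left side is
    [conj z * k i j]; as [z] is not 1, [k] vanishes. Its factors depend on independent components,
    so one of them vanishes identically. *)
Lemma clean : (forall h g, F h -> F g -> w (Q h) (Q g) = 0) \/
  (forall h g, F h -> F g -> w (h - Q h) (g - Q g) = 0).
Proof.
have [a [sa ba aE]] := extend_form H te (sqr_ge0 K) k_bounded.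
have gramM s : cnrm (comb (fun i => eI (MI i)) s) = cnrm (comb eI s).
  apply/eqP; rewrite -(@eqrXn2 _ 2)// ?cnrm_ge0//; apply/eqP/complexI.
  rewrite -!(cipxx H) !(sesq_comb _ _ _ _ (sesq_cip H)).
  apply: eq_bigr => p _; apply: eq_bigr => q _; congr (_ * _).
  rewrite /eI !eE; [|exact: svalP..]; congr (expR _)%:C => /=.
  rewrite rip_split !QM !Q'M [RHS]rip_split; congr (_ + _).
  by rewrite -!Re_cip (ur_ip HU).
have [G [lG GE bG]] : exists G : E -> E, [/\ clin G, forall i, G (eI i) = eI (MI i) &
    forall x, cnrm (G x) <= 1 * cnrm x].
  by apply: (extend_bounded H H te ler01) => s; rewrite gramM mul1r.
have b1 : fbdd rip cip 1 by move=> x y; rewrite mul1r; apply: cip_CS.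
have iG x y : cip (G x) (G y) = cip x y.
  apply: (@forms_eq _ _ _ H _ eI (fun x y => cip (G x) (G y)) cip 1 1 te ler01 ler01) => //;
    [|exact: sesq_cip| |].
  - by split=> c ? ? ?; rewrite lG ?(cipDl H, cipDr H) ?(cipZl H, cipZr H).
  - move=> p q; apply: le_trans (b1 _ _) _; rewrite !mul1r.
    by apply: ler_pM; rewrite ?cnrm_ge0// -[leRHS]mul1r.
  move=> i j; rewrite !GE /eI !eE; [|exact: svalP..]; congr (expR _)%:C => /=.
  rewrite rip_split !QM !Q'M [RHS]rip_split; congr (_ + _).
  by rewrite -!Re_cip (ur_ip HU).
have cG l x : G (U l x) = U l (G x).
  have lUl := ur_lin HU l.
  apply: (@maps_eq _ _ rip _ rip _ eI (fun x => G (U l x)) (fun x => U l (G x)) 1 1 H te) => //.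
  - by move=> c p q; rewrite lUl lG.
  - by move=> c p q; rewrite lG lUl.
  - by move=> p; apply: le_trans (bG _) _; rewrite (cnrm_U HU).
  - by move=> p; rewrite (cnrm_U HU).
  move=> i; have Fi := svalP i; have [FUi Uei] := Ue l Fi.
  have -> : U l (eI i) = eI (exist _ _ FUi) by [].
  rewrite !GE; have [_ ->] := Ue l (FM i); congr e => /=.
  rewrite /M/= (clinD _ _ lUl) /Q' (clinB _ _ lUl) !Qk !(ur_add HU) addrC.
  by rewrite [in RHS]addrC [(1 + l)%R]addrC.
have i1 x y : a (U 1 x) (U 1 y) = a x y.
  apply: (@forms_eq _ _ _ H _ eI (fun x y => a (U 1 x) (U 1 y)) a _ _ te (sqr_ge0 K) (sqr_ge0 K)) => //.
  - by have [s1 s2] := sa; split=> c p q r; rewrite (ur_lin HU) ?s1 ?s2.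
  - by move=> p q; rewrite -(cnrm_U HU 1 p) -(cnrm_U HU 1 q); apply: ba.
  move=> i j; have Fi := svalP i; have Fj := svalP j.
  have [Fi1 Ei] := Ue 1 Fi; have [Fj1 Ej] := Ue 1 Fj.
  have -> : U 1 (eI i) = eI (exist _ _ Fi1) by [].
  have -> : U 1 (eI j) = eI (exist _ _ Fj1) by [].
  rewrite !aE /k [sval (exist _ _ Fi1)]/= [sval (exist _ _ Fj1)]/=.
  rewrite -(Q'U (sval i)) -(Q'U (sval j)) -(QU (sval i)) -(QU (sval j)).
  rewrite (wU (FQ Fi) (FQ Fj)) (wU (FQ' Fj) (FQ' Fi)).
  by rewrite rmorphM/= conjcK mulrACA zz mul1r.
have ia l x y : a (U l x) (U l y) = a x y.
  elim/int_ind: l x y => [|n IH|n IH] x y; first by rewrite !(ur_id HU).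
    by rewrite -add1n PoszD -!(ur_add HU) i1 IH.
  by rewrite -add1n PoszD opprD -!(ur_add HU) -i1 !U1V IH.
have inv := commutant_invariance H HU tu (sqr_ge0 K) sa ba ia lG iG cG.
have kM i j : k i j = 0.
  have := inv (eI i) (eI j); rewrite !GE !aE /k/= !QM !Q'M.
  rewrite (wU (FQ (svalP i)) (FQ (svalP j))).
  rewrite -mulrA => /eqP; rewrite -subr_eq0 -{2}[w _ _ * _]mul1r -mulrBl mulf_eq0.
  move=> /orP[|/eqP//]; rewrite subr_eq0 => /eqP zs.
  by move: z1; rewrite -zz zs mul1r eqxx.
apply: contrapT => /not_orP[/existsNP[h1 /existsNP[g1]]].
move=> /not_implyP[Fh1 /not_implyP[Fg1 w1]] /existsNP[h2 /existsNP[g2]].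
move=> /not_implyP[Fh2 /not_implyP[Fg2 w2]].
(* Mixed vectors: their [Q] parts realise the nonzero entry at [h1, g1], and their [Q'] parts the
   nonzero entry at [h2, g2]. *)
have Fi : F (Q h1 + Q' g2) by apply: (subspaceD sF); [apply: FQ | apply: FQ'].
have Fj : F (Q g1 + Q' h2) by apply: (subspaceD sF); [apply: FQ | apply: FQ'].
have Qs x y : Q (Q x + Q' y) = Q x by rewrite QD QQ QQ' addr0.
have Q's x y : Q' (Q x + Q' y) = Q' y by rewrite {1}/Q' Qs addrAC subrr add0r.
have /eqP := kM (exist _ _ Fi) (exist _ _ Fj); rewrite /k.
rewrite [sval (exist _ _ Fi)]/= [sval (exist _ _ Fj)]/= !Qs !Q's mulf_eq0.
by rewrite conjc_eq0 => /orP[/eqP/w1|/eqP/w2].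
Qed.

End Clean.
Section Expansion.
Variable v : nat -> E.
Hypotheses (Fv : forall i, F (v i)) (ov : forall i j, i != j -> rip (v i) (v j) = 0).
Let ev (r : seq nat) := \sum_(i <- r) v i.
Let Ev (s : seq (C * seq nat)) : E := comb (fun r => e (ev r)) s.

Lemma F_sum (J : Type) (r : seq J) (f : J -> E) : (forall i, F (f i)) -> F (\sum_(i <- r) f i).
Proof.
move=> Ff; elim: r => [|i r IH]; first by rewrite big_nil; case: sF.
by rewrite big_cons; apply: (subspaceD sF).
Qed.

Let rip_ev a r : a \notin r -> rip (v a) (ev r) = 0.
Proof.
rewrite /ev; elim: r => [|i r IH]; first by rewrite big_nil ripE.
rewrite inE big_cons => /norP[ai ar]; rewrite (ipDr rh) ov// add0r; exact: IH.
Qed.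

Let shift (a : nat) (s : seq (C * seq nat)) := [seq (p.1, a :: p.2) | p <- s].
Let fresh (a : nat) (s : seq (C * seq nat)) := forall p, p \in s -> a \notin p.2.

Let cip_shift1 a s t : fresh a t -> cip (Ev (shift a s)) (Ev t) = cip (Ev s) (Ev t).
Proof.
move=> ft; rewrite !(sesq_comb _ _ _ _ (sesq_cip H)) big_map; apply: eq_bigr => p _.
apply: eq_big_seq => q qt; congr (_ * _); rewrite !eE; try exact: F_sum.
by congr (expR _)%:C; rewrite {1}/ev big_cons (ipDl rh) rip_ev ?add0r//; apply: ft.
Qed.

Let cip_shift2 a s t : fresh a s -> fresh a t ->
  cip (Ev (shift a s)) (Ev (shift a t)) = (expR (rip (v a) (v a)))%:C * cip (Ev s) (Ev t).
Proof.
move=> fs ft; rewrite !(sesq_comb _ _ _ _ (sesq_cip H)) big_map mulr_sumr.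
apply: eq_big_seq => p ps; rewrite big_map mulr_sumr; apply: eq_big_seq => q qt /=.
rewrite !eE; try exact: F_sum.
rewrite [RHS]mulrCA; congr (_ * _).
rewrite -[RHS](rmorphM (real_complex R)) -expRD; congr (expR _)%:C.
rewrite {1 2}/ev !big_cons !ripE rip_ev ?ft// (ripC (\sum_(i <- p.2) v i)) rip_ev ?fs//.
by rewrite addr0 add0r.
Qed.

Let rl l m : seq (C * seq nat) := (1, l) :: [seq (- p.1, p.2) | p <- tau C l m].

Let Ev_cat s t : Ev (s ++ t) = Ev s + Ev t. Proof. exact: comb_cat. Qed.
Let Ev_neg s : Ev [seq (- p.1, p.2) | p <- s] = - Ev s.
Proof.
by rewrite /Ev /comb big_map -sumrN; apply: eq_bigr => p _; rewrite scaleNr.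
Qed.

Let Ev_rl l m : Ev (rl l m) = e (ev l) - Ev (tau C l m).
Proof. by rewrite -Ev_neg /Ev /comb /rl big_cons scale1r. Qed.

(** In the Fock picture the factors [X_i - 1], with [X_i = e(v i)], are independent and centred, of
    squared norm [t_i - 1] with [t_i = expR (rip (v i) (v i))]. The remainder satisfies [R(a :: l, m
    + 1) = R(l, m + 1) + (X_a - 1) R(l, m)], an orthogonal sum, and [1 + 2 (t - 1) <= t^2] closes
    the induction. *)
Lemma tau_bound l m : uniq l ->
  cnrm (e (ev l) - Ev (tau C l m)) ^+ 2 <= 2^-1 ^+ m * expR (2 * rip (ev l) (ev l)).
Proof.
elim: l m => [|a l IH] m; first move=> _.
  have F0 : F (ev [::]) by rewrite /ev big_nil; case: sF.
  case: m => [|m] /=.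
    by rewrite /Ev /comb big_nil subr0 cnrm_e// /ev big_nil !ripE mulr0 expR0 mul1r.
  by rewrite /Ev /comb big_seq1 scale1r subrr (cnrm0 H) expr0n/= mulr_ge0 ?exprn_ge0 ?expR_ge0.
rewrite /= => /andP[al ul].
have aE : rip (ev (a :: l)) (ev (a :: l)) = rip (v a) (v a) + rip (ev l) (ev l).
  rewrite {1 2}/ev big_cons -/(ev l) !ripE rip_ev// (ripC (ev l)) rip_ev//; ring.
case: m => [|m].
  rewrite /Ev /comb big_nil subr0 cnrm_e; last exact: F_sum.
  by rewrite expr0 mul1r ler_expR; have := rh_ge0 rh (ev (a :: l)); lra.
have fr n : fresh a (rl l n).
  move=> p; rewrite inE => /orP[/eqP->//|/mapP[q /tau_sub[sq _] ->]] /=.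
  by apply: contra al; apply: (mem_subseq sq).
set Y := Ev (rl l m.+1); set X := Ev (rl l m); set S := Ev (shift a (rl l m)).
have SE : S = e (ev (a :: l)) - Ev (shift a (tau C l m)).
  rewrite /S /Ev /comb /shift /rl big_map big_cons scale1r; congr (_ + _).
  by rewrite !big_map -sumrN; apply: eq_bigr => p _; rewrite scaleNr.
have -> : e (ev (a :: l)) - Ev (tau C l m.+1 ++ shift a (tau C l m) ++
    [seq (- p.1, p.2) | p <- tau C l m]) = Y + S - X.
  rewrite !Ev_cat Ev_neg SE /Y /X !Ev_rl.
  move: (e (ev (a :: l))) (e (ev l)) (Ev (tau C l m.+1)) (Ev (tau C l m)) (Ev (shift _ _)).
  move=> p q x y s'; rewrite !opprD !opprK.
  by rewrite [RHS](AC (2*2*2) ((3*(2*(4*6)))*(1*5)))/= subrr addr0.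
have YS : rip Y S = rip Y X.
  by rewrite !(ripC Y) -!Re_cip /S /X /Y cip_shift1.
have SX : rip S X = rip X X by rewrite -!Re_cip /S cip_shift1.
have SS : rip S S = expR (rip (v a) (v a)) * rip X X.
  rewrite -!Re_cip /S cip_shift2// -/X.
  by case: (cip X X) => p q /=; ring.
have -> : cnrm (Y + S - X) ^+ 2 = rip Y Y + (expR (rip (v a) (v a)) - 1) * rip X X.
  rewrite (sqr_cnrm H); move: Y S X YS SX SS {SE fr IH} => Y S X YS SX SS.
  by rewrite !ripE (ripC X S) (ripC X Y) (ripC S Y) YS SX SS; ring.
have := IH m.+1 ul; have := IH m ul; rewrite -!Ev_rl -/Y -/X !(sqr_cnrm H) aE => h1 h2.
rewrite mulrDr expRD; set A := expR (2 * rip (ev l) (ev l)) in h1 h2 *.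
have va0 := rh_ge0 rh (v a); have t1 : 1 <= expR (rip (v a) (v a)) by rewrite -[1]expR0 ler_expR.
have t2 : expR (2 * rip (v a) (v a)) = expR (rip (v a) (v a)) ^+ 2.
  by rewrite -expRM_natl mulr_natl.
rewrite t2 exprS in h2 *; set t := expR (rip (v a) (v a)) in t1 *; set d := _ ^+ m in h1 h2 *.
have dA : 0 <= d * A by rewrite mulr_ge0 ?exprn_ge0 ?expR_ge0.
have X0 := rh_ge0 rh X; have sq := sqr_ge0 (t - 1).
have h3 : (t - 1) * rip X X <= (t - 1) * (d * A) by rewrite ler_wpM2l// subr_ge0.
have h4 : 0 <= (t - 1) ^+ 2 * (d * A) by rewrite mulr_ge0.
move: h2 h3 h4; clearbody d A t; lra.
Qed.

End Expansion.

(** If [w h g] were nonzero, truncation at degree [m] would give a nonzero [w] at partial sums over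
    fewer than [m] pieces. The projector onto these pieces excludes the first case of [clean]; in
    the second case [w] vanishes off these pieces, which are too small to matter. *)
Lemma intertwiner_form_zero h g : F h -> F g -> w h g = 0.
Proof.
move=> Fh Fg; apply: contrapT => w0.
set dl := normc (w h g); have dl0 : 0 < dl.
  by rewrite lt_neqAle normc_ge0 andbT eq_sym; apply/eqP => /Normc.eq0_normc.
have nh := cnrm_ge0 rip (e h); have ng := cnrm_ge0 rip (e g).
set L := cnrm (e h) + cnrm (e g) + 1.
have Lp : 0 < L by rewrite /L; lra.
have K1 : 0 < K + 1 by apply: ltr_wpDl.
have L0 : 0 < 2 * (K + 1) * L by rewrite !mulr_gt0.
pose eta := Num.min 1 (dl / (2 * (K + 1) * L)).
have eta0 : 0 < eta by rewrite lt_min ltr01 divr_gt0.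
have eta1 : eta <= 1 by rewrite ge_min lexx.
have etaL : K * (eta * L) < dl.
  have : eta <= dl / (2 * (K + 1) * L) by rewrite ge_min lexx orbT.
  rewrite ler_pdivlMr// => h1; have h2 : 0 < eta * L by rewrite mulr_gt0.
  have h3 : 0 <= K * (eta * L) by rewrite mulr_ge0// ltW.
  have h4 : eta * (2 * (K + 1) * L) = 2 * (K * (eta * L)) + 2 * (eta * L) by ring.
  by move: h1 h2 h3; rewrite h4; move: (K * (eta * L)) (eta * L) => x y; lra.
clearbody eta.
pose A := expR (2 * rip h h) + expR (2 * rip g g).
have [m mA] : exists m, 2^-1 ^+ m * A < eta ^+ 2.
  by apply: exp_small => //; [lra | exact: exprn_gt0].
(* At most [2 m] pieces are removed, each of squared norm below [eta ^+ 2 / B]; this moves [e h] in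
   squared norm by at most [expR (rip h h)] times their sum. The final 1 keeps [B] positive when
   [m = 0]. *)
pose B := (expR (rip h h) + expR (rip g g)) * (2 * m%:R) + 1.
have B0 : 0 < B by rewrite /B ltr_wpDl// !mulr_ge0// addr_ge0 ?expR_ge0.
have ep0 : 0 < eta ^+ 2 / B by rewrite divr_gt0// exprn_gt0.
have aU : @opadj R RE rip (U 1) (U (-1)).
  by move=> x y; rewrite -!Re_cip -{1}[y]U1V (ur_ip HU).
have [N [Q [aQ QQ sQ QF Qe]]] :=
  hilbert_splitting rh aU U1V UV1 sF cF FU FU' noeig Fh Fg ep0.
have lQ i := opadj_oplin rh (aQ i).
have Q0 i : Q i 0 = 0 by exact: (oplin0 (lQ i)).
have QS i (r : seq nat) (f : nat -> E) : Q i (\sum_(j <- r) f j) = \sum_(j <- r) Q i (f j).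
  exact: (oplin_sum _ _ _ (lQ i)).
pose v x i : E := if (i < N)%N then Q i x else 0.
have Fv x i : F x -> F (v x i).
  by rewrite /v => Fx; case: ifP => _; [exact: (QF i).2|case: sF].
have ov x i j : i != j -> rip (v x i) (v x j) = 0.
  rewrite /v => ij; case: ifP => iN; case: ifP => jN; rewrite ?(ip0l rh) ?(ip0r rh)//.
  by rewrite (aQ i) QQ// (negbTE ij) (ip0r rh).
pose ev x (r : seq nat) := \sum_(i <- r) v x i.
have evl x : ev x (iota 0 N) = x.
  rewrite /ev -[in RHS](sQ x) -[N in iota 0 N]subn0 -/(index_iota 0 N) big_mkord.
  by apply: eq_bigr => i _; rewrite /v ltn_ord.
(* Otherwise [w] vanishes on all terms of the two truncated expansions, and only the truncation
   errors are left. *)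
have [r [r' [sr rm sr' rm' wr]]] : exists r r', [/\ subseq r (iota 0 N), (size r < m)%N,
    subseq r' (iota 0 N), (size r' < m)%N & w (ev h r) (ev g r') <> 0].
  apply: contrapT => hN; apply: w0.
  have hz r r' : subseq r (iota 0 N) -> (size r < m)%N ->
    subseq r' (iota 0 N) -> (size r' < m)%N -> w (ev h r) (ev g r') = 0.
    by move=> *; apply: contrapT => ?; apply: hN; exists r, r'.
  pose T x := comb (fun r => e (ev x r)) (tau C (iota 0 N) m).
  have rho x : F x -> cnrm (e x - T x) ^+ 2 <= 2^-1 ^+ m * expR (2 * rip x x).
    move=> Fx; have := @tau_bound (v x) (fun i => Fv x i Fx) (ov x) (iota 0 N) m (iota_uniq _ _).
    by rewrite -/(ev x _) evl.
  have small x : F x -> expR (2 * rip x x) <= A -> cnrm (e x - T x) < eta.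
    move=> Fx xA; rewrite -(@ltr_pXn2r _ 2) ?nnegrE ?cnrm_ge0 ?(ltW eta0)//.
    apply: le_lt_trans (rho x Fx) _; apply: le_lt_trans mA; apply: ler_wpM2l => //.
  have hT : cnrm (e h - T h) < eta by apply: small => //; rewrite /A lerDl expR_ge0.
  have gT : cnrm (e g - T g) < eta by apply: small => //; rewrite /A lerDr expR_ge0.
  have TT : cip (W (T h)) (T g) = 0.
    rewrite /T /comb (clin_sum _ _ lW) (sesq_suml _ _ _ (sesq_cip H)).
    rewrite big1_seq// => p /= /tau_sub[sp pm].
    rewrite (sesq_sumr _ _ _ (sesq_cip H)) big1_seq// => q /= /tau_sub[sq qm].
    by rewrite (clinZ _ _ lW) (cipZl H) (cipZr H) -/(w _ _) hz// !mulr0.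
  have wE : w h g = cip (W (e h - T h)) (e g) + cip (W (T h)) (e g - T g).
    by rewrite /w (clinB _ _ lW) (cipBl H) (cipBr H) TT subr0 subrK.
  have nT : cnrm (T h) <= cnrm (e h) + 1.
    by have := cnrmB H (e h) (e h - T h); rewrite subKr; lra.
  exfalso; have : dl <= K * (eta * L).
    rewrite /dl wE; apply: le_trans (le_normcD _ _) _.
    have c1 := cip_CS H (W (e h - T h)) (e g); have c2 := cip_CS H (W (T h)) (e g - T g).
    have b1 := bW (e h - T h); have b2 := bW (T h).
    have p1 := cnrm_ge0 rip (e h - T h); have p2 := cnrm_ge0 rip (e g - T g).
    have p3 := cnrm_ge0 rip (T h).
    have d1 : cnrm (W (e h - T h)) * cnrm (e g) <= K * eta * cnrm (e g).
      by apply: ler_wpM2r => //; apply: le_trans b1 _; apply: ler_wpM2l => //; lra.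
    have d2 : cnrm (W (T h)) * cnrm (e g - T g) <= K * (cnrm (e h) + 1) * eta.
      apply: ler_pM; rewrite ?cnrm_ge0//; last by lra.
      by apply: le_trans b2 _; apply: ler_wpM2l => //; lra.
    rewrite /L; move: c1 c2 d1 d2; move: (normc _) (normc _) => ? ?; lra.
  lra.
(* [P] projects onto the pieces met by [r] or [r'], hence fixes both partial sums. *)
pose S := undup (r ++ r'); pose P x := \sum_(i <- S) Q i x.
have uS : uniq S by exact: undup_uniq.
have SN i : i \in S -> (i < N)%N.
  by rewrite mem_undup mem_cat => /orP[/(mem_subseq sr)|/(mem_subseq sr')]; rewrite mem_iota.
have PQ i x : (i \in S) -> P (Q i x) = Q i x.
  move=> iS; rewrite /P (bigD1_seq i)//= QQ ?SN// eqxx big1_seq ?addr0// => j /andP[ji jS].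
  by rewrite QQ ?SN// (negbTE ji).
have Pev x q : {subset q <= S} -> P (ev x q) = ev x q.
  move=> qS; rewrite /P /ev; under eq_bigr do rewrite QS.
  rewrite exchange_big/=; apply: eq_big_seq => j jq; have jS := qS _ jq.
  by rewrite /v SN//; apply: PQ.
have aP : @opadj R RE rip P P.
  suff gen (q : seq nat) x y :
    rip (\sum_(i <- q) Q i x) y = rip x (\sum_(i <- q) Q i y) by move=> x y; apply: gen.
  elim: q => [|i q IH]; first by rewrite !big_nil (ip0l rh) (ip0r rh).
  by rewrite !big_cons (ipDl rh) (ipDr rh) IH (aQ i).
have PP x : P (P x) = P x.
  transitivity (\sum_(j <- S) P (Q j x)); last by apply: eq_big_seq => j jS; apply: PQ.
  by rewrite /P; under eq_bigr do rewrite QS; rewrite exchange_big.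
have PU x : U 1 (P x) = P (U 1 x).
  rewrite /P (clin_sum _ _ (ur_lin HU _)); apply: eq_bigr => i _; exact: (QF i).1.
have FP x : F x -> F (P x) by move=> Fx; apply: F_sum => i; apply: (QF i).2.
have nP x : (forall i, (i < N)%N -> rip (Q i x) (Q i x) < eta ^+ 2 / B) ->
    rip (P x) (P x) <= 2 * m%:R * (eta ^+ 2 / B).
  move=> xs; rewrite aP PP /P.
  have -> : rip x (\sum_(i <- S) Q i x) = \sum_(i <- S) rip (Q i x) (Q i x).
    transitivity (\sum_(i <- S) rip x (Q i x)).
      by apply: (big_morph (rip x)); [move=> p q; exact: (ipDr rh)|exact: (ip0r rh)].
    by apply: eq_big_seq => i iS; rewrite (aQ i) QQ ?eqxx// SN.
  have Sm : (size S <= 2 * m)%N.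
    by apply: leq_trans (size_undup _) _; rewrite size_cat mul2n -addnn leq_add// ltnW.
  apply: le_trans (_ : (size S)%:R * (eta ^+ 2 / B) <= _); last first.
    by rewrite ler_wpM2r ?(ltW ep0)// -natrM ler_nat.
  suff gen (q : seq nat) : (forall i, i \in q -> (i < N)%N) ->
    \sum_(i <- q) rip (Q i x) (Q i x) <= (size q)%:R * (eta ^+ 2 / B) by apply: gen.
  elim: q => [|i q IH] qN; first by rewrite big_nil mul0r.
  rewrite big_cons /= -natr1 mulrDl mul1r addrC; apply: lerD.
    by apply: IH => j jq; apply: qN; rewrite inE jq orbT.
  by apply/ltW/xs/qN; rewrite inE eqxx.
have [cl|cl] := clean aP PP PU FP.
  have rS : {subset r <= S} by move=> i ir; rewrite mem_undup mem_cat ir.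
  have r'S : {subset r' <= S} by move=> i ir; rewrite mem_undup mem_cat ir orbT.
  apply: wr; rewrite -(Pev h r rS) -(Pev g r' r'S).
  by apply: cl; apply: F_sum => i; apply: Fv.
have FP' x : F x -> F (x - P x) by move=> Fx; apply: (subspaceB sF) => //; apply: FP.
have near x : F x -> (forall i, (i < N)%N -> rip (Q i x) (Q i x) < eta ^+ 2 / B) ->
    expR (rip x x) * (2 * m%:R) <= B ->
    cnrm (e x - e (x - P x)) <= eta /\ cnrm (e (x - P x)) <= cnrm (e x).
  move=> Fx xs xB; set y := x - P x.
  have Fy : F y by apply: FP'.
  have pxx : rip (P x) (P x) = rip x (P x) by rewrite aP PP.
  have xy : rip x y = rip y y.
    by rewrite /y !(ipBl rh) !(ipBr rh) (ripC (P x) x) pxx; ring.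
  have xx : rip x x = rip y y + rip (P x) (P x).
    by rewrite /y !(ipBl rh) !(ipBr rh) (ripC (P x) x) pxx; ring.
  have P0 := rh_ge0 rh (P x); have Px := nP x xs.
  have eyx : expR (rip y y) <= expR (rip x x) by rewrite ler_expR; lra.
  split; last first.
    by rewrite -(@ler_pXn2r _ 2)// ?nnegrE ?cnrm_ge0// !cnrm_e.
  rewrite -(@ler_pXn2r _ 2)// ?nnegrE ?cnrm_ge0 ?(ltW eta0)//.
  rewrite (cnrm_sqrB H) !cnrm_e// eE//= xy.
  have ex : expR (rip x x) * (1 - rip (P x) (P x)) <= expR (rip y y).
    have -> : rip y y = rip x x + - rip (P x) (P x) by lra.
    rewrite expRD ler_pM2l ?expR_gt0//; exact: expR_ge1Dx.
  have h1 : expR (rip x x) * rip (P x) (P x) <= eta ^+ 2.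
    apply: le_trans (ler_wpM2l (expR_ge0 _) Px) _.
    have -> : expR (rip x x) * (2 * m%:R * (eta ^+ 2 / B)) =
        eta ^+ 2 * (expR (rip x x) * (2 * m%:R)) / B by move: B^-1 m%:R => b k; ring.
    by rewrite ler_pdivrMr//; apply: ler_wpM2l; rewrite ?sqr_ge0.
  lra.
have Bge x y : 0 <= y -> expR x * (2 * m%:R) <= (expR x + y) * (2 * m%:R) + 1.
  by move=> y0; rewrite [(expR x + y) * _]mulrDl -addrA lerDl addr_ge0// mulr_ge0// mulr_ge0.
have [|h1 h2] := near h Fh (fun i iN => (Qe i iN).1); first exact/Bge/expR_ge0.
have [|g1 g2] := near g Fg (fun i iN => (Qe i iN).2).
  by rewrite /B (addrC (expR (rip h h))); exact/Bge/expR_ge0.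
have : dl <= K * (eta * L).
  have wE : w h g = cip (W (e h - e (h - P h))) (e g) + cip (W (e (h - P h))) (e g - e (g - P g)).
    have := cl h g Fh Fg; rewrite /w => cl0.
    by rewrite (clinB _ _ lW) (cipBl H) (cipBr H) cl0 subr0 subrK.
  rewrite /dl wE; apply: le_trans (le_normcD _ _) _.
  set x1 := e h - _; set x2 := e (h - P h); set y2 := e g - _.
  have c1 := cip_CS H (W x1) (e g); have c2 := cip_CS H (W x2) y2.
  have b1 := bW x1; have b2 := bW x2.
  have p1 := cnrm_ge0 rip x1; have p2 := cnrm_ge0 rip y2; have p3 := cnrm_ge0 rip x2.
  have d1 : cnrm (W x1) * cnrm (e g) <= K * eta * cnrm (e g).
    by apply: ler_wpM2r => //; apply: le_trans b1 _; apply: ler_wpM2l.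
  have d2 : cnrm (W x2) * cnrm y2 <= K * (cnrm (e h) + 1) * eta.
    apply: ler_pM; rewrite ?cnrm_ge0//.
    by apply: le_trans b2 _; apply: ler_wpM2l => //; lra.
  rewrite /L; move: c1 c2 d1 d2; move: (normc _) (normc _) => ? ?; lra.
lra.
Qed.

Lemma intertwiner_zero x : W x = 0.
Proof.
apply: (@maps_eq _ _ rip _ rip _ eI W (fun=> 0) K 0 H te) => //.
- by move=> c p q; rewrite scaler0 addr0.
- by move=> y; rewrite (cnrm0 H) mul0r.
move=> i; suff h y : cip y (W (eI i)) = 0.
  by apply: (cnrm_eq0 H); apply/eqP; rewrite -sqrf_eq0 (sqr_cnrm H) -Re_cip h.
apply: (@maps_eq _ _ rip C^o (@sip R) _ eI (fun y => cip y (W (eI i)) : C^o) (fun=> 0)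
  (cnrm (W (eI i))) 0 (scalar_hilbert R) te) => //.
- by move=> c p q; rewrite (cipDl H) (cipZl H).
- by move=> c p q; rewrite scaler0 addr0.
- by move=> y'; rewrite cnrm_sip mulrC; apply: cip_CS.
- by move=> y'; rewrite cnrm_sip Normc.normc0 mul0r.
move=> j; rewrite (cipC H) -/(w (sval i) (sval j)) intertwiner_form_zero ?rmorph0//; exact: svalP.
Qed.

End Intertwiner.

Lemma prim_root_complex n : (0 < n)%N -> exists zeta : C, n.-primitive_root zeta.
Proof.
move=> n_gt0; pose p : {poly C} := 'X^n - 1; have [r Dp] := closed_field_poly_normal p.
rewrite (monicP _) ?monicXnsubC // scale1r in Dp.
have rn1 : all n.-unity_root r by apply/allP=> zeta; rewrite -root_prod_XsubC -Dp.
have sz_r : (n < (size r).+1)%N by rewrite -(size_prod_XsubC r id) -Dp size_XnsubC.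
have [|zeta] := hasP (has_prim_root n_gt0 rn1 _ sz_r); last by exists zeta.
by rewrite -separable_prod_XsubC -Dp separable_Xn_sub_1 // pnatr_eq0 -lt0n.
Qed.

(** With [P] the projector onto the closed span of the [U^(n k) u], the map [i |-> U^i P U^-i] has
    period [n], and [W j] is its Fourier coefficient. For [0 < j < n] it intertwines [U] with a
    nontrivial root of unity, hence is 0; so [n P = W 0] commutes with [U], and the range of [P],
    which contains [u], is everything. *)
Theorem fock_cyclic_pow n : (0 < n)%N -> total rip (fun k => U (n%:Z * k) u).
Proof.
move=> n0; pose Un k := U (n%:Z * k) u.
pose M : set E := [set y | exists s, y = comb Un s].
have cM c x y : M x -> M y -> M (c *: x + y).
  by move=> [s ->] [t ->]; exists (cscale c s ++ t); rewrite comb_cat comb_scale.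
have M0 : M 0 by exists [::]; rewrite /comb big_nil.
have sM : @subspace R RE M by split=> // a x y; apply: cM.
pose Z := @hclosure R RE rip M.
have sZ : @subspace R RE Z by exact: (hclosure_subspace rh).
have cZ : @hclosure R RE rip Z `<=` Z.
  move=> x cx f f0; have f2 : 0 < f / 2 by lra.
  have [y Zy xy] := cx _ f2; have [m Mm ym] := Zy _ f2.
  exists m => //; apply: le_lt_trans (nrm_tri rh y _ _) _; lra.
have ZA (A : E -> E) : clin A -> (forall x, cnrm (A x) = cnrm x) ->
    (forall x, M x -> M (A x)) -> forall x, Z x -> Z (A x).
  move=> lA nA MA x Zx f f0; have [m Mm xm] := Zx _ f0.
  exists (A m); first exact: MA.
  by have := nA (x - m); rewrite (clinB _ _ lA) => h; rewrite -[nrm _ _]/(cnrm _) h.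
have [P [aP PZ Pid Po Pc]] := proj_op rh sZ cZ.
have bP x : cnrm (P x) <= cnrm x.
  have := @proj_bdd R RE rip rh P aP (fun x => Pid _ (PZ x)) x.
  by rewrite mul1r.
(* [P] is only known as a real projector; stability of [Z] under ['i] makes it complex linear. *)
have Zi : forall x, Z x -> Z ('i *: x).
  apply: ZA; first by move=> c x y; rewrite scalerDr !scalerA mulrC.
    by move=> x; rewrite (cnrmZ H) /= expr0n expr1n add0r sqrtr1 mul1r.
  by move=> x Mx; rewrite -[_ *: x]addr0; apply: cM.
have Zni x : Z x -> Z (- ('i *: x)).
  by move=> /Zi Zx; have := subspaceZ (-1) sZ Zx; rewrite scaleN1r.
have Pi x : P ('i *: x) = 'i *: P x.
  apply/esym/(Pc _ (fun x => - ('i *: x))) => // p q.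
  rewrite (ipNr rh) -[in RHS](ch_i H) scalerA -expr2 sqr_i scaleN1r (ipNr rh) opprK//.
have lP : clin P.
  move=> c x y; have PD p q : P (p + q) = P p + P q.
    exact: (oplinD _ _ (opadj_oplin rh aP)).
  have PR (a : R) p : P (a%:C *: p) = a%:C *: P p.
    exact: (oplinZ _ _ (opadj_oplin rh aP)).
  have cE (p : E) : c *: p = (Re c)%:C *: p + (Im c)%:C *: ('i *: p).
    by rewrite scalerA -scalerDl {1}[c]complexE [_ * 'i]mulrC.
  by rewrite PD !cE PD !PR Pi.
have aUk (k : int) : @opadj R RE rip (U k) (U (- k)).
  by move=> x y; rewrite -!Re_cip -{1}[y](ur_id HU) -(subrr k) -(ur_add HU) (ur_ip HU).
have ZUn (k : int) x : Z x -> Z (U (n%:Z * k) x).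
  apply: ZA; [exact: (ur_lin HU)|exact: (cnrm_U HU)|].
  move=> _ [s ->]; exists [seq (p.1, k + p.2) | p <- s].
  rewrite /comb (clin_sum _ _ (ur_lin HU _)) big_map; apply: eq_bigr => p _.
  by rewrite (clinZ _ _ (ur_lin HU _)) (ur_add HU) -mulrDr.
have PUn x : U n%:Z (P x) = P (U n%:Z x).
  have := ZUn 1; have := ZUn (-1); rewrite mulr1 mulrN1 => h1 h2.
  exact: (Pc _ _ (aUk n%:Z) h2 h1).
have [zeta pz] := prim_root_complex n0.
have zn := prim_expr_order pz.
pose W (j : nat) x : E := \sum_(i < n) zeta ^+ (i * j) *: U i%:Z (P (U (- i%:Z) x)).
have lW j : clin (W j).
  move=> c x y; rewrite /W scaler_sumr -big_split/=; apply: eq_bigr => i _.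
  by rewrite (ur_lin HU) lP (ur_lin HU) scalerDr !scalerA mulrC.
have nz : normc zeta = 1.
  apply/eqP; rewrite -(@pexpr_eq1 _ _ n) ?normc_ge0//.
  suff <- : normc (zeta ^+ n) = normc zeta ^+ n by rewrite zn Normc.normc1.
  elim: (n) => [|m IH]; first by rewrite !expr0 Normc.normc1.
  by rewrite !exprS Normc.normcM IH.
have nzk k : normc (zeta ^+ k) = 1.
  by elim: k => [|k IH]; [rewrite expr0 Normc.normc1 | rewrite exprS Normc.normcM IH nz mulr1].
have bW j x : cnrm (W j x) <= n%:R * cnrm x.
  rewrite /W mulr_natl -[X in _ *+ X]card_ord -sumr_const.
  elim/big_rec2: _ => [|i a b _ h]; first by rewrite (cnrm0 H).
  apply: le_trans (cnrmD H _ _) _; apply: lerD => //.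
  rewrite (cnrmZ H) nzk mul1r (cnrm_U HU); apply: le_trans (bP _) _.
  by rewrite (cnrm_U HU).
have WU j x : zeta ^+ j *: U 1 (W j x) = W j (U 1 x).
  (* A shift of the summation index; the end terms agree because [U^n] commutes with [P] and
     [zeta^n = 1]. *)
  pose T (i : nat) := zeta ^+ (i * j) *: U i%:Z (P (U (1 - i%:Z) x)).
  have -> : W j (U 1 x) = \sum_(i < n) T i.
    by apply: eq_bigr => i _; rewrite /T (ur_add HU) addrC.
  have -> : zeta ^+ j *: U 1 (W j x) = \sum_(i < n) T i.+1.
    rewrite /W (clin_sum _ _ (ur_lin HU _)) scaler_sumr; apply: eq_bigr => i _.
    rewrite (clinZ _ _ (ur_lin HU _)) (ur_add HU) scalerA -exprD -mulSn /T.
    by rewrite -add1n PoszD opprD addrA subrr add0r.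
  have T0n : T n = T 0%N.
    rewrite /T mulnC mul0n expr0 mulnC exprM zn expr1n !scale1r (ur_id HU) subr0.
    by rewrite PUn (ur_add HU) addrC subrK.
  have e1 : \sum_(i < n.+1) T i = T 0%N + \sum_(i < n) T i.+1 by rewrite big_ord_recl.
  have e2 : \sum_(i < n.+1) T i = \sum_(i < n) T i + T n by rewrite big_ord_recr.
  by apply: (addrI (T 0%N)); rewrite -e1 e2 T0n addrC.
have W0 j x : (0 < j < n)%N -> W j x = 0.
  move=> /andP[j0 jn].
  apply: (@intertwiner_zero (W j) n%:R (zeta ^+ j)^*) => //.
  - move=> y; rewrite -WU scalerA conjM_normc nzk expr1n scale1r//.
  - apply/eqP => /(congr1 conjc); rewrite conjcK rmorph1 => /eqP.
    by rewrite -(prim_order_dvd pz) gtnNdvd.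
  - by rewrite conjcK mulrC conjM_normc nzk expr1n.
have avg x : (n%:R : C) *: (P x : E) = W 0%N x.
  have -> : W 0%N x = \sum_(j < n) W j x.
    rewrite -(big_mkord xpredT (fun j => W j x)) big_ltn// big_nat big1 ?addr0//.
    by move=> j /W0.
  (* Summing over [j] first leaves only [i = 0], by orthogonality of the powers of [zeta]. *)
  pose f i := \sum_(j < n) zeta ^+ (i * j) *: U i%:Z (P (U (- i%:Z) x)).
  have -> : \sum_(j < n) W j x = \sum_(i < n) f i by rewrite /W exchange_big.
  rewrite -(big_mkord xpredT f) big_ltn// big_nat big1 ?addr0.
    rewrite /f; under eq_bigr do rewrite mul0n expr0 scale1r oppr0 !(ur_id HU).
    by rewrite sumr_const card_ord scaler_nat.
  move=> i /andP[i0 ilt]; rewrite /f -scaler_suml; set q := zeta ^+ i.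
  have -> : \sum_(j < n) zeta ^+ (i * j) = \sum_(j < n) q ^+ j.
    by apply: eq_bigr => j _; rewrite exprM.
  have q1 : q != 1 by rewrite /q -(prim_order_dvd pz) gtnNdvd.
  have /eqP := subrX1 q n; rewrite -exprM mulnC exprM zn expr1n subrr eq_sym mulf_eq0.
  by rewrite subr_eq0 (negbTE q1)/= => /eqP ->; rewrite scale0r.
have PU x : U 1 (P x) = P (U 1 x).
  have n1 : (n%:R : C) != 0 by rewrite pnatr_eq0 -lt0n.
  by apply: (scalerI n1); rewrite -[_ *: U 1 _](clinZ _ _ (ur_lin HU 1)) !avg -WU expr0 scale1r.
have PU' x : U (-1) (P x) = P (U (-1) x).
  by rewrite -{1}[x]U1V -PU UV1.
have Zu : Z u.
  apply: (sub_hclosure rh); exists [:: (1, 0)].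
  by rewrite /comb big_seq1 scale1r /Un mulr0 (ur_id HU).
have ZU k : Z (U k u).
  suff -> : U k u = P (U k u) by apply: PZ.
  elim/int_ind: k => [|m IH|m IH]; first by rewrite (ur_id HU) Pid.
    by rewrite -add1n PoszD -(ur_add HU) {1}IH PU.
  by rewrite -add1n PoszD opprD -(ur_add HU) {1}IH PU'.
move=> x f f0; have [s xs] := tu x f0.
suff : Z x by move=> /(_ _ f0)[_ [t ->] xt]; exists t.
have cZl (c : C) (p q : E) : Z p -> Z q -> Z (c *: p + q).
  move=> Zp Zq g g0; have c1 : 0 < normc c + 1 by have := normc_ge0 c; lra.
  have g2 : 0 < g / 2 by lra.
  have [m Mm pm] := Zp _ (divr_gt0 g2 c1); have [l Ml ql] := Zq _ g2.
  exists (c *: m + l); first exact: cM.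
  rewrite -[nrm _ _]/(cnrm (c *: p + q - (c *: m + l))) opprD addrACA -scalerBr.
  apply: le_lt_trans (cnrmD H _ _) _; rewrite (cnrmZ H).
  rewrite -[nrm _ _]/(cnrm (p - m)) ltr_pdivlMr// in pm.
  rewrite -[nrm _ _]/(cnrm (q - l)) in ql.
  have := cnrm_ge0 rip (p - m); have := normc_ge0 c; nra.
apply: cZ => g g0; have [t xt] := tu x g0; exists (comb (U^~ u) t); last exact: xt.
elim: t {xt} => [|p t IH]; first by rewrite /comb big_nil; case: sZ.
by rewrite /comb big_cons; apply: cZl.
Qed.

End Fock.

(** * L^2 spaces and Koopman operators *)

Section AlmostEverywhere.
Variables (R : realType) (d : measure_display) (X : measurableType d).
Variable mu : probability X R.

Lemma aeT (P : X -> Prop) : (forall x, P x) -> ae_prop mu P.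
Proof. by move=> h; exists set0; split=> //; split=> //; exact: measure0. Qed.

Lemma ae_imp (P Q : X -> Prop) : (forall x, P x -> Q x) -> ae_prop mu P -> ae_prop mu Q.
Proof. by move=> h [N [mN [N0 hN]]]; exists N; split=> //; split=> // x /hN/h. Qed.

Lemma ae_all (P : nat -> X -> Prop) : (forall n, ae_prop mu (P n)) ->
  ae_prop mu (fun x => forall n, P n x).
Proof.
move=> /choice[N hN]; exists (\bigcup_n N n); split.
  by apply: bigcup_measurable => n _; case: (hN n).
split; last by move=> x nx n; have [_ [_]] := hN n; apply=> nn; apply: nx; exists n.
have mU : measurable (\bigcup_n N n) by apply: bigcup_measurable => n _; case: (hN n).
apply/(negligibleP mu mU)/negligible_bigcup => n.
by have [mN [N0 _]] := hN n; apply/negligibleP.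
Qed.

Lemma ae_and (P Q : X -> Prop) : ae_prop mu P -> ae_prop mu Q ->
  ae_prop mu (fun x => P x /\ Q x).
Proof.
move=> hP hQ; have := @ae_all (fun n => if n is 0 then P else Q).
case=> [[|n]//|N [mN [N0 h]]]; exists N; split=> //; split=> // x /h a.
by split; [exact: (a 0%N) | exact: (a 1%N)].
Qed.

Lemma ae_and3 (P Q S : X -> Prop) : ae_prop mu P -> ae_prop mu Q -> ae_prop mu S ->
  ae_prop mu (fun x => [/\ P x, Q x & S x]).
Proof.
by move=> hP hQ hS; apply: ae_imp (ae_and hP (ae_and hQ hS)) => x [? []].
Qed.

Lemma ae_lib (P : X -> Prop) : ae_prop mu P -> {ae mu, forall x, P x}.
Proof.
move=> [N [mN [N0 h]]]; exists N; split=> // x /= nP.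
by apply: contrapT => nN; apply: nP; apply: h.
Qed.

Lemma lib_ae (P : X -> Prop) : {ae mu, forall x, P x} -> ae_prop mu P.
Proof.
move=> [N [mN N0 h]]; exists N; split=> //; split=> // x nN.
by apply: contrapT => nP; apply: nN; apply: h.
Qed.

Lemma mpreserving_ae (f : X -> X) (P : X -> Prop) : mpreserving mu f ->
  ae_prop mu P -> ae_prop mu (fun x => P (f x)).
Proof.
move=> [mf pf] [N [mN [N0 h]]]; exists (f @^-1` N); split.
  by rewrite -[f @^-1` N]setTI; exact: mf.
by rewrite pf//; split=> // x nN; apply: h.
Qed.

Lemma ae_eq_measure (A B : set X) : measurable A -> measurable B ->
  ae_prop mu (fun x => A x <-> B x) -> mu A = mu B.
Proof.
move=> mA mB [N [mN [N0 h]]].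
have hN (S : set X) : measurable S -> mu S = mu (S `\` N).
  move=> mS; have SN0 : mu (S `&` N) = 0%E.
    apply/eqP; rewrite -measure_le0 -N0; apply: le_measure; rewrite ?inE//.
    exact: measurableI.
  have mI : measurable (S `&` N) by exact: measurableI.
  have mD : measurable (S `\` N) by exact: measurableD.
  have dj : (S `&` N) `&` (S `\` N) = set0 by apply/seteqP; split=> x // [[_ Nx] []].
  by have := measureU mu mI mD dj; rewrite setUIDK => ->; rewrite [X in (X + _)%E]SN0 add0e.
rewrite (hN A)// (hN B)//; congr (mu _); apply/seteqP; split=> x [Sx nN]; split=> //.
  by apply/(h x nN).
by apply/(h x nN).
Qed.

End AlmostEverywhere.

(** * Integrals under measure-preserving maps *)

Section Transfer.
Variables (R : realType) (d d' : measure_display) (X : measurableType d).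
Variables (Y : measurableType d') (m : {measure set X -> \bar R}).
Variables (nu : {measure set Y -> \bar R}) (phi : X -> Y).
Hypotheses (mphi : measurable_fun setT phi).
Hypothesis pphi : forall A, measurable A -> m (phi @^-1` A) = nu A.

Lemma transfer_ge0_integral (g : Y -> \bar R) : measurable_fun setT g ->
  (forall x, 0 <= g x)%E -> (\int[m]_x g (phi x) = \int[nu]_x g x)%E.
Proof.
move=> mg g0.
pose T : {mfun X >-> Y} := HB.pack phi (isMeasurableFun.Build _ _ _ _ _ mphi).
transitivity (\int[pushforward m T]_x g x)%E; last first.
  by apply: eq_measure_integral => A mA _; apply: pphi.
by rewrite (ge0_integral_pushforward mphi) ?preimage_setT// => x _.
Qed.

Lemma transfer_integral (f : Y -> R) : nu.-integrable setT (EFin \o f) ->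
  m.-integrable setT (EFin \o (fun x => f (phi x))) /\
  fine (\int[m]_x (f (phi x))%:E)%E = fine (\int[nu]_x (f x)%:E)%E.
Proof.
move=> f1; have mf := measurable_int nu f1.
have i1 : m.-integrable setT (EFin \o (fun x => f (phi x))).
  apply/integrableP; split; first exact: (measurableT_comp mf mphi).
  move/integrableP: f1 => [_]; rewrite -(transfer_ge0_integral (g := fun x => `|(f x)%:E|)%E)//.
  exact: measurableT_comp.
split=> //; congr fine.
pose T : {mfun X >-> Y} := HB.pack phi (isMeasurableFun.Build _ _ _ _ _ mphi).
transitivity (\int[pushforward m T]_x (f x)%:E)%E; last first.
  by apply: eq_measure_integral => A mA _; apply: pphi.
by rewrite (integral_pushforward mphi) ?preimage_setT.
Qed.

End Transfer.

Section RealL2.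
Variables (R : realType) (d : measure_display) (X : measurableType d).
Variable mu : probability X R.
Local Notation Int f := (mu.-integrable setT (EFin \o f)).
Definition rI (f : X -> R) : R := fine (\int[mu]_x (f x)%:E)%E.

Lemma int_meas (f : X -> R) : Int f -> measurable_fun setT f.
Proof. by move=> /(measurable_int mu)/measurable_EFinP. Qed.

Lemma intD (f g : X -> R) : Int f -> Int g -> Int (fun x => f x + g x).
Proof. by move=> f1 g1; have := integrableD measurableT f1 g1; apply: eq_integrable. Qed.

Lemma intZ (c : R) (f : X -> R) : Int f -> Int (fun x => c * f x).
Proof. by move=> f1; have := integrableZl measurableT c f1; apply: eq_integrable. Qed.

Lemma intB (f g : X -> R) : Int f -> Int g -> Int (fun x => f x - g x).
Proof. by move=> f1 g1; have := integrableB measurableT f1 g1; apply: eq_integrable. Qed.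

Lemma int_le (f g : X -> R) : measurable_fun setT f -> (forall x, `|f x| <= g x) -> Int g -> Int f.
Proof.
move=> mf fg; apply: le_integrable => //; first exact/measurable_EFinP.
by move=> x _ /=; rewrite lee_fin (le_trans (fg x))// ler_norm.
Qed.

Lemma int_cst (c : R) : Int (fun=> c).
Proof. exact: finite_measure_integrable_cst. Qed.

Lemma int_bdd (f : X -> R) (c : R) : measurable_fun setT f -> (forall x, `|f x| <= c) -> Int f.
Proof. by move=> mf fc; apply: (int_le mf fc); exact: int_cst. Qed.

Lemma rID (f g : X -> R) : Int f -> Int g -> rI (fun x => f x + g x) = rI f + rI g.
Proof. exact: RintegralD. Qed.

Lemma rIB (f g : X -> R) : Int f -> Int g -> rI (fun x => f x - g x) = rI f - rI g.
Proof. exact: RintegralB. Qed.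

Lemma rIZ (c : R) (f : X -> R) : Int f -> rI (fun x => c * f x) = c * rI f.
Proof. exact: RintegralZl. Qed.

Lemma rI_ge0 (f : X -> R) : (forall x, 0 <= f x) -> 0 <= rI f.
Proof. by move=> f0; apply: Rintegral_ge0. Qed.

Lemma rI_le (f g : X -> R) : Int f -> Int g -> (forall x, f x <= g x) -> rI f <= rI g.
Proof. by move=> *; apply: le_Rintegral. Qed.

Lemma rI_cst (c : R) : rI (fun=> c) = c.
Proof.
transitivity (c * fine (mu setT)); last by rewrite probability_setT mulr1.
exact: Rintegral_cst.
Qed.

Lemma rIE (f : X -> R) : Int f -> ((rI f)%:E = \int[mu]_x (f x)%:E)%E.
Proof. by move=> f1; rewrite /rI fineK//; exact: integrable_fin_num. Qed.

Lemma rI_indic A : measurable A -> rI (fun x => \1_A x) = fine (mu A).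
Proof. by move=> mA; rewrite /rI integral_indic// setIT. Qed.

Lemma int_ae (f g : X -> R) : measurable_fun setT g -> ae_prop mu (fun x => f x = g x) -> Int f ->
  Int g /\ rI f = rI g.
Proof.
move=> mg fg f1; have mf := int_meas f1.
have fg' : ae_eq mu setT (EFin \o f) (EFin \o g).
  by have := ae_lib fg; apply: filterS => x /= -> _.
have e1 : (\int[mu]_x (f x)%:E = \int[mu]_x (g x)%:E)%E.
  by apply: (@ae_eq_integral _ _ _ mu setT (EFin \o g) (EFin \o f)) => //; exact/measurable_EFinP.
split; last by rewrite /rI e1.
apply/integrableP; split; first exact/measurable_EFinP.
move/integrableP: f1 => [_]; congr (_ < _)%E.
apply: ge0_ae_eq_integral => //; try by apply/measurableT_comp/measurable_EFinP.
by have := ae_lib fg; apply: filterS => x /= -> _.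
Qed.

Lemma sq_int_sqr (f : X -> R) : sq_int mu f -> Int (fun x => f x ^+ 2).
Proof.
move=> [mf f2]; apply/integrableP; split.
  by apply/measurable_EFinP; exact: measurable_funX.
by under eq_integral do rewrite /= ger0_norm ?sqr_ge0//.
Qed.

Lemma int_sq_int (f : X -> R) : measurable_fun setT f -> Int (fun x => f x ^+ 2) -> sq_int mu f.
Proof.
move=> mf /integrableP[_ h]; split=> //; apply: le_lt_trans h.
by under [leRHS]eq_integral do rewrite /= ger0_norm ?sqr_ge0//.
Qed.

Lemma sq_intM (f g : X -> R) : sq_int mu f -> sq_int mu g -> Int (fun x => f x * g x).
Proof.
move=> f2 g2; apply: (@int_le _ (fun x => f x ^+ 2 + g x ^+ 2)).
- by apply: measurable_funM; [case: f2 | case: g2].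
- move=> x; rewrite normrM; have := sqr_ge0 (`|f x| - `|g x|).
  rewrite -[f x ^+ 2]real_normK ?num_real// -[g x ^+ 2]real_normK ?num_real//.
  have := normr_ge0 (f x); have := normr_ge0 (g x); nra.
- by apply: intD; apply: sq_int_sqr.
Qed.

Lemma sq_intD (f g : X -> R) : sq_int mu f -> sq_int mu g -> sq_int mu (fun x => f x + g x).
Proof.
move=> f2 g2; have mfg : measurable_fun setT (fun x => f x + g x).
  by apply: measurable_funD; [case: f2 | case: g2].
apply: int_sq_int => //; have := intD (sq_int_sqr f2) (sq_int_sqr g2).
move=> /(intD (intZ 2 (sq_intM f2 g2))); apply: eq_integrable => // x _ /=.
by congr EFin; ring.
Qed.

Lemma sq_intZ (c : R) (f : X -> R) : sq_int mu f -> sq_int mu (fun x => c * f x).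
Proof.
move=> f2; apply: int_sq_int; first by apply: measurable_funM => //; case: f2.
have := intZ (c ^+ 2) (sq_int_sqr f2); apply: eq_integrable => // x _ /=.
by rewrite exprMn.
Qed.

Lemma sq_intB (f g : X -> R) : sq_int mu f -> sq_int mu g -> sq_int mu (fun x => f x - g x).
Proof.
move=> f2 g2; have := sq_intD f2 (sq_intZ (-1) g2).
by under eq_fun do rewrite mulN1r.
Qed.

Lemma sq_int_bdd (f : X -> R) (c : R) : measurable_fun setT f -> (forall x, `|f x| <= c) -> sq_int mu f.
Proof.
move=> mf fc; apply: int_sq_int => //.
apply: (@int_bdd _ (c ^+ 2)); first exact: measurable_funX.
by move=> x; rewrite normrX ler_pXn2r ?nnegrE ?normr_ge0// (le_trans _ (fc x)).
Qed.

Lemma sq_int_cst (c : R) : sq_int mu (fun=> c).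
Proof. exact: (@sq_int_bdd _ `|c|). Qed.

Lemma sq_int_int (f : X -> R) : sq_int mu f -> Int f.
Proof.
move=> f2; have := sq_intM f2 (sq_int_cst 1); apply: eq_integrable => // x _ /=.
by rewrite mulr1.
Qed.

Lemma sq_int_ae (f g : X -> R) : measurable_fun setT g -> ae_prop mu (fun x => f x = g x) ->
  sq_int mu f -> sq_int mu g.
Proof.
move=> mg fg f2; apply: int_sq_int => //.
have [] := @int_ae (fun x => f x ^+ 2) (fun x => g x ^+ 2) => //.
- exact: measurable_funX.
- by apply: ae_imp fg => x ->.
- exact: sq_int_sqr.
Qed.

Lemma rI_sqr_eq0 (f : X -> R) : sq_int mu f -> rI (fun x => f x ^+ 2) = 0 -> ae_prop mu (fun x => f x = 0).
Proof.
move=> f2 f0; have [mf _] := f2.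
have h : (\int[mu]_x `|(f x ^+ 2)%:E| = 0)%E.
  under eq_integral do rewrite /= ger0_norm ?sqr_ge0//.
  by rewrite -(rIE (sq_int_sqr f2)) f0.
have mf2 : measurable_fun setT (EFin \o (fun x => f x ^+ 2)).
  by apply/measurable_EFinP; exact: measurable_funX.
have [+ _] := ae_eq_integral_abs mu measurableT mf2.
move=> /(_ h)[N [mN N0 hN]]; apply: lib_ae; exists N; split=> // x /= nf.
apply: hN => /= /(_ I)[/eqP]; rewrite sqrf_eq0 => /eqP; exact: nf.
Qed.

Lemma rI_mpreserving (T : X -> X) (f : X -> R) : mpreserving mu T -> Int f ->
  Int (fun x => f (T x)) /\ rI (fun x => f (T x)) = rI f.
Proof. by move=> [mT pT]; apply: transfer_integral. Qed.

End RealL2.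

(** * Completeness of the real L^2 *)

Section RieszFischer.
Variables (R : realType) (d : measure_display) (X : measurableType d).
Variable mu : probability X R.
Local Notation rI := (rI mu).

Lemma limn_einf_le (u : nat -> \bar R) (c : \bar R) N :
  (forall n, (N <= n)%N -> (u n <= c)%E) -> (limn_einf u <= c)%E.
Proof.
move=> uc; rewrite limn_einf_lim; apply: lime_le; first exact: is_cvg_einfs.
near=> n; apply: le_trans (uc n _); last by near: n; exists N.
by apply: ereal_inf_lbound; exists n => /=.
Unshelve. all: by end_near. Qed.

(** Consecutive terms of the subsequence are at [L^2] distance below [2^-k], hence at [L^1] distance
    at most [2^-k]; the series of absolute increments is integrable, so finite almost everywhere. *)
Lemma subseq_cauchy (g : nat -> X -> R) : (forall n, sq_int mu (g n)) ->
  (forall e, 0 < e -> exists N, forall m n, (N <= m)%N -> (N <= n)%N ->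
     rI (fun x => (g m x - g n x) ^+ 2) < e) ->
  exists psi : nat -> nat, (forall k, (k <= psi k)%N) /\
    ae_prop mu (fun x => cvgn (fun k => g (psi k) x)).
Proof.
move=> g2 cg.
have /choice[phi phiP] k : exists N, forall m n, (N <= m)%N -> (N <= n)%N ->
    rI (fun x => (g m x - g n x) ^+ 2) < (2^-1 ^+ k) ^+ 2.
  by apply: cg; rewrite !exprn_gt0// invr_gt0.
(* The sum makes [psi] nondecreasing while keeping it above both [k] and [phi k]. *)
pose psi k := (k + \sum_(i < k.+1) phi i)%N.
have psik k : (k <= psi k)%N by apply: leq_addr.
have phi_psi k : (phi k <= psi k)%N.
  by rewrite /psi big_ord_recr/= addnA leq_addl.
have psiS k : (psi k <= psi k.+1)%N.
  by rewrite /psi [X in (_ <= _ + X)%N]big_ord_recr/= leq_add// leq_addr.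
exists psi; split=> //.
pose D k x := g (psi k.+1) x - g (psi k) x.
have D2 k : sq_int mu (D k) by apply: sq_intB.
have mD k : measurable_fun setT (D k) by case: (D2 k).
(* From [|D| <= c / 2 + D^2 / (2 c)] with [c = 2^-k]. *)
have iD k : (\int[mu]_x `|D k x|%:E <= (2^-1 ^+ k)%:E)%E.
  set c : R := 2^-1 ^+ k; have c0 : 0 < c by rewrite exprn_gt0// invr_gt0.
  have iabs : mu.-integrable setT (EFin \o (fun x => `|D k x|)).
    apply: (@int_le _ _ _ mu _ (fun x => 1 + D k x ^+ 2)).
    - exact: measurableT_comp.
    - move=> x; rewrite normr_id -[D k x ^+ 2]real_normK ?num_real//.
      by have := sqr_ge0 (`|D k x| - 1); have := normr_ge0 (D k x); nra.
    - by apply: intD; [exact: int_cst|exact: sq_int_sqr].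
  have ir : mu.-integrable setT (EFin \o (fun x => 2^-1 * c + (2 * c)^-1 * D k x ^+ 2)).
    by apply: intD; [exact: int_cst|apply: intZ; exact: sq_int_sqr].
  rewrite -(rIE iabs) lee_fin; apply: le_trans (_ : rI (fun x => 2^-1 * c + (2 * c)^-1 * D k x ^+ 2) <= _).
    apply: rI_le => // x; rewrite -[D k x ^+ 2]real_normK ?num_real//.
    rewrite -subr_ge0 (_ : _ - _ = (`|D k x| - c) ^+ 2 * (2 * c)^-1); last by field; rewrite gt_eqF.
    by rewrite mulr_ge0 ?sqr_ge0// invr_ge0 mulr_ge0// ltW.
  rewrite rID ?rIZ ?rI_cst; try exact: sq_int_sqr; try exact: int_cst;
    last by apply: intZ; exact: sq_int_sqr.
  have : rI (fun x => D k x ^+ 2) < c ^+ 2.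
    by apply: phiP; rewrite (leq_trans (phi_psi k)).
  move=> h; have : (2 * c)^-1 * rI (fun x => D k x ^+ 2) <= 2^-1 * c.
    rewrite -[leRHS](_ : (2 * c)^-1 * c ^+ 2 = _); last by field; rewrite gt_eqF.
    by rewrite ler_wpM2l ?(ltW h)// invr_ge0 mulr_ge0// ltW.
  lra.
pose S x : \bar R := (\sum_(k <oo) `|D k x|%:E)%E.
have mS : measurable_fun setT S.
  apply: ge0_emeasurable_sum => [k x _ _|k _]; first by rewrite lee_fin.
  by apply/measurable_EFinP; exact: measurableT_comp.
have iS : mu.-integrable setT S.
  apply/integrableP; split=> //.
  have -> : (\int[mu]_x `|S x| = \int[mu]_x S x)%E.
    by apply: eq_integral => x _; rewrite gee0_abs// nneseries_ge0// => k _ _; rewrite lee_fin.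
  rewrite integral_nneseries//; last first.
    by move=> k; apply/measurable_EFinP; exact: measurableT_comp.
  apply: le_lt_trans (_ : \sum_(k <oo) (2^-1 ^+ k)%:E < +oo)%E.
    apply: lee_nneseries => [k _ _|k _]; last exact: iD.
    by apply: integral_ge0 => x _; rewrite lee_fin.
  have -> : (\sum_(k <oo) (2^-1 ^+ k)%:E = (2 : R)%:E)%E.
    apply/cvg_lim => //.
    have -> : (fun n => \sum_(0 <= k < n) (2^-1 ^+ k)%:E)%E =
        EFin \o (series (geometric 1 (2^-1 : R))).
      apply/funext => n /=; rewrite /series/= sumEFin; congr EFin.
      by apply: eq_bigr => k _; rewrite /geometric/= mul1r.
    apply: cvg_EFin; first by near=> n.
    have h : `|2^-1 : R| < 1 by rewrite ger0_norm//; lra.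
    have := @cvg_geometric_series R 1 2^-1 h.
    by rewrite (_ : 1 / (1 - 2^-1) = 2 :> R)//; field.
  exact: ltry.
have := integrable_ae measurableT iS => /lib_ae; apply: ae_imp => x /(_ I) Sx.
have cs : cvgn [normed series (D^~ x)].
  apply: nondecreasing_is_cvgn.
    by apply: (@nondecreasing_series R (fun k => `|D k x|) xpredT 0%N) => k _ _; exact: normr_ge0.
  exists (fine (S x)) => _ [n _ <-]; rewrite -lee_fin fineK// /series/= -sumEFin.
  by apply: nneseries_lim_ge => k _ _; rewrite lee_fin.
have {}cs := normed_cvg cs.
have -> : (fun k => g (psi k) x) = (fun k => g (psi 0%N) x + series (D^~ x) k).
  apply/funext => k; rewrite /series/= telescope_sumr//.
  by rewrite addrC subrK.
by apply: is_cvgD => //; exact: is_cvg_cst.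
Unshelve. all: by end_near. Qed.

Lemma real_L2_complete (g : nat -> X -> R) : (forall n, sq_int mu (g n)) ->
  (forall e, 0 < e -> exists N, forall m n, (N <= m)%N -> (N <= n)%N ->
     rI (fun x => (g m x - g n x) ^+ 2) < e) ->
  exists2 l, sq_int mu l & forall e, 0 < e -> exists N, forall n, (N <= n)%N ->
     rI (fun x => (g n x - l x) ^+ 2) < e.
Proof.
move=> g2 cg; have [psi [psik [N0 [mN [muN cvN]]]]] := subseq_cauchy g2 cg.
(* Killing the null set makes the subsequence converge everywhere, so its limit is measurable. *)
pose h k x := g (psi k) x * \1_(~` N0) x.
have hE k : ae_prop mu (fun x => h k x = g (psi k) x).
  exists N0; split=> //; split=> // x nx; rewrite /h indicE mem_set//= mulr1//.
have mh k : measurable_fun setT (h k).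
  apply: measurable_funM; first by case: (g2 (psi k)).
  by apply: measurable_indic; exact: measurableC.
pose l x := limn (fun k => h k x).
have hl x : h^~ x @ \oo --> l x.
  have [Nx|nx] := pselect (N0 x).
    have -> : h^~ x = fun=> 0.
      by apply/funext => k; rewrite /h indicE memNset ?mulr0//=; apply.
    by rewrite /l (_ : (fun k => h k x) = fun=> 0) ?lim_cst//; [exact: cvg_cst|
      by apply/funext => k; rewrite /h indicE memNset ?mulr0//=; apply].
  have -> : h^~ x = (fun k => g (psi k) x).
    by apply/funext => k; rewrite /h indicE mem_set// mulr1.
  rewrite /l (_ : (fun k => h k x) = (fun k => g (psi k) x)); first exact: cvN.
  by apply/funext => k; rewrite /h indicE mem_set// mulr1.
have ml : measurable_fun setT l by apply: (measurable_fun_cvg (h := h)) => // x _.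
(* Fatou's lemma along the subsequence. *)
have key e N m : (forall m n, (N <= m)%N -> (N <= n)%N ->
     rI (fun x => (g m x - g n x) ^+ 2) < e) -> (N <= m)%N ->
    (\int[mu]_x ((g m x - l x) ^+ 2)%:E <= e%:E)%E.
  move=> hN Nm; have mgh k : measurable_fun setT (fun x => (g m x - h k x) ^+ 2).
    by apply: measurable_funX; apply: measurable_funB => //; case: (g2 m).
  have := @fatou _ _ _ mu setT measurableT (fun k x => ((g m x - h k x) ^+ 2)%:E)
    (fun k => proj2 (measurable_EFinP _ _) (mgh k))
    (fun k x _ => ltac:(by rewrite lee_fin sqr_ge0)).
  have -> : (\int[mu]_x limn_einf (fun k => ((g m x - h k x) ^+ 2)%:E) =
      \int[mu]_x ((g m x - l x) ^+ 2)%:E)%E.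
    apply: eq_integral => x _; apply: (fun u l h => (@cvg_limn_einf_sup R u l h).1).
    apply: cvg_EFin; first by near=> n.
    apply: (@cvg_comp _ _ _ (fun k => g m x - h k x) (fun y => y ^+ 2) _ (nbhs (g m x - l x))).
      by apply: cvgB; [exact: cvg_cst|exact: hl].
    by apply: exprn_continuous.
  move=> fa; apply: le_trans fa _; apply: (@limn_einf_le _ _ N) => k Nk.
  have [i1 e1] := @int_ae _ _ _ mu (fun x => (g m x - g (psi k) x) ^+ 2) (fun x => (g m x - h k x) ^+ 2)
     (mgh k) ltac:(by apply: ae_imp (hE k) => x ->) (sq_int_sqr (sq_intB (g2 m) (g2 (psi k)))).
  rewrite -(rIE i1) -e1 lee_fin ltW//; apply: hN => //.
  exact: leq_trans Nk (psik k).
have l2 : sq_int mu l.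
  have [N hN] := cg 1 ltr01.
  have gl : sq_int mu (fun x => g N x - l x).
    split; first by apply: measurable_funB => //; case: (g2 N).
    by apply: le_lt_trans (key _ _ _ hN (leqnn _)) _; rewrite ltry.
  by have := sq_intB (g2 N) gl; under eq_fun do rewrite subKr.
exists l => // e e0; have e2 : 0 < e / 2 by lra.
have [N hN] := cg _ e2; exists N => n Nn.
have := key _ _ _ hN Nn; rewrite -(rIE (sq_int_sqr (sq_intB (g2 n) l2))) lee_fin; lra.
Unshelve. all: by end_near. Qed.

End RieszFischer.

(** * The complex L^2 as a Hilbert space *)

Section ComplexL2.
Variables (R : realType) (d : measure_display) (X : measurableType d).
Variable mu : probability X R.
Local Notation C := R[i].
Local Notation rI := (rI mu).

Definition l2fun (f : X -> C) :=
  sq_int mu (fun x => Re (f x)) /\ sq_int mu (fun x => Im (f x)).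

Definition aeq (f g : X -> C) := ae_prop mu (fun x => f x = g x).

Lemma aeq_refl f : aeq f f. Proof. exact: aeT. Qed.
Lemma aeq_sym f g : aeq f g -> aeq g f. Proof. exact: ae_imp. Qed.
Lemma aeq_trans f g h : aeq f g -> aeq g h -> aeq f h.
Proof. by move=> fg gh; apply: ae_imp (ae_and fg gh) => x [-> ->]. Qed.

Lemma l2fun0 : l2fun (fun=> 0).
Proof. by split; exact: sq_int_cst. Qed.

Lemma l2funD f g : l2fun f -> l2fun g -> l2fun (fun x => f x + g x).
Proof.
move=> [f1 f2] [g1 g2]; split.
  by rewrite (_ : (fun x => _) = (fun x => Re (f x) + Re (g x))); [exact: sq_intD|
    apply/funext => x; rewrite raddfD].
by rewrite (_ : (fun x => _) = (fun x => Im (f x) + Im (g x))); [exact: sq_intD|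
    apply/funext => x; rewrite raddfD].
Qed.

Lemma ReM (a b : C) : Re (a * b) = Re a * Re b - Im a * Im b.
Proof. by case: a b => [a1 a2] [b1 b2]. Qed.
Lemma ImM (a b : C) : Im (a * b) = Re a * Im b + Im a * Re b.
Proof. by case: a b => [a1 a2] [b1 b2]. Qed.

Lemma l2funZ (c : C) f : l2fun f -> l2fun (fun x => c * f x).
Proof.
move=> [f1 f2]; split.
  rewrite (_ : (fun x => _) = (fun x => Re c * Re (f x) - Im c * Im (f x))).
    by apply: sq_intB; apply: sq_intZ.
  by apply/funext => x; rewrite ReM.
rewrite (_ : (fun x => _) = (fun x => Re c * Im (f x) + Im c * Re (f x))).
  by apply: sq_intD; apply: sq_intZ.
by apply/funext => x; rewrite ImM.
Qed.

(** A chosen representative for each class of almost everywhere equality; keeping only these makes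
    equality in [L2C] Leibniz equality, as the algebraic structures require. *)
Definition l2rep (f : X -> C) : X -> C := xget (fun=> 0) [set g | l2fun g /\ aeq f g].

Lemma l2repP f : l2fun f -> l2fun (l2rep f) /\ aeq f (l2rep f).
Proof.
move=> f2; have := @xgetPex _ (fun=> 0) [set g | l2fun g /\ aeq f g].
by apply; exists f; split=> //; exact: aeq_refl.
Qed.

Lemma l2rep_eq f g : aeq f g -> l2rep f = l2rep g.
Proof.
move=> fg; congr (xget _ _); apply/seteqP; split=> h [h2 e]; split=> //.
  exact: aeq_trans (aeq_sym fg) e.
exact: aeq_trans fg e.
Qed.

Record L2C := MkL2C { l2val :> X -> C; l2valP : l2fun l2val /\ l2rep l2val = l2val }.

HB.instance Definition _ := gen_eqMixin L2C.
HB.instance Definition _ := gen_choiceMixin L2C.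

Lemma l2_l2fun (x : L2C) : l2fun x. Proof. by case: (l2valP x). Qed.

Lemma l2_eq (x y : L2C) : aeq x y -> x = y.
Proof.
move=> /l2rep_eq; case: x y => [x hx] [y hy] /=; have [_ ->] := hx; have [_ ->] := hy.
move=> xy; case: _ / xy hy => hy; congr MkL2C; exact: Prop_irrelevance.
Qed.

Lemma l2rep_proof f : l2fun f -> l2fun (l2rep f) /\ l2rep (l2rep f) = l2rep f.
Proof. by move=> /l2repP[h e]; split=> //; rewrite -(l2rep_eq e). Qed.

(** Total in [f], with the class of 0 outside [L^2], so that terms carry no proof of square
    integrability. *)
Definition cls (f : X -> C) : L2C :=
  match pselect (l2fun f) with
  | left h => MkL2C (l2rep_proof h)
  | right _ => MkL2C (l2rep_proof l2fun0)
  end.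

Lemma clsE f : l2fun f -> aeq (cls f) f.
Proof.
rewrite /cls; case: pselect => // h _ /=; apply: aeq_sym.
by have [] := l2repP h.
Qed.

Lemma cls_eq f g : l2fun f -> l2fun g -> aeq f g -> cls f = cls g.
Proof.
move=> f2 g2 fg; apply: l2_eq; apply: aeq_trans (clsE f2) _.
by apply: aeq_trans fg _; apply/aeq_sym/clsE.
Qed.

Lemma cls_val (x : L2C) : cls x = x.
Proof. by apply: l2_eq; apply: clsE; exact: l2_l2fun. Qed.

Definition l2add (x y : L2C) : L2C := cls (fun s => x s + y s).
Definition l2opp (x : L2C) : L2C := cls (fun s => -1 * x s).
Definition l2scale (c : C) (x : L2C) : L2C := cls (fun s => c * x s).

Lemma l2addE x y : aeq (l2add x y) (fun s => x s + y s).
Proof. by apply: clsE; apply: l2funD; exact: l2_l2fun. Qed.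
Lemma l2scaleE c x : aeq (l2scale c x) (fun s => c * x s).
Proof. by apply: clsE; apply: l2funZ; exact: l2_l2fun. Qed.
Lemma l2oppE x : aeq (l2opp x) (fun s => -1 * x s).
Proof. by apply: clsE; apply: l2funZ; exact: l2_l2fun. Qed.
Lemma cls0E : aeq (cls (fun=> 0)) (fun=> 0).
Proof. exact: clsE l2fun0. Qed.

Lemma l2addA : associative l2add.
Proof.
move=> x y z; apply: l2_eq; apply: aeq_trans (l2addE _ _) _.
apply: aeq_sym; apply: aeq_trans (l2addE _ _) _.
by apply: ae_imp (ae_and (l2addE x y) (l2addE y z)) => s [-> ->]; rewrite addrA.
Qed.
Lemma l2addC : commutative l2add.
Proof. by move=> x y; congr cls; apply/funext => s; rewrite addrC. Qed.
Lemma l2add0 : left_id (cls (fun=> 0)) l2add.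
Proof.
move=> x; apply: l2_eq; apply: aeq_trans (l2addE _ _) _.
by apply: ae_imp cls0E => s ->; rewrite add0r.
Qed.
Lemma l2addN : left_inverse (cls (fun=> 0)) l2opp l2add.
Proof.
move=> x; apply: l2_eq; apply: aeq_trans (l2addE _ _) _.
by apply: ae_imp (ae_and cls0E (l2oppE x)) => s [-> ->]; rewrite mulN1r addNr.
Qed.
HB.instance Definition _ := GRing.isZmodule.Build L2C l2addA l2addC l2add0 l2addN.

Lemma l2scaleA a b x : l2scale a (l2scale b x) = l2scale (a * b) x.
Proof.
apply: l2_eq; apply: aeq_trans (l2scaleE _ _) _; apply: aeq_sym.
apply: aeq_trans (l2scaleE _ _) _.
by apply: ae_imp (l2scaleE b x) => s ->; rewrite mulrA.
Qed.
Lemma l2scale1 : left_id 1 l2scale.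
Proof.
move=> x; apply: l2_eq; apply: aeq_trans (l2scaleE _ _) _.
by apply: aeT => s; rewrite mul1r.
Qed.
Lemma l2scaleDr : right_distributive l2scale +%R.
Proof.
move=> c x y; apply: l2_eq; apply: aeq_trans (l2scaleE _ _) _; apply: aeq_sym.
apply: aeq_trans (l2addE _ _) _.
apply: ae_imp (ae_and3 (l2addE x y) (l2scaleE c x) (l2scaleE c y)) => s [+ -> ->].
by rewrite -[l2add x y]/(x + y) => ->; rewrite mulrDr.
Qed.
Lemma l2scaleDl x : {morph l2scale^~ x : a b / a + b}.
Proof.
move=> a b; apply: l2_eq; apply: aeq_trans (l2scaleE _ _) _; apply: aeq_sym.
apply: aeq_trans (l2addE _ _) _.
by apply: ae_imp (ae_and (l2scaleE a x) (l2scaleE b x)) => s [-> ->]; rewrite mulrDl.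
Qed.
HB.instance Definition _ :=
  GRing.Zmodule_isLmodule.Build C L2C l2scaleA l2scale1 l2scaleDr l2scaleDl.

Lemma l2D (x y : L2C) : aeq (x + y) (fun s => x s + y s). Proof. exact: l2addE. Qed.
Lemma l2Z c (x : L2C) : aeq (c *: x) (fun s => c * x s). Proof. exact: l2scaleE. Qed.
Lemma l2N (x : L2C) : aeq (- x) (fun s => - x s).
Proof. by apply: ae_imp (l2oppE x) => s; rewrite mulN1r. Qed.
Lemma l2B (x y : L2C) : aeq (x - y) (fun s => x s - y s).
Proof. by apply: ae_imp (ae_and (l2D x (- y)) (l2N y)) => s [-> ->]. Qed.
Lemma l20 : aeq (0 : L2C) (fun=> 0). Proof. exact: cls0E. Qed.

Lemma l2funB f g : l2fun f -> l2fun g -> l2fun (fun x => f x - g x).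
Proof.
move=> f2 g2; have := l2funD f2 (l2funZ (-1) g2).
by congr l2fun; apply/funext => s; rewrite mulN1r.
Qed.

Lemma clsD f g : l2fun f -> l2fun g -> cls f + cls g = cls (fun s => f s + g s).
Proof.
move=> f2 g2; apply: l2_eq; apply: aeq_trans (l2D _ _) _; apply: aeq_sym.
apply: aeq_trans (clsE (l2funD f2 g2)) _.
by apply: ae_imp (ae_and (clsE f2) (clsE g2)) => s [-> ->].
Qed.
Lemma clsZ c f : l2fun f -> c *: cls f = cls (fun s => c * f s).
Proof.
move=> f2; apply: l2_eq; apply: aeq_trans (l2Z _ _) _; apply: aeq_sym.
apply: aeq_trans (clsE (l2funZ c f2)) _.
by apply: ae_imp (clsE f2) => s ->.
Qed.
Lemma clsB f g : l2fun f -> l2fun g -> cls f - cls g = cls (fun s => f s - g s).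
Proof.
move=> f2 g2; rewrite -scaleN1r clsZ// clsD//; last exact: l2funZ.
by congr cls; apply/funext => s; rewrite mulN1r.
Qed.
Lemma clsS I (r : seq I) (F : I -> X -> C) : (forall i, l2fun (F i)) ->
  \sum_(i <- r) cls (F i) = cls (fun s => \sum_(i <- r) F i s) /\
  l2fun (fun s => \sum_(i <- r) F i s).
Proof.
move=> F2; elim: r => [|i r [IH h]].
  rewrite big_nil; under eq_fun do rewrite big_nil.
  by split; [|exact: l2fun0].
rewrite big_cons IH clsD//; split; first by congr cls; apply/funext => s; rewrite big_cons.
by under eq_fun do rewrite big_cons; exact: l2funD.
Qed.

Definition rdot (f g : X -> C) : R := rI (fun s => Re (f s) * Re (g s) + Im (f s) * Im (g s)).
Definition l2ip (x y : L2C) : R := rdot x y.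

Lemma rdot_int f g : l2fun f -> l2fun g ->
  mu.-integrable setT (EFin \o (fun s => Re (f s) * Re (g s) + Im (f s) * Im (g s))).
Proof. by move=> [f1 f2] [g1 g2]; apply: intD; exact: sq_intM. Qed.

Lemma rdot_ae f g f' g' : l2fun f -> l2fun g -> l2fun f' -> l2fun g' ->
  aeq f f' -> aeq g g' -> rdot f g = rdot f' g'.
Proof.
move=> hf hg hf' hg' ff gg.
apply: (@int_ae _ _ _ mu (fun s => Re (f s) * Re (g s) + Im (f s) * Im (g s))
  (fun s => Re (f' s) * Re (g' s) + Im (f' s) * Im (g' s)) _ _ _).2.
- exact: int_meas (rdot_int hf' hg').
- by apply: ae_imp (ae_and ff gg) => s [-> ->].
- exact: rdot_int.
Qed.

Lemma l2ip_cls f g : l2fun f -> l2fun g -> l2ip (cls f) (cls g) = rdot f g.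
Proof. by move=> hf hg; apply: rdot_ae => //; try exact: l2_l2fun; exact: clsE. Qed.

Lemma rdotDl f g h : l2fun f -> l2fun g -> l2fun h ->
  rdot (fun s => f s + g s) h = rdot f h + rdot g h.
Proof.
move=> hf hg hh; rewrite /rdot -rID; try exact: rdot_int.
by congr rI; apply/funext => s; rewrite !raddfD/=; ring.
Qed.

Lemma rdotZl (a : R) f g : l2fun f -> l2fun g ->
  rdot (fun s => a%:C * f s) g = a * rdot f g.
Proof.
move=> hf hg; rewrite /rdot -rIZ; last exact: rdot_int.
by congr rI; apply/funext => s; rewrite ReM ImM/=; ring.
Qed.

Lemma rdot_sqr f : l2fun f -> rdot f f = rI (fun s => Re (f s) ^+ 2) + rI (fun s => Im (f s) ^+ 2).
Proof.
move=> [f1 f2]; rewrite -rID; try exact: sq_int_sqr.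
by congr rI; apply/funext => s; rewrite !expr2.
Qed.

Lemma l2_hilbert : cplx_hilbert l2ip.
Proof.
split.
- move=> x y z; rewrite -[x]cls_val -[y]cls_val -[z]cls_val clsD ?l2ip_cls//;
    try exact: l2_l2fun; last by apply: l2funD; exact: l2_l2fun.
  by apply: rdotDl; exact: l2_l2fun.
- move=> a x z; rewrite -[x]cls_val -[z]cls_val clsZ ?l2ip_cls//;
    try exact: l2_l2fun; last by apply: l2funZ; exact: l2_l2fun.
  by apply: rdotZl; exact: l2_l2fun.
- move=> x y; rewrite -[x]cls_val -[y]cls_val !clsZ ?l2ip_cls//;
    try exact: l2_l2fun; try by apply: l2funZ; exact: l2_l2fun.
  by congr rI; apply/funext => s; rewrite !ReM !ImM/=; ring.
- by move=> x y; congr rI; apply/funext => s; ring.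
- by move=> x; apply: rI_ge0 => s; rewrite -!expr2 addr_ge0 ?sqr_ge0.
- move=> x; have hx := l2_l2fun x; rewrite /l2ip rdot_sqr// => x0.
  have [h1 h2] := hx.
  have p1 : 0 <= rI (fun s => Re (x s) ^+ 2) by apply: rI_ge0 => s; exact: sqr_ge0.
  have p2 : 0 <= rI (fun s => Im (x s) ^+ 2) by apply: rI_ge0 => s; exact: sqr_ge0.
  have e1 : rI (fun s => Re (x s) ^+ 2) = 0 by lra.
  have e2 : rI (fun s => Im (x s) ^+ 2) = 0 by lra.
  apply: l2_eq; apply: aeq_trans (aeq_sym l20).
  apply: ae_imp (ae_and (rI_sqr_eq0 h1 e1) (rI_sqr_eq0 h2 e2)) => s [].
  by case: (x s) => a b /= -> ->.
- move=> u cu; have hB m n : l2ip (u m - u n) (u m - u n) =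
      rI (fun s => (Re (u m s) - Re (u n s)) ^+ 2) + rI (fun s => (Im (u m s) - Im (u n s)) ^+ 2).
    rewrite -[u m]cls_val -[u n]cls_val clsB ?l2ip_cls ?cls_val; try exact: l2_l2fun;
      try by apply: l2funB; exact: l2_l2fun.
    rewrite rdot_sqr; last by apply: l2funB; exact: l2_l2fun.
    by congr (rI _ + rI _); apply/funext => s; rewrite raddfB.
  have p1 m n : 0 <= rI (fun s => (Re (u m s) - Re (u n s)) ^+ 2).
    by apply: rI_ge0 => s; exact: sqr_ge0.
  have p2 m n : 0 <= rI (fun s => (Im (u m s) - Im (u n s)) ^+ 2).
    by apply: rI_ge0 => s; exact: sqr_ge0.
  have [||l1 h1 c1] := @real_L2_complete _ _ _ mu (fun n s => Re (u n s)).
  + by move=> n; have [] := l2_l2fun (u n).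
  + move=> e /cu[N h]; exists N => m n Nm Nn; have := h m n Nm Nn.
    by rewrite hB; have := p2 m n; lra.
  have [||l2 h2 c2] := @real_L2_complete _ _ _ mu (fun n s => Im (u n s)).
  + by move=> n; have [] := l2_l2fun (u n).
  + move=> e /cu[N h]; exists N => m n Nm Nn; have := h m n Nm Nn.
    by rewrite hB; have := p1 m n; lra.
  have hl : l2fun (fun s => l1 s +i* l2 s) by split.
  exists (cls (fun s => l1 s +i* l2 s)) => e e0; have e2 : 0 < e / 2 by lra.
  have [N1 k1] := c1 _ e2; have [N2 k2] := c2 _ e2; exists (maxn N1 N2) => n.
  rewrite geq_max => /andP[/k1 a1 /k2 a2].
  rewrite -[u n]cls_val clsB ?l2ip_cls; try exact: l2_l2fun; try exact: hl;
    try by apply: l2funB => //; exact: l2_l2fun.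
  rewrite rdot_sqr; last by apply: l2funB => //; exact: l2_l2fun.
  rewrite (_ : rI (fun s => Re _ ^+ 2) = rI (fun s => (Re (u n s) - l1 s) ^+ 2)); last first.
    by congr rI; apply/funext => s; rewrite raddfB.
  rewrite (_ : rI (fun s => Im _ ^+ 2) = rI (fun s => (Im (u n s) - l2 s) ^+ 2)); last first.
    by congr rI; apply/funext => s; rewrite raddfB.
  lra.
Qed.

Lemma cnrm_cls f : l2fun f -> cnrm l2ip (cls f) ^+ 2 = rdot f f.
Proof. by move=> hf; rewrite (sqr_cnrm l2_hilbert) l2ip_cls. Qed.

Lemma cdist2E f g : l2fun f -> l2fun g ->
  cdist2 mu (fun s => Re (f s)) (fun s => Im (f s)) (fun s => Re (g s)) (fun s => Im (g s)) =
  (cnrm l2ip (cls f - cls g) ^+ 2)%:E.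
Proof.
move=> hf hg; have hB := l2funB hf hg; rewrite clsB// cnrm_cls// rIE; last exact: rdot_int.
apply: eq_integral => s _; congr EFin.
by rewrite !raddfB/= !expr2.
Qed.

Lemma cip_cls f g : l2fun f -> l2fun g ->
  cip l2ip (cls f) (cls g) = rI (fun s => Re (f s * (g s)^*)) +i* rI (fun s => Im (f s * (g s)^*)).
Proof.
move=> hf hg; rewrite /cip clsZ// !l2ip_cls//; last exact: l2funZ.
congr (_ +i* _); congr rI; apply/funext => s; rewrite !(ReM, ImM).
  by case: (f s) (g s) => [? ?] [? ?] /=; ring.
by case: (f s) (g s) => [? ?] [? ?] /=; ring.
Qed.

End ComplexL2.

(** * Composition operators between L^2 spaces *)

Section Pullback.
Variables (R : realType) (d d' : measure_display).
Variables (Y : measurableType d') (X : measurableType d).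
Variables (nu : probability Y R) (mu : probability X R).
Local Notation C := R[i].

Definition transports (g : Y -> X) :=
  measurable_fun setT g /\ forall A, measurable A -> nu (g @^-1` A) = mu A.

Lemma transports_ae g (P : X -> Prop) : transports g ->
  ae_prop mu P -> ae_prop nu (fun x => P (g x)).
Proof.
move=> [mf pf] [N [mN [N0 h]]]; exists (g @^-1` N); split.
  by rewrite -[g @^-1` N]setTI; exact: mf.
by rewrite pf//; split=> // x nN; apply: h.
Qed.

Lemma transports_int g (f : X -> R) : transports g -> mu.-integrable setT (EFin \o f) ->
  nu.-integrable setT (EFin \o (fun x => f (g x))) /\ rI nu (fun x => f (g x)) = rI mu f.
Proof. by move=> [mT pT]; apply: transfer_integral. Qed.

Lemma l2fun_comp (f : X -> C) (g : Y -> X) : transports g -> l2fun mu f ->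
  l2fun nu (fun s => f (g s)).
Proof.
move=> hg [[m1 i1] [m2 i2]]; have [mg _] := hg.
have h (u : X -> R) : sq_int mu u -> sq_int nu (fun s => u (g s)).
  move=> hu; apply: int_sq_int; first by apply: measurableT_comp => //; case: hu.
  by have [] := transports_int hg (sq_int_sqr hu).
by split; apply: (h (fun s => _ (f s))).
Qed.

Definition comp_op (g : Y -> X) (x : L2C mu) : L2C nu := cls nu (fun s => x (g s)).

Lemma comp_op_cls g f : transports g -> l2fun mu f ->
  comp_op g (cls mu f) = cls nu (fun s => f (g s)).
Proof.
move=> hg hf; apply: cls_eq; try by apply: l2fun_comp => //; exact: l2_l2fun.
exact: (transports_ae hg (clsE hf)).
Qed.

Lemma comp_op_ae g (x : L2C mu) : transports g -> aeq nu (comp_op g x) (fun s => x (g s)).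
Proof. by move=> hg; apply: clsE; apply: l2fun_comp => //; exact: l2_l2fun. Qed.

Lemma comp_op_lin g : transports g -> clin (comp_op g).
Proof.
move=> hg c x y; rewrite -[x]cls_val -[y]cls_val.
have hx := l2_l2fun x; have hy := l2_l2fun y.
have hx' := l2fun_comp hg hx; have hy' := l2fun_comp hg hy.
have ? := l2funZ c hx; have ? := l2funZ c hx'.
rewrite clsZ// clsD// !comp_op_cls//; last exact: l2funD.
by rewrite clsZ// clsD.
Qed.

Lemma comp_op_ip g x y : transports g ->
  cip (@l2ip _ _ _ nu) (comp_op g x) (comp_op g y) = cip (@l2ip _ _ _ mu) x y.
Proof.
move=> hg; have hx := l2_l2fun x; have hy := l2_l2fun y.
have hx' := l2fun_comp hg hx; have hy' := l2fun_comp hg hy.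
have e f h : l2fun mu f -> l2fun mu h ->
    rdot nu (fun s => f (g s)) (fun s => h (g s)) = rdot mu f h.
  by move=> hf hh; have [_] := transports_int hg (rdot_int hf hh).
have hy2 := l2funZ 'i hy; have hy2' := l2funZ 'i hy'.
rewrite -{2}[x]cls_val -{2}[y]cls_val /cip /comp_op (clsZ _ hy) (clsZ _ hy').
rewrite (l2ip_cls hx' hy') (l2ip_cls hx hy) (l2ip_cls hx' hy2') (l2ip_cls hx hy2).
by rewrite (e _ _ hx hy) (e _ _ hx hy2).
Qed.

End Pullback.

(** * The Koopman representation *)

Section Koopman.
Variables (R : realType) (d : measure_display) (X : measurableType d).
Variable mu : probability X R.
Local Notation C := R[i].
Implicit Type T : @aut d X.

Lemma mpreserving_id : mpreserving mu id.
Proof. by split. Qed.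

Lemma mpreserving_comp (f g : X -> X) : mpreserving mu f -> mpreserving mu g ->
  mpreserving mu (fun x => f (g x)).
Proof.
move=> [mf pf] [mg pg]; split; first exact: measurableT_comp.
move=> A mA; have mfA : measurable (f @^-1` A) by rewrite -[f @^-1` A]setTI; exact: mf.
by rewrite -(pf A)// -(pg _ mfA).
Qed.

Lemma mpreserving_iter n (f : X -> X) : mpreserving mu f -> mpreserving mu (iter n f).
Proof.
by move=> hf; elim: n => [|n IH]; [exact: mpreserving_id|exact: mpreserving_comp].
Qed.

Lemma mpreserving_zpow T k : is_aut mu T -> mpreserving mu (zpow T k).
Proof. by move=> [h1 [h2 _]]; case: k => n; exact: mpreserving_iter. Qed.

Lemma transports_zpow T k : is_aut mu T -> transports mu mu (zpow T k).
Proof. exact: mpreserving_zpow. Qed.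

Lemma zpowS T k : is_aut mu T -> ae_prop mu (fun s => zpow T (k + 1) s = T.1 (zpow T k s)).
Proof.
move=> hT; have [h1 [h2 [h21 h12]]] := hT; case: k => [n|[|n]].
- by apply: aeT => s; rewrite -PoszD addn1.
- by apply: ae_imp h12 => s /= ->.
- have -> : Negz n.+1 + 1 = Negz n by rewrite !NegzE; lia.
  by apply: ae_imp (mpreserving_ae (mpreserving_iter n.+1 h2) h12) => s /= ->.
Qed.

Lemma zpowN1 T k : is_aut mu T -> ae_prop mu (fun s => zpow T (k - 1) s = T.2 (zpow T k s)).
Proof.
move=> hT; have [h1 [h2 [h21 h12]]] := hT; case: k => [[|n]|n].
- exact: aeT.
- have -> : n.+1%:Z - 1 = n by lia.
  by apply: ae_imp (mpreserving_ae (mpreserving_iter n h1) h21) => s /= ->.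
- by apply: aeT => s; have -> : Negz n - 1 = Negz n.+1 by rewrite !NegzE; lia.
Qed.

(** Only almost everywhere, since [T.1] and [T.2] are inverse to each other off a null set. *)
Lemma zpow_add T j k : is_aut mu T ->
  ae_prop mu (fun s => zpow T k (zpow T j s) = zpow T (j + k) s).
Proof.
move=> hT; case: k => n.
  elim: n => [|n IH]; first by apply: aeT => s; rewrite addr0.
  apply: ae_imp (ae_and IH (zpowS (j + n) hT)) => s /= [->].
  by rewrite (_ : j + n.+1 = j + n + 1) ?intS; [move=> ->|ring].
elim: n => [|n IH].
  by apply: ae_imp (zpowN1 j hT) => s ->.
apply: ae_imp (ae_and IH (zpowN1 (j + Negz n) hT)) => s /= [->].
by rewrite (_ : j + Negz n.+1 = j + Negz n - 1); [move=> ->|rewrite !NegzE !intS; ring].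
Qed.

Lemma zpow_aut_pow T n k s : zpow (aut_pow T n) k s = zpow T (n%:Z * k) s.
Proof.
have zN m : zpow T (- m%:Z) s = iter m T.2 s by case: m.
case: k => k; first by rewrite -PoszM mulnC -[RHS]/(iter _ _ _) iterM.
by rewrite NegzE mulrN -PoszM zN mulnC iterM.
Qed.

Lemma is_aut_pow T n : is_aut mu T -> is_aut mu (aut_pow T n).
Proof.
move=> hT; have [h1 [h2 _]] := hT; split; first exact: mpreserving_iter.
split; first exact: mpreserving_iter.
split.
- case: n => [|n]; first exact: aeT.
  apply: ae_imp (zpow_add n.+1 (Negz n) hT) => s /=.
  by rewrite (_ : n.+1%:Z + Negz n = 0)//; rewrite NegzE subrr.
- case: n => [|n]; first exact: aeT.
  apply: ae_imp (zpow_add (Negz n) n.+1 hT) => s /=.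
  by rewrite (_ : Negz n + n.+1 = 0)//; rewrite NegzE addNr.
Qed.

Definition koop T (k : int) : L2C mu -> L2C mu := comp_op mu (zpow T k).

Lemma koop_rep T : is_aut mu T -> unitary_rep (@l2ip _ _ _ mu) (koop T).
Proof.
move=> hT; split.
- by move=> k; apply: comp_op_lin; exact: mpreserving_zpow.
- by move=> k x y; apply: comp_op_ip; exact: mpreserving_zpow.
- move=> j k x; rewrite /koop [X in comp_op _ _ X]/comp_op comp_op_cls; last 2 first.
  + exact: mpreserving_zpow.
  + by apply: l2fun_comp; [exact: mpreserving_zpow|exact: l2_l2fun].
  apply: cls_eq.
  + apply: (@l2fun_comp _ _ _ _ _ mu mu (fun s => x (zpow T k s))); first exact: mpreserving_zpow.
    by apply: l2fun_comp; [exact: mpreserving_zpow|exact: l2_l2fun].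
  + by apply: l2fun_comp; [exact: mpreserving_zpow|exact: l2_l2fun].
  + by apply: ae_imp (zpow_add j k hT) => s ->.
- by move=> x; rewrite /koop/=; exact: cls_val.
Qed.

Lemma koop_pow T n k : koop (aut_pow T n) k = koop T (n%:Z * k).
Proof.
by apply/funext => x; congr cls; apply/funext => s; rewrite zpow_aut_pow.
Qed.

(** Lists of coefficients and exponents are handier than the symmetric windows of the definitions.
    The new coefficients do not depend on the module, so the lemma serves both complex vectors and
    real combinations of a process. *)
Lemma sum_int_window (K : pzRingType) (s : seq (K * int)) :
  exists N (c : nat -> K), forall (E : lmodType K) (e : int -> E),
    \sum_(p <- s) p.1 *: e p.2 = \sum_(0 <= k < (2 * N).+1) c k *: e (k%:Z - N%:Z).
Proof.
pose N := (\max_(p <- s) `|p.2|)%N.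
exists N, (fun k => \sum_(p <- s | p.2 == k%:Z - N%:Z) p.1) => E e.
under [RHS]eq_bigr do rewrite scaler_suml big_mkcond.
rewrite exchange_big big_seq [RHS]big_seq; apply: eq_bigr => p ps.
have pN : (`|p.2| <= N)%N by rewrite /N (big_rem p)//= leq_maxl.
have pE : (absz (p.2 + N%:Z))%:Z - N%:Z = p.2 by lia.
rewrite -big_mkcond (eq_bigl (pred1 (absz (p.2 + N%:Z)))); last first.
  by move=> k; move: (p.2) (N) pN => q M qM; apply/eqP/eqP => [->|->] /=; lia.
have ui : uniq (index_iota 0 (2 * N).+1) by exact: iota_uniq.
have mi : (absz (p.2 + N%:Z)) \in index_iota 0 (2 * N).+1 by rewrite mem_index_iota; lia.
rewrite -big_filter (filter_pred1_uniq ui mi).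
by rewrite big_seq1 pE.
Qed.

Lemma comb_int (E : lmodType C) (e : int -> E) s :
  exists N (c : nat -> C), comb e s = \sum_(0 <= k < (2 * N).+1) c k *: e (k%:Z - N%:Z).
Proof. by have [N [c h]] := sum_int_window s; exists N, c; exact: h. Qed.

Lemma simple_spectrumP T : is_aut mu T ->
  simple_spectrum mu T <-> exists u, total (@l2ip _ _ _ mu) ((koop T)^~ u).
Proof.
move=> hT; have H := @l2_hilbert _ _ _ mu.
pose lcf (N : nat) (a b : nat -> R) (f : X -> C) : X -> C :=
  fun s => \sum_(0 <= k < (2 * N).+1) (a k +i* b k) * f (zpow T (k%:Z - N%:Z) s).
have lcfE N a b f : l2fun mu f -> l2fun mu (lcf N a b f) /\ cls mu (lcf N a b f) =
    \sum_(0 <= k < (2 * N).+1) (a k +i* b k) *: koop T (k%:Z - N%:Z) (cls mu f).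
  move=> hf; have hk k : l2fun mu (fun s => (a k +i* b k) * f (zpow T (k%:Z - N%:Z) s)).
    by apply: l2funZ; exact: (l2fun_comp (transports_zpow _ hT) hf).
  have [e1 e2] := @clsS _ _ _ mu _ (index_iota 0 (2 * N).+1) _ hk; split=> //.
  rewrite /lcf -e1; apply: eq_bigr => k _; rewrite /koop comp_op_cls ?clsZ//.
    exact: (l2fun_comp (transports_zpow _ hT) hf).
  exact: transports_zpow.
have lcfR N a b f : (fun s => Re (lcf N a b f s)) = (fun s => \sum_(0 <= k < (2 * N).+1)
    (a k * Re (f (zpow T (k%:Z - N%:Z) s)) - b k * Im (f (zpow T (k%:Z - N%:Z) s)))).
  by apply/funext => s; rewrite raddf_sum; apply: eq_bigr => k _; exact: ReM.
have lcfI N a b f : (fun s => Im (lcf N a b f s)) = (fun s => \sum_(0 <= k < (2 * N).+1)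
    (a k * Im (f (zpow T (k%:Z - N%:Z) s)) + b k * Re (f (zpow T (k%:Z - N%:Z) s)))).
  by apply/funext => s; rewrite raddf_sum; apply: eq_bigr => k _; exact: ImM.
split.
  move=> [u [v [u2 [v2 hc]]]]; have hf : l2fun mu (fun s => u s +i* v s) by split.
  exists (cls mu (fun s => u s +i* v s)) => x e e0; have hx := l2_l2fun x; have [x1 x2] := hx.
  have [N [a [b h]]] := hc _ _ x1 x2 _ (exprn_gt0 2 e0).
  exists [seq (a k +i* b k, k%:Z - N%:Z) | k <- index_iota 0 (2 * N).+1].
  rewrite /comb big_map/=; have [hl <-] := lcfE N a b _ hf.
  rewrite -(@ltr_pXn2r _ 2)// ?nnegrE ?cnrm_ge0 ?(ltW e0)// -[x]cls_val.
  by rewrite -lte_fin -cdist2E// lcfR lcfI.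
move=> [u tu]; have hu := l2_l2fun u; have [u1 u2] := hu.
exists (fun s => Re (u s)), (fun s => Im (u s)); split=> //; split=> // g1 g2 h1 h2 e e0.
have hg : l2fun mu (fun s => g1 s +i* g2 s) by split.
have se0 : 0 < Num.sqrt e by rewrite sqrtr_gt0.
have [s hs] := tu (cls mu (fun s => g1 s +i* g2 s)) _ se0.
have [N [c cE]] := comb_int ((koop T)^~ u) s.
exists N, (fun k => Re (c k)), (fun k => Im (c k)).
have [hl lE] := lcfE N (fun k => Re (c k)) (fun k => Im (c k)) _ hu.
rewrite -lcfR -lcfI; have /= -> := cdist2E hg hl.
have lt2 (a b : R) : 0 <= a -> a < b -> a ^+ 2 < b ^+ 2 by nra.
rewrite lte_fin -[ltRHS](sqr_sqrtr (ltW e0)); apply: lt2; first exact: cnrm_ge0.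
rewrite lE cls_val; move: hs; rewrite cE.
suff -> : \sum_(0 <= k < (2 * N).+1) c k *: koop T (k%:Z - N%:Z) u =
  \sum_(0 <= k < (2 * N).+1) (Re (c k) +i* Im (c k)) *: koop T (k%:Z - N%:Z) u by [].
by apply: eq_bigr => k _; congr (_ *: _); case: (c k).
Qed.

End Koopman.

(** * Self-couplings *)

Section RepLemmas.
Variables (R : realType) (E : lmodType R[i]) (rip : E -> E -> R).
Variable U : int -> E -> E.
Hypothesis HU : unitary_rep rip U.

Lemma rep_ind (P : int -> Prop) : P 0 -> (forall k, P k -> P (k + 1)) ->
  (forall k, P k -> P (k - 1)) -> forall k, P k.
Proof.
move=> P0 PS PN [n|n]; elim: n => [|n IH] //.
- by rewrite (_ : n.+1%:Z = n%:Z + 1) ?intS; [exact: PS|ring].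
- exact: (PN 0).
- by rewrite (_ : Negz n.+1 = Negz n - 1); [exact: PN|rewrite !NegzE !intS; ring].
Qed.

Lemma rep_form_inv (a : E -> E -> R[i]) : (forall x y, a (U 1 x) (U 1 y) = a x y) ->
  forall k x y, a (U k x) (U k y) = a x y.
Proof.
move=> h; apply: rep_ind => [x y|k IH x y|k IH x y].
- by rewrite !(ur_id HU).
- by rewrite -!(ur_add HU) IH h.
- rewrite -[LHS]h !(ur_add HU) (_ : 1 + (k - 1) = k) ?IH//; ring.
Qed.

Lemma rep_comm (G : E -> E) : (forall x, G (U 1 x) = U 1 (G x)) ->
  forall k x, G (U k x) = U k (G x).
Proof.
move=> h; apply: rep_ind => [x|k IH x|k IH x].
- by rewrite !(ur_id HU).
- by rewrite -!(ur_add HU) IH h.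
- transitivity (U (-1) (U 1 (G (U (k - 1) x)))); first by rewrite (ur_add HU) (ur_id HU).
  by rewrite -h (ur_add HU) (_ : 1 + (k - 1) = k); [rewrite IH (ur_add HU) addrC|ring].
Qed.

End RepLemmas.

Lemma comp_op_comp (R : realType) (d1 d2 d3 : measure_display) (Y : measurableType d1)
  (Z : measurableType d2) (W : measurableType d3) (nu : probability Y R)
  (m : probability Z R) (m' : probability W R) (g : Y -> Z) (h : Z -> W) (x : L2C m') :
  transports nu m g -> transports m m' h ->
  comp_op nu g (comp_op m h x) = cls nu (fun s => x (h (g s))).
Proof. by move=> hg hh; exact: comp_op_cls hg (l2fun_comp hh (l2_l2fun x)). Qed.

Section ProbabilityOfMeasure.
Variables (R : realType) (d : measure_display) (Y : measurableType d).
Variable m : {measure set Y -> \bar R}.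

Definition mkprob of m setT = 1%E : set Y -> \bar R := m.

Hypothesis m1 : m setT = 1%E.

HB.instance Definition _ := Measure.copy (mkprob m1) m.
HB.instance Definition _ := Measure_isProbability.Build _ _ _ (mkprob m1) m1.

Lemma prob_of_measure : exists nu : probability Y R, forall A, nu A = m A.
Proof. by exists (mkprob m1 : probability Y R). Qed.

End ProbabilityOfMeasure.

(** * Couplings as bounded sesquilinear forms *)

Section Couplings.
Variables (R : realType) (d : measure_display) (X : measurableType d).
Variable mu : probability X R.
Local Notation C := R[i].
Local Notation koop := (@koop R d X mu).
Implicit Types (rho : probability (X * X)%type R) (T : @aut d X).

Lemma rect_unique (m1 m2 : {measure set (X * X)%type -> \bar R}) :
  (m1 setT < +oo)%E -> (forall A B, measurable A -> measurable B ->
    m1 (A `*` B) = m2 (A `*` B)) -> forall E, measurable E -> m1 E = m2 E.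
Proof.
move=> m1f m12 E mE.
pose G : set (set (X * X)) :=
  [set G | exists A, measurable A /\ exists B, measurable B /\ G = A `*` B].
apply: (measure_unique G (fun=> setT)) => //.
- rewrite measurable_prod_measurableType //; congr (<<s _ >>).
  rewrite predeqE; split => [[A mA [B mB <-]]|[A [mA [B [mB ->]]]]].
    by exists A; split => //; exists B.
  by exists A => //; exists B.
- move=> _ _ [X1 [mX1 [X2 [mX2 ->]]]] [Y1 [mY1 [Y2 [mY2 ->]]]].
  rewrite -setXI; exists (X1 `&` Y1); split; first exact: measurableI.
  by exists (X2 `&` Y2); split => //; exact: measurableI.
- by move=> _; exists setT; split=> //; exists setT; split=> //; rewrite setXTT.
- by rewrite bigcup_const//; exists 0%N.
- by move=> _ [A [mA [B [mB ->]]]]; exact: m12.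
Qed.

Lemma pmap_measurable (f : X -> X) : measurable_fun setT f -> measurable_fun setT (pmap f).
Proof.
move=> mf; apply: measurable_fun_pair.
  exact: (measurableT_comp mf measurable_fst).
exact: (measurableT_comp mf measurable_snd).
Qed.

Lemma measurable_preim (d1 d2 : measure_display) (Y : measurableType d1)
  (Z : measurableType d2) (f : Y -> Z) A :
  measurable_fun setT f -> measurable A -> measurable (f @^-1` A).
Proof. by move=> mf mA; rewrite -[_ @^-1` _]setTI; exact: mf. Qed.

Lemma J2_rect f rho : mpreserving mu f -> coupling mu rho ->
  (forall A B, measurable A -> measurable B ->
     rho ((f @^-1` A) `*` (f @^-1` B)) = rho (A `*` B)) -> J2 mu f rho.
Proof.
move=> [mf pf] cr hr; split=> // E mE.
have mp := pmap_measurable mf.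
pose p : {mfun (X * X)%type >-> (X * X)%type} :=
  HB.pack (pmap f) (isMeasurableFun.Build _ _ _ _ _ mp).
rewrite -[LHS]/(pushforward rho p E); apply: rect_unique => //.
by rewrite /= /pushforward preimage_setT probability_setT ltry.
Qed.

Lemma coupling_fst rho : coupling mu rho -> transports rho mu fst.
Proof.
move=> cr; split=> // A mA; have [<- _] := cr A mA.
by congr (rho _); apply/seteqP; split=> [[s t]|[s t]] /=; [|case].
Qed.

Lemma coupling_snd rho : coupling mu rho -> transports rho mu snd.
Proof.
move=> cr; split=> // A mA; have [_ <-] := cr A mA.
by congr (rho _); apply/seteqP; split=> [[s t]|[s t]] /=; [|case].
Qed.

(** The form is bounded by 1 when both marginals are [mu], and its values at indicators give the
    masses of rectangles, hence the coupling; invariance of the coupling becomes invariance of the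
    form. *)
Definition cform rho (x y : L2C mu) : C :=
  cip (@l2ip _ _ _ rho) (comp_op rho fst x) (comp_op rho snd y).

Definition cind (A : set X) : X -> C := fun s => (\1_A s)%:C.

Lemma cind_l2 A : measurable A -> l2fun mu (cind A).
Proof.
move=> mA; split; last exact: sq_int_cst.
apply: (@sq_int_bdd _ _ _ _ _ 1); first exact: measurable_indic.
by move=> s; rewrite /= indicE; case: (_ \in _) => /=; rewrite ?normr1 ?normr0.
Qed.

Section Form.
Variable rho : probability (X * X)%type R.
Hypothesis cr : coupling mu rho.
Let Hr := @l2_hilbert _ _ _ rho.

Lemma cnrm_comp_op (d1 d2 : measure_display) (Y : measurableType d1)
  (Z : measurableType d2) (nu : probability Y R) (m : probability Z R) g (x : L2C m) :
  transports nu m g -> cnrm (@l2ip _ _ _ nu) (comp_op nu g x) = cnrm (@l2ip _ _ _ m) x.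
Proof. by move=> hg; rewrite !cnrmE -!Re_cip comp_op_ip. Qed.

Lemma cform_sesq : sesq (cform rho).
Proof.
have h1 := comp_op_lin (coupling_fst cr); have h2 := comp_op_lin (coupling_snd cr).
split=> c x y z; rewrite /cform.
  by rewrite h1 (cipDl Hr) (cipZl Hr).
by rewrite h2 (cipDr Hr) (cipZr Hr).
Qed.

Lemma cform_bdd : fbdd (@l2ip _ _ _ mu) (cform rho) 1.
Proof.
move=> x y; rewrite mul1r; apply: le_trans (cip_CS Hr _ _) _.
by rewrite (cnrm_comp_op _ (coupling_fst cr)) (cnrm_comp_op _ (coupling_snd cr)).
Qed.

Lemma cform_ind A B : measurable A -> measurable B ->
  Re (cform rho (cls mu (cind A)) (cls mu (cind B))) = fine (rho (A `*` B)).
Proof.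
move=> mA mB; have h1 := cind_l2 mA; have h2 := cind_l2 mB.
rewrite /cform (comp_op_cls (coupling_fst cr) h1) (comp_op_cls (coupling_snd cr) h2).
rewrite (cip_cls (l2fun_comp (coupling_fst cr) h1) (l2fun_comp (coupling_snd cr) h2)).
rewrite -[LHS]/(rI rho _) -(rI_indic rho (measurableX mA mB)).
congr (rI rho _); apply/funext => -[s t]; rewrite /cind ReM/= !indicE in_setX/=.
by case: (s \in A); case: (t \in B) => /=; ring.
Qed.

Lemma cform_comp f x y : mpreserving mu f -> J2 mu f rho ->
  cform rho (comp_op mu f x) (comp_op mu f y) = cform rho x y.
Proof.
move=> pf [_ jr]; have pp : transports rho rho (pmap f).
  by split=> //; apply: pmap_measurable; case: pf.
have hf : transports mu mu f := pf.
have e1 := comp_op_comp x (coupling_fst cr) hf.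
have e2 := comp_op_comp x pp (coupling_fst cr).
have e3 := comp_op_comp y (coupling_snd cr) hf.
have e4 := comp_op_comp y pp (coupling_snd cr).
by rewrite /cform -[RHS](comp_op_ip _ _ pp) e1 e3 e2 e4.
Qed.

End Form.

Lemma prob_fine (d1 : measure_display) (Y : measurableType d1) (nu : probability Y R) A B :
  measurable A -> measurable B -> fine (nu A) = fine (nu B) -> nu A = nu B.
Proof. by move=> mA mB h; rewrite -[nu A]fineK ?fin_num_measure// h fineK// fin_num_measure. Qed.

(** The form of the coupling is invariant under [U^n], which has a cyclic vector, and [U] is an
    isometry commuting with [U^n]: [commutant_invariance] applies with [G = U]. *)
Theorem J2_pow T n rho : is_aut mu T -> simple_spectrum mu (aut_pow T n) ->
  J2 mu (iter n T.1) rho -> J2 mu T.1 rho.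
Proof.
move=> hT /(simple_spectrumP (is_aut_pow n hT))[u tu] jr; have [cr _] := jr.
have HU := koop_rep (is_aut_pow n hT); have HT := koop_rep hT.
have [pT _] := hT; have H := @l2_hilbert _ _ _ mu.
have inv1 x y : cform rho (koop (aut_pow T n) 1 x) (koop (aut_pow T n) 1 y) = cform rho x y.
  exact: (cform_comp cr x y (mpreserving_iter n pT) jr).
have key := @commutant_invariance _ _ _ H _ HU u (cform rho) 1 (koop T 1) tu ler01
  (cform_sesq cr) (cform_bdd cr) (rep_form_inv HU inv1) (ur_lin HT 1) (ur_ip HT 1).
have {}key : forall x y, cform rho (koop T 1 x) (koop T 1 y) = cform rho x y.
  by apply: key => k x; rewrite koop_pow !(ur_add HT) addrC.
apply: J2_rect => // A B mA mB.
have mA' : measurable (T.1 @^-1` A) by apply: measurable_preim => //; case: pT.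
have mB' : measurable (T.1 @^-1` B) by apply: measurable_preim => //; case: pT.
apply: prob_fine; try exact: measurableX.
rewrite -(cform_ind cr mA' mB') -(cform_ind cr mA mB).
have pT' : transports mu mu (zpow T 1) := pT.
have := key (cls mu (cind A)) (cls mu (cind B)).
rewrite /koop (comp_op_cls pT' (cind_l2 mA)) (comp_op_cls pT' (cind_l2 mB)).
by move=> <-.
Qed.

Lemma Jinf_eq T : is_aut mu T ->
  (forall n, (0 < n)%N -> simple_spectrum mu (aut_pow T n)) -> Jinf mu T = J2 mu T.1.
Proof.
move=> hT hs; apply/seteqP; split=> rho; last by move=> h; exists 1%N.
by move=> [n [n0 h]]; apply: (J2_pow hT (hs n n0)).
Qed.

Lemma measure_split (A B : set X) : measurable A -> measurable B ->
  fine (mu (B `&` A)) + fine (mu (B `\` A)) = fine (mu B).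
Proof.
move=> mA mB; have mI := measurableI _ _ mB mA; have mD := measurableD mB mA.
have dj : (B `&` A) `&` (B `\` A) = set0 by apply/seteqP; split=> x // [[_ Nx] []].
rewrite -fineD ?fin_num_measure//; congr fine.
by have := measureU mu mI mD dj; rewrite setUIDK => ->.
Qed.

(* If [A] were invariant, multiplication by [1 - 2 1_A] would commute with the
   Koopman operator, hence preserve the invariant form [<x, 1> <1, y>]. *)
Lemma simple_spectrum_ergodic T A : is_aut mu T -> simple_spectrum mu T -> measurable A ->
  ae_prop mu (fun s => A (T.1 s) <-> A s) -> fine (mu A) = 0 \/ fine (mu A) = 1.
Proof.
move=> hT /(simple_spectrumP hT)[u tu] mA iA.
have H := @l2_hilbert _ _ _ mu; have HT := koop_rep hT; have [pT _] := hT.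
pose sg s : R := 1 - 2 * \1_A s.
have sg1 s : sg s * sg s = 1.
  by rewrite /sg indicE; case: (s \in A) => /=; ring.
have msg : measurable_fun setT sg.
  by apply: measurable_funB => //; apply: measurable_funM => //; exact: measurable_indic.
have sgb s : `|sg s| <= 1.
  by rewrite /sg indicE ler_norml; case: (s \in A) => /=; apply/andP; split; lra.
have hsg (f : X -> R) : sq_int mu f -> sq_int mu (fun s => sg s * f s).
  move=> hf; have [mf _] := hf; apply: int_sq_int; first exact: measurable_funM.
  have := sq_int_sqr hf; apply: eq_integrable => // s _ /=.
  by rewrite exprMn (_ : sg s ^+ 2 = 1) ?mul1r// expr2 sg1.
have hG f : l2fun mu f -> l2fun mu (fun s => (sg s)%:C * f s).
  move=> [f1 f2]; split.
    rewrite (_ : (fun s => _) = (fun s => sg s * Re (f s))); first exact: hsg.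
    by apply/funext => s; rewrite ReM/= mul0r subr0.
  rewrite (_ : (fun s => _) = (fun s => sg s * Im (f s))); first exact: hsg.
  by apply/funext => s; rewrite ImM/= mul0r addr0.
pose G (x : L2C mu) : L2C mu := cls mu (fun s => (sg s)%:C * x s).
have Gcls f : l2fun mu f -> G (cls mu f) = cls mu (fun s => (sg s)%:C * f s).
  move=> hf; apply: cls_eq; [exact/hG/l2_l2fun|exact: hG|].
  by apply: ae_imp (clsE hf) => s ->.
have lG : clin G.
  move=> c x y; rewrite -[x]cls_val -[y]cls_val.
  have hx := l2_l2fun x; have hy := l2_l2fun y.
  have hcx := l2funZ c hx.
  rewrite (clsZ _ hx) (clsD hcx hy) (Gcls _ (l2funD hcx hy)) (Gcls _ hx) (Gcls _ hy).
  rewrite (clsZ _ (hG _ hx)) (clsD (l2funZ c (hG _ hx)) (hG _ hy)).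
  by congr cls; apply/funext => s; ring.
have iG x y : cip (@l2ip _ _ _ mu) (G x) (G y) = cip (@l2ip _ _ _ mu) x y.
  have hx := l2_l2fun x; have hy := l2_l2fun y.
  rewrite -{2}[x]cls_val -{2}[y]cls_val (cip_cls (hG _ hx) (hG _ hy)) (cip_cls hx hy).
  have e s : (sg s)%:C * x s * ((sg s)%:C * y s)^* = x s * (y s)^*.
    transitivity ((sg s * sg s)%:C * (x s * (y s)^*)); last by rewrite sg1 mul1r.
    case: (x s) (y s) => [x1 x2] [y1 y2]; apply/eqP; rewrite eq_complex/=.
    by apply/andP; split; apply/eqP; ring.
  by congr (_ +i* _); congr (rI _ _); apply/funext => s; rewrite e.
have cG x : G (koop T 1 x) = koop T 1 (G x).
  have pT' : transports mu mu (zpow T 1) := pT.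
  have hx := l2_l2fun x; have hxT := l2fun_comp pT' hx.
  rewrite /koop (comp_op_cls pT' (hG _ hx)) (Gcls _ hxT).
  apply: cls_eq; [exact: hG|exact: (l2fun_comp pT' (hG _ hx))|].
  apply: ae_imp iA => s /= h; congr (_%:C * _); rewrite /sg !indicE.
  suff -> : (s \in A) = (T.1 s \in A) by [].
  by apply/idP/idP => /set_mem/h/mem_set.
pose one := cls mu (cind setT); have h1 := cind_l2 (@measurableT _ X).
have U1 k : koop T k one = one.
  by rewrite /koop (comp_op_cls (transports_zpow k hT) h1).
have c11 : cip (@l2ip _ _ _ mu) one one = 1.
  rewrite (cip_cls h1 h1).
  have e s : cind setT s * (cind setT s)^* = 1 :> C by rewrite /cind indicT; apply/eqP; rewrite eq_complex/=; apply/andP; split; apply/eqP; ring.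
  under eq_fun do rewrite e; under [X in _ +i* rI _ X]eq_fun do rewrite e.
  by rewrite !rI_cst.
have cG1 : cip (@l2ip _ _ _ mu) (G one) one = (1 - 2 * fine (mu A))%:C.
  rewrite (Gcls _ h1) (cip_cls (hG _ h1) h1).
  have e s : (sg s)%:C * cind setT s * (cind setT s)^* = (sg s)%:C :> C.
    by rewrite /cind indicT; apply/eqP; rewrite eq_complex/=; apply/andP; split; apply/eqP; ring.
  under eq_fun do rewrite e; under [X in _ +i* rI _ X]eq_fun do rewrite e.
  rewrite /= rI_cst; congr (_ +i* _).
  have i1 : mu.-integrable setT (EFin \o (\1_A : X -> R)).
    by apply: sq_int_int; case: (cind_l2 mA).
  by rewrite rIB ?rIZ ?rI_indic ?rI_cst//; [exact: int_cst|exact: intZ].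
clearbody one G.
pose a (x y : L2C mu) := cip (@l2ip _ _ _ mu) x one * cip (@l2ip _ _ _ mu) one y.
have sa : sesq a.
  split=> c x y z; rewrite /a; first by rewrite (cipDl H) (cipZl H) mulrDl mulrA.
  by rewrite (cipDr H) (cipZr H) mulrDr mulrCA.
have n0 := cnrm_ge0 (@l2ip _ _ _ mu) one.
have ba : fbdd (@l2ip _ _ _ mu) a (cnrm (@l2ip _ _ _ mu) one ^+ 2).
  move=> x y; rewrite /a Normc.normcM.
  apply: le_trans (ler_pM (normc_ge0 _) (normc_ge0 _) (cip_CS H _ _) (cip_CS H _ _)) _.
  move: (cnrm _ x) (cnrm _ y) (cnrm _ one) => p q r.
  by rewrite (_ : p * r * (r * q) = r ^+ 2 * (p * q)); [|ring].
have ia k x y : a (koop T k x) (koop T k y) = a x y.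
  by rewrite /a -{1 2}(U1 k) !(ur_ip HT).
have := @commutant_invariance _ _ _ H _ HT u a _ G tu (sqr_ge0 _) sa ba ia lG iG (rep_comm HT cG) one one.
rewrite /a c11 cG1 (cipC H) cG1 mulr1 => /(congr1 (@Re R)); rewrite ReM/= => h.
have : fine (mu A) * (fine (mu A) - 1) = 0 by move: h; rewrite !(mulr0, subr0, mul0r, oppr0); lra.
by move/eqP; rewrite mulf_eq0 => /orP[/eqP ?|/eqP ?]; [left|right; lra].
Qed.

Lemma prob_convex (d1 : measure_display) (Y : measurableType d1)
  (r1 r2 : probability Y R) (t : R) : 0 <= t -> t <= 1 ->
  exists nu : probability Y R, forall A, measurable A ->
    fine (nu A) = (1 - t) * fine (r1 A) + t * fine (r2 A).
Proof.
move=> t0 t1; have t1' : 0 <= 1 - t by lra.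
pose m : {measure set Y -> \bar R} := measure_add (mscale (NngNum t1') r1) (mscale (NngNum t0) r2).
have mE A : m A = ((1 - t)%:E * r1 A + t%:E * r2 A)%E by exact: measure_addE.
have [|nu nuE] := @prob_of_measure _ _ _ m.
  by rewrite mE !probability_setT !mule1 -EFinD subrK.
exists nu => A mA; rewrite nuE mE fineD ?fineM ?fin_numM ?fin_num_measure//.
Qed.

(** The relative product over [{A, A^c}], weighted by the inverses 3 and 3/2 of the two measures.
    Invariance on the square of [A] reads [3 p^2 + 3/2 q^2 = 1/3], where [p] and [q] are the
    measures of [T^-1 A] inside and outside [A]; it forces [q = 0], that is, an invariant set of
    measure 1/3. *)
Lemma noninvariant_coupling T A : is_aut mu T -> simple_spectrum mu T -> measurable A ->
  fine (mu A) = 3^-1 -> exists2 rho, coupling mu rho & ~ J2 mu T.1 rho.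
Proof.
move=> hT hs mA muA; have [pT _] := hT; have mT := pT.1; have mAc := measurableC mA.
pose pp := product_measure1 mu mu.
have c1 : 0 <= 3 :> R by []. have c2 : 0 <= 3 / 2 :> R by lra.
pose m : {measure set (X * X)%type -> \bar R} :=
  measure_add (mscale (NngNum c1) (mrestr pp (measurableX mA mA)))
              (mscale (NngNum c2) (mrestr pp (measurableX mAc mAc))).
have mE B D : measurable B -> measurable D -> m (B `*` D) =
    (3 * (fine (mu (B `&` A)) * fine (mu (D `&` A))) +
     3 / 2 * (fine (mu (B `\` A)) * fine (mu (D `\` A))))%:E.
  move=> mB mD; have e E F : measurable E -> measurable F ->
      pp (E `*` F) = (fine (mu E) * fine (mu F))%:E.
    by move=> mE mF; rewrite /pp/= product_measure1E// EFinM !fineK ?fin_num_measure.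
  transitivity ((3%:E * pp ((B `*` D) `&` (A `*` A)) +
    (3 / 2)%:E * pp ((B `*` D) `&` ((~` A) `*` (~` A))))%E); first exact: measure_addE.
  rewrite -setXI -(setXI B D (~` A)) !e; try exact: measurableI.
  by rewrite -!EFinM -EFinD -!setDE.
have muAc : fine (mu (setT `\` A)) = 2 / 3.
  by have := measure_split mA measurableT; rewrite setTI muA probability_setT/=; lra.
have [|rho rhoE] := @prob_of_measure _ _ _ m.
  by rewrite -setXTT mE// setTI muA muAc; congr EFin; field.
exists rho.
  move=> B mB; rewrite !rhoE !mE// !setTI muA muAc -[mu B]fineK ?fin_num_measure//.
  by rewrite -(measure_split mA mB); split; congr EFin; field.
move=> [_ inv]; have mTA : measurable (T.1 @^-1` A) by exact: measurable_preim.
have := inv _ (measurableX mA mA); rewrite !rhoE.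
rewrite (_ : pmap _ @^-1` _ = (T.1 @^-1` A) `*` (T.1 @^-1` A))// !mE// setIid setDv measure0.
set p := fine (mu (_ `&` A)); set q := fine (mu (_ `\` A)).
have pq : p + q = 3^-1 by rewrite -muA -[mu A](pT.2 _ mA); exact: measure_split.
have p0 : 0 <= p by rewrite fine_ge0.
have q0 : 0 <= q by rewrite fine_ge0.
(* The other root [q = 4/9] exceeds [p + q = 1/3]. *)
rewrite muA => -[] h; have {h} q00 : q = 0.
  have : q * (2 / 3 - 3 / 2 * q) = 0 by move: h; rewrite (_ : p = 3^-1 - q); [lra|lra].
  by move/eqP; rewrite mulf_eq0 => /orP[/eqP//|/eqP]; lra.
suff iA : ae_prop mu (fun s => A (T.1 s) <-> A s).
  by have [] := simple_spectrum_ergodic hT hs mA iA; rewrite muA; lra.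
have pA : fine (mu (A `\` (T.1 @^-1` A))) = 0.
  by have := measure_split mTA mA; rewrite setIC -/p muA; lra.
exists ((T.1 @^-1` A `\` A) `|` (A `\` (T.1 @^-1` A))).
have m1 := measurableD mTA mA; have m2 := measurableD mA mTA.
split; first exact: measurableU.
split; last first.
  move=> s ns; split=> hs'; apply: contrapT => h; apply: ns; by [left|right].
have z1 : mu (T.1 @^-1` A `\` A) = 0%E by rewrite -[LHS]fineK ?fin_num_measure// -/q q00.
have z2 : mu (A `\` T.1 @^-1` A) = 0%E by rewrite -[LHS]fineK ?fin_num_measure// pA.
apply/eqP; rewrite -measure_le0; apply: le_trans (measureU2 mu m1 m2) _.
by rewrite [X in (X + _)%E]z1 add0e [X in (X <= _)%E]z2.
Qed.

Lemma J2_conv T (r0 r1 r2 : probability (X * X)%type R) (t : R) : mpreserving mu T.1 ->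
  0 < t -> coupling mu r1 -> J2 mu T.1 r2 -> J2 mu T.1 r0 ->
  (forall E, measurable E -> fine (r0 E) = (1 - t) * fine (r2 E) + t * fine (r1 E)) ->
  J2 mu T.1 r1.
Proof.
move=> [mT _] t0 cr1 [_ h2] [_ h0] hE; split=> // E mE.
have mp := measurable_preim (pmap_measurable mT) mE.
apply: prob_fine => //; have := hE _ mE; have := hE _ mp; rewrite h2// h0// => -> /addrI.
by move=> /(mulfI (lt0r_neq0 t0)).
Qed.

(** A coupling that is not invariant already fails on a rectangle, and the failure survives small
    changes of the masses of that rectangle and of its preimage. *)
Lemma J2_closed f : mpreserving mu f -> c2_closed mu (J2 mu f).
Proof.
move=> pf; have [mf _] := pf; split; first by move=> rho [].
split=> [rho [] //|rho [cr nJ]].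
have [A [B [mA [mB AB]]]] : exists A B, measurable A /\ measurable B /\
    rho ((f @^-1` A) `*` (f @^-1` B)) <> rho (A `*` B).
  apply: contrapT => h; apply: nJ; apply: J2_rect => // A B mA mB.
  by apply: contrapT => hAB; apply: h; exists A, B.
have mA' := measurable_preim mf mA; have mB' := measurable_preim mf mB.
pose D := fine (rho ((f @^-1` A) `*` (f @^-1` B))) - fine (rho (A `*` B)).
have D0 : 0 < `|D| / 2.
  rewrite divr_gt0// normr_gt0 subr_eq0; apply/eqP => h; apply: AB.
  by apply: prob_fine => //; exact: measurableX.
exists 2%N, (fun i => if i is 0%N then A else f @^-1` A),
  (fun i => if i is 0%N then B else f @^-1` B), (`|D| / 2).
split; first by split=> // -[|i] _; split.
move=> r' [cr' h]; split=> //; move=> [_ inv].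
have := h 0%N isT; have := h 1%N isT => /=.
have -> : r' ((f @^-1` A) `*` (f @^-1` B)) = r' (A `*` B).
  by rewrite -(inv _ (measurableX mA mB)).
have tri (x y z : R) : `|x - y| < `|y - z| / 2 -> `|x - z| < `|y - z| / 2 -> False.
  have := ler_distD x y z; rewrite (distrC y x); lra.
exact: tri.
Qed.

(** Mixing an invariant coupling with a small amount [t] of [rho0] stays in a given open set but
    leaves [J2], by [J2_conv]. *)
Lemma J2_nowhere_dense T rho0 : mpreserving mu T.1 -> coupling mu rho0 -> ~ J2 mu T.1 rho0 ->
  c2_nowhere_dense mu (J2 mu T.1).
Proof.
move=> pT cr0 nJ U [UC oU] Ucl; apply/seteqP; split=> // rho Ur; exfalso.
have [_ [_ oJ]] := J2_closed pT.
have UJ r : U r -> J2 mu T.1 r.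
  move=> Urr; have [cr hcl] := Ucl _ Urr; apply: contrapT => nJr.
  have [k [As [Bs [e [ok sub]]]]] := oJ r (conj cr nJr).
  by have [r' [Jr' /sub[_]]] := hcl k As Bs e ok.
have [k [As [Bs [e [[e0 mAB] sub]]]]] := oU _ Ur.
have cr := UC _ Ur.
pose t := Num.min 1 (e / 2).
have t0 : 0 < t by rewrite lt_min ltr01 divr_gt0.
have t1 : t <= 1 by rewrite ge_min lexx.
have te : t <= e / 2 by rewrite ge_min lexx orbT.
have [r rE] := prob_convex rho rho0 (ltW t0) t1.
have crr : coupling mu r.
  move=> A mA; have [a1 a2] := cr A mA; have [b1 b2] := cr0 A mA.
  have m1 := measurableX mA (@measurableT _ X); have m2 := measurableX (@measurableT _ X) mA.
  split; rewrite -[LHS]fineK ?fin_num_measure// rE// ?a1 ?a2 ?b1 ?b2.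
    by rewrite -mulrDl subrK mul1r fineK// fin_num_measure.
  by rewrite -mulrDl subrK mul1r fineK// fin_num_measure.
apply: nJ; apply: (@J2_conv T r _ rho t) => //; first exact: UJ.
apply/UJ/sub; split=> // i ik; have [mA mB] := mAB i ik.
have b (nu : probability (X * X)%type R) E : measurable E -> 0 <= fine (nu E) <= 1.
  move=> mE; rewrite fine_ge0//= -lee_fin fineK ?fin_num_measure// probability_le1//.
have mX := measurableX mA mB.
rewrite rE//; have /andP[x0 x1] := b rho _ mX; have /andP[y0 y1] := b rho0 _ mX.
rewrite (_ : _ - _ = t * (fine (rho0 (As i `*` Bs i)) - fine (rho (As i `*` Bs i)))); last by ring.
rewrite normrM gtr0_norm//; apply: le_lt_trans (_ : t * 1 < e); last by lra.
by rewrite ler_pM2l// ler_norml; lra.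
Qed.

Theorem system_consequences T A : is_aut mu T -> measurable A -> fine (mu A) = 3^-1 ->
  (forall n, (0 < n)%N -> simple_spectrum mu (aut_pow T n)) ->
  Jinf mu T = J2 mu T.1 /\ c2_closed mu (Jinf mu T) /\ c2_nowhere_dense mu (Jinf mu T) /\
  ~ P_system mu T.
Proof.
move=> hT mA muA hs; have JE := Jinf_eq hT hs; have [pT _] := hT.
have hs1 : simple_spectrum mu T.
  by have := hs 1%N isT; congr simple_spectrum; rewrite /aut_pow/=; case: (T).
have [rho0 cr0 nJ] := noninvariant_coupling hT hs1 mA muA.
rewrite JE; split=> //; split; first exact: J2_closed.
split; first exact: J2_nowhere_dense nJ.
(* Density of the periodic points fails: the couplings outside [J2] form a nonempty open set which
   contains none. *)
move=> [_ /(_ (C2 mu `\` J2 mu T.1))]; rewrite JE => h.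
have [|r [[_ nr] Jr]] // := h (J2_closed pT).2.
by exists rho0.
Qed.

End Couplings.

(** * Generic automorphisms *)

Lemma bigU_ord (T : Type) m (P : pred 'I_m) (F : 'I_m -> set T) :
  \big[setU/set0]_(i < m | P i) F i = [set y | exists2 i, P i & F i y].
Proof.
rewrite -bigcup_seq_cond; apply/seteqP; split=> y [i /=].
  by move=> /andP[_ Pi] Fy; exists i.
by move=> Pi Fy; exists i => //=; rewrite mem_index_enum.
Qed.

Lemma prob_compl (R : realType) (d : measure_display) (X : measurableType d)
  (nu : probability X R) A : measurable A -> fine (nu A) + fine (nu (~` A)) = 1.
Proof.
move=> mA; have mC := measurableC mA.
have e : nu (A `|` ~` A) = (nu A + nu (~` A))%E := measureU nu mA mC (setICr A).
by rewrite -fineD ?fin_num_measure// -e setUv probability_setT.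
Qed.

(** * Rotations and interval permutations of the unit interval *)

Section UnitInterval.
Variable R : realType.
Local Notation leb := (@lebesgue_measure R).

Lemma lebesgue01 : mrestr leb (measurable_itv `[0%R, 1%R]) setT = 1%E.
Proof. by rewrite /mrestr setTI lebesgue_measure_itv/= lte_fin ltr01 oppr0 adde0. Qed.

Definition lam01 : probability (measurableTypeR R) R :=
  mkprob (Y := measurableTypeR R) lebesgue01.

Lemma lam01E B : lam01 B = leb (B `&` `[0%R, 1%R]%classic). Proof. by []. Qed.

Lemma lebesgue_shift (t : R) B : measurable B -> leb [set y | B (y + t)] = leb B.
Proof.
move=> mB.
have ms : measurable_fun [set: measurableTypeR R]
    ((fun y => y + t) : measurableTypeR R -> measurableTypeR R) by exact: measurable_funD.
pose s : {mfun measurableTypeR R >-> measurableTypeR R} :=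
  HB.pack (fun y : R => y + t) (isMeasurableFun.Build _ _ (measurableTypeR R) (measurableTypeR R) _ ms).
apply/esym; apply: (@lebesgue_measure_unique R (pushforward leb s) _ B mB).
move=> _ [[a b] _ <-] /=; rewrite /pushforward.
have -> : s @^-1` `]a, b] = `](a - t), (b - t)]%classic.
  by apply/seteqP; split=> y /=; rewrite !in_itv/= ltrBlDr lerBrDr.
by rewrite !lebesgue_measure_itv/= !lte_fin ltrD2r -!EFinB; case: ifP => // _; congr EFin; lra.
Qed.

(** Half-open, so that rotations and interval permutations act bijectively on it; it has full
    measure for [lam01]. *)
Definition I01 : set R := [set y | 0 <= y < 1].

Lemma I01_itv : I01 = `[0%R, 1%R[%classic.
Proof. by apply/seteqP; split=> y; rewrite /I01/= in_itv. Qed.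

Lemma mI01 : measurable I01. Proof. by rewrite I01_itv; exact: measurable_itv. Qed.

Lemma lam01I B : measurable B -> lam01 B = leb (B `&` I01).
Proof.
move=> mB; rewrite lam01E.
have m1 : measurable (B `&` I01) by apply: measurableI => //; exact: mI01.
have m2 : measurable (B `&` [set 1 : R]) by apply: measurableI.
have -> : B `&` `[0%R, 1%R]%classic = (B `&` I01) `|` (B `&` [set 1]).
  rewrite -setIUr; congr (_ `&` _); apply/seteqP; split=> y /=; rewrite in_itv/= /I01/=.
    by move=> /andP[->]; rewrite le_eqVlt => /orP[/eqP->|->]; [right|left].
  by move=> [/andP[-> /ltW->]//|->]; rewrite ler01 lexx.
rewrite measureU//; last first.
  by apply/seteqP; split=> y // [[_ /andP[_ y1]] [_ /= ye]]; rewrite ye ltxx in y1.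
rewrite [X in (_ + X)%E](_ : _ = 0%E) ?adde0//; apply/eqP; rewrite -measure_le0.
by rewrite -(lebesgue_measure_set1 1); apply: le_measure; rewrite ?inE.
Qed.

Lemma lam01_I01 : ae_prop lam01 I01.
Proof.
have mC := measurableC mI01; exists (~` I01); split=> //; split; last by move=> x /contrapT.
by rewrite lam01I// setICl measure0.
Qed.

Section Piecewise.
Variables (m : nat) (kap : R -> 'I_m) (t : 'I_m -> R).
Hypothesis mk : forall i, measurable [set y | kap y = i].
Let g y := y + t (kap y).

Lemma pw_measurable : measurable_fun setT g.
Proof.
move=> _ B mB; rewrite setTI.
have -> : g @^-1` B = \big[setU/set0]_(i < m) ([set y | kap y = i] `&` [set y | B (y + t i)]).
  rewrite bigU_ord; apply/seteqP; split=> y /=.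
    by move=> By; exists (kap y).
  by move=> [i _ [/= <-]].
apply: bigsetU_measurable => i _; apply: measurableI; first exact: mk.
have ms : measurable_fun setT (fun y : R => y + t i) by exact: measurable_funD.
exact: (measurable_preim ms mB).
Qed.

Hypothesis gI : forall y, I01 y -> I01 (g y).
Hypothesis ginj : forall y z, I01 y -> I01 z -> g y = g z -> y = z.

(** Injectivity makes the translated pieces of [g^-1 A] disjoint subsets of [A], so that [g^-1 A]
    has at most the measure of [A]. For [B] and its complement together this inequality must be an
    equality, the total masses being 1. *)
Lemma pw_mpreserving : mpreserving lam01 g.
Proof.
have mg := pw_measurable; split=> // B mB.
have le A : measurable A -> (lam01 (g @^-1` A) <= lam01 A)%E.
  move=> mA; have mgA := measurable_preim mg mA; rewrite !lam01I//.
  pose D (i : 'I_m) := [set y | kap y = i] `&` I01 `&` (g @^-1` A).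
  have mD i : measurable (D i).
    by do 2 apply: measurableI => //; exact: mI01.
  have D_eq : g @^-1` A `&` I01 = \big[setU/set0]_(i < m) D i.
    rewrite bigU_ord; apply/seteqP; split=> y /=.
      by move=> [Ay y1]; exists (kap y).
    by move=> [i _ [[_ y1] Ay]].
  have ms (c : R) : measurable_fun setT (fun y : R => y + c) by exact: measurable_funD.
  pose E (i : 'I_m) := [set z | D i (z - t i)].
  have mE i : measurable (E i) by exact: (measurable_preim (ms (- t i)) (mD i)).
  have DE i : leb (D i) = leb (E i).
    rewrite -(lebesgue_shift (t i) (mE i)); congr (leb _).
    by apply/seteqP; split=> y; rewrite /E/= addrK.
  have EA i z : E i z -> A z /\ I01 z /\ exists2 y, D i y & z = g y.
    move=> Ez; have [[/= ki y1] Ay] := Ez.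
    have zE : z = g (z - t i) by rewrite /g ki subrK.
    split; first by rewrite zE.
    by split; [rewrite zE; exact: gI|exists (z - t i)].
  rewrite D_eq measure_bigsetU_ord; last 2 first.
  - exact: mD.
  - by apply/trivIsetP => i j _ _ ij; apply/seteqP; split=> y // [[[/= ki _] _] [[/= kj _] _]]; rewrite -ki -kj eqxx in ij.
  rewrite (eq_bigr (fun i => leb (E i))); last by move=> i _; exact: DE.
  rewrite -[leLHS](@measure_bigsetU_ord _ _ _ leb m xpredT E); last 2 first.
  - exact: mE.
  - apply/trivIsetP => i j _ _ ij; apply/seteqP; split=> z // [/EA[_ [_ [y Dy zy]]] /EA[_ [_ [y' Dy' zy']]]].
    have yy : y = y'.
      by apply: ginj; [case: Dy => [[]]|case: Dy' => [[]]|rewrite -zy].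
    by case: Dy Dy' ij => [[/= ki _] _] [[/= kj _] _]; rewrite -ki -kj yy eqxx.
  apply: le_measure; rewrite ?inE.
  - by apply: bigsetU_measurable => i _; exact: mE.
  - by apply: measurableI => //; exact: mI01.
  - by rewrite bigU_ord => z [i _ /EA[]? []].
have mgB := measurable_preim mg mB.
have h1 := le B mB; have h2 := le _ (measurableC mB); rewrite preimage_setC in h2.
apply: prob_fine => //.
have cB := @prob_compl _ _ _ lam01.
have f A A' : measurable A -> measurable A' -> (lam01 A <= lam01 A')%E ->
    fine (lam01 A) <= fine (lam01 A').
  by move=> mA mA' h; apply: fine_le; rewrite ?fin_num_measure.
have := f _ _ mgB mB h1; have := f _ _ (measurableC mgB) (measurableC mB) h2.
have := cB _ mB; have := cB _ mgB; lra.
Qed.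

End Piecewise.

Section Index.
Variable q : nat.

Definition idx (y : R) : nat := Num.truncn (q%:R * y).

Lemma idx_measurable (P : set nat) : measurable [set y | P (idx y)].
Proof.
have mq : measurable_fun setT (fun y : R => q%:R * y) by exact: measurable_funM.
have ml n : measurable [set y | (idx y <= n)%N].
  have -> : [set y | (idx y <= n)%N] = (fun y : R => q%:R * y) @^-1` `]-oo, n.+1%:R[%classic.
    by apply/seteqP; split=> y /=; rewrite in_itv/= /idx truncn_le_nat.
  exact: measurable_preim.
have me n : measurable [set y | idx y = n].
  case: n => [|n].
    by rewrite (_ : [set y | _] = [set y | (idx y <= 0)%N])//; apply/seteqP; split=> y /=; [move->|lia].
  rewrite (_ : [set y | _] = [set y | (idx y <= n.+1)%N] `\` [set y | (idx y <= n)%N]); first exact: measurableD.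
  by apply/seteqP; split=> y /=; [move=> ->; split; lia|case; lia].
rewrite (_ : [set y | P (idx y)] = \bigcup_(n in P) [set y | idx y = n]); first exact: bigcup_measurable.
by apply/seteqP; split=> y /= => [Py|[n Pn /= ->]//]; exists (idx y).
Qed.

Hypothesis q0 : (0 < q)%N.
Let q0R : 0 < q%:R :> R. Proof. by rewrite ltr0n. Qed.

Lemma idx_itv y : I01 y -> (idx y)%:R <= q%:R * y < (idx y).+1%:R.
Proof. by move=> /andP[y0 _]; apply: truncn_itv; rewrite mulr_ge0. Qed.

Lemma idx_lt y : I01 y -> (idx y < q)%N.
Proof.
move=> /andP[y0 y1]; rewrite /idx truncn_lt_nat ?mulr_ge0//.
by rewrite -[ltRHS]mulr1 ltr_pM2l.
Qed.

Lemma idx_def y n : n%:R <= q%:R * y < n.+1%:R -> idx y = n.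
Proof. exact: truncn_def. Qed.

Lemma lam01_idx l : (l < q)%N -> fine (lam01 [set y | idx y = l]) = q%:R^-1.
Proof.
move=> lq; rewrite lam01I; last exact: (idx_measurable [set n | n = l]).
have -> : [set y | idx y = l] `&` I01 = `[l%:R / q%:R, l.+1%:R / q%:R[%classic.
  apply/seteqP; split=> y /=; rewrite in_itv/= ler_pdivrMr// ltr_pdivlMr// ![y * _]mulrC.
    by move=> [<- /idx_itv].
  move=> h; split; first exact: idx_def.
  move: h => /andP[h1 h2]; rewrite /I01/= -(pmulr_rge0 _ q0R) (le_trans _ h1)//=.
  rewrite -(ltr_pM2l q0R) mulr1; apply: lt_le_trans h2 _; by rewrite ler_nat.
rewrite lebesgue_measure_itv/= lte_fin ltr_pM2r ?invr_gt0// ltr_nat ltnSn/=.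
by rewrite -mulrBl -natrB// subSnn mul1r.
Qed.

End Index.

Definition rot (al y : R) : R := if y < 1 - al then y + al else y + al - 1.

Section Rotation.
Variable al : R.
Hypothesis al01 : 0 < al < 1.

Lemma rot_I01 y : I01 y -> I01 (rot al y).
Proof. by move: al01 => /andP[? ?] /andP[? ?]; rewrite /rot /I01/=; case: ltP => ?; apply/andP; split; lra. Qed.

Lemma rotK y : I01 y -> rot (1 - al) (rot al y) = y.
Proof.
move: al01 => /andP[a0 a1] /andP[y0 y1]; rewrite {2}/rot; case: (ltP y) => h1.
  by rewrite /rot; case: ltP => h2; move: a0 a1 y0 y1 h1 h2; lra.
by rewrite /rot; case: ltP => h2; move: a0 a1 y0 y1 h1 h2; lra.
Qed.

Lemma rot_mpreserving : mpreserving lam01 (rot al).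
Proof.
pose kap (y : R) : 'I_2 := if y < 1 - al then ord0 else ord_max.
pose t (i : 'I_2) := if i == ord0 then al else al - 1.
have gE : rot al = fun y => y + t (kap y).
  by apply/funext => y; rewrite /rot /kap /t; case: ltP => _ /=; rewrite ?addrA.
have := @pw_mpreserving 2 kap t; rewrite -gE; apply.
- move=> i; have m1 : measurable [set y : R | y < 1 - al].
    by rewrite (_ : [set y | _] = `]-oo, (1 - al)[%classic)//; apply/seteqP; split=> y /=; rewrite in_itv.
  have [->|i1] := eqVneq i ord0.
    by rewrite (_ : [set y | _] = [set y : R | y < 1 - al])//; apply/seteqP; split=> y /=; rewrite /kap; case: ltP.
  rewrite (_ : [set y | _] = ~` [set y : R | y < 1 - al]); first exact: measurableC.
  have -> : i = ord_max by apply/val_inj; case: i i1 => -[|[|]].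
  by apply/seteqP; split=> y /=; rewrite /kap; case: ltP.
- by move=> y hy; have := rot_I01 hy; rewrite gE.
- move=> y z hy hz e; have {}e : rot al y = rot al z by rewrite gE.
  by rewrite -(rotK hy) -(rotK hz) e.
Qed.

Lemma rot_iter k y : I01 y -> I01 (iter k (rot al) y) /\
  exists m : nat, iter k (rot al) y = y + k%:R * al - m%:R.
Proof.
move=> hy; elim: k => [|k [IH [m mE]]]; first by split=> //; exists 0%N; rewrite /= mul0r addr0 subr0.
split; first exact: rot_I01.
rewrite [iter _.+1 _ _]/= mE {1}/rot; case: ifP => _.
  by exists m; rewrite -[k.+1%:R]natr1; ring.
by exists m.+1; rewrite -[k.+1%:R]natr1 -[m.+1%:R]natr1; ring.
Qed.

End Rotation.

Lemma rot_aut al : 0 < al < 1 -> is_aut lam01 (rot al, rot (1 - al)).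
Proof.
move=> h; have h' : 0 < 1 - al < 1 by move: h => /andP[? ?]; apply/andP; split; lra.
split; first exact: rot_mpreserving; split; first exact: rot_mpreserving.
split; apply: ae_imp lam01_I01 => y hy; first exact: rotK.
by have := rotK h' hy; rewrite subKr.
Qed.

Section IntervalPerm.
Variable q : nat.
Implicit Type g : 'S_q.+1.
Local Notation Q := (q.+1%:R : R).

Definition oidx (y : R) : 'I_q.+1 := inord (idx q.+1 y).

Lemma val_oidx y : I01 y -> oidx y = idx q.+1 y :> nat.
Proof. by move=> hy; rewrite inordK//; exact: idx_lt. Qed.

(** The exchange of the [q + 1] equal intervals prescribed by [g]. *)
Definition pperm (g : 'S_q.+1) (y : R) : R := y + ((g (oidx y))%:R - (oidx y)%:R) / Q.

Lemma pperm_mul g y : I01 y -> Q * pperm g y = Q * y + (g (oidx y))%:R - (idx q.+1 y)%:R.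
Proof. by move=> hy; rewrite /pperm (val_oidx hy) mulrDr mulrCA mulfV ?mulr1 ?addrA// pnatr_eq0. Qed.

Lemma pperm_itv g y : I01 y -> (g (oidx y))%:R <= Q * pperm g y < (g (oidx y)).+1%:R.
Proof.
move=> hy; rewrite pperm_mul//; have := idx_itv q.+1 hy.
by rewrite -[(idx _ y).+1%:R]natr1 -[(g _).+1%:R]natr1 => /andP[? ?]; apply/andP; split; lra.
Qed.

Lemma pperm_I01 g y : I01 y -> I01 (pperm g y).
Proof.
move=> /(pperm_itv g)/andP[h1 h2]; have Q0 : 0 < Q by rewrite ltr0n.
rewrite /I01/= -(pmulr_rge0 _ Q0) (le_trans _ h1)//= -(ltr_pM2l Q0) mulr1.
by apply: lt_le_trans h2 _; rewrite ler_nat.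
Qed.

Lemma oidx_pperm g y : I01 y -> oidx (pperm g y) = g (oidx y).
Proof.
move=> hy; apply/val_inj => /=; rewrite (val_oidx (pperm_I01 g hy)).
exact: idx_def (pperm_itv g hy).
Qed.

Lemma ppermK g y : I01 y -> pperm g^-1%g (pperm g y) = y.
Proof.
move=> hy; rewrite {1}/pperm oidx_pperm// permK /pperm.
have e (u v w z : R) : z + (u - v) / w + (v - u) / w = z by rewrite -(opprB u v) mulNr addrK.
exact: e.
Qed.

Lemma pperm_mpreserving g : mpreserving lam01 (pperm g).
Proof.
have := @pw_mpreserving q.+1 oidx (fun i => ((g i)%:R - i%:R) / Q); apply.
- by move=> i; exact: (idx_measurable q.+1 [set n | inord n = i]).
- exact: pperm_I01.
- by move=> y z hy hz e; rewrite -(ppermK g hy) -(ppermK g hz) /pperm e.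
Qed.

Lemma pperm_aut g : is_aut lam01 (pperm g, pperm g^-1%g).
Proof.
split; first exact: pperm_mpreserving; split; first exact: pperm_mpreserving.
split; apply: ae_imp lam01_I01 => y hy; first exact: ppermK.
by have := ppermK g^-1%g hy; rewrite invgK.
Qed.

End IntervalPerm.

End UnitInterval.

(** * Coordinates on a standard space *)

Section Coordinates.
Variables (R : realType) (d : measure_display) (X : measurableType d).
Variable mu : probability X R.
Local Notation lam := (@lam01 R).
Local Notation RR := (measurableTypeR R).

Definition iso01 (phi : X -> R) (psi : R -> X) :=
  [/\ @transports R _ _ X RR mu lam phi, measurable_fun [set: RR] (psi : RR -> X),
      ae_prop mu (fun x => I01 (phi x) /\ psi (phi x) = x) &
      @ae_prop R _ RR lam (fun y => phi (psi y) = y)].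

Lemma standard_iso01 : standard_nonatomic mu -> exists phi psi, iso01 phi psi.
Proof.
move=> [phi [psi [mphi [mpsi [h1 [h2 h3]]]]]]; exists phi, psi.
have tp : @transports R _ _ X RR mu lam phi by split.
split=> //.
- apply: ae_imp (ae_and h1 (transports_ae tp (@lam01_I01 R))) => x [[_ e] i]; by [].
- have [N [mN [N0 h]]] := h2.
  exists (N `|` ~` `[0%R, 1%R]%classic); have mI := @measurable_itv R `[0, 1].
  have mNI : measurable (N `|` ~` `[0%R, 1%R]%classic) by apply: measurableU => //; exact: measurableC.
  split=> //; split; last first.
    by move=> y ny; apply: h => [Ny|]; [apply: ny; left|apply: contrapT => hy; apply: ny; right].
  rewrite lam01E setIUl setICl setU0; apply/eqP; rewrite -measure_le0 -N0.
  by apply: le_measure; rewrite ?inE//; exact: measurableI.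
Qed.

Lemma transports_comp (d1 d2 d3 : measure_display) (Y : measurableType d1)
  (Z : measurableType d2) (W : measurableType d3) (nu : probability Y R)
  (m : probability Z R) (m' : probability W R) (g : Y -> Z) (h : Z -> W) :
  transports nu m g -> transports m m' h -> transports nu m' (fun y => h (g y)).
Proof.
move=> [mg pg] [mh ph]; split; first exact: measurableT_comp.
by move=> A mA; rewrite -(ph A mA) -(pg _ (measurable_preim mh mA)).
Qed.

Section Lift.
Variables (phi : X -> R) (psi : R -> X).
Hypothesis iso : iso01 phi psi.

Lemma psi_transports : @transports R _ _ RR X lam mu psi.
Proof.
have [[mphi pphi] mpsi h1 _] := iso; split=> // A mA.
have mA' := measurable_preim mpsi mA; rewrite -(pphi _ mA').
apply: ae_eq_measure => //; first exact: (measurable_preim mphi mA').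
by apply: ae_imp h1 => x [_ e]; rewrite /= e.
Qed.

Lemma phi_psi_phi (f : X -> R) : @transports R _ _ X RR mu lam f ->
  ae_prop mu (fun x => phi (psi (f x)) = f x).
Proof. by move=> tf; have [_ _ _ h] := iso; exact: (transports_ae tf h). Qed.

Definition lift (g : R -> R) (x : X) : X := psi (g (phi x)).

Variables g h : R -> R.
Hypothesis gh : @is_aut R _ RR lam (g, h).

Let tphi : @transports R _ _ X RR mu lam phi. Proof. by case: iso. Qed.

Lemma lift_transports : @transports R _ _ X RR mu lam (fun x => g (phi x)).
Proof. by have [pg _] := gh; exact: (transports_comp tphi pg). Qed.

Lemma lift_mpreserving : mpreserving mu (lift g).
Proof. exact: (transports_comp lift_transports psi_transports). Qed.

Lemma lift_iter : ae_prop mu (fun x => forall k, phi (iter k (lift g) x) = iter k g (phi x)).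
Proof.
have st k : ae_prop mu (fun x => phi (iter k.+1 (lift g) x) = g (phi (iter k (lift g) x))).
  exact: (mpreserving_ae (mpreserving_iter k lift_mpreserving) (phi_psi_phi lift_transports)).
apply: ae_imp (ae_all st) => x hx; elim=> [//|k IH].
by rewrite hx IH.
Qed.

End Lift.

Lemma lift_aut phi psi g h : iso01 phi psi -> @is_aut R _ RR lam (g, h) ->
  is_aut mu (lift phi psi g, lift phi psi h).
Proof.
move=> iso gh; have hg : @is_aut R _ RR lam (h, g) by have [? [? []]] := gh.
have [tphi mpsi h1 h2] := iso.
have inv g' h' : @is_aut R _ RR lam (g', h') ->
    ae_prop mu (fun x => lift phi psi h' (lift phi psi g' x) = x).
  move=> a; have [_ [_ [e _]]] := a.
  apply: ae_imp (ae_and3 (lift_iter iso a) (transports_ae tphi e) h1) => x [l e' [_ e'']].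
  by rewrite {1}/lift (l 1%N)/=; rewrite /= in e'; rewrite e' e''.
split; first exact: (lift_mpreserving iso gh).
split; first exact: (lift_mpreserving iso hg).
by split; exact: inv.
Qed.

(** Changing coordinates by an automorphism of the interval: lifting a rotation through the new
    coordinates amounts to lifting a conjugate of it. *)
Lemma iso01_comp phi psi g h : iso01 phi psi -> @is_aut R _ RR lam (g, h) ->
  iso01 (fun x => h (phi x)) (fun y => psi (g y)).
Proof.
move=> iso gh; have [tphi mpsi h1 h2] := iso; have [pg [ph [e1 e2]]] := gh.
have hg : @is_aut R _ RR lam (h, g) by [].
split.
- exact: (transports_comp tphi ph).
- by apply: (measurableT_comp mpsi); case: pg.
- apply: ae_imp (ae_and3 h1 (transports_ae tphi e2) (transports_ae (transports_comp tphi ph) (@lam01_I01 R))).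
  by move=> x [[_ p] e i]; split=> //=; rewrite [g _]e p.
- apply: ae_imp (ae_and e1 (mpreserving_ae pg h2)) => y [e p].
  by rewrite p; exact: e.
Qed.

End Coordinates.

(** * Sets of small outer measure *)

Section Small.
Variables (R : realType) (d : measure_display) (X : measurableType d).
Variable mu : probability X R.

(** Exceptional events can thus be described by propositions, with no proof of their
    measurability. *)
Definition prlt (S : set X) (e : R) :=
  exists N, [/\ measurable N, S `<=` N & fine (mu N) < e].

Lemma prob_le (A B : set X) : measurable A -> measurable B -> A `<=` B ->
  fine (mu A) <= fine (mu B).
Proof. by move=> mA mB AB; apply: fine_le; rewrite ?fin_num_measure//; apply: le_measure; rewrite ?inE. Qed.

Lemma prlt_sub S S' e : S `<=` S' -> prlt S' e -> prlt S e.
Proof. by move=> SS [N [mN sN h]]; exists N; split=> //; apply: subset_trans SS sN. Qed.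

Lemma prlt_le S e e' : e <= e' -> prlt S e -> prlt S e'.
Proof. by move=> ee [N [mN sN h]]; exists N; split=> //; apply: lt_le_trans ee. Qed.

Lemma prltU S S' e e' : prlt S e -> prlt S' e' -> prlt (S `|` S') (e + e').
Proof.
move=> [N [mN sN h]] [N' [mN' sN' h']]; exists (N `|` N'); split.
- exact: measurableU.
- by apply: setUSS.
- apply: le_lt_trans (ltrD h h'); rewrite -fineD ?fin_num_measure//; apply: fine_le.
  + by rewrite fin_num_measure//; exact: measurableU.
  + by rewrite fin_numD !fin_num_measure.
  + exact: measureU2.
Qed.

Lemma prlt_null P e : ae_prop mu P -> 0 < e -> prlt (~` P) e.
Proof.
move=> [N [mN [N0 h]]] e0; exists N; split=> //; last by rewrite N0.
by move=> x nP; apply: contrapT => /h.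
Qed.

Lemma prlt_meas S e : measurable S -> fine (mu S) < e -> prlt S e.
Proof. by move=> mS h; exists S; split. Qed.

Lemma prltE S e : measurable S -> prlt S e -> (mu S < e%:E)%E.
Proof.
move=> mS [N [mN sN h]]; rewrite -[mu S]fineK ?fin_num_measure// lte_fin.
exact: le_lt_trans (prob_le mS mN sN) h.
Qed.

Lemma prltF S e : measurable S -> prlt S e -> fine (mu S) < e.
Proof. by move=> mS [N [mN sN h]]; exact: le_lt_trans (prob_le mS mN sN) h. Qed.

Lemma prlt_preim (f : X -> X) S e : mpreserving mu f -> prlt S e -> prlt (f @^-1` S) e.
Proof.
move=> [mf pf] [N [mN sN h]]; exists (f @^-1` N); split; first exact: measurable_preim.
  by move=> x /sN.
by rewrite pf.
Qed.

(** The extra 1 in the factor keeps the bound strict for an empty list. *)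
Lemma prlt_seq (I : eqType) (s : seq I) (S : I -> set X) e : 0 < e ->
  (forall i, i \in s -> prlt (S i) e) ->
  prlt [set x | exists2 i, i \in s & S i x] ((size s).+1%:R * e).
Proof.
move=> e0; elim: s => [|i s IH] h.
  rewrite mul1r; exists set0; split=> //; last by rewrite measure0.
  by move=> x [].
apply: (@prlt_sub _ (S i `|` [set x | exists2 i, i \in s & S i x])).
  move=> x [j]; rewrite inE => /orP[/eqP->|js] Sx; first by left.
  by right; exists j.
apply: (@prlt_le _ (e + (size s).+1%:R * e)).
  by rewrite /= -[(size s).+2%:R]natr1 mulrDl mul1r addrC.
apply: prltU; first by apply: h; rewrite mem_head.
by apply: IH => j js; apply: h; rewrite inE js orbT.
Qed.

Lemma prlt_prob A B e : measurable A -> measurable B ->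
  prlt [set x | ~ (A x <-> B x)] e -> `|fine (mu A) - fine (mu B)| < e.
Proof.
have half A' B' e' : measurable A' -> measurable B' ->
    prlt [set x | ~ (A' x <-> B' x)] e' -> fine (mu A') - fine (mu B') < e'.
  move=> mA mB [N [mN sN h]]; rewrite ltrBlDl.
  apply: le_lt_trans (_ : fine (mu (B' `|` N)) < _).
    apply: prob_le => //; first exact: measurableU.
    move=> x Ax; have [Bx|nB] := pselect (B' x); first by left.
    by right; apply: sN => -[/(_ Ax)].
  apply: le_lt_trans (_ : fine (mu B') + fine (mu N) < _); last by rewrite ltrD2l.
  rewrite -fineD ?fin_num_measure//; apply: fine_le.
  - by rewrite fin_num_measure//; exact: measurableU.
  - by rewrite fin_numD !fin_num_measure.
  - exact: measureU2.
move=> mA mB h; rewrite ltr_norml half// andbT ltrNl opprB; apply: half => //.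
by apply: prlt_sub h => x /= nh [h1 h2]; apply: nh; split.
Qed.

End Small.

(** * Approximation by unions of equal intervals *)

Section Approximation.
Variables (R : realType) (d : measure_display) (X : measurableType d).
Variable mu : probability X R.
Variables (phi : X -> R) (psi : R -> X).
Hypothesis iso : iso01 mu phi psi.
Local Notation ix q x := (idx q (phi x)).
Local Notation prlt := (prlt mu).

Lemma mphi : measurable_fun setT phi. Proof. by case: iso => -[]. Qed.

Lemma mix q (P : set nat) : measurable [set x | P (ix q x)].
Proof. exact: (measurable_preim mphi (idx_measurable q P)). Qed.

Lemma mu_ix q l : (l < q)%N -> fine (mu [set x | ix q x = l]) = q%:R^-1.
Proof.
move=> lq; have [[_ tp] _ _ _] := iso.
by rewrite -(lam01_idx R (leq_ltn_trans (leq0n l) lq) lq) -(tp _ (idx_measurable q [set n | n = l])).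
Qed.

Lemma ae_I01 : ae_prop mu (fun x => I01 (phi x)).
Proof. by have [_ _ h _] := iso; apply: ae_imp h => x []. Qed.

(** Every large [q] must work, as [q] is chosen later as the denominator of a good rational
    approximation. *)
Definition approx (A : set X) := forall e, 0 < e -> exists Q, forall q, (Q <= q)%N ->
  exists K : nat -> bool, prlt [set x | ~ (A x <-> K (ix q x))] e.

Lemma approxC A : approx A -> approx (~` A).
Proof.
move=> hA e /hA[Q hQ]; exists Q => q /hQ[K hK]; exists (fun l => ~~ K l).
apply: prlt_sub hK => x /= h h'; apply: h; split=> [nA|/negP nK Ax].
  by apply/negP => /h'.
by apply: nK; apply/h'.
Qed.

Lemma approxU A B : approx A -> approx B -> approx (A `|` B).
Proof.
move=> hA hB e e0; have e2 : 0 < e / 2 by lra.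
have [Q hQ] := hA _ e2; have [Q' hQ'] := hB _ e2; exists (maxn Q Q') => q.
rewrite geq_max => /andP[/hQ[K hK] /hQ'[K' hK']]; exists (fun l => K l || K' l).
rewrite (_ : e = e / 2 + e / 2); last by lra.
apply: prlt_sub (prltU hK hK') => x /= h.
have [hk|nk] := pselect (A x <-> K (ix q x)); last by left.
have [hk'|nk'] := pselect (B x <-> K' (ix q x)); last by right.
exfalso; apply: h; split=> [[/hk->//|/hk'->]|/orP[/hk|/hk']]; by [rewrite orbT|left|right].
Qed.

Lemma approx_cup (A : nat -> set X) : (forall n, measurable (A n)) ->
  (forall n, approx (A n)) -> approx (\bigcup_n A n).
Proof.
move=> mA hA e e0; have e2 : 0 < e / 2 by lra.
pose B n := \big[setU/set0]_(i < n) A i.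
have mB n : measurable (B n) by apply: bigsetU_measurable.
have hB n : approx (B n).
  rewrite /B; elim: n => [|n IH]; last by rewrite big_ord_recr/=; apply: approxU.
  rewrite big_ord0 => f f0; exists 0%N => q _; exists (fun=> false).
  exists set0; split=> //; last by rewrite measure0.
  by move=> x /= h; exfalso; apply: h; split.
have mU : measurable (\bigcup_n A n) by apply: bigcup_measurable.
have BU : \bigcup_n B n = \bigcup_n A n.
  rewrite /B; apply/seteqP; split=> x [n _].
    by rewrite bigU_ord => -[i _ Ax]; exists i.
  by move=> Ax; exists n.+1 => //; rewrite bigU_ord; exists ord_max.
have cB : mu \o B @ \oo --> mu (\bigcup_n A n).
  rewrite -BU; apply: nondecreasing_cvg_mu => //; first by rewrite BU.
  apply/nondecreasing_seqP => n; rewrite /B big_ord_recr/=; apply/subsetPset; exact: subsetUl.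
have [n hn] : exists n, fine (mu (\bigcup_n A n)) - fine (mu (B n)) < e / 2.
  have cf : (fun n => fine (mu (B n))) @ \oo --> fine (mu (\bigcup_n A n)).
    by apply: fine_cvg; rewrite fineK ?fin_num_measure.
  move/cvgrPdist_lt: cf => /(_ _ e2)[n _ /(_ n (leqnn _))] h; exists n.
  exact: le_lt_trans (ler_norm _) h.
have [Q hQ] := hB n _ e2; exists Q => q /hQ[K hK]; exists K.
rewrite (_ : e = e / 2 + e / 2); last by lra.
have mD : measurable (\bigcup_n A n `\` B n) by exact: measurableD.
have hD : prlt (\bigcup_n A n `\` B n) (e / 2).
  apply: prlt_meas => //; have := measure_split mu (mB n) mU.
  rewrite (_ : _ `&` B n = B n); last by apply/setIidPr; rewrite -BU; exact: bigcup_sup.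
  by move=> h; move: hn; rewrite -h; lra.
apply: prlt_sub (prltU hD hK) => x /= h.
have [hk|nk] := pselect (B n x <-> K (ix q x)); last by right.
left; have BA : B n x -> (\bigcup_n A n) x by rewrite -BU; move=> ?; exists n.
split; last first.
  by move=> Bx; apply: h; split=> _; [apply/hk|exact: BA].
by apply: contrapT => nA; apply: h; split=> [//|/hk/BA].
Qed.

(** Only the interval containing [a] can be misclassified, and its measure is [1 / q]. *)
Lemma approx_ray (a : R) : approx [set x | a < phi x].
Proof.
move=> e e0; exists (Num.truncn e^-1).+2 => q hq.
have q0 : (0 < q)%N by lia.
have qR : 0 < q%:R :> R by rewrite ltr0n.
have qe : q%:R^-1 < e.
  rewrite invf_plt ?posrE//; apply: lt_le_trans (truncnS_gt _) _.
  by rewrite ler_nat ltnW.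
exists (fun l => q%:R * a < l%:R).
pose l0 := Num.truncn (q%:R * a).
have sub x : I01 (phi x) -> ~ ((a < phi x) <-> (q%:R * a < (ix q x)%:R)) -> ix q x = l0 /\ (l0 < q)%N.
  move=> hx; have /andP[h1 h2] := idx_itv q hx; have hlt := idx_lt q0 hx.
  have [ap|ap] := ltP a (phi x); last first.
    move=> h; exfalso; apply: h; split=> // h.
    have : q%:R * phi x <= q%:R * a by rewrite ler_pM2l.
    by lra.
  have [ak|ak] := ltP (q%:R * a) (ix q x)%:R; first by move=> h; exfalso; apply: h.
  move=> _; suff e1 : ix q x = l0 by rewrite -e1.
  apply/esym/truncn_def; rewrite ak/=; apply: lt_trans h2.
  by rewrite ltr_pM2l.
have [lq|lq] := ltnP l0 q; last first.
  apply: prlt_sub (prlt_null ae_I01 e0) => x h hx.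
  by have [_] := sub x hx h; rewrite ltnNge lq.
have e3 : 0 < e - q%:R^-1 by lra.
have h1 : prlt [set x | ix q x = l0] (q%:R^-1 + (e - q%:R^-1) / 2).
  by apply: prlt_meas; [exact: (mix q [set n | n = l0])|rewrite mu_ix//; lra].
have h2 : 0 < (e - q%:R^-1) / 2 by lra.
apply: (@prlt_le _ _ _ _ _ (q%:R^-1 + (e - q%:R^-1) / 2 + (e - q%:R^-1) / 2)); first by lra.
apply: prlt_sub (prltU h1 (prlt_null ae_I01 h2)) => x h.
have [hx|nx] := pselect (I01 (phi x)); last by right.
by left; have [] := sub x hx h.
Qed.

(** The sets of reals with approximable preimage form a sigma-algebra containing the rays; a
    measurable [A] is the preimage of [psi^-1 A] up to a null set. *)
Lemma approx_all A : measurable A -> approx A.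
Proof.
have key (B : set (measurableTypeR R)) : measurable B -> approx (phi @^-1` B).
  rewrite [X in X B](RGenOInfty.measurableE R).
  pose G : set (set R) := [set B | @measurable _ (measurableTypeR R) B /\ approx (phi @^-1` B)].
  suff : <<s @RGenOInfty.G R >> `<=` G by move=> h /h[].
  apply: smallest_sub; last first.
    move=> _ [a ->]; split; first exact: measurable_itv.
    have := approx_ray a; congr approx; apply/seteqP; split=> x /=; by rewrite in_itv/= andbT.
  split.
  - split; first exact: measurable0.
    move=> e e0; exists 0%N => q _; exists (fun=> false); exists set0; split=> //; last by rewrite measure0.
    by move=> x /= h; exfalso; apply: h; split.
  - move=> C [mC hC]; rewrite setTD; split; first exact: measurableC.
    by rewrite preimage_setC; exact: approxC.
  - move=> C hC; split; first by apply: bigcup_measurable => n _; case: (hC n).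
    rewrite preimage_bigcup; apply: approx_cup => n; last by case: (hC n).
    by apply: (measurable_preim mphi); case: (hC n).
move=> mA e e0; have [_ mpsi h1 _] := iso; have mB := measurable_preim mpsi mA.
have e2 : 0 < e / 2 by lra.
have [Q hQ] := key _ mB _ e2; exists Q => q /hQ[K hK]; exists K.
rewrite (_ : e = e / 2 + e / 2); last by lra.
apply: prlt_sub (prltU hK (prlt_null h1 e2)) => x /= h.
have [hx|nx] := pselect (I01 (phi x) /\ psi (phi x) = x); last by right.
by left=> /=; have [_ ->] := hx.
Qed.

Lemma approx_fin (F : finType) (f0 : F) (tau : X -> F) :
  (forall t, measurable [set x | tau x = t]) -> forall e, 0 < e ->
  exists Q, forall q, (Q <= q)%N -> exists v : nat -> F, prlt [set x | tau x <> v (ix q x)] e.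
Proof.
move=> mtau e e0; have F0 : 0 < e / #|F|.+1%:R by rewrite divr_gt0// ltr0n.
have /choice[Q hQ] t : exists Q, forall q, (Q <= q)%N ->
    exists K : nat -> bool, prlt [set x | ~ ((tau x = t) <-> K (ix q x))] (e / #|F|.+1%:R).
  exact: (approx_all (mtau t) F0).
exists (\max_t Q t)%N => q hq.
have /choice[K hK] t := hQ t q (leq_trans (leq_bigmax t) hq).
exists (fun l => odflt f0 [pick t | K t l]).
have eE : (size (enum F)).+1%:R * (e / #|F|.+1%:R) = e.
  by rewrite -cardE mulrC divfK// pnatr_eq0.
rewrite -eE; apply: prlt_sub (prlt_seq (s := enum F) F0 (fun t _ => hK t)) => x /= h.
apply: contrapT => nh; apply: h.
have {}nh t : tau x = t <-> K t (ix q x).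
  by apply: contrapT => hh; apply: nh; exists t => //; rewrite mem_enum.
case: pickP => [t /nh//|/(_ (tau x))]; by rewrite (proj1 (nh (tau x)) erefl).
Qed.

Lemma mu_ix_card q (P : pred 'I_q.+1) :
  fine (mu [set x | P (oidx q (phi x))]) = #|P|%:R / q.+1%:R.
Proof.
pose A (l : 'I_q.+1) := [set x | ix q.+1 x = l].
have mA l : measurable (A l) by exact: (mix q.+1 [set n | n = l :> nat]).
have tA : trivIset setT A.
  by apply/trivIsetP => i j _ _ ij; apply/seteqP; split=> x // [/= e1 e2]; case/eqP: ij; apply/val_inj; rewrite /= -e1 -e2.
have mP : measurable [set x | P (oidx q (phi x))] by exact: (mix q.+1 [set n | P (inord n)]).
have -> : mu [set x | P (oidx q (phi x))] = mu (\big[setU/set0]_(l < q.+1 | P l) A l).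
  apply: ae_eq_measure => //; first by apply: bigsetU_measurable.
  apply: ae_imp ae_I01 => x hx; rewrite bigU_ord /A/=; have vx := val_oidx q hx; split.
    by move=> Px; exists (oidx q (phi x)).
  by move=> [i Pi e1]; rewrite (_ : oidx q (phi x) = i)//; apply/val_inj; rewrite /= vx.
rewrite measure_bigsetU_ord//.
rewrite (eq_bigr (fun=> (q.+1%:R^-1)%:E)); last first.
  by move=> i _; rewrite -(mu_ix (ltn_ord i)) fineK//; exact: fin_num_measure (mA i).
by rewrite sumEFin/= sumr_const mulr_natl.
Qed.

End Approximation.

(** * Matching two labellings by a cyclic permutation *)

Section PermMatching.
Variables (F : finType) (q : nat) (u v : 'I_q.+1 -> F).
Implicit Type c : 'S_q.+1.
Local Open Scope group_scope.
Local Open Scope set_scope.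

Definition pbad c := [set l | u (c l) != v l].

Lemma tpermM x y c z : (tperm x y * c) z = c (tperm x y z).
Proof. by rewrite permM. Qed.

(** A minimiser works, by exchange: if some [l] with label [t] is mismatched, every [l'] sent by [c]
    to label [t] has label [t] itself, or else swapping [l] and [l'] would do better. The mismatches
    with label [t] are then at most the excess of [v] over [u] at [t]. *)
Lemma pbad_best : exists c, (#|pbad c| <= \sum_(t : F)
  (#|[set l | v l == t]| - #|[set l | u l == t]|))%N.
Proof.
have [c _ cmin] := @arg_minnP _ (1 : 'S_q.+1) xpredT (fun c => #|pbad c|) isT.
exists c; pose M t := [set l | (v l == t) && (u (c l) != t)].
have -> : #|pbad c| = (\sum_t #|M t|)%N.
  rewrite -sum1_card (partition_big v xpredT)//=; apply: eq_bigr => t _.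
  rewrite -sum1_card; apply: eq_bigl => l; rewrite !inE andbC.
  by case: eqP => [->|].
apply: leq_sum => t _; have [->|[l]] := set_0Vmem (M t); first by rewrite cards0.
rewrite inE => /andP[/eqP vl ul].
have key l' : u (c l') = t -> v l' = t.
  move=> ul'; apply/eqP; apply: contraT => vl'.
  have ll : l != l' by apply: contraNneq vl' => <-; rewrite vl.
  have := cmin (tperm l l' * c) isT; rewrite leqNgt => /negP[].
  apply: proper_card; apply/properP; split; last first.
    by exists l; [rewrite inE vl|rewrite !inE tpermM tpermL ul' vl eqxx].
  apply/fintype.subsetP => z; rewrite !inE tpermM.
  case: tpermP => [->|->|//]; first by rewrite ul' vl eqxx.
  by move=> _; rewrite ul' eq_sym.
have cu : #|[set l | u l == t]| = #|[set l | u (c l) == t]|.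
  rewrite -(card_imset _ (@perm_inj _ c)); congr (#|pred_of_set _|); last first.
  apply/setP => y; rewrite inE; apply/idP/imsetP => [uy|[x + ->]]; last by rewrite inE.
  by exists (c^-1 y); rewrite ?inE permKV.
rewrite cu leq_subRL; last first.
  by apply: subset_leq_card; apply/fintype.subsetP => z; rewrite !inE => /eqP/key ->.
rewrite -cardsUI [X in (_ + X)%N](_ : _ = 0%N) ?addn0; last first.
  by apply/eqP; rewrite cards_eq0 -finset.subset0; apply/fintype.subsetP => z; rewrite !inE => /andP[->]; rewrite andbF.
by apply: subset_leq_card; apply/fintype.subsetP => z; rewrite !inE => /orP[/eqP/key->//|/andP[]].
Qed.

Lemma porbits_merge x y c : x \notin porbit c y -> (#|porbits (tperm x y * c)| < #|porbits c|)%N.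
Proof.
move=> xy; have := porbits_mul_tperm c x y; rewrite xy/=.
have -> : x != y by apply: contraNneq xy => ->; exact: porbit_id.
by move=> h; rewrite -(ltn_add2r 1) -h -addnn addnA ltn_add2r addn1.
Qed.

(** Composing with the transposition of two points of equal label in different cycles joins these
    cycles and adds no mismatch. At the end every cycle is a union of label classes, so there are at
    most as many cycles as labels. *)
Lemma merge_types n c : (#|porbits c| <= n)%N ->
  exists2 c', (#|pbad c'| <= #|pbad c|)%N & forall x y, v x = v y -> x \in porbit c' y.
Proof.
elim: n c => [|n IH] c cn.
  exists c => // x y _; have : porbit c y \in porbits c by apply: imset_f.
  by move: cn; rewrite leqn0 cards_eq0 => /eqP->; rewrite inE.
have [h|nh] := pselect (forall x y, v x = v y -> x \in porbit c y); first by exists c.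
have [x [y [vxy xy]]] : exists x y, v x = v y /\ x \notin porbit c y.
  apply: contrapT => h; apply: nh => x y vxy; apply: contraT => xy.
  by exfalso; apply: h; exists x, y.
have [|c' h1 h2] := IH (tperm x y * c).
  by rewrite -ltnS; apply: leq_trans cn; exact: porbits_merge.
exists c' => //; apply: leq_trans h1 _.
rewrite -(card_imset _ (@perm_inj _ (tperm x y))); apply: subset_leq_card.
apply/fintype.subsetP => _ /imsetP[z + ->]; rewrite !inE tpermM.
by case: tpermP => [->|->|//]; rewrite ?vxy.
Qed.

(** Each further transposition joins two cycles at the price of at most two new mismatches. *)
Lemma merge_all n c : (#|porbits c| <= n)%N ->
  exists2 c', (#|pbad c'| <= #|pbad c| + n.*2)%N & forall x y, x \in porbit c' y.
Proof.
elim: n c => [|n IH] c cn.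
  exists c => [|x y]; first by rewrite addn0.
  have : porbit c y \in porbits c by apply: imset_f.
  by move: cn; rewrite leqn0 cards_eq0 => /eqP->; rewrite inE.
have [h|nh] := pselect (forall x y, x \in porbit c y); first by exists c => //; rewrite leq_addr.
have [x [y xy]] : exists x y, x \notin porbit c y.
  apply: contrapT => h; apply: nh => x y; apply: contraT => xy.
  by exfalso; apply: h; exists x, y.
have [|c' h1 h2] := IH (tperm x y * c).
  by rewrite -ltnS; apply: leq_trans cn; exact: porbits_merge.
exists c' => //; apply: leq_trans h1 _; rewrite doubleS.
have sub : pbad (tperm x y * c) \subset pbad c :|: [set x; y].
  apply/fintype.subsetP => z; rewrite !inE tpermM.
  by case: tpermP => [->|->|_ _ ->//]; rewrite eqxx ?orbT.
have := leq_trans (subset_leq_card sub) (leq_card_setU _ _); rewrite cards2.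
by case: (x != y) => /= h; lia.
Qed.

Theorem cyclic_matching : exists2 c, forall x y, x \in porbit c y &
  (#|pbad c| <= \sum_(t : F) (#|[set l | v l == t]| - #|[set l | u l == t]|) + #|F|.*2)%N.
Proof.
have [c0 h0] := pbad_best; have [c1 h1 t1] := merge_types (leqnn #|porbits c0|).
have h : (#|porbits c1| <= #|F|)%N.
  pose G t := if [pick x | v x == t] is Some x then porbit c1 x else finset.set0.
  have hG : (#|G @: finset.setT| <= #|F|)%N.
    by apply: leq_trans (leq_imset_card _ _) _; rewrite cardsT.
  apply: leq_trans hG; apply: subset_leq_card.
  apply/fintype.subsetP => _ /imsetP[x _ ->]; apply/imsetP.
  exists (v x) => //; rewrite /G; case: pickP => [y /eqP vy|/(_ x)]; last by rewrite eqxx.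
  by apply/eqP; rewrite eq_porbit_mem; apply: t1.
have [c2 h2 t2] := merge_all h; exists c2 => //.
by apply: leq_trans h2 _; rewrite leq_add2r; apply: leq_trans h1 h0.
Qed.

End PermMatching.

Lemma mulmod_perm Q a : prime Q -> ~~ (Q %| a)%N ->
  exists p : 'S_Q, forall i, p i = (i * a %% Q)%N :> nat.
Proof.
move=> prQ Qa; have Q0 := prime_gt0 prQ.
pose f (i : 'I_Q) : 'I_Q := Ordinal (ltn_pmod (i * a) Q0).
have finj : injective f.
  have w (i j : 'I_Q) : (i <= j)%N -> f i = f j -> i = j.
    move=> ij /(congr1 val)/= /eqP; rewrite eq_sym eqn_mod_dvd ?leq_mul2r ?ij ?orbT//.
    rewrite -mulnBl Euclid_dvdM// (negbTE Qa) orbF => h; apply/eqP; apply: contraT => ne.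
    have : (0 < j - i)%N by rewrite subn_gt0 ltn_neqAle ij andbT.
    by move=> /dvdn_leq/(_ h); have := ltn_ord j; lia.
  move=> i j fij; case: (leqP i j) => ij; first exact: w.
  by apply/esym/w => //; exact: ltnW.
by exists (perm finj) => i; rewrite permE.
Qed.

Lemma mulmod_solve Q a r : prime Q -> ~~ (Q %| a)%N -> (r < Q)%N ->
  exists2 i, (i < Q)%N & ((r + i * a) %% Q = 0)%N.
Proof.
move=> prQ Qa rQ; have [p pE] := mulmod_perm prQ Qa; have Q0 := prime_gt0 prQ.
pose s : 'I_Q := Ordinal (ltn_pmod (Q - r) Q0).
exists (p^-1%g s) => //; have := pE (p^-1%g s); rewrite permKV/= => h.
by rewrite -modnDmr -h modnDmr subnKC ?modnn// ltnW.
Qed.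

(** [ga], sending [a] to [c^a 0], conjugates the shift by 1 to [c]; [pi], the multiplication by [p]
    modulo a prime, conjugates the shift by 1 to the shift by [p]. *)
Lemma cycle_conj q p (c : 'S_q.+1) : prime q.+1 -> (0 < p < q.+1)%N ->
  (forall x y, x \in porbit c y) ->
  exists g : 'S_q.+1, forall i j : 'I_q.+1, j = ((i + p) %% q.+1)%N :> nat -> g j = c (g i).
Proof.
move=> prQ /andP[p0 pq] tc; have ndv : ~~ (q.+1 %| p)%N.
  by apply/negP => /(dvdn_leq p0); lia.
have [pi piE] := mulmod_perm prQ ndv.
have ct : #|porbit c ord0| = q.+1.
  rewrite (_ : porbit c ord0 = finset.setT) ?cardsT ?card_ord//.
  by apply/setP => x; rewrite inE tc.
have cQ : iter q.+1 c ord0 = ord0 by have := iter_porbit c ord0; rewrite ct.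
have ginj : injective (fun i : 'I_q.+1 => iter i c ord0).
  have := uniq_traject_porbit c ord0; rewrite ct => ut i j e.
  apply/val_inj/eqP => /=; rewrite -(nth_uniq ord0 _ _ ut) ?size_traject//.
  by rewrite !nth_traject// e.
pose ga := perm ginj.
have gaS (a b : 'I_q.+1) : b = ((a + 1) %% q.+1)%N :> nat -> ga b = c (ga a).
  move=> ba; rewrite !permE ba addn1; have := ltn_ord a; rewrite ltnS leq_eqVlt => /orP[/eqP aq|aq].
    by rewrite aq modnn/= -[RHS]/(iter q.+1 c ord0) cQ.
  by rewrite modn_small.
exists (pi^-1 * ga)%g => i j ji; rewrite !permM; apply: gaS.
set a := (pi^-1%g i); set b := (pi^-1%g j).
have ia : i = (a * p %% q.+1)%N :> nat by rewrite -piE permKV.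
have jb : j = (b * p %% q.+1)%N :> nat by rewrite -piE permKV.
pose b' : 'I_q.+1 := Ordinal (ltn_pmod (a + 1) (ltn0Sn q)).
suff -> : b = b' by [].
apply: (@perm_inj _ pi); apply/val_inj; rewrite /= /b permKV ji ia piE/=.
by rewrite modnDml modnMml mulnDl mul1n.
Qed.

(** Nested intervals from [p / q] to [b], with [q] prime and [b] within [1 / ((N + 1) q^2)] of
    [p / q]. The fractions approach from below with error [o(1 / q^2)], which is the precision that
    the towers need. *)
Lemma liouville (R : realType) : exists al : R, 0 < al < 1 /\
  forall N e, 0 < e -> exists q p, [/\ prime q, (N < q)%N, (0 < p < q)%N &
    0 < al - p%:R / q%:R < e / q%:R ^+ 2].
Proof.
pose st := (nat * nat * R)%type.
pose fr (s : st) : R := s.1.1%:R / s.1.2%:R.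
pose inv (s : st) := [/\ prime s.1.2, (0 < s.1.1 < s.1.2)%N & fr s < s.2 <= 1].
have step N s : inv s -> exists s' : st, [/\ inv s', (N < s'.1.2)%N, fr s < fr s', s'.2 <= s.2 &
    s'.2 <= fr s' + N.+1%:R^-1 / s'.1.2%:R ^+ 2].
  move=> [pr /andP[p0 pq] /andP[h1 h2]]; set a := fr s in h1 *; set b := s.2 in h1 h2 *.
  have a0 : 0 <= a by rewrite /a /fr divr_ge0.
  have D : 0 < b - a by lra.
  have [q Mq prq] := prime_above (maxn N (Num.truncn (b - a)^-1).+1).
  move: Mq; rewrite gtn_max => /andP[Nq Mq].
  have q0 : 0 < q%:R :> R by rewrite ltr0n prime_gt0.
  have q1 : q%:R^-1 < b - a.
    rewrite invf_plt ?posrE//; apply: lt_trans (truncnS_gt _) _; by rewrite ltr_nat.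
  (* The least fraction of denominator [q] above [a]. *)
  pose p := (Num.truncn (q%:R * a)).+1.
  have hp1 : a < p%:R / q%:R by rewrite ltr_pdivlMr// mulrC; exact: truncnS_gt.
  have hp2 : p%:R / q%:R <= a + q%:R^-1.
    rewrite ler_pdivrMr// mulrDl mulVf ?gt_eqF// /p -natr1 lerD2r [leRHS]mulrC.
    by have /andP[] := truncn_itv (mulr_ge0 (ltW q0) a0).
  have hp3 : p%:R / q%:R < b by lra.
  have g0 : 0 < N.+1%:R^-1 / q%:R ^+ 2 :> R by rewrite divr_gt0 ?invr_gt0 ?ltr0n// exprn_gt0.
  exists (p, q, Num.min b (p%:R / q%:R + N.+1%:R^-1 / q%:R ^+ 2)); split=> //=.
  - split=> //=; last by rewrite /fr/= lt_min hp3 ltrDl g0/= ge_min h2.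
    rewrite /p/= -(ltr_nat R) -[_%:R](@mulfVK _ q%:R) ?gt_eqF// -[ltRHS]mul1r ltr_pM2r//.
    exact: lt_le_trans hp3 h2.
  - by rewrite ge_min lexx.
  - by rewrite ge_min lexx orbT.
have /choice[F FP] (Ns : nat * st) : exists s' : st, inv Ns.2 -> [/\ inv s', (Ns.1 < s'.1.2)%N,
    fr Ns.2 < fr s', s'.2 <= Ns.2.2 & s'.2 <= fr s' + Ns.1.+1%:R^-1 / s'.1.2%:R ^+ 2].
  case: (pselect (inv Ns.2)) => [h|h]; last by exists Ns.2.
  by have [s' hs] := step Ns.1 _ h; exists s'.
(* The start is [1 / 3] with upper end [1 / 2]; the precision parameter of stage [n] is [n]
   itself. *)
pose s n : st := nat_rect (fun=> st) (1%N, 3%N, 2^-1) (fun n x => F (n, x)) n.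
have invs n : inv (s n).
  elim: n => [|n IH]; last by have [] := FP (n, s n) IH.
  by split=> //=; rewrite /fr/= mul1r; apply/andP; split; lra.
have sS n := FP (n, s n) (invs n).
pose a n := fr (s n); pose b n := (s n).2.
have aS n : a n < a n.+1 by have [] := sS n.
have bS n : b n.+1 <= b n by have [] := sS n.
have am m k : a m <= a (m + k)%N.
  elim: k => [|k IH]; first by rewrite addn0.
  by rewrite addnS; apply: le_trans IH (ltW (aS _)).
have bm m k : b (m + k)%N <= b m.
  elim: k => [|k IH]; first by rewrite addn0.
  by rewrite addnS; apply: le_trans (bS _) IH.
have ab n : a n < b n by have [_ _ /andP[]] := invs n.
have abm m n : a m <= b n.
  have [mn|nm] := leqP m n.
    by rewrite -(subnKC mn); apply: le_trans (am m _) (ltW (ab _)).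
  by rewrite -(subnKC (ltnW nm)) in am *; apply: le_trans (ltW (ab _)) (bm _ _).
pose al := sup (range a).
have aal n : a n <= al by apply: ub_le_sup; [exists (b 0%N) => _ [m _ <-]|exists n].
have alb n : al <= b n by apply: ge_sup; [exists (a 0%N), 0%N|move=> _ [m _ <-]].
have aal' n : a n < al by apply: lt_le_trans (aS n) (aal _).
exists al; split.
  apply/andP; split; last by apply: le_lt_trans (alb 0%N) _; rewrite /b/=; lra.
  by apply: le_lt_trans (aal' 0%N); rewrite /a /fr/=; lra.
move=> N e e0; pose M := maxn N (Num.truncn e^-1).+1.
have [[prq pq _] Mq _ _ hb] := sS M.
exists (s M.+1).1.2, (s M.+1).1.1; split=> //; first by apply: leq_ltn_trans Mq; exact: leq_maxl.
rewrite subr_gt0 aal'/= ltrBlDl; apply: le_lt_trans (alb M.+1) _; apply: le_lt_trans hb _.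
rewrite ltrD2l ltr_pM2r ?invr_gt0 ?exprn_gt0 ?ltr0n ?prime_gt0// invf_plt ?posrE ?ltr0n//.
apply: lt_le_trans (truncnS_gt _) _; rewrite ler_nat; apply: leq_trans (leq_maxr _ _) (leqnSn _).
Qed.

(** * Rank one powers of rotations, and their density *)

Section RotationTowers.
Variables (R : realType) (d : measure_display) (X : measurableType d).
Variable mu : probability X R.
Local Notation prlt := (prlt mu).

(** Relative to the rotation by [p / q], each step of the [n]-th power drifts by [n (al - p / q)].
    The base starts at [q] times this drift, so that the drift of up to [q] steps carries no point
    of the tower out of its interval. *)
Lemma rot_level (al : R) q p n i m (y z : R) : (0 < q)%N -> 0 <= al - p%:R / q%:R -> (i <= q)%N ->
  I01 y -> z = y + (i * n)%:R * al - m%:R ->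
  n%:R * q%:R * (al - p%:R / q%:R) <= z < q%:R^-1 -> ((idx q y + i * (n * p)) %% q = 0)%N.
Proof.
move=> q0; set de := al - _ => d0 iq hy zE /andP[z1 z2].
have qR : 0 < q%:R :> R by rewrite ltr0n.
have /andP[h1 h2] := idx_itv q hy.
have zE' : q%:R * z = q%:R * y + (i * (n * p))%:R + q%:R * (i * n)%:R * de - q%:R * m%:R.
  rewrite zE /de !natrM; field; by rewrite gt_eqF.
have w1 : q%:R * (i * n)%:R * de <= q%:R * z.
  rewrite -mulrA ler_pM2l//; apply: le_trans z1; rewrite natrM.
  by rewrite [i%:R * _]mulrC ler_wpM2r// ler_wpM2l// ler_nat.
have w2 : q%:R * z < 1 by rewrite -ltr_pdivlMl// mulr1.
have w3 : 0 <= q%:R * (i * n)%:R * de by rewrite !mulr_ge0// ltW.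
suff -> : (idx q y + i * (n * p) = q * m)%N by rewrite modnMr.
rewrite -natr1 in h2; apply/eqP; rewrite eqn_leq; apply/andP; split;
  rewrite -ltnS -(ltr_nat R) -natr1 natrD [(q * m)%:R]natrM; lra.
Qed.

Section Iso.
Variables (phi : X -> R) (psi : R -> X).
Hypothesis iso : iso01 mu phi psi.

Lemma mu_itv (a b : R) : 0 <= a -> a <= b -> b <= 1 ->
  fine (mu [set x | a <= phi x < b]) = b - a.
Proof.
move=> a0 ab b1; have [[_ tp] _ _ _] := iso.
have mI := @measurable_itv R `[a, b[.
have -> : [set x | a <= phi x < b] = phi @^-1` `[a, b[%classic.
  by apply/seteqP; split=> x /=; rewrite in_itv.
rewrite (tp _ mI) lam01E (_ : _ `&` _ = `[a, b[%classic); last first.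
  apply/setIidPl => y /=; rewrite !in_itv/= => /andP[? ?]; apply/andP; split; lra.
rewrite lebesgue_measure_itv/= lte_fin; case: ltP => [_|ba]; first by [].
by rewrite /=; lra.
Qed.

Lemma mu_itv_le (a b : R) : a <= b -> fine (mu [set x | a <= phi x < b]) <= b - a.
Proof.
move=> ab; have [[_ tp] _ _ _] := iso; have mI := @measurable_itv R `[a, b[.
have -> : [set x | a <= phi x < b] = phi @^-1` `[a, b[%classic.
  by apply/seteqP; split=> x /=; rewrite in_itv.
rewrite (tp _ mI) -lee_fin fineK ?fin_num_measure// lam01E.
apply: le_trans (_ : lebesgue_measure `[a, b[%classic <= _)%E.
  by apply: le_measure; rewrite ?inE//; exact: measurableI.
by rewrite lebesgue_measure_itv/= lte_fin; case: ltP => // _; rewrite lee_fin subr_ge0.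
Qed.

Variable al : R.
Hypothesis al01 : 0 < al < 1.
Hypothesis alL : forall N e, 0 < e -> exists q p, [/\ prime q, (N < q)%N, (0 < p < q)%N &
    0 < al - p%:R / q%:R < e / q%:R ^+ 2].

(** As [q] is a prime above [n] and [p], the product [n p] is invertible modulo [q]. The levels of a
    tower of height [q] thus correspond to the [q] intervals, each level missing only a part of
    measure [n q (al - p / q)], below [e4 / q]. *)
Lemma rot_rank_one n : (0 < n)%N -> rank_one mu (iter n (lift phi psi (rot al))).
Proof.
move=> n0 k As e mAs e0; set T := lift phi psi (rot al).
have aT : is_aut mu (T, lift phi psi (rot (1 - al))) by apply: (lift_aut iso); exact: rot_aut.
have pT : mpreserving mu T by case: aT.
(* The error budget is [e4 + (2 e4 + e4)]; the cap at 1 keeps the base of positive measure. *)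
pose e4 := Num.min e 1 / 4.
have m0 : 0 < Num.min e 1 by rewrite lt_min e0 ltr01.
have m1 : Num.min e 1 <= 1 by rewrite ge_min lexx orbT.
have me : Num.min e 1 <= e by rewrite ge_min lexx.
have e40 : 0 < e4 by rewrite /e4; lra.
have e41 : e4 < 1 by rewrite /e4; lra.
have e4e : 4 * e4 <= e by rewrite /e4; lra.
clearbody e4.
have /choice[Q hQ] i : exists Q, (i < k)%N -> forall q, (Q <= q)%N -> exists K : nat -> bool,
    prlt [set x | ~ (As i x <-> K (idx q (phi x)))] e4.
  case: (ltnP i k) => ik; last by exists 0%N.
  by have [Q hQ] := approx_all iso (mAs i ik) e40; exists Q => _.
have nR : 0 < n%:R :> R by rewrite ltr0n.
have [q [p [prq Nq /andP[p0 pq] /andP[d0 d1]]]] :=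
  alL (maxn (\max_(i < k) Q i) n) (divr_gt0 e40 nR).
set de := al - _ in d0 d1; move: Nq; rewrite gtn_max => /andP[Qq nq].
have q0 := prime_gt0 prq; have qR : 0 < q%:R :> R by rewrite ltr0n.
have nde : n%:R * q%:R * de < e4 / q%:R.
  rewrite ltr_pdivlMr//; move: d1; rewrite ltr_pdivlMr ?exprn_gt0// ltr_pdivlMr//.
  by rewrite expr2; apply: le_lt_trans; rewrite le_eqVlt; apply/orP; left; apply/eqP; ring.
have nde0 : 0 <= n%:R * q%:R * de by rewrite !mulr_ge0// ltW.
have qV : e4 / q%:R < q%:R^-1 by rewrite -[ltRHS]mul1r ltr_pM2r// invr_gt0.
have qV1 : q%:R^-1 <= 1 :> R by rewrite invf_le1// ler1n.
pose B := [set x | n%:R * q%:R * de <= phi x < q%:R^-1].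
have mB : measurable B.
  have -> : B = phi @^-1` `[(n%:R * q%:R * de), q%:R^-1[%classic.
    by apply/seteqP; split=> x /=; rewrite in_itv.
  by apply: (measurable_preim (mphi iso)); exact: measurable_itv.
have muB : fine (mu B) = q%:R^-1 - n%:R * q%:R * de.
  by apply: mu_itv => //; lra.
pose f := iter n T; have pf : mpreserving mu f by exact: mpreserving_iter.
pose L i := iter i f @^-1` B.
have mL i : measurable (L i) by apply: measurable_preim => //; case: (mpreserving_iter i pf).
have muL i : fine (mu (L i)) = q%:R^-1 - n%:R * q%:R * de.
  by rewrite -muB; have [_ ->] := mpreserving_iter i pf.
pose W x := I01 (phi x) /\ forall j, phi (iter j T x) = iter j (rot al) (phi x).
have aeW : ae_prop mu W.
  by apply: ae_and; [exact: ae_I01 iso|exact: (lift_iter iso (rot_aut al01))].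
pose a := (n * p)%N.
have key i x : (i < q)%N -> W x -> L i x -> ((idx q (phi x) + i * a) %% q = 0)%N.
  move=> iq [hx hT] Lx; have [_ [m mE]] := rot_iter al01 (i * n) hx.
  apply: (rot_level q0 (ltW d0) (ltnW iq) hx mE).
  by move: Lx; rewrite /L/= /f -iterM /B/= hT.
have qa : ~~ (q %| a)%N.
  rewrite /a Euclid_dvdM// negb_or; apply/andP; split; apply/negP.
    by move=> /(dvdn_leq n0); rewrite leqNgt nq.
  by move=> /(dvdn_leq p0); rewrite leqNgt pq.
have uniq r i j : (i < q)%N -> (j < q)%N -> ((r + i * a) %% q = 0)%N -> ((r + j * a) %% q = 0)%N -> i = j.
  move=> iq jq h1 h2; have [pp ppE] := mulmod_perm prq qa.
  have : pp (Ordinal iq) = pp (Ordinal jq).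
    by apply/val_inj; rewrite /= !ppE/=; apply/eqP; rewrite -(eqn_modDl r) h1 h2.
  by move/perm_inj => -[].
(* The part that level [i] misses of the interval assigned to it. *)
pose Z i := [set x | ((idx q (phi x) + i * a) %% q = 0)%N /\ (idx q (phi x) < q)%N] `\` L i.
have hZ i : i \in iota 0 q -> prlt (Z i) (e4 / q%:R).
  rewrite mem_iota add0n => /andP[_ iq].
  pose r := ((q - (i * a) %% q) %% q)%N.
  have rq : (r < q)%N by exact: ltn_pmod.
  have rE : ((r + i * a) %% q = 0)%N.
    by rewrite /r modnDml -modnDmr subnK ?modnn// ltnW// ltn_pmod.
  have rU l : (l < q)%N -> ((l + i * a) %% q = 0)%N -> l = r.
    move=> lq h; apply/eqP; rewrite -(modn_small lq) -(modn_small rq) -[_ == _]/(_ == _ %[mod q]).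
    by rewrite -(eqn_modDr (i * a)) h rE.
  have mC : measurable [set x | idx q (phi x) = r] by exact: (mix iso q [set m | m = r]).
  apply: (@prlt_sub _ _ _ _ _ ([set x | idx q (phi x) = r] `\` L i)).
    by move=> x [[h1 h2] nL]; split=> //=; exact: rU.
  apply: prlt_meas; first exact: measurableD.
  have := measure_split mu (mL i) mC; rewrite (mu_ix iso rq).
  have -> : mu ([set x | idx q (phi x) = r] `&` L i) = mu (L i).
    apply: ae_eq_measure => //; first exact: measurableI.
    apply: ae_imp aeW => x hx; split=> [[]//|Lx]; split=> //=.
    by apply: rU; [apply: idx_lt => //; case: hx|exact: key].
  rewrite muL; lra.
have hZU : prlt [set x | exists2 i, i \in iota 0 q & Z i x] (2 * e4).
  apply: prlt_le (prlt_seq (divr_gt0 e40 qR) hZ).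
  rewrite size_iota -natr1 mulrDl mul1r mulrC divfK ?gt_eqF//.
  have : e4 / q%:R <= e4 by rewrite ler_pdivrMr// ler_pMr// ler1n.
  lra.
have hW := prlt_null aeW e40.
have good x : W x -> ~ (exists2 i, i \in iota 0 q & Z i x) ->
    exists2 i, (i < q)%N & L i x /\ ((idx q (phi x) + i * a) %% q = 0)%N.
  move=> Wx nZ; have hx : (idx q (phi x) < q)%N by apply: idx_lt => //; case: Wx.
  have [i iq iE] := mulmod_solve prq qa hx; exists i => //; split=> //.
  by apply: contrapT => nL; apply: nZ; exists i; rewrite ?mem_iota.
exists B, q; split=> //; split=> //; split.
  move=> i j iq jq ij; have mLL : measurable (L i `&` L j) by exact: measurableI.
  have -> : mu (L i `&` L j) = mu set0.
    apply: ae_eq_measure => //; apply: ae_imp aeW => x Wx; split=> // -[Li Lj].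
    by apply: ij; apply: (uniq (idx q (phi x))) => //; exact: key.
  by rewrite measure0.
have mU (J : set nat) : measurable (\bigcup_(i in J) L i) by apply: bigcup_measurable.
split.
  have h := prltU hZU hW; have hc := prob_compl mu (mU `I_q).
  rewrite -[ltRHS]fineK ?fin_num_measure// lte_fin.
  have : fine (mu (~` \bigcup_(i in `I_q) L i)) < 2 * e4 + e4.
    apply: prltF; first exact: measurableC.
    apply: prlt_sub h => x nU; have [Wx|] := pselect (W x); last by right.
    left; apply: contrapT => /(good x Wx)[i iq [Lx _]].
    by apply: nU; exists i.
  rewrite /L in hc *; lra.
move=> i ik; have [K hK] := hQ i ik q (leq_trans (leq_bigmax (Ordinal ik)) (ltnW Qq)).
(* The levels whose interval belongs to the approximation [K] of [As i]. *)
exists [set j | (j < q)%N /\ exists2 r, K r & ((r + j * a) %% q = 0 /\ (r < q))%N].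
split; first by move=> j [].
set J := [set j | _].
have mS : measurable (symdiff (As i) (\bigcup_(j in J) L j)).
  by apply: measurableU; apply: measurableD => //; exact: mAs.
apply: prltE => //; apply: (prlt_le e4e); rewrite (_ : 4 * e4 = e4 + (2 * e4 + e4)); last by ring.
apply: prlt_sub (prltU hK (prltU hZU hW)) => x Sx.
have [Wx|] := pselect (W x); last by right; right.
have [|nZ] := pselect (exists2 i, i \in iota 0 q & Z i x); first by right; left.
left=> hAK; have [i0 i0q [Lx i0E]] := good x Wx nZ.
have hx : (idx q (phi x) < q)%N by apply: idx_lt => //; case: Wx.
case: Sx => [[/hAK Kx nU]|[[j [jq [r Kr [rE rq]]] Lj] nA]].
  by apply: nU; exists i0 => //; split=> //; exists (idx q (phi x)).
apply: nA; apply/hAK; suff -> : idx q (phi x) = r by [].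
have := key j x jq Wx Lj => hE; apply/eqP.
rewrite -(modn_small hx) -(modn_small rq) -[_ == _]/(_ == _ %[mod q]).
by rewrite -(eqn_modDr (j * a)) hE rE.
Qed.

(** The rotation by [al] exceeds the rotation by [p / q] by a small amount, which matters only near
    the right end of an interval. *)
Lemma rot_oidx q p (y : R) : 0 < al - p%:R / q.+1%:R -> (p < q.+1)%N -> I01 y ->
  q.+1%:R * y + q.+1%:R * (al - p%:R / q.+1%:R) < (idx q.+1 y).+1%:R ->
  oidx q (rot al y) = ((oidx q y + p) %% q.+1)%N :> nat.
Proof.
move=> d0 pq hy h; have qR : 0 < q.+1%:R :> R by rewrite ltr0n.
have hr := rot_I01 al01 hy; rewrite (val_oidx q hr) (val_oidx q hy).
have /andP[h1 h2] := idx_itv q.+1 hy; have hl := idx_lt (ltn0Sn q) hy.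
set l := idx q.+1 y in h h1 h2 hl *; set de := al - _ in d0 h.
have qal : q.+1%:R * al = p%:R + q.+1%:R * de.
  by rewrite /de mulrBr [q.+1%:R * (_ / _)]mulrC divfK ?gt_eqF// addrC subrK.
have qd : 0 < q.+1%:R * de by rewrite mulr_gt0.
have /andP[_ r1] := hr; have /andP[r0 _] := hr.
have r1' : q.+1%:R * rot al y < q.+1%:R by rewrite -[ltRHS]mulr1 ltr_pM2l.
have r0' : 0 <= q.+1%:R * rot al y by rewrite mulr_ge0// ltW.
rewrite -[l.+1%:R]natr1 in h; rewrite -[l.+1%:R]natr1 in h2.
have [yl|yl] := ltP y (1 - al).
  have rE : q.+1%:R * rot al y = q.+1%:R * y + p%:R + q.+1%:R * de.
    by rewrite /rot yl mulrDr qal; lra.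
  rewrite (@idx_def _ q.+1 _ (l + p)); last first.
    by rewrite rE -[(l + p).+1%:R]natr1 natrD; apply/andP; split; lra.
  rewrite modn_small// -(ltr_nat R) natrD; lra.
have rE : q.+1%:R * rot al y = q.+1%:R * y + p%:R + q.+1%:R * de - q.+1%:R.
  by rewrite /rot ltNge yl/= mulrBr mulrDr qal mulr1; lra.
have lp : (q.+1 <= l + p)%N.
  by rewrite -ltnS -(ltr_nat R) -[(l + p).+1%:R]natr1 natrD; lra.
rewrite (@idx_def _ q.+1 _ (l + p - q.+1)); last first.
  by rewrite rE -[(l + p - q.+1).+1%:R]natr1 natrB// natrD; apply/andP; split; lra.
rewrite -{2}(subnK lp) modnDr modn_small// ltn_subLR//.
exact: leq_add hl (ltnW pq).
Qed.

(** The exceptional points lie in strips of width [al - p / q] at the right ends of the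
    intervals. *)
Lemma rot_bad q p e : prime q.+1 -> (p < q.+1)%N ->
  0 < al - p%:R / q.+1%:R -> al - p%:R / q.+1%:R < e / 4 / q.+1%:R ^+ 2 ->
  prlt [set x | I01 (phi x) /\
    oidx q (rot al (phi x)) <> ((oidx q (phi x) + p) %% q.+1)%N :> nat] e.
Proof.
move=> prq pq d0 d1; have qR : 0 < q.+1%:R :> R by rewrite ltr0n.
set de := al - _ in d0 d1.
have q1 : 1 <= q.+1%:R :> R by rewrite ler1n.
have d2 : de * q.+1%:R ^+ 2 < e / 4 by rewrite -ltr_pdivlMr ?exprn_gt0.
have hS (l : nat) : l \in iota 0 q.+1 -> prlt [set x | l.+1%:R / q.+1%:R - de <= phi x < l.+1%:R / q.+1%:R] (2 * de).
  rewrite mem_iota add0n => /andP[_ lq].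
  apply: prlt_meas.
    have -> : [set x | l.+1%:R / q.+1%:R - de <= phi x < l.+1%:R / q.+1%:R] =
        phi @^-1` `[(l.+1%:R / q.+1%:R - de), (l.+1%:R / q.+1%:R)[%classic.
      by apply/seteqP; split=> x /=; rewrite in_itv.
    by apply: (measurable_preim (mphi iso)); exact: measurable_itv.
  have le1 (c dd : R) : 0 < dd -> c - dd <= c by move=> ?; lra.
  have lt2 (c dd : R) : 0 < dd -> c - (c - dd) < 2 * dd by move=> ?; lra.
  exact: le_lt_trans (mu_itv_le (le1 _ _ d0)) (lt2 _ _ d0).
have d20 : 0 < 2 * de by lra.
apply: (@prlt_le _ _ _ _ _ ((size (iota 0 q.+1)).+1%:R * (2 * de))).
  rewrite size_iota -[q.+2%:R]natr1; have : de * q.+1%:R <= de * q.+1%:R ^+ 2 by rewrite ler_pM2l// ler_eXnr.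
  have : de <= de * q.+1%:R ^+ 2 by rewrite ler_peMr ?expr_ge1 ?(ltW d0)//; apply: exprn_ege1.
  by move=> ? ?; lra.
apply: prlt_sub (prlt_seq d20 hS) => x [hx nE].
have /andP[h1 h2] := idx_itv q.+1 hx; have hl := idx_lt (ltn0Sn q) hx.
exists (idx q.+1 (phi x)); first by rewrite mem_iota.
rewrite /= ltr_pdivlMr// [phi x * _]mulrC h2 andbT lerBlDr ler_pdivrMr// mulrC mulrDr.
by rewrite leNgt; apply/negP => h; apply: nE; exact: rot_oidx.
Qed.

End Iso.

Lemma approx_fin_o (F : finType) (f0 : F) phi psi (tau : X -> F) : iso01 mu phi psi ->
  (forall t, measurable [set x | tau x = t]) -> forall e, 0 < e ->
  exists Q, forall q, (Q <= q)%N -> exists v : 'I_q.+1 -> F, prlt [set x | tau x <> v (oidx q (phi x))] e.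
Proof.
move=> iso mtau e e0; have e2 : 0 < e / 2 by lra.
have [Q hQ] := approx_fin iso f0 mtau e2; exists Q => q Qq.
have [v hv] := hQ q.+1 (leqW Qq); exists (fun l => v l).
rewrite (_ : e = e / 2 + e / 2); last by lra.
apply: prlt_sub (prltU hv (prlt_null (ae_I01 iso) e2)) => x /= h.
have [hx|] := pselect (I01 (phi x)); last by right.
by left; rewrite -(val_oidx q hx).
Qed.

(** [tau] records the atom of the [As] containing a point; [u] and [v] approximate [tau] and
    [tau o T] by labellings of equal intervals. As [T] preserves the measure, each label has the
    same frequency in both up to [2 eta], so a cycle [c] matches [v] with [u o c] on most intervals.
    A conjugate of the rotation by [al] follows [c], hence acts on the [As] almost as [T]. *)
Theorem dense_rank_one phi psi (T : @aut d X) k (As : nat -> set X) (e : R) :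
  iso01 mu phi psi -> is_aut mu T -> (forall i, (i < k)%N -> measurable (As i)) -> 0 < e ->
  exists T' : @aut d X, [/\ is_aut mu T', forall n, (0 < n)%N -> rank_one mu (iter n T'.1) &
    forall i, (i < k)%N -> (mu (symdiff (T.1 @^-1` As i) (T'.1 @^-1` As i)) < e%:E)%E].
Proof.
move=> iso hT mAs e0; have [pT _] := hT; have [mT qT] := pT.
have [al [al01 alL]] := liouville R.
pose F : finType := {ffun 'I_k -> bool}.
pose tau (x : X) : F := [ffun i : 'I_k => `[< As i x >]].
have mtau t : measurable [set x | tau x = t].
  have -> : [set x | tau x = t] = \bigcap_(i in [set: 'I_k]) (if t i then As i else ~` As i).
    apply/seteqP; split=> x /=.
      by move=> <- i _; rewrite ffunE; case: asboolP.
    move=> h; apply/ffunP => i; rewrite ffunE; have := h i I.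
    by case: (t i) => hh; [exact/asboolP|exact/asboolPn].
  apply: fin_bigcap_measurable => // i _; have mi := mAs i (ltn_ord i).
  by case: (t i) => //; exact: measurableC.
have mtauT t : measurable [set x | tau (T.1 x) = t] by exact: (measurable_preim mT (mtau t)).
pose f : R := #|F|%:R; have f0 : 0 <= f by [].
(* Five error terms: [eta] each for [v], for [u], for the rotation and for the null set, and
   [(4 f + 1) eta] for the mismatches. *)
pose eta := e / (8 * (f + 1)).
have eta0 : 0 < eta by rewrite divr_gt0// mulr_gt0//; lra.
have etaE : (4 * f + 5) * eta <= e.
  rewrite mulrC /eta mulrAC ler_pdivrMr ?mulr_gt0//; last by lra.
  by rewrite ler_pM2l//; lra.
clearbody eta.
have [Q1 h1] := approx_fin_o [ffun=> false] iso mtau eta0.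
have [Q2 h2] := approx_fin_o [ffun=> false] iso mtauT eta0.
have [q' [p [prq Nq p01 /andP[d0 d1]]]] :=
  alL (maxn (maxn Q1 Q2) (Num.truncn eta^-1).+1).+1 (eta / 4) (ltac:(by rewrite divr_gt0)).
have [q qE] : exists q, q' = q.+1 by exists q'.-1; rewrite prednK// prime_gt0.
move: prq Nq p01 d0 d1; rewrite {}qE ltnS gtn_max => prq /andP[] + /ltnW qt p01 d0 d1 {q'}.
rewrite gtn_max => /andP[/ltnW Q1q /ltnW Q2q].
have qR : 0 < q.+1%:R :> R by rewrite ltr0n.
have qeta : q.+1%:R^-1 <= eta.
  rewrite invf_ple ?posrE//; apply: le_trans (ltW (truncnS_gt _)) _.
  by rewrite ler_nat; exact: leqW.
have [u hu] := h1 q Q1q; have [v hv] := h2 q Q2q.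
have [c tc hc] := cyclic_matching u v.
have [g gE] := cycle_conj prq p01 tc.
(* Conjugation by the interval permutation [g] is absorbed in the coordinates, so that
   [rot_rank_one] applies verbatim. *)
have iso' := iso01_comp iso (pperm_aut R g).
set phi' := (fun x => pperm g^-1 (phi x)) in iso'; set psi' := (fun y => psi _) in iso'.
exists (lift phi' psi' (rot al), lift phi' psi' (rot (1 - al))).
have aT' := lift_aut iso' (rot_aut al01); set T' := (_, _) in aT' *.
split=> //; first by move=> n n0; exact: (rot_rank_one iso' al01 alL n0).
have [pT' _] := aT'; have pq : (p < q.+1)%N by case/andP: p01.
have hbad := rot_bad iso' al01 prq pq d0 d1.
have hmis : prlt [set x | u (c (oidx q (phi x))) <> v (oidx q (phi x))] (4 * f * eta + eta).
  pose P : pred 'I_q.+1 := [pred l | u (c l) != v l].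
  have -> : [set x | u (c (oidx q (phi x))) <> v (oidx q (phi x))] = [set x | P (oidx q (phi x))].
    by apply/seteqP; split=> x /= /eqP.
  apply: prlt_meas; first exact: (mix iso q.+1 [set n | P (inord n)]).
  rewrite (mu_ix_card iso) ltr_pdivrMr//.
  have cP : #|P| = #|pbad u v c| by apply: eq_card => l; rewrite !inE.
  rewrite cP; apply: le_lt_trans (_ : (\sum_(t : F) (#|[set l | v l == t]%SET| - #|[set l | u l == t]%SET|) + #|F|.*2)%N%:R < _).
    by rewrite ler_nat.
  have ht t : ((#|[set l | v l == t]%SET| - #|[set l | u l == t]%SET|)%N)%:R <= 2 * eta * q.+1%:R :> R.
    have [le|lt] := leqP #|[set l | v l == t]%SET| #|[set l | u l == t]%SET|.
      by move: le; rewrite -subn_eq0 => /eqP->; exact: mulr_ge0 (mulr_ge0 (ler0n R 2) (ltW eta0)) (ltW qR).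
    rewrite natrB ?(ltnW lt)// -ler_pdivrMr// mulrBl.
    pose Pu : pred 'I_q.+1 := [pred l | u l == t]; pose Pv : pred 'I_q.+1 := [pred l | v l == t].
    have -> : #|[set l | v l == t]%SET| = #|Pv| by apply: eq_card => l; rewrite !inE.
    have -> : #|[set l | u l == t]%SET| = #|Pu| by apply: eq_card => l; rewrite !inE.
    rewrite -(mu_ix_card iso Pv) -(mu_ix_card iso Pu).
    have mPu : measurable [set x | Pu (oidx q (phi x))] by exact: (mix iso q.+1 [set n | Pu (inord n)]).
    have mPv : measurable [set x | Pv (oidx q (phi x))] by exact: (mix iso q.+1 [set n | Pv (inord n)]).
    have b1 : `|fine (mu [set x | tau x = t]) - fine (mu [set x | Pu (oidx q (phi x))])| < eta.
      apply: prlt_prob => //; apply: prlt_sub hu => x /= nh e1; apply: nh.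
      by rewrite e1; split=> /eqP.
    have b2 : `|fine (mu [set x | tau (T.1 x) = t]) - fine (mu [set x | Pv (oidx q (phi x))])| < eta.
      apply: prlt_prob => //; apply: prlt_sub hv => x /= nh e1; apply: nh.
      by rewrite e1; split=> /eqP.
    have eT : mu [set x | tau (T.1 x) = t] = mu [set x | tau x = t] := qT _ (mtau t).
    move: b2; rewrite eT; move: b1; rewrite !ltr_norml => /andP[? ?] /andP[? ?]; lra.
  have hs : (\sum_(t : F) (#|[set l | v l == t]%SET| - #|[set l | u l == t]%SET|)%N)%:R <= f * (2 * eta * q.+1%:R) :> R.
    rewrite natr_sum (_ : f * _ = \sum_(t : F) (2 * eta * q.+1%:R)); first by apply: ler_sum => t _.
    by rewrite sumr_const -[RHS]mulr_natl.
  (* This absorbs the [2 f] mismatches created by merging cycles. *)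
  have hq : 1 <= eta * q.+1%:R by rewrite -ler_pdivrMr// div1r.
  have hf : f <= f * (eta * q.+1%:R) by rewrite ler_peMr.
  have hq0 : 0 < eta * q.+1%:R by rewrite mulr_gt0.
  rewrite natrD -muln2 natrM -/f; lra.
move=> i ik; have [mT' _] := pT'.
have mS : measurable (symdiff (T.1 @^-1` As i) (T'.1 @^-1` As i)).
  by apply: measurableU; apply: measurableD; apply: measurable_preim => //; exact: mAs.
apply: prltE => //; apply: (prlt_le etaE).
have aeW : ae_prop mu (fun x => [/\ I01 (phi x), I01 (phi (T'.1 x)) & phi' (T'.1 x) = rot al (phi' x)]).
  apply: ae_imp (ae_and3 (ae_I01 iso) (mpreserving_ae pT' (ae_I01 iso)) (lift_iter iso' (rot_aut al01))).
  by move=> x [? ? h]; split=> //; exact: (h 1%N).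
have -> : (4 * f + 5) * eta = eta + (eta + (eta + ((4 * f * eta + eta) + eta))) by ring.
apply: prlt_sub (prltU hv (prltU (prlt_preim pT' hu) (prltU hbad (prltU hmis (prlt_null aeW eta0))))).
move=> x Sx.
have [a1|] := pselect (tau (T.1 x) = v (oidx q (phi x))); last by left.
have [a2|] := pselect (tau (T'.1 x) = u (oidx q (phi (T'.1 x)))); last by right; left.
have [|a3] := pselect (I01 (phi' x) /\
    oidx q (rot al (phi' x)) <> ((oidx q (phi' x) + p) %% q.+1)%N :> nat); first by right; right; left.
have [a4|] := pselect (u (c (oidx q (phi x))) = v (oidx q (phi x))); last by right; right; right; left.
have [[w1 w2 w3]|] := pselect [/\ I01 (phi x), I01 (phi (T'.1 x)) & phi' (T'.1 x) = rot al (phi' x)];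
  last by right; right; right; right.
exfalso.
have {}a3 : oidx q (rot al (phi' x)) = ((oidx q (phi' x) + p) %% q.+1)%N :> nat.
  by apply: contrapT => h; apply: a3; split=> //; exact: pperm_I01.
have e1 : oidx q (phi (T'.1 x)) = c (oidx q (phi x)).
  have e2 z : I01 (phi z) -> g (oidx q (phi' z)) = oidx q (phi z).
    by move=> hz; rewrite /phi' oidx_pperm// permKV.
  by rewrite -(e2 _ w2) -(e2 _ w1) w3; exact: gE.
have : tau (T'.1 x) = tau (T.1 x) by rewrite a1 a2 e1.
move=> /ffunP/(_ (Ordinal ik)); rewrite !ffunE /= => h.
case: Sx => [[h3 h4]|[h3 h4]]; apply: h4.
  by move/asboolP: h3; rewrite -h => /asboolP.
by move/asboolP: h3; rewrite h => /asboolP.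
Qed.

End RotationTowers.

(** * Rank one as a countable intersection of open conditions *)

Section GenericTowers.
Variables (R : realType) (d : measure_display) (X : measurableType d).
Variable mu : probability X R.
Implicit Type T : @aut d X.

Lemma fine_sub2 (S S1 S2 : set X) : measurable S -> measurable S1 -> measurable S2 ->
  S `<=` S1 `|` S2 -> fine (mu S) <= fine (mu S1) + fine (mu S2).
Proof.
move=> m m1 m2 sub; have mU := measurableU _ _ m1 m2.
apply: le_trans (prob_le mu m mU sub) _; rewrite -fineD ?fin_num_measure//.
by apply: fine_le; [rewrite fin_num_measure|rewrite fin_numD !fin_num_measure|exact: measureU2].
Qed.

Lemma fine_bigU n (P : pred 'I_n) (S : 'I_n -> set X) : (forall i, measurable (S i)) ->
  fine (mu (\big[setU/set0]_(i < n | P i) S i)) <= \sum_(i < n | P i) fine (mu (S i)).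
Proof.
move=> mS; suff : measurable (\big[setU/set0]_(i < n | P i) S i) /\
  fine (mu (\big[setU/set0]_(i < n | P i) S i)) <= \sum_(i < n | P i) fine (mu (S i)) by case.
elim/big_ind2: _ => [|A a B b [mA hA] [mB hB]|i _]; [by rewrite measure0| |by split].
split; first exact: measurableU.
apply: le_trans (fine_sub2 _ mA mB _) (lerD hA hB) => //; exact: measurableU.
Qed.

Definition dm (A B : set X) : R := fine (mu (symdiff A B)).

Lemma symdiff_meas (A B : set X) : measurable A -> measurable B -> measurable (symdiff A B).
Proof. by move=> mA mB; apply: measurableU; exact: measurableD. Qed.

Lemma symdiff_tri (A B D : set X) : symdiff A D `<=` symdiff A B `|` symdiff B D.
Proof.
move=> x [[Ax nD]|[Dx nA]].
  by have [Bx|nB] := pselect (B x); [right; left|left; left].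
by have [Bx|nB] := pselect (B x); [left; right|right; right].
Qed.

Lemma dm_tri (A B D : set X) : measurable A -> measurable B -> measurable D ->
  dm A D <= dm A B + dm B D.
Proof.
move=> mA mB mD; apply: fine_sub2; try exact: symdiff_meas; exact: symdiff_tri.
Qed.

Lemma dm_ge0 A B : 0 <= dm A B. Proof. exact: fine_ge0. Qed.

Lemma dm_preim (f : X -> X) (A B : set X) : mpreserving mu f -> measurable A -> measurable B ->
  dm (f @^-1` A) (f @^-1` B) = dm A B.
Proof. by move=> [mf pf] mA mB; rewrite /dm -(pf _ (symdiff_meas mA mB)). Qed.

Lemma dm_bigU n (P : pred 'I_n) (A B : 'I_n -> set X) :
  (forall i, measurable (A i)) -> (forall i, measurable (B i)) ->
  dm (\big[setU/set0]_(i < n | P i) A i) (\big[setU/set0]_(i < n | P i) B i) <=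
  \sum_(i < n) dm (A i) (B i).
Proof.
move=> mA mB; have mS i := symdiff_meas (mA i) (mB i).
have mU (F : 'I_n -> set X) Q : (forall i, measurable (F i)) ->
    measurable (\big[setU/set0]_(i < n | Q i) F i) by move=> mF; apply: bigsetU_measurable.
apply: le_trans (_ : fine (mu (\big[setU/set0]_(i < n) symdiff (A i) (B i))) <= _).
  apply: prob_le; [by apply: symdiff_meas; exact: mU|exact: mU|].
  rewrite !bigU_ord => x [[[i Pi Ax] nB]|[[i Pi Bx] nA]]; exists i => //.
    by left; split=> // Bx; apply: nB; exists i.
  by right; split=> // Ax; apply: nA; exists i.
exact: fine_bigU.
Qed.

(** The comparison passes through [S^-1 T^-k B]: the neighbourhood contributes one new error [e],
    while the previous error is preserved by [S]. *)
Lemma iter_close T S (B : set X) K e : is_aut mu T -> is_aut mu S -> measurable B -> 0 <= e ->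
  aut_nbhd mu T K (fun k => iter k T.1 @^-1` B) e S ->
  forall k, (k <= K)%N -> dm (iter k T.1 @^-1` B) (iter k S.1 @^-1` B) <= k%:R * e.
Proof.
move=> [pT _] [pS _] mB e0 [_ nb].
have mI f k : mpreserving mu f -> measurable (iter k f @^-1` B).
  by move=> pf; apply: measurable_preim => //; case: (mpreserving_iter k pf).
elim=> [_|k IH kK].
  by rewrite mul0r /dm /symdiff /= setDv setU0 measure0.
have e1 f : iter k.+1 f @^-1` B = f @^-1` (iter k f @^-1` B).
  by apply/seteqP; split=> x; rewrite /preimage/= -iterSr.
rewrite !e1.
have m1 := measurable_preim pT.1 (mI _ k pT); have m2 := measurable_preim pS.1 (mI _ k pT).
have m3 := measurable_preim pS.1 (mI _ k pS).
apply: le_trans (dm_tri m1 m2 m3) _; rewrite -natr1 mulrDl mul1r addrC; apply: lerD.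
  by rewrite dm_preim//; [apply: IH; exact: ltnW|exact: mI|exact: mI].
rewrite /dm -lee_fin fineK ?fin_num_measure//; last exact: symdiff_meas.
exact/ltW/(nb k kK).
Qed.

Section Open.
Variables (phi : X -> R) (psi : R -> X).
Hypothesis iso : iso01 mu phi psi.

Definition lev (f : X -> X) (B : set X) (h : nat) (P : nat -> bool) : set X :=
  \big[setU/set0]_(j < h | P j) (iter j f @^-1` B).
Definition cell (L l : nat) : set X := [set x | idx L (phi x) = l].

(** Exact disjointness of the levels is not an open condition, so overlaps are only required to be
    small. The weight [L * h] is the price of deleting them from the base later: [h] levels, for
    each of [L] cells. *)
Definition defect (f : X -> X) (L : nat) (B : set X) (h : nat) (J : nat -> nat -> bool) : R :=
  (L * h)%:R * \sum_(j < h | (0 < j)%N) fine (mu (B `&` iter j f @^-1` B)) +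
  \sum_(l < L) dm (cell L l) (lev f B h (J l)).

Definition towerset (n L : nat) : set (@aut d X) := [set T | is_aut mu T /\
  exists B h J, [/\ measurable B, (0 < h)%N & defect (iter n T.1) L B h J < L%:R^-1]].

Lemma mcell L l : measurable (cell L l). Proof. exact: (mix iso L [set m | m = l]). Qed.

Lemma mlev f B h P : mpreserving mu f -> measurable B -> measurable (lev f B h P).
Proof.
move=> pf mB; apply: bigsetU_measurable => i _.
by apply: measurable_preim => //; case: (mpreserving_iter i pf).
Qed.

Lemma levE f B h P : lev f B h P = \bigcup_(j in [set j | (j < h)%N /\ P j]) (iter j f @^-1` B).
Proof.
rewrite /lev bigU_ord; apply/seteqP; split=> x.
  by move=> [i Pi Bx]; exists i.
by move=> [j [jh Pj] Bx]; exists (Ordinal jh).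
Qed.

(** With the tower data kept fixed, the defect grows at most by [C] times the distance between the
    two maps, measured on finitely many sets [T^-k B]. *)
Lemma towerset_open n L : (0 < L)%N -> aut_open mu (towerset n L).
Proof.
move=> L0; split=> [T []//|T [hT [B [h [J [mB h0 hF]]]]]].
have [pT _] := hT; set F0 := defect _ _ _ _ _ in hF.
pose K := (h * n)%N; pose C : R := (L * h)%:R * (h%:R * K%:R) + L%:R * (h%:R * K%:R).
have C0 : 0 <= C by rewrite addr_ge0 ?mulr_ge0.
pose e := (L%:R^-1 - F0) / (C + 1).
have e0 : 0 < e by rewrite divr_gt0 ?subr_gt0//; lra.
exists K, (fun k => iter k T.1 @^-1` B), e; split=> //.
have mI f k : mpreserving mu f -> measurable (iter k f @^-1` B).
  by move=> pf; apply: measurable_preim => //; case: (mpreserving_iter k pf).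
split; first by move=> i _; exact: mI.
move=> S nbS; have hS : is_aut mu S by case: nbS.
have [pS _] := hS; split=> //; exists B, h, J; split=> //.
have cl := iter_close hT hS mB (ltW e0) nbS.
have clj (j : 'I_h) : dm (iter j (iter n T.1) @^-1` B) (iter j (iter n S.1) @^-1` B) <= K%:R * e.
  have itE f : iter j (iter n f) @^-1` B = iter (j * n) f @^-1` B.
    by apply/seteqP; split=> x; rewrite /preimage/= iterM.
  rewrite !itE; apply: le_trans (cl _ _) _; first by rewrite leq_mul2r (ltnW (ltn_ord j)) orbT.
  by rewrite ler_pM2r// ler_nat leq_mul2r (ltnW (ltn_ord j)) orbT.
have pTn := mpreserving_iter n pT; have pSn := mpreserving_iter n pS.
have d1 (j : 'I_h) : fine (mu (B `&` iter j (iter n S.1) @^-1` B)) <=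
    fine (mu (B `&` iter j (iter n T.1) @^-1` B)) + K%:R * e.
  apply: le_trans (_ : fine (mu (B `&` iter j (iter n T.1) @^-1` B)) +
    dm (iter j (iter n T.1) @^-1` B) (iter j (iter n S.1) @^-1` B) <= _);
    last by rewrite lerD2l; exact: clj.
  apply: fine_sub2; try by apply: measurableI => //; exact: mI.
    by apply: symdiff_meas; exact: mI.
  move=> x [Bx Sx]; have [Tx|nT] := pselect ((iter j (iter n T.1) @^-1` B) x).
    by left; split.
  by right; right.
have d2 l : dm (cell L l) (lev (iter n S.1) B h (J l)) <=
    dm (cell L l) (lev (iter n T.1) B h (J l)) + h%:R * (K%:R * e).
  have := dm_tri (mcell L l) (mlev h (J l) pTn mB) (mlev h (J l) pSn mB).
  move=> /le_trans; apply; rewrite lerD2l; apply: le_trans (dm_bigU _ _ _) _.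
  - by move=> i; exact: mI.
  - by move=> i; exact: mI.
  - rewrite (_ : h%:R * _ = \sum_(i < h) (K%:R * e)); first by apply: ler_sum => i _; exact: clj.
    by rewrite sumr_const card_ord -[RHS]mulr_natl.
have s1 : \sum_(j < h | (0 < j)%N) fine (mu (B `&` iter j (iter n S.1) @^-1` B)) <=
    \sum_(j < h | (0 < j)%N) fine (mu (B `&` iter j (iter n T.1) @^-1` B)) + h%:R * (K%:R * e).
  apply: le_trans (_ : \sum_(j < h | (0 < j)%N)
    (fine (mu (B `&` iter j (iter n T.1) @^-1` B)) + K%:R * e) <= _).
    by apply: ler_sum => j _; exact: d1.
  rewrite big_split/= lerD2l sumr_const -[(K%:R * e) *+ _]mulr_natl.
  apply: ler_wpM2r; first exact: mulr_ge0 (ler0n _ _) (ltW e0).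
  by rewrite ler_nat; apply: leq_trans (max_card _) _; rewrite card_ord.
have s2 : \sum_(l < L) dm (cell L l) (lev (iter n S.1) B h (J l)) <=
    \sum_(l < L) dm (cell L l) (lev (iter n T.1) B h (J l)) + L%:R * (h%:R * (K%:R * e)).
  apply: le_trans (_ : \sum_(l < L) (dm (cell L l) (lev (iter n T.1) B h (J l)) + h%:R * (K%:R * e)) <= _).
    by apply: ler_sum => l _; exact: d2.
  by rewrite big_split/= lerD2l sumr_const card_ord -[(h%:R * (K%:R * e)) *+ L]mulr_natl.
apply: le_lt_trans (_ : F0 + C * e < _).
  rewrite /defect /F0 /defect.
  have := ler_wpM2l (ler0n R (L * h)) s1; rewrite mulrDr /C => s1'.
  move: s1' s2; set a1 := _ * \sum_(_ < h | _) _; set a2 := _ * \sum_(_ < h | _) _.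
  set b1 := \sum_(_ < L) _; set b2 := \sum_(_ < L) _ => s1' s2.
  have -> : ((L * h)%:R * (h%:R * K%:R) + L%:R * (h%:R * K%:R)) * e =
    (L * h)%:R * (h%:R * (K%:R * e)) + L%:R * (h%:R * (K%:R * e)) by ring.
  lra.
have : C * e < L%:R^-1 - F0.
  by rewrite /e mulrCA gtr_pMr ?subr_gt0// ltr_pdivrMr//; lra.
lra.
Qed.

(** Removing from [B] its overlaps with the other levels makes all levels disjoint; the measure lost
    is already counted in the defect. *)
Lemma towerset_rank_one n T : is_aut mu T -> (forall L, (0 < L)%N -> towerset n L T) ->
  rank_one mu (iter n T.1).
Proof.
move=> hT hO k As e mAs e0; have [pT _] := hT; set f := iter n T.1.
have pf : mpreserving mu f by exact: mpreserving_iter.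
have e4 : 0 < e / 4 by lra.
have /choice[Q hQ] i : exists Q, (i < k)%N -> forall q, (Q <= q)%N -> exists K : nat -> bool,
    prlt mu [set x | ~ (As i x <-> K (idx q (phi x)))] (e / 4).
  case: (ltnP i k) => ik; last by exists 0%N.
  by have [Q hQ] := approx_all iso (mAs i ik) e4; exists Q => _.
pose L := (maxn (\max_(i < k) Q i) (Num.truncn (e / 4)^-1).+1).+1.
have Le : L%:R^-1 < e / 4.
  rewrite invf_plt ?posrE ?ltr0n//; apply: lt_le_trans (truncnS_gt _) _.
  by rewrite ler_nat /L; apply: leqW; exact: leq_maxr.
have L0 : (0 < L)%N by [].
have LQ (i : 'I_k) : (Q i <= L)%N by apply: leqW; apply: leq_trans (leq_maxl _ _); exact: (leq_bigmax i).
clearbody L.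
have [_ [B [h [J [mB h0 hF]]]]] := hO L L0; rewrite -/f /defect in hF.
have mI (A : set X) j : measurable A -> measurable (iter j f @^-1` A).
  by move=> mA; apply: measurable_preim => //; case: (mpreserving_iter j pf).
pose ov := \big[setU/set0]_(j < h | (0 < j)%N) (B `&` iter j f @^-1` B).
have mov : measurable ov by apply: bigsetU_measurable => j _; apply: measurableI => //; exact: mI.
pose B' := B `\` ov; have mB' : measurable B' by exact: measurableD.
set s := \sum_(j < h | (0 < j)%N) _ in hF.
have dB : dm B B' <= s.
  apply: le_trans (fine_bigU _ _) => //; last by move=> j; apply: measurableI => //; exact: mI.
  apply: prob_le => //; first exact: symdiff_meas.
  move=> x [[Bx nB']|[[Bx _] nB]] //; apply: contrapT => no; apply: nB'; by split.
have s0 : 0 <= s by apply: le_trans dB; exact: dm_ge0.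
have dis x i j : (i < j)%N -> (j < h)%N -> (iter i f @^-1` B') x -> (iter j f @^-1` B') x -> False.
  move=> ij jh [Bi nov] [Bj _]; apply: nov; rewrite /ov bigU_ord.
  have jh' : (j - i < h)%N by lia.
  exists (Ordinal jh') => /=; first by rewrite subn_gt0.
  by split=> //=; rewrite -iterD subnK// ltnW.
pose V l := lev f B' h (J l).
have mV l : measurable (V l) by exact: mlev.
have dV : \sum_(l < L) dm (cell L l) (V l) < L%:R^-1.
  apply: le_lt_trans hF.
  apply: le_trans (_ : \sum_(l < L) (dm (cell L l) (lev f B h (J l)) + h%:R * s) <= _).
    apply: ler_sum => l _; apply: le_trans (dm_tri (mcell L l) (mlev h (J l) pf mB) (mV l)) _.
    rewrite lerD2l; apply: le_trans (dm_bigU _ _ _) _; [by move=> i; exact: mI|by move=> i; exact: mI|].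
    apply: le_trans (_ : \sum_(i < h) s <= _); last by rewrite sumr_const card_ord mulr_natl.
    by apply: ler_sum => i _; rewrite dm_preim//; exact: mpreserving_iter.
  by rewrite big_split/= sumr_const card_ord -[(h%:R * s) *+ L]mulr_natl natrM addrC mulrA lexx.
have hV : prlt mu [set x | exists l : 'I_L, symdiff (cell L l) (V l) x] (e / 4).
  exists (\big[setU/set0]_(l < L) symdiff (cell L l) (V l)); split.
  - by apply: bigsetU_measurable => l _; apply: symdiff_meas => //; exact: mcell.
  - by move=> x [l Sx]; rewrite bigU_ord; exists l.
  - apply: le_lt_trans (fine_bigU _ _) _; last exact: lt_trans Le.
    by move=> l; apply: symdiff_meas => //; exact: mcell.
have hI := prlt_null (ae_I01 iso) e4.
have good x : I01 (phi x) -> ~ (exists l : 'I_L, symdiff (cell L l) (V l) x) ->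
    forall l, (l < L)%N -> idx L (phi x) = l <-> V l x.
  move=> hx nS l lL; split=> h'.
    by apply: contrapT => nV; apply: nS; exists (Ordinal lL); left.
  by apply: contrapT => nc; apply: nS; exists (Ordinal lL); right.
exists B', h; split=> //; split=> //; split.
  move=> i j ih jh ij; rewrite (_ : _ `&` _ = set0) ?measure0//.
  apply/seteqP; split=> x // [xi xj].
  by case: (ltngtP i j) => // ij'; [exact: (dis x i j)|exact: (dis x j i)].
have mU (D : set nat) : measurable (\bigcup_(i in D) (iter i f @^-1` B')).
  by apply: bigcup_measurable => i _; exact: mI.
split.
  have hc := prob_compl mu (mU `I_h); rewrite -[ltRHS]fineK ?fin_num_measure// lte_fin.
  have : fine (mu (~` \bigcup_(i in `I_h) (iter i f @^-1` B'))) < e / 4 + e / 4.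
    apply: prltF; first exact: measurableC.
    apply: prlt_sub (prltU hV hI) => x nU.
    have [hx|] := pselect (I01 (phi x)); last by right.
    left; apply: contrapT => nS; apply: nU.
    have := (good x hx nS _ (idx_lt L0 hx)).1 erefl; rewrite /V levE => -[j [jh _] Bx].
    by exists j.
  lra.
move=> i ik; have [K hK] := hQ i ik L (LQ (Ordinal ik)).
exists [set j | (j < h)%N /\ exists2 l, K l && (l < L)%N & J l j].
split; first by move=> j [].
apply: prltE; first by apply: symdiff_meas => //; exact: mAs.
apply: (@prlt_le _ _ _ _ _ (e / 4 + (e / 4 + e / 4))); first by lra.
apply: prlt_sub (prltU hK (prltU hV hI)) => x Sx.
have [hx|] := pselect (I01 (phi x)); last by right; right.
have [|nS] := pselect (exists l : 'I_L, symdiff (cell L l) (V l) x); first by right; left.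
left=> hAK; have g := good x hx nS; have ixL := idx_lt L0 hx.
case: Sx => [[/hAK Kx nU]|[[j [jh [l /andP[Kl lL] Jl]] Bj] nA]].
  have := (g _ ixL).1 erefl; rewrite /V levE => -[j [jh Jj] Bx].
  by apply: nU; exists j => //; split=> //; exists (idx L (phi x)); rewrite ?Kx.
apply: nA; apply/hAK; suff -> : idx L (phi x) = l by [].
by apply/g => //; rewrite /V levE; exists j.
Qed.

Lemma rank_one_towerset n L T : is_aut mu T -> rank_one mu (iter n T.1) -> (0 < L)%N ->
  towerset n L T.
Proof.
move=> hT hr L0; split=> //; have LR : 0 < L%:R :> R by rewrite ltr0n.
have e0 : 0 < (2 * L%:R ^+ 2)^-1 :> R by rewrite invr_gt0 mulr_gt0// exprn_gt0.
have [pT _] := hT; have pf := mpreserving_iter n pT.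
have [B [h [mB [h0 [dis [_ hJ]]]]]] := hr L (cell L) _ (fun l _ => mcell L l) e0.
have /choice[J JP] l : exists J : nat -> bool, (l < L)%N ->
    dm (cell L l) (lev (iter n T.1) B h J) < (2 * L%:R ^+ 2)^-1.
  case: (ltnP l L) => lL; last by exists (fun=> true).
  have [D [Dh hD]] := hJ l lL; exists (fun j => `[< D j >]) => _.
  rewrite /dm -lte_fin fineK ?fin_num_measure//; last first.
    by apply: symdiff_meas; [exact: mcell|exact: mlev].
  rewrite levE (_ : [set j | _] = D)//; apply/seteqP; split=> j /=.
    by move=> [_ /asboolP].
  by move=> Dj; split; [exact: Dh|exact/asboolP].
exists B, h, J; split=> //; rewrite /defect big1 ?mulr0 ?add0r; last first.
  move=> j j0; suff -> : mu (B `&` iter j (iter n T.1) @^-1` B) = 0%E by [].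
  by apply: (dis 0%N j) => //; case: j j0 => -[].
apply: le_lt_trans (_ : \sum_(l < L) (2 * L%:R ^+ 2)^-1 < _).
  by apply: ler_sum => l _; apply/ltW/JP.
rewrite sumr_const card_ord -[_ *+ L]mulr_natl (_ : L%:R * _ = L%:R^-1 / 2); last by field; rewrite gt_eqF.
have : 0 < L%:R^-1 :> R by rewrite invr_gt0.
by move: (L%:R^-1) => ?; lra.
Qed.

End Open.

(** The same levels in reverse order: the new base is the last level, [f^-(h - 1) B]. *)
Lemma rank_one_inv f g : is_aut mu (f, g) -> rank_one mu f -> rank_one mu g.
Proof.
move=> hT hr k As e mAs e0; have [B [h [mB [h0 [dis [hU hJ]]]]]] := hr k As e mAs e0.
have [pf [pg _]] := hT; simpl in pf, pg.
have mI (f' : X -> X) (A : set X) j : mpreserving mu f' -> measurable A -> measurable (iter j f' @^-1` A).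
  by move=> pf' mA; apply: measurable_preim => //; case: (mpreserving_iter j pf').
pose B' := iter h.-1 f @^-1` B; have mB' : measurable B' by exact: mI.
have aeE i : (i < h)%N -> ae_prop mu (fun x => (iter i g @^-1` B') x <-> (iter (h.-1 - i) f @^-1` B) x).
  move=> ih; have := zpow_add (if i is i'.+1 then Negz i' else 0) h.-1%:Z hT; apply: ae_imp => x.
  have -> : (if i is i'.+1 then Negz i' else 0) + h.-1%:Z = (h.-1 - i)%N%:Z.
    by case: i ih => [|i] ih; rewrite ?NegzE; lia.
  rewrite /B' /preimage/=; case: i ih => [|i] ih /= e1; by rewrite ?subn0 ?e1.
have aeU (D : set nat) : D `<=` `I_h -> ae_prop mu (fun x =>
    (\bigcup_(j in D) (iter j g @^-1` B')) x <->
    (\bigcup_(j in [set (h.-1 - j)%N | j in D]) (iter j f @^-1` B)) x).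
  move=> Dh; have : ae_prop mu (fun x => forall i, (i < h)%N ->
      ((iter i g @^-1` B') x <-> (iter (h.-1 - i) f @^-1` B) x)).
    apply: ae_all => i; case: (ltnP i h) => ih; last by apply: aeT.
    by apply: ae_imp (aeE i ih) => x ? _.
  apply: ae_imp => x hx; split=> [[j Dj Bj]|[_ [j Dj <-] Bj]].
    by exists (h.-1 - j)%N; [exists j|apply/hx => //; exact: Dh].
  by exists j => //; apply/hx => //; exact: Dh.
have mU (f' : X -> X) (A : set X) (D : set nat) : mpreserving mu f' -> measurable A ->
    measurable (\bigcup_(i in D) (iter i f' @^-1` A)).
  by move=> pf' mA; apply: bigcup_measurable => i _; exact: mI.
exists B', h; split=> //; split=> //; split.
  move=> i j ih jh ij; rewrite -(dis (h.-1 - i) (h.-1 - j))%N; [|lia|lia|lia].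
  apply: ae_eq_measure; try by apply: measurableI; exact: mI.
  by apply: ae_imp (ae_and (aeE i ih) (aeE j jh)) => x [hi hj]; split=> -[/hi ? /hj ?].
split.
  have -> : mu (\bigcup_(i in `I_h) (iter i g @^-1` B')) = mu (\bigcup_(i in `I_h) (iter i f @^-1` B)).
    apply: ae_eq_measure; try exact: mU.
    apply: ae_imp (aeU `I_h _) => // x ->; split=> -[j].
      by move=> [i ih <-] ?; exists (h.-1 - i)%N => //=; lia.
    move=> /= jh ?; exists j => //; exists (h.-1 - j)%N => //=; lia.
  exact: hU.
move=> i ik; have [D [Dh hD]] := hJ i ik.
exists [set (h.-1 - j)%N | j in D].
have Dh' : [set (h.-1 - j)%N | j in D] `<=` `I_h by move=> _ [j /Dh/= jh <-] /=; lia.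
split=> //; suff -> : mu (symdiff (As i) (\bigcup_(j in [set (h.-1 - j)%N | j in D]) (iter j g @^-1` B'))) =
  mu (symdiff (As i) (\bigcup_(j in D) (iter j f @^-1` B))) by [].
apply: ae_eq_measure; try by apply: symdiff_meas; [exact: mAs|exact: mU].
have DD : [set (h.-1 - j)%N | j in [set (h.-1 - j)%N | j in D]] = D.
  apply/seteqP; split=> j.
    by move=> [_ [j' Dj' <-] <-]; rewrite (_ : (_ - _)%N = j')//; have /= := Dh _ Dj'; lia.
  by move=> Dj; exists (h.-1 - j)%N; [exists j|have /= := Dh _ Dj; lia].
have := aeU _ Dh'; rewrite DD; apply: ae_imp => x hx.
by rewrite /symdiff /setU /setD /mkset; split=> -[[h1 h2]|[h1 h2]];
  [left|right|left|right]; split=> //; try (by move=> /hx); apply/hx.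
Qed.

End GenericTowers.

(** * From rank one to simple spectrum *)

Section Orthogonality.
Variables (R : realType) (E : lmodType R[i]) (rip : E -> E -> R).
Hypothesis H : cplx_hilbert rip.

Lemma total_orth (I : Type) (e : I -> E) :
  (forall x, (forall i, cip rip x (e i) = 0) -> x = 0) -> total rip e.
Proof.
move=> h x f f0; pose M : set (realify E) := [set y | exists s, y = comb e s].
have sM : subspace M.
  split; first by exists [::]; rewrite /comb big_nil.
  move=> a _ _ [s ->] [t ->]; exists (cscale a%:C s ++ t).
  by rewrite comb_cat comb_scale.
have [p cp op] := hprojection (realify_hilbert H) (x : realify E) sM.
have xp : x = p.
  apply/subr0_eq; apply: h => i; rewrite /cip; congr (_ +i* _).
    by apply: op; exists [:: (1, i)]; rewrite /comb big_seq1 scale1r.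
  by apply: op; exists [:: ('i, i)]; rewrite /comb big_seq1.
by have [_ [s ->] hs] := cp f f0; exists s; rewrite xp.
Qed.

End Orthogonality.

Section IndicatorsTotal.
Variables (R : realType) (d : measure_display) (X : measurableType d).
Variable mu : probability X R.
Local Notation ip := (@l2ip _ _ _ mu).
Local Notation ci A := (cls mu (@cind R d X A)).

Lemma rI_indic_eq0 (g : X -> R) : mu.-integrable setT (EFin \o g) ->
  (forall A, measurable A -> rI mu (fun x => g x * \1_A x) = 0) -> ae_prop mu (fun x => g x = 0).
Proof.
move=> gi h; have mg := int_meas gi; pose A := [set x | 0 < g x].
have mA : measurable A.
  rewrite (_ : A = g @^-1` `]0, +oo[%classic); first by apply: measurable_preim.
  by apply/seteqP; split=> x; rewrite /A/= in_itv/= andbT.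
have iA D : measurable D -> mu.-integrable setT (EFin \o (fun x => g x * \1_D x)).
  move=> mD; apply: (@int_le _ _ _ mu _ (fun x => `|g x|)).
  - by apply: measurable_funM => //; exact: measurable_indic.
  - by move=> x; rewrite normrM indicE; case: (_ \in _); rewrite ?normr1 ?normr0 ?mulr1 ?mulr0.
  - exact: (integrable_abse gi).
have e1 : rI mu (fun x => `|g x|) = 0.
  have -> : (fun x => `|g x|) = (fun x => g x * \1_A x - g x * \1_(~` A) x).
    apply/funext => x; rewrite !indicE in_setC; have [gx|gx] := ltP 0 (g x).
      by rewrite (_ : x \in A) ?mem_set//= mulr1 mulr0 subr0 gtr0_norm.
    rewrite (_ : (x \in A) = false) ?mulr0 ?mulr1 ?sub0r ?ler0_norm//.
    by apply/memNset; rewrite /A/= => h0; move: gx; rewrite leNgt h0.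
  by rewrite rIB ?h ?subrr//; try exact: measurableC; apply: iA => //; exact: measurableC.
have e2 : (\int[mu]_x `|(g x)%:E| = 0)%E.
  have := rIE (integrable_abse gi : mu.-integrable setT (EFin \o (fun x => `|g x|))).
  by rewrite e1 => <-.
have mg' : measurable_fun setT (EFin \o g) by exact/measurable_EFinP.
have [+ _] := ae_eq_integral_abs mu measurableT mg'.
move=> /(_ e2)[N [mN N0 hN]]; apply: lib_ae; exists N; split=> // x /= nf.
by apply: hN => /= /(_ I)[]; exact: nf.
Qed.

Lemma cip_ind (f : X -> R[i]) A : l2fun mu f -> measurable A ->
  cip ip (cls mu f) (ci A) = rI mu (fun x => Re (f x) * \1_A x) +i* rI mu (fun x => Im (f x) * \1_A x).
Proof.
move=> hf mA; rewrite (cip_cls hf (cind_l2 mu mA)); congr (_ +i* _); congr (rI mu _);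
  apply/funext => x; rewrite /cind; case: (f x) => a b /=; ring.
Qed.

Lemma indic_orth (x : L2C mu) : (forall A, measurable A -> cip ip x (ci A) = 0) -> x = 0.
Proof.
move=> h; have hx := l2_l2fun x; have [h1 h2] := hx.
apply: l2_eq; apply: aeq_trans (aeq_sym (@l20 _ _ _ mu)).
have k A : measurable A -> rI mu (fun s => Re (x s) * \1_A s) = 0 /\ rI mu (fun s => Im (x s) * \1_A s) = 0.
  by move=> mA; have := h A mA; rewrite -{1}[x]cls_val (cip_ind hx mA) => -[-> ->].
apply: ae_imp (ae_and (rI_indic_eq0 (sq_int_int h1) (fun A mA => (k A mA).1))
  (rI_indic_eq0 (sq_int_int h2) (fun A mA => (k A mA).2))) => s [].
by case: (x s) => a b /= -> ->.
Qed.

Lemma ind_dist A B : measurable A -> measurable B -> cnrm ip (ci A - ci B) ^+ 2 = dm mu A B.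
Proof.
move=> mA mB; have hA := cind_l2 mu mA; have hB := cind_l2 mu mB.
rewrite (clsB hA hB) (cnrm_cls (l2funB hA hB)) /dm -(rI_indic mu (symdiff_meas mA mB)).
congr (rI mu _); apply/funext => s; rewrite /cind /= !indicE /symdiff in_setU !in_setD.
by case: (s \in A); case: (s \in B) => /=; ring.
Qed.

Lemma ind_close A B e : measurable A -> measurable B -> 0 < e -> dm mu A B < e ^+ 2 ->
  cnrm ip (ci A - ci B) < e.
Proof.
move=> mA mB e0; rewrite -ind_dist// ltr_pXn2r// ?nnegrE ?cnrm_ge0//; exact: ltW.
Qed.

Variables (phi : X -> R) (psi : R -> X).
Hypothesis iso : iso01 mu phi psi.

(** Indicators of measurable sets are limits of sums of indicators of cells. The family of cells is
    countable, which suits the sequence expected by [cyclic_vector]. *)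
Lemma cell_orth (x : L2C mu) : (forall q l, cip ip x (ci (cell phi q l)) = 0) -> x = 0.
Proof.
move=> h; have H := @l2_hilbert _ _ _ mu; apply: indic_orth => A mA.
apply: Normc.eq0_normc; apply/eqP; rewrite eq_le normc_ge0 andbT; apply/ler_addgt0Pr => e e0.
rewrite add0r; have n1 : 0 < cnrm ip x + 1 by have := cnrm_ge0 ip x; lra.
have d0 : 0 < e / (cnrm ip x + 1) by rewrite divr_gt0.
have [Q hQ] := approx_all iso mA (exprn_gt0 2 d0); have [K hK] := hQ Q.+1 (leqnSn Q).
set q := Q.+1 in hK; pose D := [set s | K (idx q (phi s))].
have mD : measurable D by exact: (mix iso q K).
have zD : cip ip x (ci D) = 0.
  pose c (l : 'I_q) : R[i] := if K l then 1 else 0.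
  have mc (l : 'I_q) : l2fun mu (fun s => c l * cind R (cell phi q l) s).
    by apply: l2funZ; apply: cind_l2; exact: (mcell iso).
  have [sE sl] := clsS (index_enum _) mc.
  have -> : ci D = \sum_(l < q) c l *: ci (cell phi q l).
    rewrite (eq_bigr (fun l => cls mu (fun s => c l * cind R (cell phi q l) s))); last first.
      by move=> l _; rewrite clsZ//; apply: cind_l2; exact: (mcell iso).
    rewrite sE; apply: cls_eq => //; first exact: cind_l2.
    apply: ae_imp (ae_I01 iso) => s hs; have sq := idx_lt (ltn0Sn Q) hs.
    rewrite (bigD1 (Ordinal sq))//= big1 ?addr0.
      rewrite /cind /cell !indicE /c/= (_ : s \in [set x0 | _])/=; last by rewrite inE.
      rewrite mulr1 (_ : (s \in D) = K (idx q (phi s))); first by case: (K _).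
      by apply/idP/idP; rewrite inE.
    move=> l ls; rewrite /cind indicE memNset ?mulr0//= => sl'.
    by case/eqP: ls; apply/val_inj; rewrite /= sl'.
  by rewrite (sesq_sumr _ _ _ (sesq_cip H)) big1// => l _; rewrite (cipZr H) h mulr0.
rewrite -[cip ip x (ci A)]subr0 -zD -(cipBr H).
apply: le_trans (cip_CS H _ _) _.
have : cnrm ip (ci A - ci D) < e / (cnrm ip x + 1).
  apply: ind_close => //; apply: prltF; first exact: symdiff_meas.
  apply: prlt_sub hK => s [[As nD]|[Ds nA]] /= hh; [apply: nD|apply: nA]; exact/hh.
rewrite ltr_pdivlMr// => hlt; apply: le_trans (ltW hlt); rewrite mulrC ler_wpM2l ?cnrm_ge0//; lra.
Qed.

(** Finitely many vectors are close to combinations of finitely many indicators, and one tower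
    approximates all these sets: a union of levels has indicator [q(U) 1_B], where [q] is a
    polynomial with coefficients 0 and 1. This is the hypothesis of [cyclic_vector]. *)
Theorem rank_one_simple (S : @aut d X) : is_aut mu S -> rank_one mu S.1 -> simple_spectrum mu S.
Proof.
move=> hS hr; apply/(simple_spectrumP hS).
have H := @l2_hilbert _ _ _ mu; have HU := koop_rep hS; have [pS _] := hS.
pose ind (A : {A : set X | measurable A}) : L2C mu := ci (sval A).
have tind : total ip ind.
  by apply: (total_orth H) => x hx; apply: indic_orth => A mA; exact: (hx (exist _ A mA)).
have pvD c p q b : pv (koop S) (c *: p + q) b = c *: pv (koop S) p b + pv (koop S) q b.
  have -> : c *: p + q = c *: p - (-1) *: q by rewrite scaleN1r opprK.
  by rewrite (pv_sub (koop S)) !(pv_scale (koop S)) scaleN1r opprK.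
pose g m : L2C mu := if (unpickle m : option (nat * nat)) is Some (q, l) then ci (cell phi q l) else 0.
have In_cat (I0 : Type) (a : I0) s1 s2 : List.In a s1 \/ List.In a s2 -> List.In a (s1 ++ s2).
  elim: s1 => [[]//|b s1 IH] [[->|h]|h] /=; first by left.
    by right; apply: IH; left.
  by right; apply: IH; right.
have In_map (I0 : Type) (p : R[i] * I0) s : List.In p s -> List.In p.2 [seq p.2 | p <- s].
  by elim: s => [//|b s IH] [->|/IH h] /=; [left|right].
have inL (sx : L2C mu -> seq (R[i] * {A : set X | measurable A})) (l' : seq (L2C mu)) y p :
    y \in l' -> List.In p (sx y) ->
    List.In p.2 (flatten [seq [seq p.2 | p <- sx x] | x <- l']).
  move=> + yp; elim: l' => [//|z l' IH]; rewrite inE => /orP[/eqP<-|/IH hi] /=.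
    by apply: In_cat; left; exact: In_map.
  by apply: In_cat; right.
have [|u hu] := @cyclic_vector _ _ _ H _ HU g.
  move=> l f f0; have f2 : 0 < f / 2 by lra.
  have /choice[sx hsx] (x : L2C mu) := tind x _ f2.
  pose nx (x : L2C mu) : R := \sum_(p <- sx x) normc p.1.
  have nx0 x : 0 <= nx x by apply: sumr_ge0 => p _; exact: normc_ge0.
  (* [M] dominates the sum of the moduli of the coefficients of each vector, turning precision
     [f / 2 / M] on indicators into [f / 2] on vectors. *)
  pose M := 1 + \sum_(x <- l) nx x.
  have Mx x : x \in l -> nx x <= M.
    move=> xl; rewrite /M (big_rem x)//=.
    have : 0 <= \sum_(y <- rem x l) nx y by apply: sumr_ge0.
    by have := nx0 x; lra.
  have M0 : 0 < M by rewrite ltr_wpDr// sumr_ge0.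
  have d0 : 0 < f / 2 / M by rewrite divr_gt0.
  pose Ls := flatten [seq [seq p.2 | p <- sx x] | x <- l].
  pose A0 : {A : set X | measurable A} := exist _ set0 measurable0.
  have [B [h [mB [h0 [dis [_ hJ]]]]]] := hr (size Ls) (fun i => sval (nth A0 Ls i)) _
    (fun i _ => svalP (nth A0 Ls i)) (exprn_gt0 2 d0).
  have mI j : measurable (iter j S.1 @^-1` B).
    by apply: measurable_preim => //; case: (mpreserving_iter j pS).
  exists (ci B).
  have one A : List.In A Ls -> exists q, cnrm ip (ind A - pv (koop S) q (ci B)) <= f / 2 / M.
    move=> ALs; have [i iL iE] : exists2 i, (i < size Ls)%N & nth A0 Ls i = A.
      elim: Ls ALs {hJ} => [//|A1 s IH] /= [->|/IH[i il iE]]; first by exists 0%N.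
      by exists i.+1.
    have [J [Jh hd]] := hJ i iL; rewrite iE in hd.
    pose q := \poly_(j < h) (if `[< J j >] then 1 else 0 : R[i]); exists q.
    have mU : measurable (\bigcup_(j in J) (iter j S.1 @^-1` B)) by apply: bigcup_measurable.
    suff -> : pv (koop S) q (ci B) = ci (\bigcup_(j in J) (iter j S.1 @^-1` B)).
      apply/ltW/ind_close => //; first exact: svalP.
      by rewrite /dm -lte_fin fineK// fin_num_measure//; apply: symdiff_meas => //; exact: svalP.
    rewrite (pv_widen _ _ (size_poly _ _ : (size q <= h)%N)).
    pose c (j : 'I_h) : R[i] := if `[< J j >] then 1 else 0.
    have hB := cind_l2 mu mB.
    have mc (j : 'I_h) : l2fun mu (fun s => c j * cind R (iter j S.1 @^-1` B) s).
      by apply: l2funZ; exact: cind_l2.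
    have [sE sl] := clsS (index_enum _) mc.
    rewrite (eq_bigr (fun j : 'I_h => cls mu (fun s => c j * cind R (iter j S.1 @^-1` B) s))); last first.
      move=> j _; rewrite coef_poly ltn_ord /koop.
      rewrite (comp_op_cls (transports_zpow j hS) hB) clsZ//.
      exact: (cind_l2 mu (mI j)).
    rewrite sE; apply: cls_eq => //; first exact: cind_l2.
    have aed : ae_prop mu (fun s => forall i j, (i < h)%N -> (j < h)%N -> i <> j ->
        ~ ((iter i S.1 @^-1` B) s /\ (iter j S.1 @^-1` B) s)).
      apply: ae_all => i1; apply: ae_all => j1.
      case: (pselect [/\ (i1 < h)%N, (j1 < h)%N & i1 <> j1]) => [[i1h j1h ij]|no]; last first.
        by apply: aeT => s ? ? ? _; apply: no.
      exists (iter i1 S.1 @^-1` B `&` iter j1 S.1 @^-1` B).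
      by split; [exact: measurableI|split; [exact: dis|move=> s ns _ _ _; exact: ns]].
    apply: ae_imp aed => s ds; rewrite /cind.
    have [[j Jj Bj]|nU] := pselect ((\bigcup_(j in J) (iter j S.1 @^-1` B)) s).
      have jh := Jh _ Jj; rewrite (bigD1 (Ordinal jh))//= big1 ?addr0.
        rewrite /c/= !indicE (_ : s \in _)/=; last exact: mem_set.
        rewrite (_ : s \in \bigcup_(_ in _) _)/=; last by apply: mem_set; exists j.
        by rewrite (_ : `[< J j >]) ?mulr1//; exact/asboolP.
      move=> i1 ij; rewrite indicE memNset ?mulr0//= => Bi.
      by apply: (ds i1 j) => // e1; case/eqP: ij; apply/val_inj.
    rewrite [RHS]/real_complex_def indicE memNset//= big1// => i1 _; rewrite /c; case: asboolP => Ji; rewrite ?mul0r//.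
    by rewrite indicE memNset ?mulr0//= => Bi; apply: nU; exists i1.
  move=> x xl; have [q hq] : exists q, cnrm ip (comb ind (sx x) - pv (koop S) q (ci B)) <= nx x * (f / 2 / M).
    have : forall p, List.In p (sx x) -> exists q, cnrm ip (ind p.2 - pv (koop S) q (ci B)) <= f / 2 / M.
      by move=> p ps; apply: one; exact: (inL _ _ _ _ xl ps).
    rewrite /comb /nx; elim: (sx x) => [|p s IH] hp.
      by exists 0; rewrite !big_nil /pv size_poly0 big_ord0 subr0 cnrm0// mul0r.
    have [q1 h1] := hp p (or_introl erefl); have [|q2 h2] := IH; first by move=> p' ?; apply: hp; right.
    exists (p.1 *: q1 + q2); rewrite !big_cons pvD opprD addrACA -scalerBr mulrDl.
    apply: le_trans (cnrmD H _ _) (lerD _ h2); rewrite (cnrmZ H).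
    by rewrite ler_wpM2l ?normc_ge0.
  exists q; apply: le_lt_trans (cnrm_tri H (comb ind (sx x)) _ _) _.
  have : nx x * (f / 2 / M) <= f / 2 by rewrite mulrA ler_pdivrMr// mulrC ler_pM2l//; exact: Mx.
  have lt2 (a b c f' : R) : a < f' / 2 -> b <= c -> c <= f' / 2 -> a + b < f' by move=> *; lra.
  exact: lt2 (hsx x) hq.
exists u; apply: (total_orth H) => x hx; apply: cell_orth => q l.
have := hu (pickle (q, l)); rewrite /g pickleK => cu.
apply: Normc.eq0_normc; apply/eqP; rewrite eq_le normc_ge0 andbT; apply/ler_addgt0Pr => e e0.
rewrite add0r; have n1 : 0 < cnrm ip x + 1 by have := cnrm_ge0 ip x; lra.
have [s hs] := cu _ (divr_gt0 e0 n1).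
have z : cip ip x (lc (koop S) s u) = 0.
  by rewrite /lc /comb (sesq_sumr _ _ _ (sesq_cip H)) big1// => p _; rewrite (cipZr H) hx mulr0.
rewrite -[cip ip x _]subr0 -z -(cipBr H); apply: le_trans (cip_CS H _ _) _.
move: hs; rewrite ltr_pdivlMr// => hlt; apply: le_trans (ltW hlt).
by rewrite mulrC ler_wpM2l ?cnrm_ge0//; lra.
Qed.

End IndicatorsTotal.

(** * A dense G_delta of maps whose powers have rank one *)

Section PartOne.
Variables (R : realType) (d : measure_display) (X : measurableType d).
Variable mu : probability X R.
Variables (phi : X -> R) (psi : R -> X).
Hypothesis iso : iso01 mu phi psi.

Theorem generic_rank_one : exists Rinf : set (@aut d X),
  [/\ Rinf `<=` is_aut mu, aut_dense mu Rinf, aut_Gdelta mu Rinf &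
      forall T, Rinf T -> forall n, (0 < n)%N -> rank_one mu (iter n T.1)].
Proof.
(* Pairs [(n, L)] are enumerated by [unpickle]; a code of no pair gives the whole group, and the
   shifts by one avoid [n = 0] and [L = 0]. *)
pose U m : set (@aut d X) := if (unpickle m : option (nat * nat)) is Some (n, L)
  then towerset mu phi n.+1 L.+1 else is_aut mu.
have UO T : (\bigcap_m U m) T -> forall n L, towerset mu phi n.+1 L.+1 T.
  by move=> h n L; have := h (pickle (n, L)) I; rewrite /U pickleK.
exists (\bigcap_m U m); split.
- by move=> T /UO/(_ 0%N 0%N)[].
- move=> T hT k As e e0 mAs; have [T' [hT' hr hd]] := dense_rank_one iso hT mAs e0.
  exists T'; split; last by split.
  move=> m _; rewrite /U; case: (unpickle m) => [[n L]|//].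
  by apply: (rank_one_towerset iso) => //; exact: hr.
- exists U; split=> // m; rewrite /U; case: (unpickle m) => [[n L]|]; first exact: (towerset_open iso).
  by split=> // T hT; exists 0%N, (fun=> set0), 1; split=> //; split=> // S [].
- move=> T /UO hT [//|n] _; have aT : is_aut mu T by have [] := hT 0%N 0%N.
  by apply: (towerset_rank_one iso aT) => -[//|L] _; exact: hT.
Qed.

End PartOne.

(** * Gaussian systems *)

Section RealBounds.
Variable R : realType.
Implicit Types x y t : R.

Lemma mean_value (f df : R -> R) (a b : R) : (forall x, is_derive x (1 : R) f (df x)) -> a <= b ->
  exists2 c, a <= c <= b & f b - f a = df c * (b - a).
Proof.
move=> d ab; have [|c] := @MVT_segment R f df a b ab (fun x _ => d x); last by rewrite in_itv/= => cI e; exists c.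
by apply: derivable_within_continuous => x _; have [] := d x.
Qed.

Lemma nonneg_of_derive (f df : R -> R) : (forall x, is_derive x (1 : R) f (df x)) ->
  f 0 = 0 -> (forall x, 0 <= x -> 0 <= df x) -> forall x, 0 <= x -> 0 <= f x.
Proof.
move=> d f0 df0 x x0; have [c /andP[c0 _]] := mean_value d x0.
by rewrite f0 !subr0 => ->; rewrite mulr_ge0// df0.
Qed.

Let dsq x : is_derive x (1 : R) (fun x => x * x) (x *: 1 + x *: 1) :=
  is_deriveM (is_derive_id x 1) (is_derive_id x 1).

Let dcube x : is_derive x (1 : R) (fun x => x * x * x) (x * x *: 1 + x *: (x *: 1 + x *: 1)) :=
  is_deriveM (dsq x) (is_derive_id x 1).

Let dquart x : is_derive x (1 : R) (fun x => (x * x) * (x * x))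
  (x * x *: (x *: 1 + x *: 1) + x * x *: (x *: 1 + x *: 1)) := is_deriveM (dsq x) (dsq x).

Lemma sin_le_id x : 0 <= x -> sin x <= x.
Proof.
move=> x0; rewrite -subr_ge0.
have d y : is_derive y (1 : R) (fun x => x - sin x) (1 - cos y) by exact: is_deriveB.
apply: (nonneg_of_derive d) x0 => [|y _]; first by rewrite sin0 subr0.
by rewrite subr_ge0 cos_le1.
Qed.

Lemma cos_ge_quad x : 0 <= x -> 1 - x * x / 2 <= cos x.
Proof.
move=> x0; have d y : is_derive y (1 : R) (fun x => cos x + 2^-1 * (x * x) - 1) (- sin y + y).
  have h : is_derive y (1 : R) (fun x => cos x + 2^-1 * (x * x) - 1) _ :=
    is_deriveB (is_deriveD (is_derive_cos y) (is_deriveZ 2^-1 (dsq y))) (is_derive_cst (1 : R) y 1).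
  by apply: is_derive_eq h _; rewrite /GRing.scale/=; lra.
have := nonneg_of_derive d _ _ x0; rewrite cos0 => h.
suff : 0 <= cos x + 2^-1 * (x * x) - 1 by lra.
by apply: h => [|y y0]; [lra|have := sin_le_id y0; lra].
Qed.

Lemma sin_ge_cube x : 0 <= x -> x - x * x * x / 6 <= sin x.
Proof.
move=> x0; have d y : is_derive y (1 : R) (fun x => sin x + 6^-1 * (x * x * x) - x) (cos y + y * y / 2 - 1).
  have h : is_derive y (1 : R) (fun x => sin x + 6^-1 * (x * x * x) - x) _ :=
    is_deriveB (is_deriveD (is_derive_sin y) (is_deriveZ 6^-1 (dcube y))) (is_derive_id y 1).
  by apply: is_derive_eq h _; rewrite /GRing.scale/=; lra.
have := nonneg_of_derive d _ _ x0; rewrite sin0 => h.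
suff : 0 <= sin x + 6^-1 * (x * x * x) - x by lra.
by apply: h => [|y y0]; [lra|have := cos_ge_quad y0; lra].
Qed.

(** The trivial bound [cos <= 1] integrated four times, through [sin_le_id], [cos_ge_quad] and
    [sin_ge_cube]. *)
Lemma cos_le_quart x : cos x <= 1 - x ^+ 2 / 2 + x ^+ 4 / 24.
Proof.
wlog x0 : x / 0 <= x.
  move=> h; have [/h//|/ltW xn] := leP 0 x.
  have e4 : (- x) ^+ 4 = x ^+ 4 by ring.
  by have := h (- x); rewrite cosN sqrrN e4; apply; rewrite oppr_ge0.
have d y : is_derive y (1 : R) (fun x => 24^-1 * ((x * x) * (x * x)) - cos x - 2^-1 * (x * x) + 1)
    (y * y * y / 6 + sin y - y).
  have h : is_derive y (1 : R) (fun x => 24^-1 * ((x * x) * (x * x)) - cos x - 2^-1 * (x * x) + 1) _ :=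
    is_deriveD (is_deriveB (is_deriveB (is_deriveZ 24^-1 (dquart y)) (is_derive_cos y))
      (is_deriveZ 2^-1 (dsq y))) (is_derive_cst (1 : R) y 1).
  by apply: is_derive_eq h _; rewrite /GRing.scale/=; lra.
have := nonneg_of_derive d _ _ x0; rewrite cos0 => h.
have e4 : x ^+ 4 = (x * x) * (x * x) by ring.
suff : 0 <= 24^-1 * ((x * x) * (x * x)) - cos x - 2^-1 * (x * x) + 1 by rewrite e4 expr2; lra.
by apply: h => [|y y0]; [lra|have := sin_ge_cube y0; lra].
Qed.

Lemma cos_quad x : `|cos x - 1| <= x ^+ 2 / 2.
Proof.
have h y : 0 <= y -> `|cos y - 1| <= y ^+ 2 / 2.
  move=> y0; have := cos_ge_quad y0; have := cos_le1 y; rewrite expr2 => ? ?.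
  by rewrite ler_norml; apply/andP; split; lra.
have [/h//|/ltW xn] := leP 0 x.
by have := h (- x); rewrite cosN sqrrN; apply; lra.
Qed.

Lemma sin_quad x : `|sin x - x| <= x ^+ 2.
Proof.
have h y : 0 <= y -> `|sin y - y| <= y ^+ 2.
  move=> y0; have := sin_ge_cube y0; have := sin_le_id y0 => s1 s2.
  rewrite ler_norml; apply/andP; split; last by have := sqr_ge0 y; lra.
  have [y6|y6] := leP y 6; first by rewrite expr2; nra.
  by have := sin_geN1 y; rewrite expr2; nra.
have [/h//|/ltW xn] := leP 0 x.
by have := h (- x); rewrite sinN sqrrN -opprD normrN; apply; lra.
Qed.

Lemma cos_lip x y : `|cos x - cos y| <= `|x - y|.
Proof.
wlog xy : x y / x <= y.
  by move=> h; have [/h//|/ltW/h] := leP x y; rewrite distrC [leRHS]distrC.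
have [c _ e] := mean_value (@is_derive_cos R) xy.
by rewrite distrC e normrM normrN [leRHS]distrC ler_piMl// sin_max.
Qed.

Lemma sin_lip x y : `|sin x - sin y| <= `|x - y|.
Proof.
wlog xy : x y / x <= y.
  by move=> h; have [/h//|/ltW/h] := leP x y; rewrite distrC [leRHS]distrC.
have [c _ e] := mean_value (@is_derive_sin R) xy.
by rewrite distrC e normrM [leRHS]distrC ler_piMl// cos_max.
Qed.

Lemma cos_taylor (u v : R) : `|cos (u + v) - cos u + v * sin u| <= 2 * v ^+ 2.
Proof.
rewrite (_ : _ + _ = cos u * (cos v - 1) - sin u * (sin v - v)); last first.
  by rewrite cosD; ring.
apply: le_trans (ler_normB _ _) _; rewrite !normrM.
have := cos_quad v; have := sin_quad v; have := cos_max u; have := sin_max u.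
have := normr_ge0 (cos u); have := normr_ge0 (sin u).
have := normr_ge0 (cos v - 1); have := normr_ge0 (sin v - v).
move: `|cos u| `|sin u| `|cos v - 1| `|sin v - v| (v ^+ 2) => a b c e f *; nra.
Qed.

Lemma sin_taylor (u v : R) : `|sin (u + v) - sin u - v * cos u| <= 2 * v ^+ 2.
Proof.
rewrite (_ : _ - _ = sin u * (cos v - 1) + cos u * (sin v - v)); last first.
  by rewrite sinD; ring.
apply: le_trans (ler_normD _ _) _; rewrite !normrM.
have := cos_quad v; have := sin_quad v; have := cos_max u; have := sin_max u.
have := normr_ge0 (cos u); have := normr_ge0 (sin u).
have := normr_ge0 (cos v - 1); have := normr_ge0 (sin v - v).
move: `|cos u| `|sin u| `|cos v - 1| `|sin v - v| (v ^+ 2) => a b c e f *; nra.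
Qed.

Lemma exp_taylor y : `|expR y - 1 - y| <= y ^+ 2 * expR `|y|.
Proof.
have h1 := expR_ge1Dx y; have h2 := expR_ge1Dx (- y).
have ep : 0 < expR y := expR_gt0 y.
have h3 : expR y * (1 - y) <= 1.
  by rewrite -[leRHS](expRxMexpNx_1 y) ler_pM2l//; lra.
have e1 : 1 <= expR `|y| by rewrite -expR0 ler_expR.
have y2 := sqr_ge0 y.
rewrite ger0_norm; last by lra.
have [y0|y0] := leP 0 y.
  rewrite ger0_norm//; have : y * (expR y - 1) <= y * (y * expR y) by rewrite ler_wpM2l//; lra.
  by rewrite expr2; lra.
have : y * (expR y - 1) <= y * y by rewrite ler_nM2l//; lra.
have : y * y <= y ^+ 2 * expR `|y| by rewrite -expr2 ler_peMr.
lra.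
Qed.

(** Comparison of first-order terms at 0; it also shows that a quantity bounded by [K * a] for all
    small [a] is zero. *)
Lemma small_linear (c K : R) : (forall a, 0 < a <= 1 -> `|a * c| <= K * a ^+ 2) -> c = 0.
Proof.
move=> h; apply/eqP; rewrite -normr_eq0 eq_le normr_ge0 andbT; apply/ler_addgt0Pr => e e0.
rewrite add0r; have K1 : 0 < `|K| + 1 by have := normr_ge0 K; lra.
pose a := Num.min 1 (e / (`|K| + 1)).
have a0 : 0 < a by rewrite lt_min ltr01 divr_gt0.
have a1 : a <= 1 by rewrite ge_min lexx.
have ae : a <= e / (`|K| + 1) by rewrite ge_min lexx orbT.
have a01 : 0 < a <= 1 by rewrite a0.
have := h a a01; rewrite normrM gtr0_norm// expr2 mulrCA ler_pM2l// => /le_trans; apply.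
apply: le_trans (_ : (`|K| + 1) * a <= e); last by rewrite mulrC -ler_pdivlMr.
by rewrite ler_pM2r//; have := ler_norm K; lra.
Qed.

(** Applied to integrals depending on a parameter, a quadratic remainder gives the derivative with
    no limit under the integral sign. *)
Lemma is_derive_quad (f : R -> R) (x l K : R) :
  (forall a, `|a| <= 1 -> `|f (a + x) - f x - a * l| <= K * a ^+ 2) -> is_derive x (1 : R) f l.
Proof.
move=> h; have K1 : 0 < `|K| + 1 by have := normr_ge0 K; lra.
have c : (fun a => a^-1 *: (f (a *: 1 + x) - f x)) @ (0 : R)^' --> l.
  apply/cvgrPdist_lt => e e0; have e1 : 0 < Num.min 1 (e / (`|K| + 1)) by rewrite lt_min ltr01 divr_gt0.
  near=> a.
  have a0 : a != 0 by near: a; exact: nbhs_dnbhs_neq.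
  have : `|a| < Num.min 1 (e / (`|K| + 1)) by near: a; exact: dnbhs0_lt.
  rewrite lt_min => /andP[a1 ae].
  have := h a (ltW a1); rewrite /GRing.scale/= mulr1 => ha.
  have na : 0 < `|a| by rewrite normr_gt0.
  rewrite distrC (_ : _ - l = a^-1 * (f (a + x) - f x - a * l)); last by field.
  rewrite normrM normfV mulrC ltr_pdivrMr//; apply: le_lt_trans ha _.
  rewrite -(real_normK (num_real a)) expr2 mulrA ltr_pM2r//.
  apply: le_lt_trans (_ : (`|K| + 1) * `|a| < e); last by rewrite mulrC -ltr_pdivlMr.
  by rewrite ler_pM2r//; have := ler_norm K; lra.
by apply: DeriveDef; [apply/cvg_ex; exists l|exact: cvg_lim].
Unshelve. all: by end_near. Qed.

Lemma exp_half_derive t : is_derive t (1 : R) (fun t => expR (t ^+ 2 / 2)) (t * expR (t ^+ 2 / 2)).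
Proof.
apply: (@is_derive_quad _ _ _ (expR (t ^+ 2 / 2) * ((`|t| + 1) ^+ 2 * expR (`|t| + 1) + 1))) => a a1.
pose y := t * a + a ^+ 2 / 2.
have yE : (a + t) ^+ 2 / 2 = t ^+ 2 / 2 + y by rewrite /y; field.
rewrite yE expRD (_ : _ - _ = expR (t ^+ 2 / 2) * ((expR y - 1 - y) + a ^+ 2 / 2)); last first.
  by rewrite /y; field.
rewrite normrM ger0_norm ?expR_ge0// -mulrA ler_pM2l ?expR_gt0//.
have ya : `|y| <= (`|t| + 1) * `|a|.
  rewrite /y; apply: le_trans (ler_normD _ _) _; rewrite normrM mulrDl lerD2l mul1r normrM normrX.
  rewrite (@gtr0_norm _ 2^-1) ?invr_gt0// expr2; have := normr_ge0 a; nra.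
have y1 : `|y| <= `|t| + 1.
  by apply: le_trans ya _; rewrite ler_piMr// addr_ge0.
have y2 : y ^+ 2 <= (`|t| + 1) ^+ 2 * a ^+ 2.
  rewrite -(real_normK (num_real y)) -[a ^+ 2](real_normK (num_real a)) -exprMn.
  by rewrite ler_pXn2r// nnegrE// mulr_ge0// addr_ge0.
apply: le_trans (ler_normD _ _) _; rewrite mulrDl mul1r; apply: lerD.
  apply: le_trans (exp_taylor y) _; rewrite [leRHS]mulrAC.
  by apply: ler_pM; rewrite ?sqr_ge0 ?expR_ge0 ?ler_expR.
by rewrite ger0_norm; have := sqr_ge0 a; lra.
Qed.

Lemma exp_ge_pow2 y : 0 <= y -> y ^+ 2 <= 2 * expR y.
Proof. by move=> y0; have := @expR_ge1Dxn R y 1 y0; rewrite (_ : 2`!%:R = 2)//; lra. Qed.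

Lemma exp_ge_pow3 y : 0 <= y -> y ^+ 3 <= 6 * expR y.
Proof. by move=> y0; have := @expR_ge1Dxn R y 2 y0; rewrite (_ : 3`!%:R = 6)//; lra. Qed.

End RealBounds.

(** * Integration against a density *)

Section Density.
Variable R : realType.
Local Notation leb := (@lebesgue_measure R).
Local Notation RR := (measurableTypeR R).
Variables (P : {measure set RR -> \bar R}) (p : R -> R).
Hypothesis mp : measurable_fun setT p.
Hypothesis p0 : forall x, 0 <= p x.
Hypothesis hP : forall V, measurable V -> P V = (\int[leb]_(x in V) (p x)%:E)%E.
Import HBNNSimple.

Lemma ge0_integral_density (g : R -> \bar R) : measurable_fun setT g -> (forall x, 0 <= g x)%E ->
  (\int[P]_x g x = \int[leb]_x (g x * (p x)%:E))%E.
Proof.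
move=> mg g0; pose f_ := nnsfun_approx (@measurableT _ RR) mg.
have fc x : (EFin \o f_^~ x) @ \oo --> g x by apply: cvg_nnsfun_approx.
have mf n : measurable_fun [set: RR] (EFin \o f_ n) by exact/measurable_EFinP/measurable_funP.
have ndf x m n : (m <= n)%N -> ((f_ m x)%:E <= (f_ n x)%:E)%E.
  by move=> mn; rewrite lee_fin; exact/lefP/nd_nnsfun_approx.
have mpE : measurable_fun [set: RR] (EFin \o p) by exact/measurable_EFinP.
transitivity (limn (fun n => \int[P]_x (f_ n x)%:E))%E.
  rewrite -monotone_convergence//.
  - by apply: eq_integral => x _; apply/esym/cvg_lim => //; exact: fc.
  - by move=> n x _; rewrite lee_fin.
  - by move=> x _ m n mn; exact: ndf.
rewrite [X in limn X](_ : _ = (fun n => \int[leb]_x ((f_ n x)%:E * (p x)%:E)))%E.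
  rewrite -monotone_convergence//; last 3 first.
  - by move=> n; exact: emeasurable_funM (mf n) mpE.
  - by move=> n x _; rewrite mule_ge0// lee_fin.
  - by move=> x _ m n mn; rewrite lee_wpmul2r ?lee_fin//; exact: ndf.
  by apply: eq_integral => x _; apply/cvg_lim => //; apply: cvgeZr => //; exact: fc.
apply/funext => n.
have mA r : measurable (f_ n @^-1` [set r]) by exact: measurable_sfunP.
have r0 r : r \in range (f_ n) -> 0 <= r by rewrite inE => -[x _ <-].
transitivity (\sum_(r \in range (f_ n)) (r%:E * P (f_ n @^-1` [set r])))%E.
  by rewrite integralT_nnsfun sintegralE.
transitivity (\int[leb]_x \sum_(r \in range (f_ n)) ((r * \1_(f_ n @^-1` [set r]) x)%:E * (p x)%:E))%E; last first.
  apply: eq_integral => x _; rewrite [in RHS]fimfunE -fsumEFin// ge0_mule_fsuml//.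
  by move=> r; rewrite lee_fin; exact: nnfun_muleindic_ge0.
rewrite ge0_integral_fsum//; last 2 first.
- move=> r; apply: emeasurable_funM => //; apply/measurable_EFinP/measurable_funM => //.
- by move=> r x _; rewrite mule_ge0// ?lee_fin//; exact: nnfun_muleindic_ge0.
apply: eq_fsbigr => r rr; rewrite hP//.
have -> : (\int[leb]_(x in f_ n @^-1` [set r]) (p x)%:E = \int[leb]_x ((\1_(f_ n @^-1` [set r]) x)%:E * (p x)%:E))%E.
  rewrite integral_mkcond; apply: eq_integral => x _; rewrite patchE indicE.
  by case: ifP => _; rewrite ?mul1e ?mul0e.
rewrite -ge0_integralZl//.
- by apply: eq_integral => x _; rewrite EFinM muleA.
- by apply: emeasurable_funM => //; exact/measurable_EFinP/measurable_indic.
- by move=> x _; rewrite mule_ge0// lee_fin.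
- by rewrite lee_fin r0.
Qed.

End Density.

Lemma rI_norm_le (R : realType) (d : measure_display) (X : measurableType d) (mu : probability X R)
  (f g : X -> R) : mu.-integrable setT (EFin \o f) -> mu.-integrable setT (EFin \o g) ->
  (forall x, `|f x| <= g x) -> `|rI mu f| <= rI mu g.
Proof.
move=> f1 g1 h; rewrite ler_norml; apply/andP; split; last first.
  by apply: rI_le => // x; apply: le_trans (h x); exact: ler_norm.
rewrite lerNl -mulN1r -rIZ//; apply: rI_le => //; first exact: intZ.
by move=> x; apply: le_trans (h x); rewrite mulN1r -normrN ler_norm.
Qed.

Lemma measurable_cos_comp (R : realType) (d : measure_display) (X : measurableType d) (h : X -> R) :
  measurable_fun setT h -> measurable_fun setT (fun x => cos (h x)).
Proof.
by move=> mh; apply: (measurableT_comp _ mh); apply: continuous_measurable_fun; exact: continuous_cos.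
Qed.

Lemma measurable_sin_comp (R : realType) (d : measure_display) (X : measurableType d) (h : X -> R) :
  measurable_fun setT h -> measurable_fun setT (fun x => sin (h x)).
Proof.
by move=> mh; apply: (measurableT_comp _ mh); apply: continuous_measurable_fun; exact: continuous_sin.
Qed.

(** * Stein's identity and the standard normal law *)

Section Stein.
Variables (R : realType) (d : measure_display) (X : measurableType d).
Variable mu : probability X R.
Local Notation rI := (rI mu).
Local Notation Int f := (mu.-integrable setT (EFin \o f)).
Variable Z : X -> R.
Hypothesis mZ : measurable_fun setT Z.
(** The single property of the standard normal law on which this section rests; mean, variance and
    characteristic function are derived from it. *)
Hypothesis cameron_martin : forall (a : R) (G : R -> R), measurable_fun setT G -> (forall y, 0 <= G y) ->
  (\int[mu]_x (G (Z x + a))%:E = \int[mu]_x (G (Z x) * expR (a * Z x - a ^+ 2 / 2))%:E)%E.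

Let w (a : R) x := expR (a * Z x - a ^+ 2 / 2).

Let mw a : measurable_fun setT (w a).
Proof. by apply: measurableT_comp => //; apply: measurable_funB => //; exact: measurable_funM. Qed.

Let iw a : Int (w a) /\ rI (w a) = 1.
Proof.
have e : (\int[mu]_x (w a x)%:E = 1)%E.
  transitivity (\int[mu]_x (1 : R)%:E)%E; last by rewrite integral_cst// mul1e; exact: probability_setT.
  have h := cameron_martin a (G := fun=> 1); rewrite h//.
  by apply: eq_integral => x _; rewrite mul1r.
split; last by rewrite /rI e.
apply/integrableP; split; first exact/measurable_EFinP.
by under eq_integral do rewrite /= ger0_norm ?expR_ge0//; rewrite e ltry.
Qed.

Let iexp a : Int (fun x => expR (a * Z x)).
Proof.
have := intZ (expR (a ^+ 2 / 2)) (iw a).1; apply: eq_integrable => // x _ /=.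
by rewrite /w -expRD addrC subrK.
Qed.

(** An integrable function that dominates [|Z|], [Z^2], [|Z|^3] and, up to constants, the Taylor
    remainder of [w]. *)
Let D x := expR (2 * Z x) + expR (- 2 * Z x).
Let iD : Int D. Proof. exact: intD (iexp 2) (iexp (- 2)). Qed.

Let DE x : expR (2 * `|Z x|) <= D x.
Proof.
rewrite /D; have := expR_ge0 (2 * Z x); have := expR_ge0 (- 2 * Z x).
have [h|h] := leP 0 (Z x); first by rewrite ger0_norm// => *; lra.
by rewrite ltr0_norm// mulrN mulNr => *; lra.
Qed.

Let Z1 x : `|Z x| <= D x.
Proof. by apply: le_trans (DE x); have := expR_ge1Dx (2 * `|Z x|); have := normr_ge0 (Z x); lra. Qed.

Let Z2 x : Z x ^+ 2 <= D x.
Proof.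
apply: le_trans (DE x); rewrite -(real_normK (num_real (Z x))).
have h : 0 <= 2 * `|Z x| by rewrite mulr_ge0.
by have := exp_ge_pow2 h; rewrite exprMn; have := sqr_ge0 `|Z x|; lra.
Qed.

Let Z3 x : `|Z x| ^+ 3 <= D x.
Proof.
apply: le_trans (DE x); have h : 0 <= 2 * `|Z x| by rewrite mulr_ge0.
have := exp_ge_pow3 h; rewrite exprMn; have : 0 <= `|Z x| ^+ 3 by rewrite exprn_ge0.
lra.
Qed.

Let iZ : Int Z. Proof. by apply: int_le mZ _ iD. Qed.

Lemma stein_sq_int : sq_int mu Z.
Proof.
apply: int_sq_int => //; apply: int_le iD; first exact: measurable_funX.
by move=> x; rewrite ger0_norm ?sqr_ge0.
Qed.

Let tilt a (G : R -> R) : measurable_fun setT G -> (forall y, `|G y| <= 1) ->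
  rI (fun x => G (Z x + a)) = rI (fun x => G (Z x) * w a x).
Proof.
(* The formula is given for nonnegative functions; adding 1 brings [G] into that range. *)
move=> mG G1; have G0 y : 0 <= G y + 1 by have := G1 y; rewrite ler_norml => /andP[]; lra.
have mG' : measurable_fun setT (fun y => G y + 1) by exact: measurable_funD.
have := congr1 fine (cameron_martin a mG' G0); rewrite -!/(rI _).
have iG1 : Int (fun x => G (Z x + a)).
  apply: (@int_bdd _ _ _ mu _ 1) => [|x]; last exact: G1.
  by apply: (measurableT_comp mG); exact: measurable_funD.
have iG2 : Int (fun x => G (Z x) * w a x).
  apply: int_le (iw a).1; first by apply: measurable_funM (mw a); exact: measurableT_comp mG mZ.
  by move=> x; rewrite normrM [X in _ * X]ger0_norm ?expR_ge0// ler_piMl ?expR_ge0.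
rewrite (rID iG1 (int_cst _ _)) rI_cst.
under [X in _ = rI X -> _]eq_fun do rewrite mulrDl mul1r.
by rewrite (rID iG2 (iw a).1) (iw a).2; lra.
Qed.

Let wE a x : 0 < a <= 1 -> `|w a x - 1 - a * Z x| <= (2 * expR 2 * D x + 1) * a ^+ 2.
Proof.
move=> /andP[a0 a1]; have z0 := normr_ge0 (Z x).
pose y := a * Z x - a ^+ 2 / 2; have y1 : `|y| <= a * (`|Z x| + 1).
  rewrite /y; apply: le_trans (ler_normB _ _) _; rewrite normrM gtr0_norm// mulrDr lerD2l.
  by rewrite ger0_norm ?divr_ge0 ?sqr_ge0// expr2; nra.
have y2 : y ^+ 2 <= a ^+ 2 * (`|Z x| + 1) ^+ 2.
  by rewrite -(real_normK (num_real y)) -exprMn ler_pXn2r// nnegrE mulr_ge0 ?ltW// addr_ge0.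
have y3 : expR `|y| <= expR (`|Z x| + 1).
  by rewrite ler_expR (le_trans y1)// ler_piMl// addr_ge0.
have y4 : (`|Z x| + 1) ^+ 2 * expR (`|Z x| + 1) <= 2 * expR 2 * D x.
  have h : 0 <= `|Z x| + 1 by rewrite addr_ge0.
  apply: le_trans (_ : 2 * expR (`|Z x| + 1) * expR (`|Z x| + 1) <= _).
    by rewrite ler_pM2r ?expR_gt0// exp_ge_pow2.
  rewrite -!mulrA ler_pM2l// -expRD (_ : _ + _ = 2 + 2 * `|Z x|); last by ring.
  by rewrite expRD ler_pM2l ?expR_gt0//; exact: DE.
have -> : w a x - 1 - a * Z x = (expR y - 1 - y) - a ^+ 2 / 2 by rewrite /w -/y {3}/y; lra.
apply: le_trans (ler_normB _ _) _; rewrite mulrDl mul1r; apply: lerD; last first.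
  by rewrite ger0_norm; have := sqr_ge0 a; lra.
apply: le_trans (exp_taylor y) _.
apply: le_trans (ler_pM (sqr_ge0 _) (expR_ge0 _) y2 y3) _.
by rewrite -[leLHS]mulrA [leRHS]mulrC; exact: (ler_wpM2l (sqr_ge0 a) y4).
Qed.

(* Differentiating both sides of the Cameron-Martin formula at shift [0]. *)
Lemma stein (G G' : R -> R) c : measurable_fun setT G -> measurable_fun setT G' ->
  (forall y, `|G y| <= 1) -> (forall y, `|G' y| <= c) ->
  (forall y v, `|G (y + v) - G y - v * G' y| <= c * v ^+ 2) ->
  rI (fun x => Z x * G (Z x)) = rI (fun x => G' (Z x)).
Proof.
move=> mG mG' G1 G'1 GT; apply/eqP; rewrite -subr_eq0; apply/eqP.
have mGZ : measurable_fun setT (fun x => G (Z x)) by exact: measurableT_comp mG mZ.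
have i1 : Int (fun x => Z x * G (Z x)).
  apply: int_le iD; first exact: measurable_funM.
  by move=> x; rewrite normrM (le_trans _ (Z1 x))// ler_piMr.
have i2 : Int (fun x => G' (Z x)).
  by apply: (@int_bdd _ _ _ mu _ c) => //; exact: measurableT_comp mG' mZ.
have i3 : Int (fun x => G (Z x)) by exact: (@int_bdd _ _ _ mu _ 1).
have iE : Int (fun x => 2 * expR 2 * D x + 1) by apply: intD (intZ _ iD) (int_cst _ _).
apply: (@small_linear _ _ (rI (fun x => 2 * expR 2 * D x + 1) + c)) => a a01.
have i4 : Int (fun x => G (Z x) * w a x).
  apply: int_le (iw a).1; first exact: measurable_funM.
  by move=> x; rewrite normrM [X in _ * X]ger0_norm ?expR_ge0// ler_piMl ?expR_ge0.
have i5 : Int (fun x => G (Z x + a)).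
  apply: (@int_bdd _ _ _ mu _ 1) => [|x]; last exact: G1.
  by apply: (measurableT_comp mG); exact: measurable_funD.
have t := tilt a mG G1.
have e1 : `|rI (fun x => G (Z x) * w a x) - rI (fun x => G (Z x)) - a * rI (fun x => Z x * G (Z x))|
    <= rI (fun x => 2 * expR 2 * D x + 1) * a ^+ 2.
  rewrite -(rIB i4 i3) -(rIZ a i1) -(rIB (intB i4 i3) (intZ a i1)) [leRHS]mulrC -(rIZ _ iE).
  apply: rI_norm_le (intB (intB i4 i3) (intZ a i1)) (intZ _ iE) _ => x.
  rewrite [leRHS]mulrC (_ : _ - _ = G (Z x) * (w a x - 1 - a * Z x)); last by ring.
  rewrite normrM; apply: le_trans (wE x a01); exact: ler_piMl.
have e2 : `|rI (fun x => G (Z x + a)) - rI (fun x => G (Z x)) - a * rI (fun x => G' (Z x))| <= c * a ^+ 2.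
  rewrite -(rIB i5 i3) -(rIZ a i2) -(rIB (intB i5 i3) (intZ a i2)) -[leRHS](rI_cst mu).
  by apply: rI_norm_le (intB (intB i5 i3) (intZ a i2)) (int_cst _ _) _ => x; exact: GT.
rewrite t in e2; rewrite mulrDl; move: e1 e2; rewrite !ler_norml => /andP[? ?] /andP[? ?].
apply/andP; split; lra.
Qed.

Let psi t := rI (fun x => cos (t * Z x)).
Let S t := rI (fun x => sin (t * Z x)).
Let m1 t : measurable_fun setT (fun y : R => t * y). Proof. exact: measurable_funM. Qed.
Let mt t : measurable_fun setT (fun x => t * Z x). Proof. exact: measurable_funM. Qed.

Let steinC t : rI (fun x => Z x * cos (t * Z x)) = - t * S t.
Proof.
rewrite (@stein (fun y => cos (t * y)) (fun y => - t * sin (t * y)) (`|t| + 2 * t ^+ 2)).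
- rewrite rIZ//; apply: (@int_bdd _ _ _ mu _ 1); first exact: measurable_sin_comp.
  by move=> x; exact: sin_max.
- exact: measurable_cos_comp.
- by apply: measurable_funM => //; exact: measurable_sin_comp.
- by move=> y; exact: cos_max.
- move=> y; rewrite normrM normrN; apply: le_trans (_ : `|t| <= _); last by have := sqr_ge0 t; lra.
  by rewrite ler_piMr// sin_max.
- move=> y v; rewrite mulrDr (_ : _ - _ = cos (t * y + t * v) - cos (t * y) + (t * v) * sin (t * y)); last by ring.
  apply: le_trans (cos_taylor _ _) _; rewrite exprMn mulrA ler_wpM2r ?sqr_ge0//.
  by rewrite lerDr.
Qed.

Let steinS t : rI (fun x => Z x * sin (t * Z x)) = t * psi t.
Proof.
rewrite (@stein (fun y => sin (t * y)) (fun y => t * cos (t * y)) (`|t| + 2 * t ^+ 2)).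
- rewrite rIZ//; apply: (@int_bdd _ _ _ mu _ 1); first exact: measurable_cos_comp.
  by move=> x; exact: cos_max.
- exact: measurable_sin_comp.
- by apply: measurable_funM => //; exact: measurable_cos_comp.
- by move=> y; exact: sin_max.
- move=> y; rewrite normrM; apply: le_trans (_ : `|t| <= _); last by have := sqr_ge0 t; lra.
  by rewrite ler_piMr// cos_max.
- move=> y v; rewrite mulrDr (_ : _ - _ = sin (t * y + t * v) - sin (t * y) - (t * v) * cos (t * y)); last by ring.
  apply: le_trans (sin_taylor _ _) _; rewrite exprMn mulrA ler_wpM2r ?sqr_ge0//.
  by rewrite lerDr.
Qed.

Let icos t : Int (fun x => cos (t * Z x)).
Proof. by apply: (@int_bdd _ _ _ mu _ 1); [exact: measurable_cos_comp|move=> x; exact: cos_max]. Qed.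
Let isin t : Int (fun x => sin (t * Z x)).
Proof. by apply: (@int_bdd _ _ _ mu _ 1); [exact: measurable_sin_comp|move=> x; exact: sin_max]. Qed.
Let iZcos t : Int (fun x => Z x * cos (t * Z x)).
Proof.
apply: int_le iD => [|x]; first by apply: measurable_funM => //; exact: measurable_cos_comp.
by rewrite normrM (le_trans _ (Z1 x))// ler_piMr// cos_max.
Qed.
Let iZsin t : Int (fun x => Z x * sin (t * Z x)).
Proof.
apply: int_le iD => [|x]; first by apply: measurable_funM => //; exact: measurable_sin_comp.
by rewrite normrM (le_trans _ (Z1 x))// ler_piMr// sin_max.
Qed.
Let iZ2 : Int (fun x => Z x ^+ 2). Proof. exact: sq_int_sqr stein_sq_int. Qed.

(** [y t * expR (t ^+ 2 / 2)] has zero derivative. *)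
Let ode (y : R -> R) : (forall t, is_derive t (1 : R) y (- t * y t)) ->
  forall t, y t = y 0 * expR (- (t ^+ 2 / 2)).
Proof.
move=> dy t; have ds s : is_derive s (1 : R) (fun s => y s * expR (s ^+ 2 / 2)) 0.
  have h : is_derive s (1 : R) (fun s => y s * expR (s ^+ 2 / 2)) _ :=
    is_deriveM (dy s) (exp_half_derive s).
  by apply: is_derive_eq h _; rewrite /GRing.scale/=; ring.
have := @is_derive_0_is_cst R _ t 0 ds; rewrite expr0n/= mul0r expR0 mulr1 => <-.
by rewrite -mulrA -expRD subrr expR0 mulr1.
Qed.

(** The derivative of [psi] is minus the mean of [Z sin (t Z)], which Stein's identity turns into
    [- t * psi t]. *)
Lemma stein_cos t : rI (fun x => cos (t * Z x)) = expR (- (t ^+ 2 / 2)).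
Proof.
suff dy s : is_derive s (1 : R) psi (- s * psi s).
  by rewrite -/(psi t) (ode dy) /psi; under eq_fun do rewrite mul0r cos0; rewrite rI_cst mul1r.
move: s => {}t; rewrite mulNr -steinS; apply: (@is_derive_quad _ _ _ _ (2 * rI (fun x => Z x ^+ 2))) => a _.
rewrite mulrN opprK -(rIB (icos _) (icos _)) -(rIZ a (iZsin t)) -(rID (intB (icos _) (icos _)) (intZ a (iZsin t))).
rewrite mulrAC -(rIZ _ iZ2).
apply: rI_norm_le (intD (intB (icos _) (icos _)) (intZ a (iZsin t))) (intZ _ iZ2) _ => x.
have := cos_taylor (t * Z x) (a * Z x); rewrite exprMn -mulrDl [t + a]addrC.
by rewrite !mulrA.
Qed.

Lemma stein_sin t : rI (fun x => sin (t * Z x)) = 0.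
Proof.
suff dy s : is_derive s (1 : R) S (- s * S s).
  by rewrite -/(S t) (ode dy) /S; under eq_fun do rewrite mul0r sin0; rewrite rI_cst mul0r.
move: s => {}t; rewrite -steinC; apply: (@is_derive_quad _ _ _ _ (2 * rI (fun x => Z x ^+ 2))) => a _.
rewrite -(rIB (isin _) (isin _)) -(rIZ a (iZcos t)) -(rIB (intB (isin _) (isin _)) (intZ a (iZcos t))).
rewrite mulrAC -(rIZ _ iZ2).
apply: rI_norm_le (intB (intB (isin _) (isin _)) (intZ a (iZcos t))) (intZ _ iZ2) _ => x.
have := sin_taylor (t * Z x) (a * Z x); rewrite exprMn -mulrDl [t + a]addrC.
by rewrite !mulrA.
Qed.

Lemma stein_mean : rI Z = 0.
Proof.
have := steinC 0; rewrite oppr0 mul0r => <-; congr rI; apply/funext => x.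
by rewrite mul0r cos0 mulr1.
Qed.

(** The mean of [Z sin (t Z)] equals [t * psi t], and both are linear in [t] up to [O(t^2)], with
    slopes the mean of [Z^2] and 1. *)
Lemma stein_var : rI (fun x => Z x ^+ 2) = 1.
Proof.
have iZ3 : Int (fun x => `|Z x| ^+ 3).
  apply: int_le iD => [|x]; first by apply: measurable_funX; exact: measurableT_comp.
  by rewrite ger0_norm// exprn_ge0.
apply/eqP; rewrite -subr_eq0; apply/eqP.
apply: (@small_linear _ _ (rI (fun x => `|Z x| ^+ 3) + rI (fun x => Z x ^+ 2))) => t /andP[t0 t1].
have e1 : `|rI (fun x => Z x * sin (t * Z x)) - t * rI (fun x => Z x ^+ 2)| <= t ^+ 2 * rI (fun x => `|Z x| ^+ 3).
  rewrite -(rIZ t iZ2) -(rIB (iZsin t) (intZ t iZ2)) -(rIZ _ iZ3).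
  apply: rI_norm_le (intB (iZsin t) (intZ t iZ2)) (intZ _ iZ3) _ => x.
  rewrite (_ : _ - _ = Z x * (sin (t * Z x) - t * Z x)); last by ring.
  rewrite normrM; apply: le_trans (ler_wpM2l (normr_ge0 _) (sin_quad _)) _.
  by rewrite exprMn -[Z x ^+ 2](real_normK (num_real (Z x))) mulrCA -exprS.
have e2 : `|psi t - 1| <= t ^+ 2 * rI (fun x => Z x ^+ 2).
  rewrite -(rIZ _ iZ2) -[X in psi t - X](rI_cst mu) -(rIB (icos t) (int_cst _ _)).
  apply: rI_norm_le (intB (icos t) (int_cst _ _)) (intZ _ iZ2) _ => x.
  by apply: le_trans (cos_quad _) _; rewrite -exprMn; have := sqr_ge0 (t * Z x); lra.
have e3 : `|t * psi t - t| <= t ^+ 2 * rI (fun x => Z x ^+ 2).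
  rewrite (_ : _ - t = t * (psi t - 1)); last by rewrite mulrBr mulr1.
  rewrite normrM gtr0_norm//; apply: le_trans e2; exact: ler_piMl.
move: e1 e3; rewrite steinS !ler_norml => /andP[? ?] /andP[? ?]; apply/andP; split; lra.
Qed.

End Stein.

(** * Characteristic functions of Gaussian variables *)

Section GaussianChar.
Variables (R : realType) (d : measure_display) (X : measurableType d).
Variable mu : probability X R.
Local Notation rI := (rI mu).
Local Notation RR := (measurableTypeR R).
Local Notation leb := (@lebesgue_measure R).

(** Translation of the Lebesgue integral by [a * s], then completion of the square in the
    density. *)
Lemma normal_cameron_martin (h : X -> R) (m s : R) : measurable_fun setT h -> 0 < s ->
  (forall B : set R, measurable B -> mu (h @^-1` B) = normal_prob m s B) ->
  forall (a : R) (G : R -> R), measurable_fun setT G -> (forall y, 0 <= G y) ->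
  (\int[mu]_x (G ((h x - m) / s + a))%:E =
   \int[mu]_x (G ((h x - m) / s) * expR (a * ((h x - m) / s) - a ^+ 2 / 2))%:E)%E.
Proof.
move=> mh s0 hn a G mG G0; have s0' : s != 0 by rewrite gt_eqF.
pose P : {measure set RR -> \bar R} := normal_prob m s.
pose z (y : R) := (y - m) / s.
have mz : measurable_fun [set: RR] (z : RR -> RR).
  by apply: measurable_funM => //; exact: measurable_funB.
have mGz : measurable_fun [set: RR] (fun y : RR => G (z y)) by exact: measurableT_comp mG mz.
have mGa : measurable_fun [set: RR] (fun y : RR => G (z y + a)).
  by apply: measurableT_comp mG _; exact: measurable_funD.
have mw : measurable_fun [set: RR] (fun y : RR => expR (a * z y - a ^+ 2 / 2)).
  by apply: measurableT_comp => //; apply: measurable_funB => //; exact: measurable_funM.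
have hP V : measurable V -> P V = (\int[leb]_(x in V) (normal_pdf m s x)%:E)%E by [].
have mp : measurable_fun [set: RR] (normal_pdf m s) := measurable_normal_pdf m s.
have p0 := @normal_pdf_ge0 R m s.
transitivity (\int[P]_y (G (z y + a))%:E)%E.
  apply: (@transfer_ge0_integral _ _ _ _ RR mu P h mh hn (fun y => (G (z y + a))%:E)%E).
    exact/measurable_EFinP.
  by move=> y; rewrite lee_fin.
transitivity (\int[P]_y (G (z y) * expR (a * z y - a ^+ 2 / 2))%:E)%E; last first.
  apply/esym; apply: (@transfer_ge0_integral _ _ _ _ RR mu P h mh hn (fun y => (G (z y) * expR (a * z y - a ^+ 2 / 2))%:E)%E).
    by apply/measurable_EFinP; exact: measurable_funM.
  by move=> y; rewrite lee_fin mulr_ge0 ?expR_ge0.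
rewrite (ge0_integral_density mp p0 hP); last 2 first.
- exact/measurable_EFinP.
- by move=> y; rewrite lee_fin.
rewrite (ge0_integral_density mp p0 hP); last 2 first.
- by apply/measurable_EFinP; exact: measurable_funM.
- by move=> y; rewrite lee_fin mulr_ge0 ?expR_ge0.
have ms : measurable_fun [set: RR] ((fun y => y + - (a * s)) : RR -> RR) by exact: measurable_funD.
rewrite -(@transfer_ge0_integral _ _ _ RR RR leb leb _ ms (fun B mB => lebesgue_shift _ mB)
  (fun y => (G (z y + a))%:E * (normal_pdf m s y)%:E)%E); last 2 first.
- by apply: emeasurable_funM; exact/measurable_EFinP.
- by move=> y; rewrite mule_ge0// lee_fin.
apply: eq_integral => y _; rewrite -!EFinM; congr EFin.
rewrite (_ : z (y + - (a * s)) + a = z y); last by rewrite /z; field.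
rewrite -mulrA; congr (_ * _); rewrite normal_pdfE// mulrCA; congr (_ * _).
by rewrite /normal_fun -expRD; congr expR; rewrite /z -[_ *+ 2]mulr_natr; field.
Qed.

Lemma gaussian_rv_char (h : X -> R) : measurable_fun setT h -> gaussian_rv mu h ->
  [/\ sq_int mu h, rI (fun x => sin (h x - rI h)) = 0 &
      rI (fun x => cos (h x - rI h)) = expR (- (rI (fun x => (h x - rI h) ^+ 2) / 2))].
Proof.
(* A constant variable has no density and is treated apart, as the case of variance 0. *)
move=> mh [[c hc]|[m [s [s0 hn]]]].
  have hc' : ae_prop mu (fun x => c = h x) by apply: ae_imp hc.
  have [_ e] := int_ae mh hc' (int_cst mu c); rewrite rI_cst in e.
  have h2 : sq_int mu h by exact: sq_int_ae mh hc' (sq_int_cst mu c).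
  have mhc : measurable_fun setT (fun x => h x - c) by exact: measurable_funB.
  have aux (G : R -> R) : measurable_fun setT (fun x => G (h x - c)) -> rI (fun x => G (h x - c)) = G 0.
    move=> mG; have := int_ae (f := fun=> G 0) mG _ (int_cst mu _); rewrite rI_cst => -[|//].
    by apply: ae_imp hc => x ->; rewrite subrr.
  rewrite -e; split=> //.
  - by rewrite (aux sin) ?sin0//; exact: measurable_sin_comp.
  - rewrite (aux cos) ?cos0 ?(aux (fun y => y ^+ 2)) ?expr0n/= ?mul0r ?oppr0 ?expR0//.
      exact: measurable_funX.
    exact: measurable_cos_comp.
have s0' : s != 0 by rewrite gt_eqF.
pose Z x := (h x - m) / s; have mZ : measurable_fun setT Z.
  by apply: measurable_funM => //; exact: measurable_funB.
have cm := normal_cameron_martin mh s0 hn.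
have hE x : h x = m + s * Z x by rewrite /Z; field.
have Z2 := stein_sq_int mZ cm.
have hf : h = fun x => m + s * Z x by apply/funext.
have iZ := sq_int_int Z2.
have e : rI h = m.
  by rewrite hf (rID (int_cst _ _) (intZ _ iZ)) rI_cst (rIZ _ iZ) (stein_mean mZ cm) mulr0 addr0.
rewrite e; have hm x : h x - m = s * Z x by rewrite hE addrC addKr.
split.
- by rewrite hf; apply: sq_intD (sq_int_cst _ _) (sq_intZ _ Z2).
- by under eq_fun do rewrite hm; exact: (stein_sin mZ cm).
under eq_fun do rewrite hm; under [in RHS]eq_fun do rewrite hm exprMn.
by rewrite (rIZ _ (sq_int_sqr Z2)) (stein_var mZ cm) mulr1; exact: (stein_cos mZ cm).
Qed.

End GaussianChar.

(** * Orthogonality to trigonometric functions of a process *)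

Section TrigOrthogonality.
Variables (R : realType) (d : measure_display) (X : measurableType d).
Variable mu : probability X R.
Local Notation rI := (rI mu).
Local Notation Int f := (mu.-integrable setT (EFin \o f)).
Local Notation RR := (measurableTypeR R).

Lemma rI_dominated0 (F : nat -> X -> R) (f g : X -> R) : (forall n, measurable_fun setT (F n)) ->
  Int g -> (forall n x, `|F n x| <= g x) -> (forall x, F ^~ x @ \oo --> f x) ->
  (forall n, rI (F n) = 0) -> rI f = 0.
Proof.
move=> mF ig Fg Ff F0.
have iF n : Int (F n) by exact: int_le (mF n) (Fg n) ig.
have mf : measurable_fun setT f by apply: (measurable_fun_cvg mF) => x _; exact: Ff.
have mFE n : measurable_fun setT (EFin \o F n) by exact/measurable_EFinP.
have h : (fun n => \int[mu]_x (F n x)%:E)%E @ \oo --> (\int[mu]_x (f x)%:E)%E.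
  apply: (@dominated_cvg _ _ _ mu setT measurableT (fun n => EFin \o F n) (EFin \o f) (EFin \o g)) => //.
    by move=> x _; apply: cvg_EFin; [exact: nearW|exact: Ff].
  by move=> n x _; rewrite lee_fin.
have e : (\int[mu]_x (f x)%:E = 0)%E.
  have e0 : (fun n => \int[mu]_x (F n x)%:E)%E = (fun=> 0%E).
    by apply/funext => n; rewrite -(rIE (iF n)) F0.
  by rewrite e0 in h; apply: (cvg_unique _ h) => //; exact: cvg_cst.
by rewrite /rI e.
Qed.

(* Newton's iteration for the sign function. *)
Definition sign_step (s : R) : R := (3 * s - s ^+ 3) / 2.

Lemma sign_step_bound s : `|s| <= 1 -> `|sign_step s| <= 1.
Proof.
rewrite /sign_step !ler_norml (_ : s ^+ 3 = s * s * s); last by ring.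
move=> /andP[h1 h2].
have a1 : 0 <= (1 - s) * (1 - s) * (2 + s) by rewrite mulr_ge0 ?mulr_ge0//; lra.
have a2 : 0 <= (1 + s) * (1 + s) * (2 - s) by rewrite mulr_ge0 ?mulr_ge0//; lra.
by apply/andP; split; lra.
Qed.

Lemma sign_iter_bound s k : `|s| <= 1 -> `|iter k sign_step s| <= 1.
Proof. by move=> s1; elim: k => //= k; exact: sign_step_bound. Qed.

Lemma sign_iter_odd s k : iter k sign_step (- s) = - iter k sign_step s.
Proof. by elim: k => //= k ->; rewrite /sign_step; field. Qed.

(** A step multiplies the gap [1 - u] by at most [1 - u / 2], and [u] never falls below [s]. *)
Lemma sign_iter_pos s k : 0 < s <= 1 ->
  s <= iter k sign_step s <= 1 /\ 1 - iter k sign_step s <= (1 - s / 2) ^+ k.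
Proof.
move=> /andP[s0 s1]; elim: k => [|k] /=; first by rewrite lexx s1 expr0; split=> //; lra.
move: (iter k _ s) => u [/andP[su u1] h].
rewrite /sign_step (_ : u ^+ 3 = u * u * u); last by ring.
have u2 : 0 <= u * u by rewrite mulr_ge0; lra.
have u3 : u * u <= 1 by nra.
split.
  apply/andP; split; last by nra.
  by have : 0 <= u * (1 - u * u); [rewrite mulr_ge0; lra|lra].
have e1 : 1 - (3 * u - u * u * u) / 2 <= (1 - u) * (1 - u / 2).
  have : 0 <= u * u * (1 - u) by rewrite mulr_ge0//; lra.
  lra.
apply: le_trans e1 _; rewrite exprSr; apply: ler_pM => //; lra.
Qed.

Lemma sign_iter_cvg s : `|s| <= 1 -> (fun k => iter k sign_step s) @ \oo --> Num.sg s.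
Proof.
have pos t : 0 < t <= 1 -> (fun k => iter k sign_step t) @ \oo --> (1 : R).
  move=> t01; have /andP[t0 t1] := t01.
  apply: (@squeeze_cvgr _ _ _ _ (fun k => 1 - (1 - t / 2) ^+ k) (fun=> 1)).
  - apply: nearW => k; have [/andP[_ ->] h] := sign_iter_pos k t01.
    by rewrite andbT; lra.
  - rewrite -[X in _ --> X]subr0; apply: cvgB; first exact: cvg_cst.
    by apply: cvg_expr; rewrite ltr_norml; apply/andP; split; lra.
  - exact: cvg_cst.
move=> s1; have [s0|s0|->] := ltgtP s 0.
- rewrite ltr0_sg//; have -> : (fun k => iter k sign_step s) = (fun k => - iter k sign_step (- s)).
    by apply/funext => k; rewrite sign_iter_odd opprK.
  apply: cvgN; apply: pos; move: s1; rewrite ltr0_norm// => ->.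
  by rewrite andbT; lra.
- by rewrite gtr0_sg//; apply: pos; rewrite s0/= -(gtr0_norm s0).
- rewrite sgr0; have -> : (fun k => iter k sign_step 0) = (fun=> 0 : R); last exact: cvg_cst.
  by apply/funext; elim=> //= k ->; rewrite /sign_step expr0n/=; lra.
Qed.

Variables (xi : X -> R) (HH : set (X -> R)).
Hypothesis ixi : Int xi.
Hypothesis mH : forall h, HH h -> measurable_fun setT h.
Hypothesis H0 : HH (fun=> 0).
Hypothesis HD : forall h g, HH h -> HH g -> HH (fun x => h x + g x).
Hypothesis HZ : forall (c : R) h, HH h -> HH (fun x => c * h x).
Hypothesis Hc : forall (c : R) h, HH h -> HH (fun x => h x + c).
Hypothesis xi_cos : forall h, HH h -> rI (fun x => xi x * cos (h x)) = 0.

Definition bddm (w : X -> R) := measurable_fun setT w /\ exists K : R, forall x, `|w x| <= K.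

Let iabs : Int (fun x => `|xi x|). Proof. exact: (integrable_abse ixi). Qed.

Let ibdd w : bddm w -> Int (fun x => xi x * w x).
Proof.
move=> [mw [K wK]]; apply: int_le (intZ K iabs).
  by apply: measurable_funM => //; exact: int_meas ixi.
by move=> x; rewrite normrM mulrC ler_wpM2r.
Qed.

Let bddmM w v : bddm w -> bddm v -> bddm (fun x => w x * v x).
Proof.
move=> [mw [K wK]] [mv [L vL]]; split; first exact: measurable_funM.
by exists (K * L) => x; rewrite normrM; apply: ler_pM.
Qed.

Let bddmD w v : bddm w -> bddm v -> bddm (fun x => w x + v x).
Proof.
move=> [mw [K wK]] [mv [L vL]]; split; first exact: measurable_funD.
by exists (K + L) => x; apply: le_trans (ler_normD _ _) _; apply: lerD.
Qed.

Let bddm_cst c : bddm (fun=> c). Proof. by split=> //; exists `|c|. Qed.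

Let bddm_cos h : HH h -> bddm (fun x => cos (h x)).
Proof. by move=> Hh; split; [exact/measurable_cos_comp/mH|exists 1 => x; exact: cos_max]. Qed.

Definition cos_null (w : X -> R) :=
  bddm w /\ forall h, HH h -> rI (fun x => xi x * (w x * cos (h x))) = 0.

(** Multipliers of the null weights form an algebra, closed under bounded pointwise limits and
    containing the cosines and sines of [HH]. Sign functions, then indicators, are reached inside
    it, which replaces a density theorem for trigonometric polynomials. *)
Definition cos_mult (m : X -> R) := bddm m /\ forall w, cos_null w -> cos_null (fun x => m x * w x).

Let null1 : cos_null (fun=> 1).
Proof.
split; first exact: bddm_cst.
by move=> h Hh; under eq_fun do rewrite mul1r; exact: xi_cos.
Qed.

Let nullD w v : cos_null w -> cos_null v -> cos_null (fun x => w x + v x).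
Proof.
move=> [bw hw] [bv hv]; split; first exact: bddmD.
move=> h Hh; under eq_fun do rewrite mulrDl mulrDr.
have bc := bddm_cos Hh.
by rewrite (rID (ibdd (bddmM bw bc)) (ibdd (bddmM bv bc))) hw// hv// addr0.
Qed.

Let nullZ c w : cos_null w -> cos_null (fun x => c * w x).
Proof.
move=> [bw hw]; split; first exact: bddmM (bddm_cst c) bw.
move=> h Hh; under eq_fun do rewrite -mulrA mulrCA.
by rewrite (rIZ _ (ibdd (bddmM bw (bddm_cos Hh)))) hw// mulr0.
Qed.

Let multD m v : cos_mult m -> cos_mult v -> cos_mult (fun x => m x + v x).
Proof.
move=> [bm hm] [bv hv]; split; first exact: bddmD.
by move=> w hw; under eq_fun do rewrite mulrDl; apply: nullD; [exact: hm|exact: hv].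
Qed.

Let multM m v : cos_mult m -> cos_mult v -> cos_mult (fun x => m x * v x).
Proof.
move=> [bm hm] [bv hv]; split; first exact: bddmM.
by move=> w hw; under eq_fun do rewrite -mulrA; apply: hm; exact: hv.
Qed.

Let mult_cst c : cos_mult (fun=> c).
Proof. by split; [exact: bddm_cst|move=> w; exact: nullZ]. Qed.

Let multZ c m : cos_mult m -> cos_mult (fun x => c * m x).
Proof. exact: multM (mult_cst c). Qed.

(** By [2 cos a cos b = cos (a + b) + cos (a - b)] and the linear structure of [HH]. *)
Let mult_cos g : HH g -> cos_mult (fun x => cos (g x)).
Proof.
move=> Hg; split; first exact: bddm_cos.
move=> w [bw hw]; split; first exact: bddmM (bddm_cos Hg) bw.
move=> h Hh.
have Hs := HD Hh Hg; have Ht := HD Hh (HZ (-1) Hg).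
have is1 := ibdd (bddmM bw (bddm_cos Hs)); have it1 := ibdd (bddmM bw (bddm_cos Ht)).
transitivity (rI (fun x => 2^-1 * (xi x * (w x * cos (h x + g x)) + xi x * (w x * cos (h x + -1 * g x))))).
  by congr rI; apply/funext => x; rewrite mulN1r cosB cosD; field.
by rewrite (rIZ _ (intD is1 it1)) (rID is1 it1) hw// hw// addr0 mulr0.
Qed.

Let mult_sin g : HH g -> cos_mult (fun x => sin (g x)).
Proof.
move=> Hg; have := mult_cos (Hc (- (pi / 2)) Hg).
by under eq_fun do rewrite cosBpihalf.
Qed.

Let mult_lim (m : nat -> X -> R) (l : X -> R) (K : R) : (forall n, cos_mult (m n)) ->
  (forall n x, `|m n x| <= K) -> (forall x, m ^~ x @ \oo --> l x) -> cos_mult l.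
Proof.
move=> hm mK ml.
have bl : bddm l.
  split; first by apply: (measurable_fun_cvg (fun n => (hm n).1.1)) => x _; exact: ml.
  exists K => x; have h : (fun n => `|m n x|) @ \oo --> `|l x| by apply: cvg_norm; exact: ml.
  rewrite -(cvg_lim (@Rhausdorff R) h).
  by apply: limr_le; [exact/cvgP/h|apply: nearW => n; exact: mK].
split=> // w hw; have [bw _] := hw; split; first exact: bddmM.
move=> h Hh; have bc := bddm_cos Hh.
have [mwc [L wL]] := bddmM bw bc.
apply: (@rI_dominated0 (fun n x => xi x * (m n x * w x * cos (h x))) _ (fun x => (K * L) * `|xi x|)).
- move=> n; apply: int_meas; apply: ibdd; exact: bddmM (bddmM (hm n).1 bw) bc.
- exact: intZ.
- move=> n x; rewrite normrM mulrC ler_wpM2r// -mulrA normrM.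
  by apply: ler_pM.
- move=> x; apply: cvgM; first exact: cvg_cst.
  apply: cvgM; last exact: cvg_cst.
  by apply: cvgM; [exact: ml|exact: cvg_cst].
- by move=> n; have [_] := (hm n).2 _ hw; apply.
Qed.

Let mult_sgn m : cos_mult m -> (forall x, `|m x| <= 1) -> cos_mult (fun x => Num.sg (m x)).
Proof.
move=> hm m1; apply: (@mult_lim (fun k x => iter k sign_step (m x)) _ 1).
- elim=> [|k IH] //=; rewrite /sign_step.
  have := multZ 2^-1 (multD (multZ 3 IH) (multZ (-1) (multM IH (multM IH IH)))).
  by congr cos_mult; apply/funext => x; ring.
- by move=> k x; exact: sign_iter_bound.
- by move=> x; exact: sign_iter_cvg.
Qed.

Let mult_pos m : cos_mult m -> (forall x, `|m x| <= 1) -> cos_mult (\1_[set x | 0 < m x] : X -> R).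
Proof.
move=> hm m1; have hs := mult_sgn hm m1.
have := multZ 2^-1 (multD (multM hs hs) hs); congr cos_mult; apply/funext => x.
rewrite indicE; have [h|h|h] := ltgtP (m x) 0.
- rewrite ltr0_sg// memNset/=; first by lra.
  by move=> h'; have := lt_trans h h'; rewrite ltxx.
- by rewrite gtr0_sg// mem_set//=; lra.
- by rewrite h sgr0 memNset/= ?h ?ltxx//; lra.
Qed.

Let mult_set (A : set X) := measurable A /\ cos_mult (\1_A : X -> R).

(** [sin ((h - a) / (n + 1))] has the sign of [h - a] once [n] is large, so the indicators of its
    positivity converge to that of [a < h]. *)
Let mult_half h a : HH h -> mult_set [set x | a < h x].
Proof.
move=> Hh; split.
  rewrite (_ : [set x | _] = h @^-1` `]a, +oo[%classic); first by apply: measurable_preim => //; exact: mH.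
  by apply/seteqP; split=> x /=; rewrite in_itv/= andbT.
pose g n x := n.+1%:R^-1 * (h x + - a).
have Hg n : HH (g n) by exact/HZ/Hc.
apply: (@mult_lim (fun n => \1_[set x | 0 < sin (g n x)]) _ 1).
- by move=> n; apply: mult_pos; [exact: mult_sin|move=> x; exact: sin_max].
- by move=> n x; rewrite indicE; case: (_ \in _); rewrite ?normr1 ?normr0.
move=> x; have pos (y : R) : 0 < y -> \forall n \near \oo, 0 < sin (n.+1%:R^-1 * y).
  move=> y0; have p0 : 0 < pi / y by rewrite divr_gt0// pi_gt0.
  have := near_infty_natSinv_lt (PosNum p0); apply: filterS => n /= hn.
  by apply: sin_gt0_pi; rewrite mulr_gt0//= -ltr_pdivlMr.
apply: cvg_near_cst; have [xa|xa|xa] := ltgtP (h x) a.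
- have : 0 < a - h x by lra.
  move=> /pos; apply: filterS => n hn; rewrite !indicE !memNset//=.
    by move=> h'; have := lt_trans h' xa; rewrite ltxx.
  have -> : g n x = - (n.+1%:R^-1 * (a - h x)) by rewrite /g -mulrN opprB.
  by rewrite sinN oppr_gt0 => h'; have := lt_trans h' hn; rewrite ltxx.
- have : 0 < h x - a by lra.
  by move=> /pos; apply: filterS => n hn; rewrite !indicE !mem_set.
- apply: nearW => n; rewrite !indicE !memNset//= ?xa ?ltxx// /g xa subrr mulr0 sin0 ltxx//.
Qed.

Let mult_set0 : mult_set set0.
Proof. by split=> //; have := mult_cst 0; congr cos_mult; apply/funext => x; rewrite indic0. Qed.

Let mult_setC A : mult_set A -> mult_set (~` A).
Proof.
move=> [mA hA]; split; first exact: measurableC.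
have := multD (mult_cst 1) (multZ (-1) hA); congr cos_mult; apply/funext => x.
by rewrite !indicE in_setC; case: (_ \in _) => /=; lra.
Qed.

Let mult_setU A B : mult_set A -> mult_set B -> mult_set (A `|` B).
Proof.
move=> hA hB; rewrite -[A `|` B]setCK setCU; apply: mult_setC.
have [mA cA] := mult_setC hA; have [mB cB] := mult_setC hB.
split; first exact: measurableI.
by have := multM cA cB; congr cos_mult; apply/funext => x; rewrite indicI.
Qed.

Let mult_bigU (A : nat -> set X) : (forall n, mult_set (A n)) -> mult_set (\bigcup_n A n).
Proof.
move=> hA; split; first by apply: bigcup_measurable => n _; case: (hA n).
pose B n := \big[setU/set0]_(i < n) A i.
have hB n : mult_set (B n).
  by rewrite /B; elim: n => [|n IH]; [rewrite big_ord0|rewrite big_ord_recr/=; exact: mult_setU].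
apply: (@mult_lim (fun n => \1_(B n)) _ 1).
- by move=> n; case: (hB n).
- by move=> n x; rewrite indicE; case: (_ \in _); rewrite ?normr1 ?normr0.
move=> x; apply: cvg_near_cst; have [[k _ Ak]|nA] := pselect ((\bigcup_n A n) x).
  exists k.+1 => // n /= kn; rewrite !indicE !mem_set//; first by exists k.
  by rewrite /B -bigcup_mkord; exists k.
apply: nearW => n; rewrite !indicE !memNset// /B -bigcup_mkord => -[k _ Ak].
by apply: nA; exists k.
Qed.

Let mult_preim h B : HH h -> measurable (B : set RR) -> mult_set (h @^-1` B).
Proof.
move=> Hh; suff : @measurable _ RR `<=` [set B | mult_set (h @^-1` B)] by move=> s /s.
rewrite [X in X `<=` _](_ : _ = <<s @RGenOInfty.G R >>); last exact: RGenOInfty.measurableE.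
apply: smallest_sub; last first.
  move=> _ [a ->]; rewrite /= (_ : _ @^-1` _ = [set x | a < h x]); first exact: mult_half.
  by apply/seteqP; split=> x /=; rewrite in_itv/= andbT.
split=> //=.
- by move=> A hA; rewrite setTD preimage_setC; exact: mult_setC.
- by move=> A hA; rewrite preimage_bigcup; exact: mult_bigU.
Qed.

(** The sets whose indicator is a multiplier form a sigma-algebra containing the generators, and the
    constant 1 is a null weight. *)
Lemma trig_orthogonal (GG : set (set X)) (A : set X) :
  (forall E, GG E -> exists2 h, HH h & exists2 B : set RR, measurable B & E = h @^-1` B) ->
  <<s GG >> A -> measurable A /\ rI (fun x => xi x * \1_A x) = 0.
Proof.
move=> hG hA; have [mA cA] : mult_set A.
  apply: (smallest_sub (C := sigma_algebra setT) (X := mult_set) _ _ hA).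
  - split=> //; first by move=> B hB; rewrite setTD; exact: mult_setC.
  - by move=> E /hG[h Hh [B mB ->]]; exact: mult_preim.
split=> //; have [_ /(_ _ H0)] := cA.2 _ null1.
by under eq_fun do rewrite cos0 !mulr1.
Qed.

End TrigOrthogonality.

(** * The Fock space of a Gaussian system *)

Section GaussianSystem.
Variables (R : realType) (d : measure_display) (X : measurableType d).
Variable mu : probability X R.
Local Notation rI := (rI mu).
Local Notation Int f := (mu.-integrable setT (EFin \o f)).
Local Notation ip := (@l2ip R d X mu).
Local Notation C := R[i].
Local Notation RE := (realify (L2C mu)).
Let H := @l2_hilbert R d X mu.

Lemma exp_lip (u v : R) : 0 <= u -> 0 <= v -> `|expR (- u) - expR (- v)| <= `|u - v|.
Proof.
wlog uv : u v / u <= v.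
  move=> h u0 v0; have [/h->//|/ltW/h] := leP u v.
  by move=> /(_ v0 u0); rewrite distrC (distrC v).
move=> u0 v0; rewrite ger0_norm ?subr_ge0 ?ler_expR ?lerN2// ler0_norm ?subr_le0// opprB.
have e1 : expR (- u) <= 1 by rewrite -expR0 ler_expR oppr_le0.
have e2 : expR (- v) = expR (- u) * expR (u - v) by rewrite -expRD; congr expR; ring.
have e3 := expR_ge1Dx (u - v); have e4 := expR_ge0 (- u).
rewrite e2 -[X in X - _]mulr1 -mulrBr; apply: le_trans (_ : 1 * (1 - expR (u - v)) <= _); last by lra.
by rewrite ler_wpM2r// subr_ge0 -expR0 ler_expR subr_le0.
Qed.

Definition rc (g : X -> R) : X -> C := fun x => (g x)%:C.

Lemma rc_l2 g : sq_int mu g -> l2fun mu (rc g).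
Proof. by move=> hg; split=> //; exact: sq_int_cst. Qed.

(** The set where [Q] exceeds its mean is invariant, hence null or of full measure; in the second
    case [Q] minus its mean is nonnegative with integral 0. *)
Lemma ergodic_le T (Q : X -> R) : is_aut mu T -> simple_spectrum mu T -> Int Q ->
  ae_prop mu (fun x => Q (T.1 x) = Q x) -> ae_prop mu (fun x => Q x <= rI Q).
Proof.
move=> hT hs iQ invQ; have mQ := int_meas iQ; pose A := [set x | rI Q < Q x].
have mA : measurable A.
  rewrite (_ : A = Q @^-1` `]rI Q, +oo[%classic); first exact: measurable_preim.
  by apply/seteqP; split=> x; rewrite /A/= in_itv/= andbT.
have invA : ae_prop mu (fun s => A (T.1 s) <-> A s) by apply: ae_imp invQ => x; rewrite /A/= => ->.
have [A0|A1] := simple_spectrum_ergodic hT hs mA invA.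
  exists A; split=> //; split; last by move=> x /negP; rewrite -leNgt.
  by rewrite -[LHS]fineK ?fin_num_measure// A0.
have Ac : ae_prop mu A.
  exists (~` A); split; first exact: measurableC.
  split; last by move=> x; rewrite /setC/= => /contrapT.
  by rewrite probability_setC// -[mu A]fineK ?fin_num_measure// A1 subee.
have iD := intB iQ (int_cst mu (rI Q)).
have iN := integrable_abse iD.
have z : rI (fun x => `|Q x - rI Q|) = 0.
  have aeN : ae_prop mu (fun x => Q x - rI Q = `|Q x - rI Q|).
    by apply: ae_imp Ac => x h; rewrite ger0_norm// subr_ge0 ltW.
  have [_ <-] := int_ae (int_meas iN) aeN iD.
  by rewrite (rIB iQ (int_cst _ _)) rI_cst subrr.
have z2 : ae_prop mu (fun x => Q x - rI Q = 0).
  have mD := int_meas iD.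
  have e2 : (\int[mu]_x `|(Q x - rI Q)%:E| = 0)%E by rewrite -(rIE iN) z.
  have mD' : measurable_fun setT (EFin \o (fun x => Q x - rI Q)) by exact/measurable_EFinP.
  have [+ _] := ae_eq_integral_abs mu measurableT mD'.
  move=> /(_ e2)[N [mN N0 hN]]; apply: lib_ae; exists N; split=> // x /= nf.
  by apply: hN => /= /(_ I)[]; exact: nf.
by apply: ae_imp z2 => x /eqP; rewrite subr_eq0 => /eqP ->.
Qed.

Variables (T : @aut d X) (f : X -> R).
Hypotheses (hT : is_aut mu T) (mf : measurable_fun setT f).
Hypothesis gauss : forall (N : nat) (a : nat -> R),
  gaussian_rv mu (fun x => \sum_(0 <= k < (2 * N).+1) a k * f (zpow T (k%:Z - N%:Z) x)).

Definition rsum (s : seq (R * int)) x := \sum_(p <- s) p.1 * f (zpow T p.2 x).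
Definition rscale (c : R) (s : seq (R * int)) := [seq (c * p.1, p.2) | p <- s].
Definition csum s x := rsum s x - rI (rsum s).

Let rsum_meas s : measurable_fun setT (rsum s).
Proof.
apply: measurable_sum => p; apply: measurable_funM => //.
by apply: measurableT_comp mf _; case: (mpreserving_zpow p.2 hT).
Qed.

Let rsum_gauss s : gaussian_rv mu (rsum s).
Proof.
have [N [c h]] := sum_int_window s; have := gauss N c; congr gaussian_rv.
by apply/funext => x; apply/esym; exact: (h R^o (fun k => f (zpow T k x))).
Qed.

Let chr s := gaussian_rv_char (rsum_meas s) (rsum_gauss s).

Let rsum2 s : sq_int mu (rsum s). Proof. by have [] := chr s. Qed.
Let csum2 s : sq_int mu (csum s). Proof. exact: sq_intB (rsum2 s) (sq_int_cst _ _). Qed.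
Let csum_meas s : measurable_fun setT (csum s). Proof. by case: (csum2 s). Qed.

Let rsum_lin c s t x : rsum (rscale c s ++ t) x = c * rsum s x + rsum t x.
Proof.
by rewrite /rsum big_cat big_map/= mulr_sumr; congr (_ + _); apply: eq_bigr => p _; rewrite mulrA.
Qed.

Let csum_lin c s t x : csum (rscale c s ++ t) x = c * csum s x + csum t x.
Proof.
rewrite /csum rsum_lin (_ : rI (rsum (rscale c s ++ t)) = c * rI (rsum s) + rI (rsum t)); first by ring.
rewrite -(rIZ _ (sq_int_int (rsum2 s))) -(rID (intZ _ (sq_int_int (rsum2 s))) (sq_int_int (rsum2 t))).
by congr rI; apply/funext => y; rewrite rsum_lin.
Qed.

Let csum_nil x : csum [::] x = 0.
Proof.
have e : rsum [::] = fun=> 0 by apply/funext => y; rewrite /rsum big_nil.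
by rewrite /csum e rI_cst subrr.
Qed.

Let cc s : L2C mu := cls mu (rc (csum s)).

Definition gauss0 : set RE := [set h | exists s, h = cc s].
(** A real subspace: its elements are real almost everywhere and are limits of centred Gaussian
    variables, as the exponentials of [i h] require. *)
Definition gaussF : set (L2C mu) := @hclosure R RE ip gauss0.

Let cc_lin (c : R) s t : c%:C *: cc s + cc t = cc (rscale c s ++ t).
Proof.
rewrite /cc (clsZ _ (rc_l2 (csum2 s))) (clsD (l2funZ _ (rc_l2 (csum2 s))) (rc_l2 (csum2 t))).
congr cls; apply/funext => x; rewrite /rc csum_lin; apply/eqP; rewrite eq_complex/=.
by apply/andP; split; apply/eqP; ring.
Qed.

Let sF0 : subspace gauss0.
Proof.
split; last by move=> a _ _ [s ->] [t ->]; exists (rscale a s ++ t); exact: cc_lin.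
exists [::]; apply: l2_eq; apply: aeq_trans (@l20 _ _ _ mu) _; apply: aeq_sym.
by apply: aeq_trans (clsE (rc_l2 (csum2 _))) _; apply: aeT => x; rewrite /rc csum_nil.
Qed.

Let sF : @subspace R RE gaussF. Proof. exact: (hclosure_subspace (realify_hilbert H) sF0). Qed.

Let cF : @hclosure R RE ip gaussF `<=` gaussF.
Proof.
move=> x cx e e0; have e2 : 0 < e / 2 by lra.
have [y cy xy] := cx _ e2; have [m Mm ym] := cy _ e2; exists m => //.
have := ltrD xy ym; rewrite -splitr; apply: le_lt_trans.
exact: (nrm_tri (realify_hilbert H) y).
Qed.

Let F_cc s : gaussF (cc s). Proof. by apply: (sub_hclosure (realify_hilbert H)); exists s. Qed.

Let approx (h : L2C mu) e : gaussF h -> 0 < e -> exists s,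
  [/\ rI (fun x => (Re (h x) - csum s x) ^+ 2) <= e ^+ 2, rI (fun x => Im (h x) ^+ 2) <= e ^+ 2 &
      cnrm ip (h - cc s) < e].
Proof.
move=> Fh e0; have [_ [s ->] hs] := Fh _ e0; have hh := l2_l2fun h.
have hc := rc_l2 (csum2 s).
have le : rI (fun x => (Re (h x) - csum s x) ^+ 2) + rI (fun x => Im (h x) ^+ 2) <= e ^+ 2.
  apply: le_trans (_ : cnrm ip (h - cc s) ^+ 2 <= _).
    rewrite -[h in cnrm _ (h - _)]cls_val (clsB hh hc) (cnrm_cls (l2funB hh hc)) (rdot_sqr (l2funB hh hc)).
    rewrite le_eqVlt; apply/orP; left; apply/eqP; congr (_ + _); congr rI; apply/funext => x; rewrite /rc; case: (h x) => a b /=; ring.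
  by rewrite ler_pXn2r ?nnegrE ?(cnrm_ge0 ip) ?ltW.
have p1 : 0 <= rI (fun x => (Re (h x) - csum s x) ^+ 2) by apply: rI_ge0 => x; exact: sqr_ge0.
have p2 : 0 <= rI (fun x => Im (h x) ^+ 2) by apply: rI_ge0 => x; exact: sqr_ge0.
by exists s; split=> //; lra.
Qed.

Let F_im (h : L2C mu) : gaussF h -> ae_prop mu (fun x => Im (h x) = 0).
Proof.
move=> Fh; have [_ hi] := l2_l2fun h; apply: rI_sqr_eq0 => //.
have p : 0 <= rI (fun x => Im (h x) ^+ 2) by apply: rI_ge0 => x; exact: sqr_ge0.
apply: (@small_linear _ _ 1) => e /andP[e0 e1]; have [s [_ + _]] := approx Fh e0.
move: (rI _) p => q p qe; rewrite normrM gtr0_norm// ger0_norm// mul1r.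
by rewrite -[leRHS]mul1r; apply: ler_pM => //; exact: ltW.
Qed.

Let F_ip (h : L2C mu) : gaussF h -> ip h h = rI (fun x => Re (h x) ^+ 2).
Proof.
move=> Fh; have hh := l2_l2fun h; rewrite -{1 2}[h]cls_val (l2ip_cls hh hh) (rdot_sqr hh).
have mi : measurable_fun setT (fun x => Im (h x) ^+ 2) by apply: measurable_funX; case: hh => _ [].
have ae0 : ae_prop mu (fun x => 0 = Im (h x) ^+ 2) by apply: ae_imp (F_im Fh) => x ->; rewrite expr0n.
by have [_] := int_ae mi ae0 (int_cst _ _); rewrite rI_cst => <-; rewrite addr0.
Qed.

Let trig_close (G : R -> R) (h : L2C mu) s e : (forall u v, `|G u - G v| <= `|u - v|) ->
  (forall u, `|G u| <= 1) -> (forall g : X -> R, measurable_fun setT g -> measurable_fun setT (fun x => G (g x))) ->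
  0 < e -> rI (fun x => (Re (h x) - csum s x) ^+ 2) <= e ^+ 2 ->
  `|rI (fun x => G (Re (h x))) - rI (fun x => G (csum s x))| <= e.
Proof.
move=> lG bG mG e0 he; have [hr _] := l2_l2fun h; have [mr _] := hr.
have i1 : Int (fun x => G (Re (h x))) by apply: (@int_bdd _ _ _ mu _ 1) => //; exact: mG.
have i2 : Int (fun x => G (csum s x)) by apply: (@int_bdd _ _ _ mu _ 1) => //; exact: mG.
have i3 := sq_int_sqr (sq_intB hr (csum2 s)).
have i4 := intD (int_cst mu (e / 2)) (intZ (2 * e)^-1 i3).
rewrite -(rIB i1 i2); apply: le_trans (rI_norm_le (intB i1 i2) i4 _) _.
  move=> x; apply: le_trans (lG _ _) _; move: (_ - _) => D.
  rewrite -(real_normK (num_real D)); move: `|D| => D'.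
  have -> : e / 2 + (2 * e)^-1 * D' ^+ 2 = D' + (e - D') ^+ 2 / (2 * e) by field; rewrite gt_eqF.
  by rewrite lerDl divr_ge0 ?sqr_ge0// mulr_ge0// ltW.
rewrite (rID (int_cst _ _) (intZ _ i3)) rI_cst (rIZ _ i3).
have : (2 * e)^-1 * rI (fun x => (Re (h x) - csum s x) ^+ 2) <= (2 * e)^-1 * e ^+ 2.
  by rewrite ler_wpM2l// invr_ge0 mulr_ge0// ltW.
have -> : (2 * e)^-1 * e ^+ 2 = e / 2 by field; rewrite gt_eqF.
lra.
Qed.

Let F_sin (h : L2C mu) : gaussF h -> rI (fun x => sin (Re (h x))) = 0.
Proof.
move=> Fh; apply: (@small_linear _ _ 1) => e /andP[e0 e1]; have [s [he _ _]] := approx Fh e0.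
have := trig_close (@sin_lip R) (@sin_max R) (@measurable_sin_comp R d X) e0 he.
have [_ -> _] := chr s; rewrite subr0 => hq.
by rewrite normrM gtr0_norm// mul1r expr2 ler_pM2l.
Qed.

(** The characteristic function of the approximating sums passes to the limit: the mean cosines
    differ by at most [e], and so do the norms. *)
Let F_cos (h : L2C mu) : gaussF h -> rI (fun x => cos (Re (h x))) = expR (- (ip h h / 2)).
Proof.
move=> Fh; apply/eqP; rewrite -subr_eq0; apply/eqP.
have a0 := cnrm_ge0 ip h; rewrite -(sqr_cnrm H h).
have [a aE] : exists a, a = cnrm ip h by exists (cnrm ip h).
rewrite -aE in a0 *.
apply: (@small_linear _ _ (a + 2)) => e /andP[e0 e1]; have [s [he _ hn]] := approx Fh e0.
have := trig_close (@cos_lip R) (@cos_max R) (@measurable_cos_comp R d X) e0 he.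
have b0 := cnrm_ge0 ip (cc s); have [_ _ ->] := chr s.
have -> : rI (fun x => (rsum s x - rI (rsum s)) ^+ 2) = cnrm ip (cc s) ^+ 2.
  rewrite (sqr_cnrm H) (F_ip (F_cc s)); have hc := rc_l2 (csum2 s).
  have [|||_ <-//] := @int_ae _ _ _ mu (fun x => csum s x ^+ 2) (fun x => Re (cc s x) ^+ 2).
  - by apply: measurable_funX; have [[]] := l2_l2fun (cc s).
  - by apply: ae_imp (clsE hc) => x; rewrite -/(cc s) => ->.
  - exact: sq_int_sqr (csum2 s).
have t1 : cnrm ip (cc s) <= a + e.
  have := cnrmD H (cc s - h) h; rewrite subrK (cnrmBC H) -aE => le1.
  by apply: le_trans le1 _; rewrite addrC lerD2l ltW.
have t2 : a <= cnrm ip (cc s) + e.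
  have := cnrmD H (h - cc s) (cc s); rewrite subrK -aE; move: hn.
  by move: (cnrm ip (h - cc s)) (cnrm ip (cc s)) => p q pe apq; apply: le_trans apq _; rewrite addrC lerD2l ltW.
move: (cnrm ip (cc s)) b0 t1 t2 => b b0 t1 t2 h1.
have h2 : `|expR (- (b ^+ 2 / 2)) - expR (- (a ^+ 2 / 2))| <= (a + 1) * e.
  apply: le_trans (exp_lip _ _) _; rewrite ?divr_ge0 ?sqr_ge0//.
  rewrite -mulrBl subr_sqr normrM normrM [`|2^-1|]gtr0_norm ?invr_gt0// (@ger0_norm _ (b + a)) ?addr_ge0//.
  have : `|b - a| <= e by rewrite ler_norml; apply/andP; split; lra.
  have := normr_ge0 (b - a); move: `|b - a| => D D0 De.
  have : D * (b + a) <= e * (2 * a + 1) by apply: ler_pM => //; [exact: addr_ge0|lra].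
  nra.
rewrite normrM gtr0_norm// expr2 mulrA [X in _ <= X]mulrC ler_pM2l//.
apply: le_trans (ler_distD (expR (- (b ^+ 2 / 2))) _ _) _; lra.
Qed.

Let zpow_sum k s : ae_prop mu (fun x => rsum s (zpow T k x) = rsum [seq (p.1, k + p.2) | p <- s] x).
Proof.
elim: s => [|p s IH]; first by apply: aeT => x; rewrite /rsum !big_nil.
apply: ae_imp (ae_and IH (zpow_add k p.2 hT)) => x [h1 h2].
by rewrite /rsum/= !big_cons/= h2; congr (_ + _).
Qed.

Let koop_cc k s : koop T k (cc s) = cc [seq (p.1, k + p.2) | p <- s].
Proof.
have hc := rc_l2 (csum2 s); have tk := transports_zpow k hT.
rewrite /koop /cc (comp_op_cls tk hc); apply: cls_eq; [exact: l2fun_comp tk hc|exact: rc_l2|].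
have [i1 e1] := transports_int tk (sq_int_int (rsum2 s)).
have [_ e2] := int_ae (rsum_meas _) (zpow_sum k s) i1.
by apply: ae_imp (zpow_sum k s) => x hx; rewrite /rc /csum hx -e2 e1.
Qed.

Let HU := koop_rep hT.

Let F_koop k h : gaussF h -> gaussF (koop T k h).
Proof.
move=> Fh e e0; have [_ [s ->] hs] := Fh _ e0; exists (koop T k (cc s)).
  by rewrite koop_cc; eexists.
have h2 : cnrm ip (koop T k h - koop T k (cc s)) < e.
  by rewrite -(clinB _ _ (ur_lin HU k)) (cnrm_U HU); exact: hs.
exact: h2.
Qed.

Let trigc (g : X -> R) : X -> C := fun x => cos (g x) +i* sin (g x).

Let trigc_l2 g : measurable_fun setT g -> l2fun mu (trigc g).
Proof.
move=> mg; split; apply: (@sq_int_bdd _ _ _ mu _ 1).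
- exact: measurable_cos_comp.
- by move=> x; exact: cos_max.
- exact: measurable_sin_comp.
- by move=> x; exact: sin_max.
Qed.

Definition coherent (h : L2C mu) : L2C mu :=
  cls mu (fun x => (expR (ip h h / 2))%:C * trigc (fun x => Re (h x)) x).

Let mre (h : L2C mu) : measurable_fun setT (fun x => Re (h x)).
Proof. by have [[]] := l2_l2fun h. Qed.

Let coh_l2 (h : L2C mu) : l2fun mu (fun x => (expR (ip h h / 2))%:C * trigc (fun x => Re (h x)) x).
Proof. exact: l2funZ (trigc_l2 (mre h)). Qed.

(** [h - g] belongs to the same subspace, so its mean cosine is [exp (- |h - g|^2 / 2)] and its mean
    sine is 0; the normalising factors leave [exp <h, g>]. *)
Let eE h g : gaussF h -> gaussF g -> cip ip (coherent h) (coherent g) = (expR (ip h g))%:C.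
Proof.
move=> Fh Fg; have Fk : gaussF (h - g) := subspaceB sF Fh Fg.
have kE : ae_prop mu (fun x => Re ((h - g) x) = Re (h x) - Re (g x)).
  by apply: ae_imp (l2B h g) => x ->; case: (h x) (g x) => [a b] [a' b'].
rewrite (cip_cls (coh_l2 h) (coh_l2 g)).
set A := expR (ip h h / 2); set B := expR (ip g g / 2).
have mD : measurable_fun setT (fun x => Re (h x) - Re (g x)) by exact: measurable_funB.
have aux (G : R -> R) : (forall u, `|G u| <= 1) ->
    (forall g : X -> R, measurable_fun setT g -> measurable_fun setT (fun x => G (g x))) ->
    rI (fun x => A * B * G (Re (h x) - Re (g x))) = A * B * rI (fun x => G (Re ((h - g) x))).
  move=> bG mG; have i1 : Int (fun x => G (Re ((h - g) x))).
    by apply: (@int_bdd _ _ _ mu _ 1) => //; exact/mG/mre.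
  have [i2 ->] := int_ae (mG _ mD) (ae_imp (fun x e => congr1 G e) kE) i1.
  by rewrite rIZ.
rewrite [X in X +i* _](_ : _ = expR (ip h g)); last first.
  transitivity (rI (fun x => A * B * cos (Re (h x) - Re (g x)))).
    by congr rI; apply/funext => x; rewrite cosB /trigc/=; ring.
  rewrite (aux cos) ?F_cos//; [|exact: cos_max|exact: measurable_cos_comp].
  rewrite -!expRD; congr expR; rewrite -(sqr_cnrm H (h - g)) (cnrm_sqrB H) !(sqr_cnrm H) Re_cip.
  by field.
congr (_ +i* _); transitivity (rI (fun x => A * B * sin (Re (h x) - Re (g x)))).
  by congr rI; apply/funext => x; rewrite sinB /trigc/=; ring.
by rewrite (aux sin) ?F_sin ?mulr0//; [exact: sin_max|exact: measurable_sin_comp].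
Qed.

Let koop_ip k h : ip (koop T k h) (koop T k h) = ip h h.
Proof. by rewrite -!Re_cip (ur_ip HU). Qed.

Let eU h : koop T 1 (coherent h) = coherent (koop T 1 h).
Proof.
have tk := transports_zpow 1 hT.
rewrite /coherent {1}/koop (comp_op_cls tk (coh_l2 h)).
apply: cls_eq; [exact: l2fun_comp tk (coh_l2 h)|exact: coh_l2|].
rewrite koop_ip; apply: ae_imp (comp_op_ae h tk) => x hx.
by rewrite /trigc /koop hx.
Qed.

Hypothesis gen : forall A : set X, measurable A -> exists A' : set X,
  <<s [set E | exists (n : int) (B : set R), measurable B /\
                 E = (fun x => f (zpow T n x)) @^-1` B] >> A' /\ mu (symdiff A A') = 0%E.

(** Testing against the exponentials of [h] and of [- h] separates the real and imaginary parts of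
    [x] as well as cosine from sine; [trig_orthogonal] then makes [x] orthogonal to all sets
    generated by the process, which are all measurable sets up to null sets. *)
Let te : total ip (fun i : {h | gaussF h} => coherent (sval i)).
Proof.
apply: (total_orth H) => x hx; have hx2 := l2_l2fun x; have [hr hi] := hx2.
have it (G : R -> R) (g : X -> R) s : sq_int mu g -> (forall u, `|G u| <= 1) ->
    measurable_fun setT (fun y => G (csum s y)) -> Int (fun y => g y * G (csum s y)).
  by move=> hg bG mG; apply: sq_intM hg _; exact: (@sq_int_bdd _ _ _ mu _ 1).
have ic g s : sq_int mu g -> Int (fun y => g y * cos (csum s y)).
  by move=> hg; apply: it => //; [exact: cos_max|exact: measurable_cos_comp].
have is_ g s : sq_int mu g -> Int (fun y => g y * sin (csum s y)).
  by move=> hg; apply: it => //; [exact: sin_max|exact: measurable_sin_comp].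
pose r y := Re (x y); pose i y := Im (x y).
have k s : rI (fun y => r y * cos (csum s y)) + rI (fun y => i y * sin (csum s y)) = 0 /\
    rI (fun y => i y * cos (csum s y)) - rI (fun y => r y * sin (csum s y)) = 0.
  have := hx (exist _ (cc s) (F_cc s)); rewrite /= -[x]cls_val.
  have hc := rc_l2 (csum2 s).
  have -> : coherent (cc s) = cls mu (fun y => (expR (ip (cc s) (cc s) / 2))%:C * trigc (csum s) y).
    apply: cls_eq; [exact: coh_l2|exact: l2funZ (trigc_l2 (csum_meas s))|].
    by apply: ae_imp (clsE hc) => y e; rewrite /trigc /cc e.
  set A := expR _; have A0 : A != 0 by rewrite gt_eqF// expR_gt0.
  rewrite (cip_cls hx2 (l2funZ _ (trigc_l2 (csum_meas s)))) => -[e1 e2]; split.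
    rewrite -(rID (ic _ _ hr) (is_ _ _ hi)); apply: (mulfI A0); rewrite mulr0 -e1.
    rewrite -(rIZ _ (intD (ic _ s hr) (is_ _ s hi))); congr rI; apply/funext => y.
    by rewrite /trigc /r /i; case: (x y) => a b /=; ring.
  rewrite -(rIB (ic _ _ hi) (is_ _ _ hr)); apply: (mulfI A0); rewrite mulr0 -e2.
  rewrite -(rIZ _ (intB (ic _ s hi) (is_ _ s hr))); congr rI; apply/funext => y.
  by rewrite /trigc /r /i; case: (x y) => a b /=; ring.
have k4 s : [/\ rI (fun y => r y * cos (csum s y)) = 0, rI (fun y => r y * sin (csum s y)) = 0,
    rI (fun y => i y * cos (csum s y)) = 0 & rI (fun y => i y * sin (csum s y)) = 0].
  have cN y : csum (rscale (-1) s ++ [::]) y = - csum s y by rewrite csum_lin csum_nil addr0 mulN1r.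
  have [e1 e2] := k s; have := k (rscale (-1) s ++ [::]).
  under [X in rI X + _]eq_fun do rewrite cN cosN.
  under [X in _ + rI X]eq_fun do rewrite cN sinN mulrN -mulN1r.
  under [X in rI X - _]eq_fun do rewrite cN cosN.
  under [X in _ - rI X]eq_fun do rewrite cN sinN mulrN -mulN1r.
  rewrite (rIZ _ (is_ _ _ hr)) (rIZ _ (is_ _ _ hi)) => -[e3 e4].
  by split; lra.
pose HH : set (X -> R) := [set h | exists s (c : R), h = fun y => rsum s y + c].
have key (xi : X -> R) : sq_int mu xi -> (forall s, rI (fun y => xi y * cos (csum s y)) = 0) ->
    (forall s, rI (fun y => xi y * sin (csum s y)) = 0) ->
    forall A, measurable A -> rI (fun y => xi y * \1_A y) = 0.
  move=> hxi c0 s0 A mA; have [A' [gA' AA']] := gen mA; have mxi := hxi.1.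
  have [||||||| mA' z] := @trig_orthogonal R d X mu xi HH (sq_int_int hxi) _ _ _ _ _ _ _ A' _ gA'.
  - by move=> _ [s [c ->]]; exact: measurable_funD.
  - by exists [::], 0; apply/funext => y; rewrite /rsum big_nil addr0.
  - move=> _ _ [s [c ->]] [t [c' ->]]; exists (rscale 1 s ++ t), (c + c').
    by apply/funext => y; rewrite rsum_lin; ring.
  - move=> a _ [s [c ->]]; exists (rscale a s ++ [::]), (a * c); apply/funext => y.
    by rewrite rsum_lin /(rsum [::]) big_nil; ring.
  - by move=> a _ [s [c ->]]; exists s, (c + a); apply/funext => y; rewrite addrA.
  - move=> _ [s [c ->]]; pose c' := rI (rsum s) + c.
    transitivity (rI (fun y => cos c' * (xi y * cos (csum s y)) - sin c' * (xi y * sin (csum s y)))).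
      congr rI; apply/funext => y; rewrite (_ : rsum s y + c = csum s y + c') ?cosD; first by ring.
      by rewrite /csum /c'; ring.
    rewrite (rIB (intZ _ (ic _ _ hxi)) (intZ _ (is_ _ _ hxi))) (rIZ _ (ic _ _ hxi)) (rIZ _ (is_ _ _ hxi)).
    by rewrite c0 s0 !mulr0 subrr.
  - move=> E [n [B [mB ->]]]; exists (fun y => rsum [:: (1, n)] y + 0); first by exists [:: (1, n)], 0.
    by exists B => //; apply/seteqP; split=> y; rewrite /preimage/= /rsum big_seq1 mul1r addr0.
  rewrite -z; have iA (D : set X) : measurable D -> Int (fun y => xi y * \1_D y).
    move=> mD; apply: sq_intM hxi _; apply: (@sq_int_bdd _ _ _ mu _ 1); first exact: measurable_indic.
    by move=> y; rewrite indicE; case: (_ \in _); rewrite ?normr1 ?normr0.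
  have [|_ ->//] := int_ae (f := fun y => xi y * \1_A y) (int_meas (iA _ mA')) _ (iA _ mA).
  exists (symdiff A A'); split; first by apply: measurableU; exact: measurableD.
  split=> // y ny; rewrite !indicE; congr (_ * _%:R); congr nat_of_bool.
  apply/idP/idP => /set_mem h; apply/mem_set; apply: contrapT => h'; apply: ny; by [left|right].
apply: indic_orth => A mA; rewrite -[x]cls_val (cip_ind hx2 mA).
have kr := key r hr (fun s => let: And4 e _ _ _ := k4 s in e) (fun s => let: And4 _ e _ _ := k4 s in e) A mA.
have ki := key i hi (fun s => let: And4 _ _ e _ := k4 s in e) (fun s => let: And4 _ _ _ e := k4 s in e) A mA.
by rewrite -[X in X +i* _]/(rI (fun y => r y * \1_A y)) kr -[X in _ +i* X]/(rI (fun y => i y * \1_A y)) ki.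
Qed.

Hypothesis hs : simple_spectrum mu T.

(** [7 / 12] is the value at [y = 1] of the chord [1 - 5 y / 12] used in [not_bounded]; [(7 / 8)^4]
    exceeds it by a narrow margin. *)
Let exp_half_bound : 7 / 12 < expR (- (1 / 2)) :> R.
Proof.
have e : expR (- (1 / 2)) = expR (- (1 / 8)) ^+ 4 :> R by rewrite -expRM_natl; congr expR; field.
have h : 7 / 8 <= expR (- (1 / 8)) :> R by have := @expR_ge1Dx R (- (1 / 8)); lra.
rewrite e; apply: lt_le_trans (_ : (7 / 8) ^+ 4 <= _).
  by rewrite (_ : (7 / 8) ^+ 4 = 7 / 8 * (7 / 8) * (7 / 8) * (7 / 8)); [lra|ring].
by apply: lerXn2r => //; rewrite nnegrE ?expR_ge0//; lra.
Qed.

(** By convexity [1 - y / 2 + y^2 / 24 <= 1 - 5 y / 12] for [0 <= y <= 2]. If [h^2 <= 2], this with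
    [y = h^2] bounds the mean of [cos h] by [7 / 12], below its true value [exp (- 1 / 2)]. *)
Let not_bounded (h : L2C mu) : gaussF h -> ip h h = 1 -> ~ ae_prop mu (fun x => Re (h x) ^+ 2 <= 2).
Proof.
move=> Fh h1 hb; have [hr _] := l2_l2fun h; have i2 := sq_int_sqr hr.
have e2 : rI (fun x => Re (h x) ^+ 2) = 1 by rewrite -(F_ip Fh).
have ic : Int (fun x => cos (Re (h x))).
  by apply: (@int_bdd _ _ _ mu _ 1); [exact: measurable_cos_comp (mre h)|move=> x; exact: cos_max].
(* Truncation turns the bound that holds almost everywhere into a pointwise one. *)
pose m x := Num.min (Re (h x) ^+ 2) 2.
have mm : measurable_fun setT m.
  by apply: measurable_minr => //; apply: measurable_funX; exact: mre.
have m0 x : 0 <= m x <= 2 by rewrite /m le_min sqr_ge0/= ge_min lexx orbT ler0n.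
have ae_m : ae_prop mu (fun x => Re (h x) ^+ 2 = m x) by apply: ae_imp hb => x; rewrite /m => /min_idPl ->.
have [im em] := int_ae mm ae_m i2.
have hF := F_cos Fh; rewrite h1 in hF.
pose b x := 1 + (- (5 / 12)) * m x.
have mb : measurable_fun setT b by apply: measurable_funD => //; exact: measurable_funM.
have ib : Int b := intD (int_cst mu 1) (intZ _ im).
pose c x := Num.min (cos (Re (h x))) (b x).
suff : rI (fun x => cos (Re (h x))) <= 7 / 12 by rewrite hF; have := exp_half_bound; lra.
apply: le_trans (_ : rI b <= _); last first.
  by rewrite (rID (int_cst _ _) (intZ _ im)) rI_cst (rIZ _ im) -em e2; lra.
have mc : measurable_fun setT c.
  by apply: measurable_minr => //; exact: measurable_cos_comp (mre h).
suff aec : ae_prop mu (fun x => cos (Re (h x)) = c x).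
  have [icc ->] := int_ae mc aec ic.
  by apply: rI_le => // x; rewrite /c ge_min lexx orbT.
apply: ae_imp ae_m => x e; rewrite /c; apply/esym/min_idPl; apply: le_trans (cos_le_quart _) _.
rewrite (_ : Re (h x) ^+ 4 = m x * m x); last by rewrite -e; ring.
by rewrite e /b; have := m0 x; move: (m x) => y /andP[y0 y2]; nra.
Qed.

(** With [a = h] and [b = h o T^-1], the recurrence [h o T + b = t a] preserves
    [Q = a^2 - t a b + b^2], which has mean [2 - t^2 / 2]; by ergodicity [Q] is at most its mean.
    For [t^2 < 4], completing the square bounds [a^2] by 2. For [t^2 = 4] it gives [b = t a / 2], so
    [a^2] is invariant and bounded by 1. Both contradict [not_bounded]. *)
Let noeig1 (t : R) h : gaussF h -> ip h h = 1 -> koop T 1 h + koop T (-1) h <> t%:C *: h.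
Proof.
move=> Fh h1 heq; apply: (not_bounded Fh h1).
pose a x := Re (h x); pose b x := Re (koop T (-1) h x); pose c x := Re (koop T 1 h x).
have [ha _] := l2_l2fun h; have [hb _] := l2_l2fun (koop T (-1) h); have [hc _] := l2_l2fun (koop T 1 h).
have a1 : rI (fun x => a x ^+ 2) = 1 by rewrite -(F_ip Fh).
have b1 : rI (fun x => b x ^+ 2) = 1 by rewrite -(F_ip (F_koop (-1) Fh)) koop_ip.
have rel : ae_prop mu (fun x => c x + b x = t * a x).
  apply: ae_imp (ae_and3 (l2D (koop T 1 h) (koop T (-1) h)) (l2Z t%:C h) (aeT mu (fun x : X => I))) => x [].
  rewrite heq /a /b /c => -> e _; have := congr1 (@Re R) e; rewrite ReM/= mul0r subr0 => <-.
  by case: (koop T 1 h x) (koop T (-1) h x) => [? ?] [? ?].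
have pT : mpreserving mu T.1 := hT.1.
have cT : ae_prop mu (fun x => c x = a (T.1 x)).
  by apply: ae_imp (comp_op_ae h (transports_zpow 1 hT)) => x e; rewrite /c /koop e.
have bT : ae_prop mu (fun x => b (T.1 x) = a x).
  have e1 := mpreserving_ae pT (comp_op_ae h (transports_zpow (-1) hT)).
  have [_ [_ [inv _]]] := hT.
  by apply: ae_imp (ae_and e1 inv) => x [e i]; rewrite /b /koop e /zpow/= i.
have iab := sq_intM ha hb; have ia := sq_int_sqr ha; have ib := sq_int_sqr hb; have ica := sq_intM hc ha.
have ab : rI (fun x => a x * b x) = t / 2.
  have [i1 e1] := rI_mpreserving pT iab.
  have e2 : rI (fun x => c x * a x) = rI (fun x => a x * b x).
    rewrite -e1; have [|_ ->//] := int_ae (f := fun x => c x * a x) (int_meas i1) _ ica.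
    by apply: ae_imp (ae_and cT bT) => x [-> e]; rewrite -/(b _) e.
  have : rI (fun x => c x * a x + a x * b x) = t * rI (fun x => a x ^+ 2).
    rewrite -(rIZ _ ia); have [|_ ->//] := int_ae (int_meas (intZ t ia)) _ (intD ica iab).
    by apply: ae_imp rel => x e; rewrite [a x * b x]mulrC -mulrDl e expr2 mulrA.
  by rewrite (rID ica iab) e2 a1; lra.
pose Q x := a x ^+ 2 - t * (a x * b x) + b x ^+ 2.
have iQ : Int Q by exact: intD (intB ia (intZ _ iab)) ib.
have rQ : rI Q = 2 - t ^+ 2 / 2.
  by rewrite (rID (intB ia (intZ _ iab)) ib) (rIB ia (intZ _ iab)) (rIZ _ iab) a1 b1 ab; field.
have invQ : ae_prop mu (fun x => Q (T.1 x) = Q x).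
  apply: ae_imp (ae_and3 rel cT bT) => x [e1 e2 e3]; rewrite /Q e3 -e2.
  by rewrite (_ : c x = t * a x - b x); [ring|lra].
have leQ := ergodic_le hT hs iQ invQ; rewrite rQ in leQ.
(* The mean of [(b - t a / 2)^2] is [1 - t^2 / 4]. *)
have t2 : t ^+ 2 <= 4.
  have p1 : 0 <= rI (fun x => (b x - t / 2 * a x) ^+ 2) by apply: rI_ge0 => x; exact: sqr_ge0.
  have e : rI (fun x => (b x - t / 2 * a x) ^+ 2) = 1 - t ^+ 2 / 4.
    transitivity (rI (fun x => b x ^+ 2 - t * (a x * b x) + t ^+ 2 / 4 * a x ^+ 2)).
      by congr rI; apply/funext => x; field.
    rewrite (rID (intB ib (intZ _ iab)) (intZ _ ia)) (rIB ib (intZ _ iab)) (rIZ _ iab) (rIZ _ ia) a1 b1 ab.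
    by field.
  by move: p1; rewrite e; lra.
have QE x : Q x = (b x - t / 2 * a x) ^+ 2 + (1 - t ^+ 2 / 4) * a x ^+ 2 by rewrite /Q; field.
have [t4|t4] := ltP (t ^+ 2) 4.
  apply: ae_imp leQ => x; rewrite QE -/(a x) => hq.
  have p := sqr_ge0 (b x - t / 2 * a x).
  have q : 0 < 1 - t ^+ 2 / 4 by lra.
  by rewrite -(ler_pM2l q); lra.
have {t2 t4} t4 : t ^+ 2 = 4 by apply/eqP; rewrite eq_le t2.
have ba : ae_prop mu (fun x => b x = t / 2 * a x).
  apply: ae_imp leQ => x; rewrite QE t4 => hq.
  have : (b x - t / 2 * a x) ^+ 2 <= 0 by lra.
  by move=> h'; apply/eqP; rewrite -subr_eq0 -sqrf_eq0 eq_le h' sqr_ge0.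
have inv2 : ae_prop mu (fun x => a (T.1 x) ^+ 2 = a x ^+ 2).
  apply: ae_imp (ae_and bT (mpreserving_ae pT ba)) => x [e1 e2].
  by rewrite -e1 e2 exprMn expr_div_n t4; field.
have := ergodic_le hT hs ia inv2; rewrite a1; apply: ae_imp => x; rewrite -/(a x); lra.
Qed.

Let noeig (t : R) h : gaussF h -> koop T 1 h + koop T (-1) h = t%:C *: h -> h = 0.
Proof.
move=> Fh heq; apply: contrapT => h0.
have n0 : 0 < cnrm ip h.
  by rewrite lt_neqAle (cnrm_ge0 ip) andbT eq_sym; apply/eqP => /(cnrm_eq0 H).
pose c := (cnrm ip h)^-1; have Fc : gaussF (c%:C *: h) := subspaceZ c sF Fh.
apply: (@noeig1 t _ Fc).
  rewrite (ch_scal H) (ch_sym H) (ch_scal H) -(sqr_cnrm H) /c; field; by rewrite gt_eqF.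
have lZ k : koop T k (c%:C *: h) = c%:C *: koop T k h.
  by have := ur_lin HU k c%:C h 0; rewrite addr0 (clin0 (ur_lin HU k)) addr0.
by rewrite !lZ -scalerDr heq !scalerA mulrC.
Qed.

Theorem gaussian_simple_spectrum n : (0 < n)%N -> simple_spectrum mu (aut_pow T n).
Proof.
move=> n0; have [u tu] := (simple_spectrumP hT).1 hs.
apply/(simple_spectrumP (is_aut_pow n hT)); exists u.
have := fock_cyclic_pow H HU tu sF cF (F_koop 1) (F_koop (-1)) noeig eE
  (fun h _ => eU h) te n0.
by under eq_fun do rewrite -koop_pow.
Qed.

End GaussianSystem.

Theorem mainTheorem10 (R : realType) (d : measure_display) (X : measurableType d)
    (mu : probability X R) :
  standard_nonatomic mu ->
  (exists Rinf : set (@aut d X),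
      Rinf `<=` is_aut mu /\ aut_dense mu Rinf /\ aut_Gdelta mu Rinf /\
      forall T, Rinf T ->
        (forall n : int, n != 0 -> rank_one mu (zpow T n)) /\
        (forall n : nat, (0 < n)%N -> simple_spectrum mu (aut_pow T n)) /\
        Jinf mu T = J2 mu T.1 /\
        c2_closed mu (Jinf mu T) /\ c2_nowhere_dense mu (Jinf mu T) /\
        ~ P_system mu T) /\
  (forall T : @aut d X, is_aut mu T -> gaussian_system mu T -> simple_spectrum mu T ->
      (forall n : nat, (0 < n)%N -> simple_spectrum mu (aut_pow T n)) /\
      Jinf mu T = J2 mu T.1 /\ ~ P_system mu T).
Proof.
move=> /standard_iso01[phi [psi iso]].
(* With measure 1/2 the relative product over [{A, A^c}] would be undisturbed on the square of [A]
   by a map exchanging [A] and its complement; measure 1/3 excludes this. *)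
pose A := [set x | 0 <= phi x < 3^-1].
have muA : fine (mu A) = 3^-1 by rewrite (mu_itv iso) ?subr0//; lra.
have mA : measurable A.
  have [[mphi _] _ _ _] := iso.
  rewrite (_ : A = phi @^-1` `[0, 3^-1[%classic); first exact: measurable_preim.
  by apply/seteqP; split=> x; rewrite /A/= in_itv.
split.
  have [Rinf [R1 R2 R3 R4]] := generic_rank_one iso.
  exists Rinf; split=> //; split=> //; split=> // T RT; have hT := R1 _ RT.
  have hp n : (0 < n)%N -> simple_spectrum mu (aut_pow T n).
    by move=> n0; apply: (rank_one_simple iso (is_aut_pow n hT)); exact: R4.
  split; last by split=> //; exact: system_consequences hT mA muA hp.
  (* The power of exponent [Negz n] is the second component of [aut_pow T n.+1], the inverse of a
     rank one map. *)
  case=> [[//|n]|n] _; first exact: R4.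
  exact: (rank_one_inv (is_aut_pow n.+1 hT) (R4 _ RT _ (ltn0Sn n))).
move=> T hT [f [mf [g gen]]] hs.
have hp n : (0 < n)%N -> simple_spectrum mu (aut_pow T n).
  exact: gaussian_simple_spectrum hT mf g gen hs n.
by have [? [_ [_ ?]]] := system_consequences hT mA muA hp.
Qed.
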